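(* Let $d\in\mathbb N$, $0<\sigma<1$ and $0<\alpha<\beta<\infty$. Let $f,S_0\colon\mathbb R^{1+2d}\to\mathbb R$ be sufficiently smooth and satisfy $$(\partial_t+v\cdot\nabla_x)f=D_v^\sigma S_0 .$$ Then for every $\tau>0$ and every $(t,x,v)\in\mathbb R^{1+2d}$, $$f(t,x,v)-[T_{K_\tau}f](t,x,v)=\Bigl[T_{\int_0^\tau G_{r,\sigma}\,\mathrm dr}(S_0)+T_{\int_0^\tau G^v_{r,\sigma}\,\mathrm dr}(D_v^\sigma f)\Bigr](t,x,v).$$
   Context: **Fractional operators.** $D_v^\sigma$ acts in the velocity variable as the Fourier multiplier $\widehat{D_v^\sigma g}(\xi)=|\xi|^\sigma\widehat g(\xi)$, $\xi\in\mathbb R^d$; its inverse, the Riesz potential $I_v^\sigma$, is defined on mean-zero (Schwartz) functions by $\widehat{I_v^\sigma g}(\xi)=|\xi|^{-\sigma}\widehat g(\xi)$. The same operators acting in a variable $w\in\mathbb R^d$ are denoted $D_w^\sigma,I_w^\sigma$. **Kinetic group and convolution.** $(t,x,v)\circ(s,y,w)=(t+s,x+y+sv,v+w)$, $(t,x,v)^{-1}=(-t,-x+tv,-v)$. For $J\colon\mathbb R^{1+2d}\to\mathbb R$: $[T_Jf](t,x,v):=\int_{\mathbb R^{1+2d}}f(\mathbf m)J((t,x,v)^{-1}\circ\mathbf m)\,\mathrm d\mathbf m$. **Matrices.** $2\times2$ matrices act on $\mathbb R^{2d}$ (and $1\times2$ matrices from $\mathbb R^{2d}$ to $\mathbb R^d$)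 through their tensor product with $\mathrm{Id}_d$. Let $g_1(r)=r^\beta\sin(\log r)$, $g_2(r)=r^\beta\cos(\log r)$ for $r>0$, and $$\mathcal W(r)=\begin{pmatrix}g_1(r)&g_2(r)\\ \frac{\dot g_1(r)}{\alpha r^{\alpha-1}}&\frac{\dot g_2(r)}{\alpha r^{\alpha-1}}\end{pmatrix},\quad \mathcal D_\delta=\begin{pmatrix}\delta&0\\0&1\end{pmatrix},\quad \mathcal A_\delta(r)=\mathcal D_\delta\mathcal W(r)\mathcal D_\delta^{-1}\ (\delta\ne0),$$ $$\mathcal F_\delta(r)=\Bigl(\tfrac1\delta\,\partial_r\tfrac{\dot g_1(r)}{\alpha r^{\alpha-1}}\,,\ \partial_r\tfrac{\dot g_2(r)}{\alpha r^{\alpha-1}}\Bigr).$$ $\mathfrak c=\mathfrak c_{\alpha,d}\neq0$ is the constant with $\det\mathcal A_\delta(r)=\mathfrak c\,r^{(2\beta-\alpha)d}$ (determinant on $\mathbb R^{2d}$), and $\mathsf Q:=(2\beta-\alpha)d+\alpha$. **Kernels.** Fix $0\le\psi\in C_c^\infty(\mathbb R^{1+2d})$ with $\operatorname{supp}\psi\subset(-2,-1)\times B_1(0)\times B_1(0)$ and $\int\psi=1$. For $r>0$ (all kernels understood as $0$ when $s/r^\alpha\notin(-2,-1)$), $$K_r(s,y,w):=|\mathfrak c|^{-1}r^{-\mathsf Q}\,\psi\Bigl(\tfrac s{r^\alpha},\mathcal A_{s/r^\alpha}(r)^{-1}\tbinom yw\Bigr),$$ $$\vec K_r(s,y,w):=-|\mathfrak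 c|^{-1}r^{-\mathsf Q}\,\psi\Bigl(\tfrac s{r^\alpha},\mathcal A_{s/r^\alpha}(r)^{-1}\tbinom yw\Bigr)\,\mathcal F_{s/r^\alpha}(r)\mathcal A_{s/r^\alpha}(r)^{-1}\tbinom yw\in\mathbb R^d,$$ $$L_r:=-\nabla_w\cdot\vec K_r,\qquad G^v_{r,\sigma}(s,y,\cdot):=I_w^\sigma L_r(s,y,\cdot)$$ ($L_r(s,y,\cdot)$ has zero average in $w$), and $$G_{r,\sigma}(s,y,w):=-\alpha|\mathfrak c|^{-1}r^{\alpha-1-\mathsf Q}\,\frac s{r^\alpha}\,D_w^\sigma\Bigl[\psi\Bigl(\tfrac s{r^\alpha},\mathcal A_{s/r^\alpha}(r)^{-1}\tbinom yw\Bigr)\Bigr].$$ ''Sufficiently smooth'' is qualitative: $f$ and $S_0$ are regular and decaying enough that the equation holds pointwise and that differentiation under the integral, Fubini, integration by parts and the self-adjointness of $D_v^\sigma$ can be used. *)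

(* Defs.v *)
From HB Require Import structures.
From mathcomp Require Import all_boot all_order all_algebra.
From mathcomp Require Import complex mxtens.
From mathcomp Require Import all_classical all_reals all_analysis.
From mathcomp Require Import measurable_realfun.

Set Implicit Arguments.
Unset Strict Implicit.
Unset Printing Implicit Defensive.

Import Order.TTheory GRing.Theory Num.Theory.
Import numFieldNormedType.Exports.

Local Open Scope classical_set_scope.
Local Open Scope ring_scope.

Section LebesgueRn.
Context {R : realType}.
Local Notation mR := (measurableTypeR R).

Definition tcons n (p : mR * n.-tuple mR) : n.+1.-tuple mR :=
  [the n.+1.-tuple mR of p.1 :: p.2].

Definition tuncons n (t : n.+1.-tuple mR) : mR * n.-tuple mR :=
  (thead t, [tuple of behead t]).

Lemma tconsK n : cancel (@tcons n) (@tuncons n).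
Proof. by move=> [x t]; congr pair; apply: val_inj. Qed.

Lemma measurable_tcons n : measurable_fun setT (@tcons n).
Proof. exact: measurable_cons. Qed.

Lemma measurable_tuncons n : measurable_fun setT (@tuncons n).
Proof.
by apply: measurable_fun_pair; [exact: measurable_tnth|exact: measurable_behead].
Qed.

Section cons_measure.
Context n (mu : {sigma_finite_measure set (n.-tuple mR) -> \bar R}).
Local Open Scope ereal_scope.

Definition cons_measure (A : set (n.+1.-tuple mR)) : \bar R :=
  (@lebesgue_measure R \x mu) (@tcons n @^-1` A).

Let cons_measure0 : cons_measure set0 = 0.
Proof. by rewrite /cons_measure preimage_set0 measure0. Qed.

Let cons_measure_ge0 A : 0 <= cons_measure A.
Proof. exact: measure_ge0. Qed.

Let cons_measure_sigma_additive : semi_sigma_additive cons_measure.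
Proof.
move=> F mF tF mUF; rewrite /cons_measure preimage_bigcup.
apply: measure_semi_sigma_additive.
- by move=> k; rewrite -[X in measurable X]setTI; exact: measurable_tcons.
- apply/trivIsetP => /= i j _ _ ij; rewrite -preimage_setI.
  by move/trivIsetP : tF => /(_ _ _ _ _ ij) ->//; rewrite preimage_set0.
- by rewrite -preimage_bigcup -[X in measurable X]setTI; exact: measurable_tcons.
Qed.

HB.instance Definition _ := isMeasure.Build _ _ _ cons_measure
  cons_measure0 cons_measure_ge0 cons_measure_sigma_additive.

Let cons_measure_sigma_finite : sigma_finite setT cons_measure.
Proof.
have /sigma_finiteP[F [TF ndF Foo]] := sigma_finiteT (@lebesgue_measure R).
have /sigma_finiteP[G [TG ndG Goo]] := sigma_finiteT mu.
exists (fun k => @tuncons n @^-1` (F k `*` G k)).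
  rewrite -preimage_bigcup (_ : \bigcup_k _ = setT) ?preimage_setT//.
  apply/seteqP; split => // -[x y] _.
  have [k _ Fx] : (\bigcup_k F k) x by rewrite -TF.
  have [l _ Gy] : (\bigcup_k G k) y by rewrite -TG.
  exists (maxn k l) => //; split => /=.
  - by move: x Fx; exact/subsetPset/ndF/leq_maxl.
  - by move: y Gy; exact/subsetPset/ndG/leq_maxr.
move=> k; have [mF Fk] := Foo k; have [mG Gk] := Goo k; split.
  rewrite -[X in measurable X]setTI.
  by apply: measurable_tuncons => //; exact: measurableX.
rewrite /cons_measure -comp_preimage (_ : _ \o _ = id).
  by rewrite preimage_id product_measure1E// lte_mul_pinfty// ge0_fin_numE.
by apply/funext => p /=; rewrite tconsK.
Qed.

HB.instance Definition _ := Measure_isSigmaFinite.Build _ _ _ cons_measure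
  cons_measure_sigma_finite.

End cons_measure.

Let dirac_sigma_finite : sigma_finite setT (@dirac _ (0.-tuple mR) [tuple] R).
Proof.
apply: fin_num_fun_sigma_finite => [|A mA]; rewrite diracE ?ltry//.
Qed.

HB.instance Definition _ := Measure_isSigmaFinite.Build _ _ _
  (@dirac _ (0.-tuple mR) [tuple] R) dirac_sigma_finite.

Fixpoint lebesgue_tuple n : {sigma_finite_measure set (n.-tuple mR) -> \bar R} :=
  if n is k.+1 then cons_measure (lebesgue_tuple k)
  else @dirac _ (0.-tuple mR) [tuple] R.


Section square.
Context (n : nat).
Local Open Scope ereal_scope.

Definition lebesgue_square : set (n.-tuple mR * n.-tuple mR) -> \bar R :=
  lebesgue_tuple n \x lebesgue_tuple n.

HB.instance Definition _ := Measure.on lebesgue_square.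

(* The library's instance on [m1 \x m2] is shadowed by the one for
   subprobabilities, so sigma-finiteness is not inferred. *)
Let lebesgue_square_sigma_finite : sigma_finite setT lebesgue_square.
Proof.
have /sigma_finiteP[F [TF ndF Foo]] := sigma_finiteT (lebesgue_tuple n).
exists (fun k => F k `*` F k).
  apply/seteqP; split => // -[x y] _.
  have [k _ Fx] : (\bigcup_k F k) x by rewrite -TF.
  have [l _ Fy] : (\bigcup_k F k) y by rewrite -TF.
  exists (maxn k l) => //; split => /=.
  - by move: x Fx; exact/subsetPset/ndF/leq_maxl.
  - by move: y Fy; exact/subsetPset/ndF/leq_maxr.
move=> k; have [mF Fk] := Foo k; split; first exact: measurableX.
by rewrite /lebesgue_square product_measure1E// lte_mul_pinfty// ge0_fin_numE.
Qed.

HB.instance Definition _ := Measure_isSigmaFinite.Build _ _ _ lebesgue_square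
  lebesgue_square_sigma_finite.

End square.
End LebesgueRn.

Arguments lebesgue_square {R} n _.

Section Space.
Context {R : realType} {d : nat}.
Local Notation mR := (measurableTypeR R).

Definition rowt (t : d.-tuple mR) : 'rV[R]_d := \row_i tnth t i.

Definition phaset (u : mR * (d.-tuple mR * d.-tuple mR)) :
  R * 'rV[R]_d * 'rV[R]_d := (u.1, rowt u.2.1, rowt u.2.2).

Definition intRd (g : 'rV[R]_d -> R) : R :=
  \int[lebesgue_tuple d]_(t in setT) g (rowt t).

Definition integrableRd (g : 'rV[R]_d -> R) : Prop :=
  (lebesgue_tuple d).-integrable setT (EFin \o (g \o rowt)).

Definition int_phase (F : R * 'rV[R]_d * 'rV[R]_d -> R) : R :=
  \int[(lebesgue_measure \x lebesgue_square d)%E]_(u in setT) F (phaset u).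

End Space.

Section Operators.
Context {R : realType} {d : nat}.
Local Notation phase := (R * 'rV[R]_d * 'rV[R]_d)%type.

Definition dot (v w : 'rV[R]_d) : R := \sum_i v 0 i * w 0 i.

(* The norm of the library on ['rV[R]_d] is the sup norm. *)
Definition enorm (v : 'rV[R]_d) : R := Num.sqrt (dot v v).

Definition cexpi (a : R) : R[i] := (cos a +i* sin a)%C.

Definition intRdC (h : 'rV[R]_d -> R[i]) : R[i] :=
  (intRd (fun v => complex.Re (h v)) +i* intRd (fun v => complex.Im (h v)))%C.

Definition fourier (g : 'rV[R]_d -> R) (xi : 'rV[R]_d) : R[i] :=
  intRdC (fun v => (g v)%:C%C * cexpi (- dot v xi)).

Definition inv_fourier (h : 'rV[R]_d -> R[i]) (v : 'rV[R]_d) : R[i] :=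
  (((2 * pi) ^- d)%:C)%C * intRdC (fun xi => h xi * cexpi (dot v xi)).

(* Meaningful when [g] and [|xi|^s * fourier g] are integrable. The multiplier
   is even and [g] is real, so the inverse transform is real. *)
Definition fourier_mult (s : R) (g : 'rV[R]_d -> R) (v : 'rV[R]_d) : R :=
  complex.Re (inv_fourier (fun xi => (enorm xi `^ s)%:C%C * fourier g xi) v).

Definition Dfrac (s : R) := fourier_mult s.

Definition Ifrac (s : R) := fourier_mult (- s).

Definition kmul (p q : phase) : phase :=
  (p.1.1 + q.1.1, p.1.2 + q.1.2 + q.1.1 *: p.2, p.2 + q.2).

Definition kinv (p : phase) : phase :=
  (- p.1.1, - p.1.2 + p.1.1 *: p.2, - p.2).

(* [T_J f]. The integral over R^(1+2d) is iterated, with the time variable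
   outermost. It is the Lebesgue integral whenever that converges absolutely
   (see [kconvE]); but if (beta - alpha) * sigma >= alpha, the kernel
   [\int_0^tau G_(r,sigma) dr] is not integrable near s = 0, and its convolution
   with a smooth function converges only in the iterated sense. *)
Definition kconv (J f : phase -> R) (p : phase) : R :=
  \int[lebesgue_measure]_(s in setT)
    \int[lebesgue_square d]_(z in setT)
      (f (phaset (s, z)) * J (kmul (kinv p) (phaset (s, z)))).

Lemma kconvE (J f : phase -> R) (p : phase) :
  (lebesgue_measure \x lebesgue_square d)%E.-integrable setT
    (fun u => (f (phaset u) * J (kmul (kinv p) (phaset u)))%:E) ->
  kconv J f p = int_phase (fun m => f m * J (kmul (kinv p) m)).
Proof.
move=> intf; rewrite /kconv /int_phase /Rintegral; congr fine.
rewrite -(integral12_prod_meas1 intf).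
have mF := measurable_fubini_F intf.
have iF := integrable_fubini_F intf.
apply: ae_eq_integral => //.
  by apply/measurable_EFinP; apply: measurableT_comp mF.
have := ae_integrable1 intf; apply: filterS => s ints _ /=.
by rewrite fineK//; exact: integrable_fin_num.
Qed.

Definition transport (f : phase -> R) (p : phase) : R :=
  'D_((1, 0, 0) : phase) f p +
  \sum_i p.2 0 i * 'D_((0, delta_mx 0 i, 0) : phase) f p.

Definition divergence (K : 'rV[R]_d -> 'rV[R]_d) (w : 'rV[R]_d) : R :=
  \sum_i 'D_(delta_mx 0 i) (fun w' => K w' 0 i) w.

End Operators.

Fixpoint Ck {R : realType} {V : normedModType R} (k : nat) (g : V -> R) : Prop :=
  if k is k'.+1 then
    (forall p, differentiable g p) /\ (forall u, Ck k' ('D_u g))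
  else continuous g.

Section Regularity.
Context {R : realType} {d : nat}.
Local Notation phase := (R * 'rV[R]_d * 'rV[R]_d)%type.

(* [g] and [|xi|^sigma] times its Fourier transform in v are integrable in v,
   resp. xi, with a majorant that is locally uniform in (t, x). This holds for
   instance if g has enough derivatives in v, all of which decay like
   (1 + |v|)^(-d-1), locally uniformly in (t, x). *)
Definition v_regular (sigma : R) (g : phase -> R) : Prop :=
  forall M : R, exists phi Phi : 'rV[R]_d -> R,
    [/\ integrableRd phi, integrableRd Phi &
      forall t x, `|t| <= M -> enorm x <= M ->
        (forall v, `|g (t, x, v)| <= phi v) /\
        (forall xi, enorm xi `^ sigma *
           ComplexField.Normc.normc (fourier (fun v => g (t, x, v)) xi) <= Phi xi)].

Definition test_function (psi : phase -> R) : Prop :=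
  [/\ forall k, Ck k psi,
      compact (closure [set m | psi m != 0]),
      closure [set m | psi m != 0] `<=`
        [set m | [/\ -2 < m.1.1 < -1, enorm m.1.2 < 1 & enorm m.2 < 1]],
      forall m, 0 <= psi m &
      int_phase psi = 1].

End Regularity.

Section Kernels.
Context {R : realType} {d : nat}.
Variables (alpha beta sigma c : R) (psi : R * 'rV[R]_d * 'rV[R]_d -> R).
Local Notation phase := (R * 'rV[R]_d * 'rV[R]_d)%type.

Definition g1 (r : R) : R := r `^ beta * sin (ln r).

Definition g2 (r : R) : R := r `^ beta * cos (ln r).

Definition h1 (r : R) : R := derive1 g1 r / (alpha * r `^ (alpha - 1)).

Definition h2 (r : R) : R := derive1 g2 r / (alpha * r `^ (alpha - 1)).

Definition Wmat (r : R) : 'M[R]_(1 + 1) :=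
  block_mx (g1 r)%:M (g2 r)%:M (h1 r)%:M (h2 r)%:M.

Definition Dmat (delta : R) : 'M[R]_(1 + 1) := block_mx delta%:M 0 0 1%:M.

Definition Amat (delta r : R) : 'M[R]_(1 + 1) :=
  Dmat delta *m Wmat r *m invmx (Dmat delta).

Definition Frow (delta r : R) : 'M[R]_(1, 1 + 1) :=
  row_mx (delta^-1 * derive1 h1 r)%:M (derive1 h2 r)%:M.

(* This determines [c], namely c = (- 1 / alpha) ^+ d. The determinant on
   R^(2d) is that of the tensor product of [Amat delta r] with the identity. *)
Definition det_constant : Prop :=
  forall delta r : R, delta != 0 -> 0 < r ->
    \det (Amat delta r *t (1%:M : 'M[R]_d)) =
    c * r `^ ((2 * beta - alpha) * d%:R).

Definition hdim : R := (2 * beta - alpha) * d%:R + alpha.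

(* [col_mx y w], a 2 x d matrix, stands for (y, w) in R^(2d): left
   multiplication by a 2-column matrix M is the action of M tensored with the
   identity of R^d. *)
Definition Ainv (r s : R) (y w : 'rV[R]_d) : 'M[R]_(1 + 1, d) :=
  invmx (Amat (s / r `^ alpha) r) *m col_mx y w.

Definition psi_r (r : R) (m : phase) : R :=
  let: (s, y, w) := m in
  if -2 < s / r `^ alpha < -1 then
    psi (s / r `^ alpha, usubmx (Ainv r s y w), dsubmx (Ainv r s y w))
  else 0.

Definition Kker (r : R) (m : phase) : R :=
  `|c|^-1 * r `^ (- hdim) * psi_r r m.

Definition vecK (r : R) (m : phase) : 'rV[R]_d :=
  let: (s, y, w) := m in
  (- (`|c|^-1 * r `^ (- hdim) * psi_r r (s, y, w))) *:
    (Frow (s / r `^ alpha) r *m Ainv r s y w).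

Definition Lker (r : R) (m : phase) : R :=
  let: (s, y, w) := m in - divergence (fun w' => vecK r (s, y, w')) w.

Definition Gvker (r : R) (m : phase) : R :=
  let: (s, y, w) := m in Ifrac sigma (fun w' => Lker r (s, y, w')) w.

Definition Gker (r : R) (m : phase) : R :=
  let: (s, y, w) := m in
  - alpha * `|c|^-1 * r `^ (alpha - 1 - hdim) * (s / r `^ alpha) *
    Dfrac sigma (fun w' => psi_r r (s, y, w')) w.

End Kernels.

(* Main.v *)
(* Fix p = (t, x, v). For th in (-2, -1) and (eta, zeta) in R^(2d), consider the
   curve r |-> p o (r^alpha th, y_r, w_r), (y_r, w_r) = A_th(r) (eta, zeta). The
   matrix A_th is designed so that y_r' = (r^alpha th)' w_r; hence the derivative
   of f along the curve is alpha r^(alpha-1) th (d_t + v . grad_x) f plus the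
   velocity term w_r' . grad_v f. Since alpha < beta, the curve starts at p, so
   integrating this derivative over r in (0, tau) and averaging against
   psi(th, eta, zeta), which has mass 1, gives (T_(K_tau) f)(p) - f(p). For each
   r, the average is also an integral in (s, y, w), by the change of variables
   (eta, zeta) |-> (y_r, w_r), th |-> s = t + r^alpha th. In the first term the
   equation turns the transport derivative into D^sigma S0, and D^sigma is moved
   onto the kernel. In the second one, integration by parts in w produces
   L_r = D^sigma I^sigma L_r, and D^sigma is moved onto f.

   Since the kernels integrated over r need not be integrable near s = t, the
   time variable is frozen while r, y and w are exchanged: if s <> t, then r is
   bounded away from 0 on the support of the kernels. The exchange of s and r is
   done afterwards, once the change of variables has removed the singularity.

   That I^sigma L is integrable, with D^sigma I^sigma L = L, is obtained by
   writing I^sigma L as an integral of heat flows of L = - div K: the gradient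
   falls on the Gaussian, which gives decay at large times. *)

From HB Require Import structures.
Require Import Defs.
From mathcomp Require Import all_boot all_order all_algebra.
From mathcomp Require Import complex mxtens.
From mathcomp Require Import all_classical all_reals all_analysis.
From mathcomp Require Import measurable_realfun.
From mathcomp Require Import ring lra.
Set Implicit Arguments.
Unset Strict Implicit.
Unset Printing Implicit Defensive.
Import Order.TTheory GRing.Theory Num.Theory.
Import numFieldNormedType.Exports.
Local Open Scope classical_set_scope.
Local Open Scope ring_scope.

(** * Integrable functions and Fubini *)

(** The entries r^beta sin(log r) and r^beta cos(log r) have the same size, and yet their Wronskian
    is a pure power of r without zeros; so A_th(r) is invertible for every r > 0 and its inverse is
    bounded by powers of r. At a fixed time s, r^alpha is comparable to t - s on the support, so all
    these powers, positive or negative, are bounded. In the variables (r, th, eta, zeta) only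
    r^(alpha - 1) and r^(beta - alpha - 1) remain, both integrable at 0. The other obstacle is that
    D^sigma and I^sigma are nonlocal in w. They act in w alone, so the kernels keep a compact
    support in y, recorded by a factor [J y] in the bounds. In w, the first term is integrable
    because of S0, its kernel being only bounded; in the second, D^sigma f is only bounded and the
    kernel itself must be integrable, which is why I^sigma L needs its own analysis. Fourier
    transforms are handled as real integrals with a free phase; multiplication by i becomes a phase
    shift of pi / 2. *)

Section L1.
Context d (T : measurableType d) (R : realType).
Variable mu : {measure set T -> \bar R}.
Implicit Types f g h : T -> R.

Definition L1 f : Prop := mu.-integrable setT (EFin \o f).
Definition I f : R := \int[mu]_(x in setT) f x.

Lemma L1_meas f : L1 f -> measurable_fun setT f.
Proof. by move/measurable_int => mf; apply/measurable_EFinP. Qed.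

Lemma L1_le f g : measurable_fun setT f -> L1 g -> (forall x, `|f x| <= g x) ->
  L1 f.
Proof.
move=> mf ig fg; apply: le_integrable ig => //.
  by apply/measurable_EFinP.
by move=> x _ /=; rewrite lee_fin (le_trans (fg x))// ler_norm.
Qed.

Lemma eq_L1 f g : f =1 g -> L1 f -> L1 g.
Proof. by move/funext => ->. Qed.

Lemma L1D f g : L1 f -> L1 g -> L1 (fun x => f x + g x).
Proof. by move=> lf lg; have := integrableD measurableT lf lg. Qed.

Lemma L1N f : L1 f -> L1 (fun x => - f x).
Proof. by move=> lf; exact: (integrableN lf). Qed.

Lemma L1B f g : L1 f -> L1 g -> L1 (fun x => f x - g x).
Proof. by move=> lf /L1N; exact: L1D. Qed.

Lemma L1Zl k f : L1 f -> L1 (fun x => k * f x).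
Proof. by move=> lf; have := integrableZl measurableT k lf. Qed.

Lemma L1Zr k f : L1 f -> L1 (fun x => f x * k).
Proof. by move=> /(L1Zl k); apply: eq_L1 => x; rewrite mulrC. Qed.

Lemma L1_0 : L1 (fun=> 0).
Proof. exact: integrable0. Qed.

Lemma L1_sum (J : Type) (s : seq J) (P : pred J) (F : J -> T -> R) :
  (forall j, P j -> L1 (F j)) -> L1 (fun x => \sum_(j <- s | P j) F j x).
Proof.
move=> lF; elim: s => [|j s IH].
  by apply: eq_L1 L1_0 => x; rewrite big_nil.
have [Pj|Pj] := boolP (P j).
  by apply: eq_L1 (L1D (lF j Pj) IH) => x; rewrite big_cons Pj.
by apply: eq_L1 IH => x; rewrite big_cons (negbTE Pj).
Qed.

Lemma L1_norm f : L1 f -> L1 (fun x => `|f x|).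
Proof. by move=> lf; have := integrable_abse lf. Qed.

Lemma L1_bounded_mul f h B : L1 f -> measurable_fun setT h ->
  (forall x, `|h x| <= B) -> L1 (fun x => f x * h x).
Proof.
move=> lf mh hB; apply: (@L1_le _ (fun x => `|f x| * B)).
- by apply: measurable_funM => //; exact: L1_meas.
- exact/L1Zr/L1_norm.
- by move=> x; rewrite normrM ler_wpM2l.
Qed.

Lemma eq_I f g : f =1 g -> I f = I g.
Proof. by move/funext => ->. Qed.

Lemma I_0 : I (fun=> 0) = 0.
Proof. by rewrite /I /Rintegral integral0. Qed.

Lemma I_D f g : L1 f -> L1 g -> I (fun x => f x + g x) = I f + I g.
Proof. by move=> lf lg; exact: RintegralD. Qed.

Lemma I_B f g : L1 f -> L1 g -> I (fun x => f x - g x) = I f - I g.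
Proof. by move=> lf lg; exact: RintegralB. Qed.

Lemma I_Zl k f : L1 f -> I (fun x => k * f x) = k * I f.
Proof. by move=> lf; exact: RintegralZl. Qed.

Lemma I_Zr k f : L1 f -> I (fun x => f x * k) = I f * k.
Proof. by move=> lf; exact: RintegralZr. Qed.

Lemma I_N f : L1 f -> I (fun x => - f x) = - I f.
Proof.
move=> lf; rewrite -mulN1r -I_Zl//.
by apply: eq_I => x; rewrite mulN1r.
Qed.

Lemma I_sum (J : Type) (s : seq J) (P : pred J) (F : J -> T -> R) :
  (forall j, P j -> L1 (F j)) ->
  I (fun x => \sum_(j <- s | P j) F j x) = \sum_(j <- s | P j) I (F j).
Proof.
move=> lF; elim: s => [|j s IH].
  by rewrite big_nil -[RHS]I_0; apply: eq_I => x; rewrite big_nil.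
rewrite big_cons; have [Pj|Pj] := boolP (P j).
  rewrite -IH -I_D; [|exact: lF|exact: L1_sum].
  by apply: eq_I => x; rewrite big_cons Pj.
by rewrite -IH; apply: eq_I => x; rewrite big_cons (negbTE Pj).
Qed.

Lemma I_ge0 f : (forall x, 0 <= f x) -> 0 <= I f.
Proof. by move=> f0; apply: Rintegral_ge0 => x _. Qed.

Lemma I_le f g : L1 f -> L1 g -> (forall x, f x <= g x) -> I f <= I g.
Proof. by move=> lf lg fg; apply: le_Rintegral. Qed.

Lemma I_norm_le f g : measurable_fun setT f -> L1 g ->
  (forall x, `|f x| <= g x) -> `|I f| <= I g.
Proof.
move=> mf lg fg; have lf := L1_le mf lg fg.
apply: (le_trans (le_normr_Rintegral measurableT lf)).
by apply: I_le => //; exact: L1_norm.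
Qed.

Lemma EFin_I f : L1 f -> (I f)%:E = (\int[mu]_x (f x)%:E)%E.
Proof. by move=> lf; rewrite /I /Rintegral fineK//; exact: integrable_fin_num. Qed.

Lemma I_cvg (F : nat -> T -> R) f g : (forall n, measurable_fun setT (F n)) ->
  (forall x, F n x @[n --> \oo] --> f x) -> L1 g ->
  (forall n x, `|F n x| <= g x) -> I (F n) @[n --> \oo] --> I f.
Proof.
move=> mF Ff lg Fg.
have mf : measurable_fun setT f by apply: (measurable_fun_cvg mF) => x _; exact: Ff.
have fg x : `|f x| <= g x.
  have h : `|F n x| @[n --> \oo] --> `|f x| by apply: cvg_norm; exact: Ff.
  by rewrite -(cvg_lim _ h)//; apply: limr_le; [apply/cvg_ex; exists (`|f x|)|exact: nearW].
have lf := L1_le mf lg fg.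
apply: fine_cvg; rewrite -/(I f) EFin_I//.
have [] := @dominated_convergence _ _ _ mu setT measurableT
  (fun n x => (F n x)%:E) (EFin \o f) (EFin \o g).
- by move=> n; exact/measurable_EFinP.
- exact/measurable_EFinP.
- by apply: aeW => x _; apply: cvg_EFin; [exact: nearW|exact: Ff].
- exact: lg.
- by apply: aeW => x n _; rewrite lee_fin.
- by [].
Qed.

End L1.

Section Fubini.
Context d1 d2 (T1 : measurableType d1) (T2 : measurableType d2) (R : realType).
Variable m1 : {sigma_finite_measure set T1 -> \bar R}.
Variable m2 : {sigma_finite_measure set T2 -> \bar R}.
Implicit Types F : T1 -> T2 -> R.
Local Notation unc F := (fun u => F u.1 u.2).

(** No integrability is assumed: by Tonelli the integrals of the positive and of the negative part
    are measurable in x, and [fine] of their difference is measurable whatever infinite values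
    occur. *)
Lemma measurable_I2 F : measurable_fun setT (unc F) ->
  measurable_fun setT (fun x => I m2 (F x)).
Proof.
move=> mF; rewrite /I /Rintegral; apply: measurableT_comp => //.
pose f u := (F u.1 u.2)%:E.
have mf : measurable_fun setT f by exact/measurable_EFinP.
rewrite (_ : (fun x => _) = (fun x => \int[m2]_y (f^\+ (x, y)) - \int[m2]_y (f^\- (x, y)))%E).
  apply: emeasurable_funB.
    by apply: (measurable_fun_fubini_tonelli_F (m2 := m2) (f^\+)%E) => //; exact: measurable_funepos.
  by apply: (measurable_fun_fubini_tonelli_F (m2 := m2) (f^\-)%E) => //; exact: measurable_funeneg.
apply/funext => x; rewrite integralE.
have fE : (fun y => (F x y)%:E) = (fun y => f (x, y)) by [].
by rewrite fE funepos_comp funeneg_comp.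
Qed.

(** Tonelli, with a majorant for the inner norms: these are usually only estimated, not computed. *)
Lemma L1_iter F (H : T1 -> R) : measurable_fun setT (unc F) -> L1 m1 H ->
  (forall x, L1 m2 (F x)) -> (forall x, I m2 (fun y => `|F x y|) <= H x) ->
  L1 (m1 \x m2)%E (unc F).
Proof.
move=> mF lH lF FH; rewrite /L1.
apply/integrable12ltyP; first exact/measurable_EFinP.
apply: (@le_lt_trans _ _ (\int[m1]_x (H x)%:E)%E); last first.
  exact: integrable_lty lH.
apply: ge0_le_integral => //=.
- by move=> x _; apply: integral_ge0 => y _.
- apply: (measurable_fun_fubini_tonelli_F (fun u => `|(F u.1 u.2)%:E|%E)) => //=.
  by apply/measurable_EFinP; exact: measurableT_comp.
- exact: measurable_int lH.
- move=> x _.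
  have := EFin_I (L1_norm (lF x)) => /= <-.
  by rewrite lee_fin.
Qed.

Lemma L1_prod F (a : T1 -> R) (b : T2 -> R) : measurable_fun setT (unc F) ->
  L1 m1 a -> L1 m2 b -> (forall x y, `|F x y| <= a x * b y) ->
  L1 (m1 \x m2)%E (unc F).
Proof.
move=> mF la lb Fab.
have mFx x : measurable_fun setT (F x).
  exact: (measurableT_comp mF (measurable_pair1 x)).
have lF x : L1 m2 (F x) by apply: (L1_le (mFx x) (L1Zl (a x) lb)) => y.
apply: (@L1_iter _ (fun x => a x * I m2 b)) => //; first exact: L1Zr.
move=> x; rewrite -I_Zl//; apply: I_le => //; first exact: L1_norm.
exact: L1Zl.
Qed.

Lemma I_prod F : L1 (m1 \x m2)%E (unc F) ->
  I (m1 \x m2)%E (unc F) = I m1 (fun x => I m2 (F x)).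
Proof.
move=> lF; rewrite /I /Rintegral; congr fine.
rewrite -(integral12_prod_meas1 lF).
apply: ae_eq_integral => //.
- exact: measurable_fubini_F lF.
- by apply/measurable_EFinP; apply: measurableT_comp (measurable_fubini_F lF).
(* [fine] turns an infinite inner integral into 0, so the two sides are compared only where the
   section is integrable, which is almost everywhere. *)
- have := ae_integrable1 lF; apply: filterS => s ints _ /=.
  by rewrite fineK//; exact: integrable_fin_num.
Qed.

Lemma L1_I2 F : L1 (m1 \x m2)%E (unc F) -> L1 m1 (fun x => I m2 (F x)).
Proof.
move=> lF; have := integrable_fubini_F lF; apply: le_integrable => //.
  by apply/measurable_EFinP; apply: measurable_I2; exact: L1_meas lF.
move=> x _ /=; rewrite /fubini_F /I /Rintegral /=.
by case: (\int[m2]_y _)%E => [r//| |] /=; rewrite ?normr0 ?lexx ?leey.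
Qed.
End Fubini.

Section Swap.
Context d1 d2 (T1 : measurableType d1) (T2 : measurableType d2) (R : realType).
Variable m1 : {sigma_finite_measure set T1 -> \bar R}.
Variable m2 : {sigma_finite_measure set T2 -> \bar R}.
Implicit Types F : T1 -> T2 -> R.
Local Notation unc F := (fun u => F u.1 u.2).

Lemma L1_swap F : L1 (m1 \x m2)%E (unc F) -> L1 (m2 \x m1)%E (fun u => F u.2 u.1).
Proof.
move=> lF; have mF := L1_meas lF.
have mF' : measurable_fun setT (fun u : T2 * T1 => F u.2 u.1).
  exact: (measurableT_comp mF (@measurable_swap _ _ T2 T1)).
apply/integrable21ltyP; first exact/measurable_EFinP.
have /integrable12ltyP := lF; apply; first exact/measurable_EFinP.
Qed.

Lemma I_swap F : L1 (m1 \x m2)%E (unc F) ->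
  I m1 (fun x => I m2 (F x)) = I m2 (fun y => I m1 (F^~ y)).
Proof.
move=> lF; rewrite -(I_prod lF) -(I_prod (F := fun y x => F x y) (L1_swap lF)).
rewrite /I /Rintegral; congr fine.
rewrite -(integral21_prod_meas1 lF).
by rewrite -(integral12_prod_meas1 (L1_swap lF)).
Qed.
End Swap.

(** * Measurability of continuous functions of finitely many coordinates *)

Section Boxes.
Context d (T : measurableType d) (R : realType) (V : pseudoMetricType R).
Context (J : finType) (coord : J -> V -> R).
Hypothesis ball_coord : forall (v w : V) (e : R), 0 < e ->
  (forall j, `|coord j v - coord j w| < e) -> ball v e w.

(** The preimage under g of a half-line is open, hence a countable union of boxes with rational
    centres and radii 1 / (k + 1); lying in a box is a measurable condition on finitely many
    coordinates. *)
Lemma continuous_coord_measurable (g : V -> R) (u : T -> V) : continuous g ->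
  (forall j, measurable_fun setT (fun x => coord j (u x))) ->
  measurable_fun setT (g \o u).
Proof.
move=> cg mu.
move=> mT; apply: (measurability _ (RGenOInfty.measurableE R)) => //.
move=> /= _ [_ [a ->] <-]; rewrite setTI.
pose B (q : {ffun J -> rat} * nat) : set V :=
  [set v | forall j, `|ratr (q.1 j) - coord j v| < q.2.+1%:R^-1].
pose Q := [set q | B q `<=` g @^-1` `]a, +oo[].
have -> : (g \o u) @^-1` `]a, +oo[ = \bigcup_(q in Q) (u @^-1` B q).
  apply/seteqP; split => x /=; last by move=> [q Qq] /Qq.
  rewrite in_itv/= andbT => agx.
  have : nbhs (u x) (g @^-1` `]a, +oo[).
    apply: (cg (u x)); apply: open_nbhs_nbhs; split; first exact: interval_open.
    by rewrite /= in_itv/= agx.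
  move=> /nbhs_ballP[e /= e0 be].
  (* Two points of the same box are compared through its rational centre, so twice the radius must
     be at most e. *)
  pose k := (Num.trunc (2 / e)).
  have k0 : (0 : R) < k.+1%:R^-1 by rewrite invr_gt0.
  have ke : k.+1%:R^-1 + k.+1%:R^-1 <= e.
    have h : 2 / e < k.+1%:R by rewrite truncnS_gt.
    rewrite -mulr2n -[X in X <= _]mulr_natl.
    rewrite ler_pdivrMr// mulrC -ler_pdivrMr//; exact: ltW.
  have /choice[q Hq] : forall j, exists q : rat, `|ratr q - coord j (u x)| < k.+1%:R^-1.
    move=> j.
    have h : coord j (u x) - k.+1%:R^-1 < coord j (u x) + k.+1%:R^-1.
      by rewrite ltrD2l gtrN.
    have [q] := rat_in_itvoo h.
    rewrite in_itv/= => /andP[h1 h2]; exists q; by rewrite ltr_distl h1 h2.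
  exists ([ffun j => q j], k); last by move=> j /=; rewrite ffunE.
  move=> v /= Bv; apply: be; apply: ball_coord => // j.
  have := Bv j; have := Hq j; rewrite /= ffunE => h1 h2.
  apply: lt_le_trans ke.
  have -> : coord j (u x) - coord j v =
    (ratr (q j) - coord j v) - (ratr (q j) - coord j (u x)) by ring.
  by apply: (le_lt_trans (ler_normB _ _)); exact: ltrD.
rewrite bigcup_mkcond; apply: countable_bigcupT_measurable => // q.
case: ifPn => // _.
have -> : u @^-1` B q = \big[setI/setT]_(j <- index_enum J)
    (fun x => `|ratr (q.1 j) - coord j (u x)|) @^-1` `]-oo, q.2.+1%:R^-1[.
  apply/seteqP; split => x /=.
    by move=> Bx; rewrite -bigcap_seq => j _ /=; rewrite in_itv/=; exact: Bx.
  rewrite -bigcap_seq => Bx j.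
  by have := Bx j (mem_index_enum j); rewrite /= in_itv.
apply: bigsetI_measurable => j _.
rewrite -[X in measurable X]setTI.
have mm : measurable_fun setT (fun x => `|ratr (q.1 j) - coord j (u x)|).
  by apply: measurableT_comp => //; apply: measurable_funB.
by apply: mm.
Qed.
End Boxes.

Section SpaceMeas.
Context {R : realType} {n : nat}.
Local Notation mR := (measurableTypeR R).
Local Notation phase := (R * 'rV[R]_n * 'rV[R]_n)%type.
Context d (T : measurableType d).

Definition mvec (u : T -> 'rV[R]_n) := forall i, measurable_fun setT (fun x => u x 0 i).

(** Measurability is tested on tuples, on which the Lebesgue measure is defined. *)
Definition mRd (g : 'rV[R]_n -> R) := measurable_fun setT (g \o @rowt R n).

Definition tof (w : 'rV[R]_n) : n.-tuple mR := [tuple w 0 i | i < n].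

Lemma rowtK : cancel tof (@rowt R n).
Proof. by move=> w; apply/rowP => i; rewrite mxE tnth_mktuple. Qed.

Lemma measurable_tof u : mvec u -> measurable_fun setT (tof \o u).
Proof.
move=> mu; apply/measurable_fun_tnthP => i.
have := mu i; congr (measurable_fun _ _).
by apply: funext => x /=; rewrite tnth_mktuple.
Qed.

Lemma mRd_comp g u : mRd g -> mvec u -> measurable_fun setT (fun x => g (u x)).
Proof.
move=> mg mu; have := measurableT_comp mg (measurable_tof mu).
by congr (measurable_fun _ _); apply/funext => x /=; rewrite rowtK.
Qed.

Lemma mvecD u v : mvec u -> mvec v -> mvec (fun x => u x + v x).
Proof.
move=> mu mv i; rewrite (_ : (fun _ => _) = (fun x => u x 0 i + v x 0 i)).
  exact: measurable_funD.
by apply/funext => x; rewrite mxE.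
Qed.

Lemma mvecN u : mvec u -> mvec (fun x => - u x).
Proof.
move=> mu i; rewrite (_ : (fun _ => _) = (fun x => - u x 0 i)).
  exact: measurableT_comp.
by apply/funext => x; rewrite mxE.
Qed.

Lemma mvecB u v : mvec u -> mvec v -> mvec (fun x => u x - v x).
Proof. by move=> mu /mvecN; exact: mvecD. Qed.

Lemma mvecZ (k : T -> R) u : measurable_fun setT k -> mvec u -> mvec (fun x => k x *: u x).
Proof.
move=> mk mu i; rewrite (_ : (fun _ => _) = (fun x => k x * u x 0 i)).
  exact: measurable_funM.
by apply/funext => x; rewrite mxE.
Qed.

Lemma mvec_cst u : mvec (fun=> u).
Proof. by move=> i. Qed.

Lemma mvec_rowt (t : T -> n.-tuple mR) : measurable_fun setT t -> mvec (fun x => rowt (t x)).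
Proof.
move=> mt i; rewrite (_ : (fun _ => _) = (fun x => tnth (t x) i)).
  exact: (measurableT_comp (@measurable_tnth _ mR _ i) mt).
by apply/funext => x; rewrite mxE.
Qed.

Lemma measurable_dot u v : mvec u -> mvec v -> measurable_fun setT (fun x => dot (u x) (v x)).
Proof.
by move=> mu mv; apply: measurable_sum => i; exact: measurable_funM.
Qed.

Lemma measurable_enorm u : mvec u -> measurable_fun setT (fun x => enorm (u x)).
Proof.
move=> mu; apply: measurableT_comp; last exact: measurable_dot.
exact: continuous_measurable_fun (@sqrt_continuous R).
Qed.

Lemma continuous_mvec g u : continuous g -> mvec u -> measurable_fun setT (fun x => g (u x) : R).
Proof.
move=> cg mu.
have := @continuous_coord_measurable _ T R 'rV[R]_n 'I_n (fun i (v : 'rV[R]_n) => v 0 i).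
move=> /(_ _ g u); apply => //.
by move=> v w e e0 vw; split => // i j; rewrite (ord1 i); exact: vw.
Qed.

Lemma continuous_mphase g (s : T -> R) y w : continuous (g : phase -> R) -> measurable_fun setT s ->
  mvec y -> mvec w -> measurable_fun setT (fun x => g (s x, y x, w x)).
Proof.
move=> cg ms my mw.
pose coord (j : option ('I_n + 'I_n)) (v : phase) : R :=
  match j with None => v.1.1 | Some (inl i) => v.1.2 0 i | Some (inr i) => v.2 0 i end.
have := @continuous_coord_measurable _ T R phase _ coord.
move=> /(_ _ g (fun x => (s x, y x, w x))); apply => //.
  move=> v v' e e0 vw; split; first split.
  - exact: (vw None).
  - by split => // i j; rewrite (ord1 i); exact: (vw (Some (inl j))).
  - by split => // i j; rewrite (ord1 i); exact: (vw (Some (inr j))).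
by move=> [[i|i]|] /=.
Qed.
End SpaceMeas.

(** * Linear changes of variables *)

Section Push.
Context d d' (T1 : measurableType d) (T2 : measurableType d') (R : realType).
Variables (m : {measure set T1 -> \bar R}) (f : T1 -> T2).
Hypothesis mf : measurable_fun [set: T1] f.

Definition push : {measure set T2 -> \bar R} :=
  measure_function_pushforward__canonical__measure_function_Measure m mf.

Lemma ge0_integral_push (G : T2 -> \bar R) : measurable_fun setT G ->
  (forall x, 0 <= G x)%E ->
  (\int[push]_y G y = \int[m]_x G (f x))%E.
Proof.
move=> mG G0; have := ge0_integral_pushforward mf m measurableT mG (fun y _ => G0 y).
by rewrite preimage_setT.
Qed.
End Push.

Section Scales.
Context d (T : measurableType d) (R : realType) (mu : {measure set T -> \bar R}).

(** A change of variables with constant Jacobian 1 / k. Stating it for nonnegative functions makes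
    it compatible with Tonelli and stable under composition; integrable functions follow from their
    positive and negative parts. *)
Definition scales (phi : T -> T) (k : R) := [/\ 0 <= k, measurable_fun setT phi &
  forall G : T -> \bar R, measurable_fun setT G -> (forall x, 0 <= G x)%E ->
  (\int[mu]_x G (phi x) = k%:E * \int[mu]_x G x)%E].

Lemma scales_comp phi psi k l : scales phi k -> scales psi l -> scales (phi \o psi) (k * l).
Proof.
move=> [k0 mphi hphi] [l0 mpsi hpsi]; split; first exact: mulr_ge0.
  exact: measurableT_comp.
move=> G mG G0 /=; rewrite (hpsi (G \o phi)); first last.
- by move=> x /=.
- exact: measurableT_comp.
by rewrite hphi// muleA -EFinM mulrC.
Qed.

Variables (phi : T -> T) (k : R).
Hypothesis sphi : scales phi k.

Lemma scales_L1 F : L1 mu F -> L1 mu (F \o phi).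
Proof.
move=> lF; have [k0 mphi cov] := sphi.
have mF := L1_meas lF.
apply/integrableP; split.
  by apply/measurable_EFinP; exact: measurableT_comp.
rewrite [ltLHS](_ : _ = \int[mu]_x (fun y => (`|F y|)%:E) (phi x))%E//.
rewrite (cov (fun y => (`|F y|)%:E))//; last by apply/measurable_EFinP; exact: measurableT_comp.
rewrite lte_mul_pinfty//; last by case/integrableP: lF.
Qed.

Lemma scales_I F : L1 mu F -> I mu (F \o phi) = k * I mu F.
Proof.
move=> lF; have [k0 mphi cov] := sphi.
have mF := L1_meas lF.
apply: EFin_inj; rewrite EFinM !EFin_I//; last exact: scales_L1.
rewrite integralE [in RHS]integralE muleBr//; last first.
  by apply: fin_num_adde_defr; exact: integrable_pos_fin_num lF.
rewrite -!cov//.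
- by congr (_ - _)%E; apply: eq_integral => x _; [rewrite !funeposE|rewrite !funenegE].
- by apply: measurable_funeneg; exact/measurable_EFinP.
- by apply: measurable_funepos; exact/measurable_EFinP.
Qed.
End Scales.

Section LineScales.
Variable R : realType.
Local Notation mR := (measurableTypeR R).
Local Notation leb := (@lebesgue_measure R).

(** Uniqueness of the Lebesgue measure: the image measure multiplied by |l| agrees with it on
    half-open intervals. For l < 0 the preimage of such an interval is half-open on the other side,
    which does not change its length. *)
Lemma scales_line (z l : R) : l != 0 -> scales leb (fun x : mR => z + l * x) `|l|^-1.
Proof.
move=> l0; have nl0 : 0 < `|l| by rewrite normr_gt0.
pose phi := fun x : mR => (z + l * x : mR).
have mphi : measurable_fun setT phi.
  by apply: measurable_funD => //; apply: measurable_funM.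
split=> [||]; [by rewrite invr_ge0|exact: mphi|].
move=> G mG G0.
pose r : {nonneg R} := NngNum (ltW nl0).
have -> : (\int[leb]_x G x = \int[mscale r (push leb mphi)]_x G x)%E.
  apply: eq_measure_integral => A mA _.
  apply: lebesgue_measure_unique => // _ [[a b]] _ <- /=.
  rewrite /mscale /= /push /= /pushforward.
  have [lpos|lneg] := ltP 0 l.
    have -> : phi @^-1` [set` `]a, b]] = [set` `](a - z) / l, (b - z) / l]].
      apply/seteqP; split => x /=; rewrite /phi !in_itv /=
        ltr_pdivrMr// ler_pdivlMr// (mulrC x) => /andP[h1 h2]; apply/andP; split; lra.
    rewrite !lebesgue_measure_itv /= !lte_fin ltr_pM2r ?invr_gt0//.
    rewrite ltrD2r; case: ifPn => _; last by rewrite mule0.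
    rewrite -!EFinB -EFinM; congr EFin; rewrite gtr0_norm//; field.
    by rewrite gt_eqF.
  have {}lneg : l < 0 by rewrite lt_neqAle l0.
  have -> : phi @^-1` [set` `]a, b]] = [set` `[(b - z) / l, (a - z) / l[].
    apply/seteqP; split => x /=; rewrite /phi !in_itv /=
      ler_ndivrMr// ltr_ndivlMr// (mulrC x) => /andP[h1 h2]; apply/andP; split; lra.
  rewrite !lebesgue_measure_itv /= !lte_fin ltr_nM2r ?invr_lt0//.
  rewrite ltrD2r; case: ifPn => _; last by rewrite mule0.
  rewrite -!EFinB -EFinM; congr EFin; rewrite ltr0_norm//; field.
  by rewrite lt_eqF.
rewrite ge0_integral_mscale//= ge0_integral_push//.
by rewrite muleA -EFinM mulVf ?gt_eqF// mul1e.
Qed.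
End LineScales.

Section TupleInt.
Variable R : realType.
Local Notation mR := (measurableTypeR R).
Local Notation leb := (@lebesgue_measure R).
Local Notation lebn := (@lebesgue_tuple R).

Lemma tuple_pushforward n (G : n.+1.-tuple mR -> \bar R) : measurable_fun setT G ->
  (forall x, 0 <= G x)%E ->
  (\int[lebn n.+1]_t G t = \int[leb \x lebn n]_u G (tcons u))%E.
Proof.
move=> mG G0.
transitivity (\int[push (leb \x lebn n)%E (@measurable_tcons R n)]_t G t)%E.
  by apply: eq_measure_integral => A mA _.
by rewrite ge0_integral_push.
Qed.

Lemma ge0_int_tupleS n (G : n.+1.-tuple mR -> \bar R) : measurable_fun setT G ->
  (forall x, 0 <= G x)%E ->
  (\int[lebn n.+1]_t G t = \int[leb]_x \int[lebn n]_t G (tcons (x, t)))%E.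
Proof.
move=> mG G0; rewrite tuple_pushforward//.
rewrite (fubini_tonelli1 (G \o @tcons R n)) => [//||x]; last exact: G0.
by apply: measurableT_comp => //; exact: measurable_tcons.
Qed.

Lemma L1_tupleS n (F : n.+1.-tuple mR -> R) : measurable_fun setT F ->
  L1 (leb \x lebn n)%E (F \o @tcons R n) -> L1 (lebn n.+1) F.
Proof.
move=> mF /integrableP[_ iF]; apply/integrableP; split; first exact/measurable_EFinP.
rewrite tuple_pushforward//.
by apply/measurable_EFinP; exact: measurableT_comp.
Qed.

Lemma I_tupleS n (F : n.+1.-tuple mR -> R) : measurable_fun setT F ->
  I (lebn n.+1) F = I (leb \x lebn n)%E (F \o @tcons R n).
Proof.
move=> mF; rewrite /I /Rintegral; congr fine.
rewrite integralE [in RHS]integralE !tuple_pushforward//.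
- by congr (_ - _)%E; apply: eq_integral => x _; [rewrite !funeposE|rewrite !funenegE].
- by apply: measurable_funeneg; exact/measurable_EFinP.
- by apply: measurable_funepos; exact/measurable_EFinP.
Qed.

Lemma measurable_section n (G : n.+1.-tuple mR -> \bar R) x : measurable_fun setT G ->
  measurable_fun setT (fun t => G (tcons (x, t))).
Proof.
move=> mG; apply: measurableT_comp => //.
apply: (measurableT_comp (@measurable_tcons R n)).
exact: measurable_pair1.
Qed.

Lemma tof_tcons n (z : 'rV[R]_n.+1) l (x : R) (t : n.-tuple mR) :
  tof (z + l *: rowt (tcons (x, t))) =
  tcons (z 0 0 + l * x, tof (\row_i z 0 (lift ord0 i) + l *: rowt t)).
Proof.
apply: eq_from_tnth => i; rewrite tnth_mktuple !mxE.
have [->|[j ->]] : i = ord0 \/ exists j, i = lift ord0 j.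
    by case: (unliftP ord0 i) => [j ->|->]; [right; exists j|left].
  by rewrite !tnth0.
by rewrite /tcons /= !tnthS tnth_mktuple !mxE.
Qed.

(** Tonelli and induction on the dimension: one coordinate at a time is rescaled by
    [scales_line]. *)
Lemma scales_tuple n (z : 'rV[R]_n) l : l != 0 ->
  scales (lebn n) (fun t => tof (z + l *: rowt t)) (`|l| ^- n).
Proof.
move=> l0; have nl0 : 0 < `|l| by rewrite normr_gt0.
split; first by rewrite invr_ge0 exprn_ge0.
  by apply: measurable_tof; apply: mvecD; [exact: mvec_cst|apply: mvecZ => //; exact: mvec_rowt].
elim: n z => [|n IH] z G mG G0.
  rewrite expr0 invr1 mul1e; apply: eq_integral => t _; congr G.
  by rewrite [LHS]tuple0 [RHS]tuple0.
rewrite !ge0_int_tupleS//; last first.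
  apply: measurableT_comp => //.
  by apply: measurable_tof; apply: mvecD; [exact: mvec_cst|apply: mvecZ => //; exact: mvec_rowt].
pose z' : 'rV[R]_n := \row_i z 0 (lift ord0 i).
under eq_integral do under eq_integral do rewrite tof_tcons.
set a := z 0 0.
have mGs x : measurable_fun setT (fun t => G (tcons (x, t))) by exact: measurable_section.
pose K (y : mR) := (\int[lebn n]_t G (tcons (y, t)))%E.
have mK : measurable_fun setT K.
  apply: (measurable_fun_fubini_tonelli_F (m2 := lebn n) (G \o @tcons R n)) => [|x]; last exact: G0.
  by apply: measurableT_comp => //; exact: measurable_tcons.
have K0 x : (0 <= K x)%E by exact: integral_ge0.
have [_ ml hl] := scales_line a l0.
transitivity (\int[leb]_x ((`|l| ^- n)%:E * K (a + l * x)%R))%E.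
  by apply: eq_integral => x _; rewrite (IH z' (fun t => G (tcons ((a + l * x)%R, t)))).
rewrite ge0_integralZl; [|exact: measurableT|exact: (measurableT_comp mK ml)|by move=> *; exact: K0|by rewrite lee_fin invr_ge0 exprn_ge0].
by rewrite (hl K)// muleA -EFinM -invfM -exprSr.
Qed.
End TupleInt.

Section Square.
Variables (R : realType) (n : nat).
Local Notation mR := (measurableTypeR R).
Local Notation lebn := (@lebesgue_tuple R n).
Local Notation sq := (@lebesgue_square R n).
Local Notation Z := (n.-tuple mR * n.-tuple mR)%type.

Definition lin2 (y0 w0 : 'rV[R]_n) (a b c e : R) (u : Z) : Z :=
  (tof (y0 + a *: rowt u.1 + b *: rowt u.2), tof (w0 + c *: rowt u.1 + e *: rowt u.2)).

Lemma measurable_lin2 y0 w0 a b c e : measurable_fun setT (lin2 y0 w0 a b c e).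
Proof.
apply: measurable_fun_pair; apply: measurable_tof; apply: mvecD;
  try (apply: mvecD; first exact: mvec_cst); apply: mvecZ => //; apply: mvec_rowt.
- exact: measurable_fst.
- exact: measurable_snd.
- exact: measurable_fst.
- exact: measurable_snd.
Qed.

Lemma scales_swap : scales sq (fun u : Z => (u.2, u.1)) 1.
Proof.
split => //; first exact: measurable_swap.
move=> G mG G0; rewrite mul1e /lebesgue_square.
rewrite [RHS]fubini_tonelli1// [LHS](fubini_tonelli2 (fun u => G (u.2, u.1)))//.
by apply: (measurableT_comp mG); exact: measurable_swap.
Qed.

(** Gauss elimination. At fixed zeta, the first block replaces eta by y; then w = w0 + (c / a) (y -
    y0) + h zeta, and at fixed y the factor h = (a e - b c) / a rescales zeta. *)
Let scales_square_neq0 y0 w0 a b c e : a != 0 -> a * e - b * c != 0 ->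
  scales sq (lin2 y0 w0 a b c e) (`|a * e - b * c| ^- n).
Proof.
move=> a0 D0; split; first by rewrite invr_ge0 exprn_ge0.
  exact: measurable_lin2.
move=> G mG G0.
have mGl := measurableT_comp mG (measurable_lin2 y0 w0 a b c e).
rewrite /lebesgue_square.
rewrite [LHS](fubini_tonelli2 (G \o lin2 y0 w0 a b c e)) => [|//|x]; last exact: G0.
pose h := (a * e - b * c) / a.
have h0 : h != 0 by rewrite mulf_neq0// invr_eq0.
pose H (y zeta : n.-tuple mR) := G (y, tof (w0 + (c / a) *: (rowt y - y0) + h *: rowt zeta)).
have mH : measurable_fun setT (fun u : Z => H u.1 u.2).
  apply: (measurableT_comp mG); apply: measurable_fun_pair; first exact: measurable_fst.
  apply: measurable_tof; apply: mvecD; last first.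
    by apply: mvecZ => //; apply: mvec_rowt; exact: measurable_snd.
  apply: mvecD; first exact: mvec_cst.
  apply: mvecZ => //; apply: mvecB; last exact: mvec_cst.
  by apply: mvec_rowt; exact: measurable_fst.
transitivity (\int[lebn]_zeta ((`|a| ^- n)%:E * \int[lebn]_y H y zeta))%E.
  apply: eq_integral => zeta _.
  have [_ mt ht] := scales_tuple (y0 + b *: rowt zeta) a0.
  rewrite -(ht (H^~ zeta)) => [||y]; last exact: G0.
    rewrite /fubini_G; apply: eq_integral => eta _ /=; rewrite /lin2 /H /= rowtK.
    congr (G (tof _, tof _)); first by rewrite addrAC.
    apply/rowP => i; rewrite !mxE /h; field => //.
  exact: (measurableT_comp mH (measurable_pair2 zeta)).
rewrite ge0_integralZl; [|exact: measurableT| |by move=> *; apply: integral_ge0 => *; exact: G0|by rewrite lee_fin invr_ge0 exprn_ge0]; last first.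
  by apply: (measurable_fun_fubini_tonelli_G (m1 := lebn) (fun u => H u.1 u.2)) => // x; exact: G0.
rewrite -(fubini_tonelli (m1 := lebn) (m2 := lebn) (fun u => H u.1 u.2))//; last by move=> x; exact: G0.
rewrite [X in (_ * X)%E](_ : _ = \int[lebn]_y ((`|h| ^- n)%:E * \int[lebn]_w G (y, w)))%E; last first.
  apply: eq_integral => y _.
  have [_ mt ht] := scales_tuple (w0 + (c / a) *: (rowt y - y0)) h0.
  rewrite -(ht (fun w => G (y, w)))//.
  exact: (measurableT_comp mG (measurable_pair1 y)).
rewrite ge0_integralZl; [|exact: measurableT| |by move=> *; apply: integral_ge0 => *; exact: G0|by rewrite lee_fin invr_ge0 exprn_ge0]; last first.
  exact: (measurable_fun_fubini_tonelli_F (m2 := lebn) G).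
rewrite muleA -EFinM -invfM -exprMn -normrM mulrC /h divfK//.
by rewrite [in RHS](fubini_tonelli1 G).
Qed.

(** If a = 0, the determinant forces b != 0, and exchanging the two variables leads back to the case
    already treated. *)
Lemma scales_square y0 w0 a b c e : a * e - b * c != 0 ->
  scales sq (lin2 y0 w0 a b c e) (`|a * e - b * c| ^- n).
Proof.
move=> D0; have [a0|a0] := eqVneq a 0; last exact: scales_square_neq0.
have b0 : b != 0.
  by apply: contra_neq D0 => ->; rewrite a0 !mul0r subrr.
have D1 : b * c - a * e != 0 by rewrite -opprB oppr_eq0.
have := scales_comp (@scales_square_neq0 y0 w0 b a e c b0 D1) scales_swap.
rewrite mulr1 distrC (_ : _ \o _ = lin2 y0 w0 a b c e)//.
by apply: funext => u; rewrite /lin2 /= addrAC (addrAC w0).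
Qed.
End Square.

Section VecScales.
Variables (R : realType) (n : nat).

Lemma intRd_affine (g : 'rV[R]_n -> R) z l : l != 0 -> integrableRd g ->
  integrableRd (fun w => g (z + l *: w)) /\ intRd (fun w => g (z + l *: w)) = `|l| ^- n * intRd g.
Proof.
move=> l0 ig; have sc := scales_tuple z l0.
have E : (g \o @rowt R n) \o (fun t => tof (z + l *: rowt t)) = (fun w => g (z + l *: w)) \o @rowt R n.
  by apply: funext => t /=; rewrite rowtK.
split; first by have := scales_L1 sc ig; rewrite E.
by have := scales_I sc ig; rewrite E.
Qed.

Lemma intRd_translate (g : 'rV[R]_n -> R) z : integrableRd g ->
  integrableRd (fun w => g (z + w)) /\ intRd (fun w => g (z + w)) = intRd g.
Proof.
move=> ig; have [] := intRd_affine z (oner_neq0 R) ig.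
under eq_fun do rewrite scale1r.
by rewrite normr1 expr1n invr1 mul1r.
Qed.
End VecScales.

Lemma scaleR_mul (R : realType) (a b : R) : a *: b = a * b.
Proof. by []. Qed.

(** * Integrals of derivatives, and the Fourier transform of the Gaussian *)

Section ShiftIntegral.
Context d (T : measurableType d) (R : realType) (mu : {measure set T -> \bar R}).
Variables (phi : R -> T -> T).
Hypothesis sphi : forall h, scales mu (phi h) 1.

(** Each difference quotient of F has integral 0 because the shift preserves the measure; dominated
    convergence passes this on to the limit. *)
Lemma shift_int0 (F DF M : T -> R) : L1 mu F -> L1 mu M ->
  (forall x, (n.+1%:R * (F (phi n.+1%:R^-1 x) - F x)) @[n --> \oo] --> DF x) ->
  (forall x n, `|n.+1%:R * (F (phi n.+1%:R^-1 x) - F x)| <= M x) ->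
  I mu DF = 0.
Proof.
move=> lF lM Fc Fb.
have lFp h : L1 mu (F \o phi h) by have := scales_L1 (sphi h) lF.
have lB n : L1 mu (fun x => F (phi n.+1%:R^-1 x) - F x) by apply: L1B => //; exact: lFp.
have E n : I mu (fun x => n.+1%:R * (F (phi n.+1%:R^-1 x) - F x)) = 0.
  rewrite I_Zl// I_B//; last exact: lFp.
  have := scales_I (sphi n.+1%:R^-1) lF; rewrite mul1r /comp => ->.
  by rewrite subrr mulr0.
have := I_cvg (fun n => L1_meas (L1Zl n.+1%:R (lB n))) Fc lM (fun n x => Fb x n).
under eq_fun do rewrite E.
by move/cvg_lim => <-//; exact: lim_cst.
Qed.

Context {V : normedModType R}.
Variables (kappa : T -> V) (u : V).
Hypothesis kphi : forall h x, kappa (phi h x) = kappa x + h *: u.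

(** This replaces boundary terms in integrations by parts. The mean value theorem bounds the
    difference quotients by DF on a unit segment, so DF must be dominated along the whole segment.
    The map [kappa] separates the space T of the measure from the normed space V in which F is
    differentiated. *)
Lemma int_derive0 (F DF : V -> R) (M : T -> R) :
  L1 mu (F \o kappa) -> L1 mu M ->
  (forall v, is_derive v u F (DF v)) ->
  (forall x s, `|s| <= 1 -> `|DF (kappa x + s *: u)| <= M x) ->
  I mu (DF \o kappa) = 0.
Proof.
move=> lF lM dF Db; apply: (@shift_int0 (F \o kappa) _ M) => //.
- move=> x /=.
  have := dF (kappa x) => -[df <-].
  have : (fun h => h^-1 *: (F (h *: u + kappa x) - F (kappa x))) @ 0^' --> 'D_u F (kappa x) by exact: df.
  move=> /cvgr_dnbhsP /(_ (fun n => n.+1%:R^-1)).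
  have h0 n : n.+1%:R^-1 != 0 :> R by rewrite invr_eq0.
  move=> /(_ (conj h0 (@cvg_harmonic R))).
  move=> H; apply: cvg_trans H; apply: near_eq_cvg; apply: nearW => n.
  by rewrite /= invrK kphi (addrC (kappa x)).
- move=> x n /=; rewrite kphi.
  pose g s := F (kappa x + s *: u).
  have dg (s : R) : is_derive s 1 g (DF (kappa x + s *: u)).
    have [df dv] := dF (kappa x + s *: u).
    have E : (fun h : R => h^-1 *: ((g \o shift s) (h *: 1) - g s)) =
      (fun h => h^-1 *: ((F \o shift (kappa x + s *: u)) (h *: u) - F (kappa x + s *: u))).
      apply/funext => h /=; rewrite /g; congr (_ *: (F _ - _)).
      by rewrite scalerDl addrCA /GRing.scale /= mulr1.
    by split; [rewrite /derivable E|rewrite /derive E].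
  have n0 : (0 : R) < n.+1%:R^-1 by rewrite invr_gt0.
  have cg : {within `[0, n.+1%:R^-1], continuous g}.
    apply: continuous_subspaceT => s.
    by apply: differentiable_continuous; apply/derivable1_diffP; case: (dg s).
  have [s] := MVT n0 (fun s _ => dg s) cg.
  rewrite in_itv /= => /andP[s0 sn].
  rewrite /g scale0r addr0 subr0 => ->.
  rewrite mulrCA mulfV ?pnatr_eq0// mulr1; apply: Db.
  rewrite gtr0_norm// (le_trans (ltW sn))// invf_le1//.
  by rewrite ler1n.
Qed.
End ShiftIntegral.

Section OneDim.
Variable R : realType.
Local Notation mR := (measurableTypeR R).
Local Notation leb := (@lebesgue_measure R).

(** Chosen as a majorant since its tails are heavy: it is integrable, dominates Gaussians, and
    changes by at most a constant factor under shifts of length 1, as [int_derive0] requires. *)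
Definition cauchy1 (x : R) : R := (oneDsqr x)^-1.

Lemma cauchy1_gt0 x : 0 < cauchy1 x.
Proof. by rewrite invr_gt0 (lt_le_trans _ (oneDsqr_ge1 x)). Qed.

Lemma cauchy1_shift x s : `|s| <= 1 -> cauchy1 (x + s) <= 3 * cauchy1 x.
Proof.
move=> s1; have s2 : s ^+ 2 <= 1 by rewrite -real_normK ?num_real// exprn_ile1.
have p y : 0 < oneDsqr y by rewrite (lt_le_trans _ (oneDsqr_ge1 y)).
rewrite /cauchy1 -[X in X * _]invrK -invfM lef_pV2 ?posrE ?mulr_gt0 ?invr_gt0//.
rewrite ler_pdivrMl// /oneDsqr.
have := sqr_ge0 (2 * s + x); rewrite !sqrrD !exprMn; nra.
Qed.

Lemma L1_cauchy1 : L1 leb cauchy1.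
Proof.
apply/integrableP; split.
  by apply/measurable_EFinP; exact: continuous_measurable_fun (@continuous_oneDsqrV R).
under eq_integral do rewrite /= (gtr0_norm (cauchy1_gt0 _)).
rewrite ge0_symfun_integralT.
- rewrite (_ : [set x | _] = `[0, +oo[%classic) ?integral0y_oneDsqr ?ltry//.
  by apply/seteqP; split => x /=; rewrite in_itv /= ?andbT.
- by move=> x; exact/ltW/cauchy1_gt0.
- exact: continuous_oneDsqrV.
- by move=> x /=; rewrite /cauchy1 /oneDsqr sqrrN.
Qed.

Lemma gauss_cauchy x : expR (- x ^+ 2) <= cauchy1 x.
Proof.
rewrite expRN /cauchy1 lef_pV2 ?posrE ?expR_gt0 ?(lt_le_trans _ (oneDsqr_ge1 x))//.
exact: expR_ge1Dx.
Qed.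

(** Squaring 1 + u <= exp u at u = x^2 / 2 leaves the polynomial inequality y (1 + y^2) <= 2 (1 +
    y^2 / 2)^2, which follows from (1 + y^2) (y - 1)^2 >= 0. *)
Lemma xgauss_cauchy x : `|x| * expR (- x ^+ 2) <= 2 * cauchy1 x.
Proof.
have p : 0 < oneDsqr x by rewrite (lt_le_trans _ (oneDsqr_ge1 x)).
have e : (1 + x ^+ 2 / 2) ^+ 2 <= expR (x ^+ 2).
  have -> : expR (x ^+ 2) = expR (x ^+ 2 / 2) ^+ 2 by rewrite -expRM_natl; congr expR; field.
  have h := expR_ge1Dx (x ^+ 2 / 2).
  by rewrite lerXn2r ?nnegrE// ?expR_ge0// addr_ge0// divr_ge0// sqr_ge0.
rewrite expRN ler_pdivrMr ?expR_gt0// /cauchy1 mulrAC ler_pdivlMr// /oneDsqr.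
apply: (le_trans _ (ler_wpM2l _ e)) => //.
have -> : x ^+ 2 = `|x| ^+ 2 by rewrite real_normK ?num_real.
move: `|x| (normr_ge0 x) => y y0.
have := mulr_ge0 (addr_ge0 ler01 (sqr_ge0 y)) (sqr_ge0 (y - 1)); have := sqr_ge0 y; nra.
Qed.

Lemma gauss_ode (A : R -> R) (b : R) :
  (forall b : R, is_derive b 1 A (- (b / 2) * A b)) -> A b = expR (- (b / 2) ^+ 2) * A 0.
Proof.
move=> dA; pose E (c : R) : R := expR ((c / 2) ^+ 2) * A c.
have dE (c : R) : is_derive c 1 E 0.
  have : is_derive c 1 ((expR \o (fun c => (c * 2^-1) ^+ 2)) * A) 0.
    apply: is_derive_eq; rewrite /= !scaleR_mul.
    by move: (A c) (expR _) => y z; field.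
  by [].
have := is_derive_0_is_cst b 0 dE.
rewrite /E mul0r expr0n expR0 mul1r => <-.
by rewrite mulrA -expRD addNr expR0 mul1r.
Qed.

(** As a function of b the integral A satisfies A' = - (b / 2) A: differentiation under the integral
    gives the integral of x exp(- x^2) sin(a - b x), and an integration by parts in x brings the
    cosine back. At b = 0 it is the Gaussian integral. *)
Lemma gauss_cos (a b : R) :
  I leb (fun x => expR (- x ^+ 2) * cos (a - b * x)) = Num.sqrt pi * expR (- (b / 2) ^+ 2) * cos a.
Proof.
pose F (b' x : R) : R := expR (- x ^+ 2) * cos (a - b' * x).
pose S (b' x : R) : R := expR (- x ^+ 2) * sin (a - b' * x).
have mid : measurable_fun (setT : set mR) (fun x : mR => x : R) by exact: measurable_id.
have mS b' : measurable_fun (setT : set mR) (S b').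
  apply: measurable_funM; first exact: measurable_gauss_fun.
  apply: measurableT_comp; first exact: continuous_measurable_fun (@continuous_sin R).
  by apply: measurable_funB => //; apply: measurable_funM.
have mF b' : measurable_fun (setT : set mR) (F b').
  apply: measurable_funM; first exact: measurable_gauss_fun.
  apply: measurableT_comp; first exact: continuous_measurable_fun (@continuous_cos R).
  by apply: measurable_funB => //; apply: measurable_funM.
have lF b' : L1 leb (F b').
  apply: (@L1_le _ _ _ leb _ cauchy1 (mF b') L1_cauchy1) => x.
  rewrite normrM ger0_norm ?expR_ge0// -[leRHS]mulr1.
  by apply: ler_pM; rewrite ?expR_ge0 ?gauss_cauchy//; exact: cos_max.
have lS b' : L1 leb (S b').
  apply: (@L1_le _ _ _ leb _ cauchy1 (mS b') L1_cauchy1) => x.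
  rewrite normrM ger0_norm ?expR_ge0// -[leRHS]mulr1.
  by apply: ler_pM; rewrite ?expR_ge0 ?gauss_cauchy//; exact: sin_max.
have lxS b' : L1 leb (fun x => x * S b' x).
  apply: (@L1_le _ _ _ leb _ (fun x => 2 * cauchy1 x)) => [||x].
  - exact: (measurable_funM mid (mS b')).
  - exact: L1Zl L1_cauchy1.
  - rewrite normrM normrM mulrA (ger0_norm (expR_ge0 _)) -[leRHS]mulr1.
    by apply: ler_pM; rewrite ?mulr_ge0 ?expR_ge0// ?xgauss_cauchy//; exact: sin_max.
have dS (b' x : R) : is_derive x 1 (S b') (- 2 * (x * S b' x) - b' * F b' x).
  have : is_derive x 1 ((expR \o (fun x => - x ^+ 2)) * (sin \o (fun x => a - b' * x)))
      (- 2 * (x * S b' x) - b' * F b' x).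
    by apply: is_derive_eq; rewrite /S /F /= !scaleR_mul; ring.
  by [].
have EQ (b' : R) : I leb (fun x => x * S b' x) = - (b' / 2) * I leb (F b').
  have : I leb ((fun x => - 2 * (x * S b' x) - b' * F b' x) \o id) = 0.
    apply: (@int_derive0 _ _ _ leb (fun h x => h + 1 * x) _ _ id 1 _ (S b')
      _ (fun x => 3 * ((4 + `|b'|) * cauchy1 x))).
    - by move=> h; have := scales_line h (oner_neq0 R); rewrite normr1 invr1.
    - by move=> h x; rewrite /= mul1r addrC /GRing.scale /= mulr1.
    - exact: lS.
    - by do 2 apply: L1Zl; exact: L1_cauchy1.
    - move=> x s s1; rewrite /GRing.scale /= mulr1.
      apply: (@le_trans _ _ ((4 + `|b'|) * cauchy1 (x + s))); last first.
        rewrite mulrCA; apply: ler_wpM2l; first by rewrite addr_ge0.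
        exact: cauchy1_shift.
      move: (x + s) => y; rewrite mulrDl; apply: (le_trans (ler_normB _ _)); apply: lerD.
        rewrite !normrM normrN (ger0_norm (expR_ge0 _)) (ger0_norm (ler0n _ 2)).
        rewrite (_ : 4 = 2 * 2)%R -?mulrA ?ler_pM2l//; last by rewrite -natrM.
        rewrite mulrA -[leRHS]mulr1.
        by apply: ler_pM; rewrite ?mulr_ge0 ?expR_ge0// ?xgauss_cauchy//; exact: sin_max.
      rewrite !normrM (ger0_norm (expR_ge0 _)); apply: ler_wpM2l => //.
      rewrite -[leRHS]mulr1.
      by apply: ler_pM; rewrite ?expR_ge0 ?gauss_cauchy//; exact: cos_max.
  rewrite /= I_B; [|exact: L1Zl|exact: L1Zl].
  rewrite !I_Zl//; lra.
have dF' (b' x : R) : is_derive b' 1 (F^~ x) (x * S b' x).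
  have : is_derive b' 1 (cst (expR (- x ^+ 2)) * (cos \o (fun b => a - b * x))) (x * S b' x).
    by apply: is_derive_eq; rewrite /S /= !scaleR_mul; ring.
  by [].
have dA (b' : R) : is_derive b' 1 (fun b => I leb (F b)) (- (b' / 2) * I leb (F b')).
  have b1 : b' - 1 < b' < b' + 1 by lra.
  have Ib : `]b' - 1, b' + 1[%classic b' by rewrite /= in_itv.
  have p1 (y x : R) : partial1of2 F y x = x * S y x.
    by rewrite partial1of2E; have [_ ->] := dF' y x.
  have h1 : forall y, `]b' - 1, b' + 1[%classic y -> leb.-integrable setT (EFin \o F y) by move=> y _; exact: lF.
  have h2 y x : `]b' - 1, b' + 1[%classic y -> setT x -> derivable (F^~ x) y 1.
    by move=> _ _; case: (dF' y x).
  have h3 : forall y, 0 <= 2 * cauchy1 y.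
    by move=> y; rewrite mulr_ge0// ltW// cauchy1_gt0.
  have h4 : leb.-integrable setT (EFin \o (fun y : R => 2 * cauchy1 y)) by exact: L1Zl L1_cauchy1.
  have h5 y x : `]b' - 1, b' + 1[%classic y -> setT x -> `|partial1of2 F y x| <= 2 * cauchy1 x.
    move=> _ _; rewrite p1 normrM normrM mulrA (ger0_norm (expR_ge0 _)) -[leRHS]mulr1.
    by apply: ler_pM; rewrite ?mulr_ge0 ?expR_ge0// ?xgauss_cauchy//; exact: sin_max.
  split; first exact: (derivable_under_integral measurableT Ib h1 h2 h3 h4 h5).
  rewrite -derive1E (differentiation_under_integral measurableT Ib h1 h2 h3 h4 h5) -EQ.
  by apply: eq_I => x; rewrite p1.
rewrite [LHS](gauss_ode _ dA).
have F0 : I leb (F 0) = Num.sqrt pi * cos a.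
  rewrite /F; under eq_fun do rewrite mul0r subr0.
  rewrite I_Zr; last exact: integrableT_gauss.
  congr (_ * _); apply: EFin_inj; rewrite EFin_I; last exact: integrableT_gauss.
  exact: integralT_gauss.
by rewrite F0 mulrA (mulrC (expR _)).
Qed.
End OneDim.

(** * Product weights and Gaussians *)

Section ProductFunctions.
Variable R : realType.
Local Notation mR := (measurableTypeR R).
Local Notation leb := (@lebesgue_measure R).

Definition prodV n (h : R -> R) (w : 'rV[R]_n) : R := \prod_i h (w 0 i).

Lemma prodV_tcons n h (x : R) (t : n.-tuple mR) :
  prodV h (rowt (tcons (x, t))) = h x * prodV h (rowt t).
Proof.
rewrite /prodV big_ord_recl; congr (_ * _); first by rewrite mxE tnth0.
by apply: eq_bigr => i _; rewrite !mxE /tcons tnthS.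
Qed.

Lemma dot_tcons n (x : R) (t : n.-tuple mR) (xi : 'rV[R]_n.+1) :
  dot (rowt (tcons (x, t))) xi = x * xi 0 0 + dot (rowt t) (\row_i xi 0 (lift ord0 i)).
Proof.
rewrite /dot big_ord_recl; congr (_ * _ + _); first by rewrite mxE tnth0.
by apply: eq_bigr => i _; rewrite !mxE /tcons tnthS.
Qed.

Lemma mRd_prodV n h : measurable_fun (setT : set mR) h -> mRd (@prodV n h).
Proof.
move=> mh; apply: (@measurable_prod _ _ _ setT _ (index_enum _) (fun i t => h (rowt t 0 i))) => i _.
apply: (measurableT_comp mh); exact: (mvec_rowt (@measurable_id _ _ setT)).
Qed.

Lemma mRd_cos n (a : R) (xi : 'rV[R]_n) : mRd (fun w => cos (a - dot w xi)).
Proof.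
apply: measurableT_comp; first exact: continuous_measurable_fun (@continuous_cos R).
apply: measurable_funB => //; apply: measurable_dot; last exact: mvec_cst.
exact: (mvec_rowt (@measurable_id _ _ setT)).
Qed.

Lemma L1_tuple0 (F : 0.-tuple mR -> R) : L1 (lebesgue_tuple 0) F /\
  I (lebesgue_tuple 0) F = F [tuple].
Proof.
have -> : F = cst (F [tuple]) by apply: funext => t; rewrite [t]tuple0.
have m1 : (lebesgue_tuple 0 setT = 1 :> \bar R)%E by rewrite /= diracT.
split.
  apply/integrableP; split; first by apply/measurable_EFinP; exact: measurable_cst.
  have := integral_cst (lebesgue_tuple 0) measurableT (`|F [tuple]|%:E)%E.
  by rewrite /= diracT mule1 => ->; rewrite ltry.
have := @Rintegral_cst _ _ _ (lebesgue_tuple 0) _ measurableT (F [tuple]).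
by move=> H; rewrite [LHS]H [X in fine X]m1 mulr1.
Qed.

Lemma L1_prodV n h : L1 leb h -> integrableRd (@prodV n h).
Proof.
move=> lh; have mh := L1_meas lh.
elim: n => [|n IH]; first by have [] := L1_tuple0 (@prodV 0 h \o @rowt R 0).
apply: (@L1_tupleS R n (@prodV n.+1 h \o @rowt R n.+1)); first exact: mRd_prodV.
have -> : (@prodV n.+1 h \o @rowt R n.+1) \o @tcons R n = fun u => h u.1 * prodV h (rowt u.2).
  by apply: funext => -[x t] /=; rewrite prodV_tcons.
apply: (L1_prod (F := fun x t => h x * prodV h (rowt t)) (a := fun x => `|h x|)
  (b := fun t => `|prodV h (rowt t)|)).
- apply: measurable_funM; first exact: (measurableT_comp mh measurable_fst).
  exact: (measurableT_comp (mRd_prodV mh) measurable_snd).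
- exact: L1_norm.
- by have := L1_norm IH.
- by move=> x y; rewrite normrM.
Qed.

(** The free phase a closes the induction: when the last n coordinates are integrated out, the first
    one only appears as a shift of the phase by x xi_0. *)
Lemma prodV_cos n h hh (a : R) (xi : 'rV[R]_n) : L1 leb h ->
  (forall a b, I leb (fun x => h x * cos (a - b * x)) = hh b * cos a) ->
  intRd (fun w => prodV h w * cos (a - dot w xi)) = prodV hh xi * cos a.
Proof.
move=> lh hc; have mh := L1_meas lh.
elim: n a xi => [|n IH] a xi.
  have [_ ] := L1_tuple0 ((fun w => prodV h w * cos (a - dot w xi)) \o @rowt R 0).
  move=> H; rewrite /intRd -/(I _ _) [LHS]H.
  by rewrite /= /prodV /dot !big_ord0 subr0.
have mF : mRd (fun w : 'rV[R]_n.+1 => prodV h w * cos (a - dot w xi)).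
  by apply: measurable_funM; [exact: mRd_prodV|exact: mRd_cos].
have := I_tupleS mF; rewrite /intRd -/(I _ _) => ->.
pose xi' : 'rV[R]_n := \row_i xi 0 (lift ord0 i).
pose F x t := h x * prodV h (rowt t) * cos (a - x * xi 0 0 - dot (rowt t) xi') : R.
have E : ((fun w : 'rV[R]_n.+1 => prodV h w * cos (a - dot w xi)) \o @rowt R n.+1) \o @tcons R n =
   fun u => F u.1 u.2.
  by apply: funext => -[x t] /=; rewrite prodV_tcons dot_tcons opprD addrA.
have lF : L1 (leb \x lebesgue_tuple n)%E (fun u => F u.1 u.2).
  apply: (L1_prod (F := F) (a := fun x => `|h x|)
    (b := fun t => `|prodV h (rowt t)|)).
  - rewrite -E; apply: (measurableT_comp mF); exact: measurable_tcons.
  - exact: L1_norm.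
  - by have := L1_norm (L1_prodV n lh).
  - move=> x y; rewrite !normrM -[leRHS]mulr1; apply: ler_wpM2l; last exact: cos_max.
    by rewrite mulr_ge0.
rewrite E (I_prod lF).
have E2 x : I (lebesgue_tuple n) (F x) = prodV hh xi' * (h x * cos (a - xi 0 0 * x)).
  rewrite mulrCA (mulrC _ x) -(IH (a - x * xi 0 0) xi') /intRd -/(I _ _).
  rewrite -I_Zl; first by apply: eq_I => t; rewrite /F mulrA.
  apply: (@L1_le _ _ _ _ _ (fun t => `|prodV h (rowt t)|)).
  - by apply: measurable_funM; [exact: mRd_prodV|exact: mRd_cos].
  - by have := L1_norm (L1_prodV n lh).
  - by move=> t; rewrite normrM -[leRHS]mulr1; apply: ler_wpM2l => //; exact: cos_max.
under eq_I do rewrite E2.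
rewrite I_Zl; last first.
  apply: (@L1_le _ _ _ leb _ (fun x => `|h x|)).
  - apply: measurable_funM => //.
    apply: measurableT_comp; first exact: continuous_measurable_fun (@continuous_cos R).
    by apply: measurable_funB => //; apply: measurable_funM.
  - exact: L1_norm.
  - by move=> t; rewrite normrM -[leRHS]mulr1; apply: ler_wpM2l => //; exact: cos_max.
rewrite hc mulrA; congr (_ * _); rewrite /prodV big_ord_recl mulrC; congr (_ * _).
by apply: eq_bigr => i _; rewrite mxE.
Qed.
End ProductFunctions.

Section Jfun.
Variables (R : realType) (n : nat).

(** The common majorant in velocity, in position and in frequency: integrable, positive, at most 1,
    and stable up to a factor 3 under unit shifts along the axes. *)
Definition J (w : 'rV[R]_n) : R := prodV (@cauchy1 R) w.

Lemma J_gt0 w : 0 < J w.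
Proof. by apply: prodr_gt0 => i _; exact: cauchy1_gt0. Qed.

Lemma J_ge0 w : 0 <= J w. Proof. exact/ltW/J_gt0. Qed.

Lemma integrable_J : integrableRd J.
Proof. exact: L1_prodV (@L1_cauchy1 R). Qed.

Lemma J_shift w s i : `|s| <= 1 -> J (w + s *: delta_mx 0 i) <= 3 * J w.
Proof.
move=> s1; rewrite /J /prodV (bigD1 i)//= [in leRHS](bigD1 i)//= mulrA.
rewrite !mxE !eqxx mulr1.
rewrite (eq_bigr (fun j => cauchy1 (w 0 j))); last first.
  by move=> j ji; rewrite !mxE (negbTE ji) andbF mulr0 addr0.
apply: ler_wpM2r; last exact: cauchy1_shift.
by apply: prodr_ge0 => j _; exact/ltW/cauchy1_gt0.
Qed.

(** With the majorant J a pointwise bound is enough, since [J_shift] extends it to unit segments. *)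
Lemma int_derive_dir0 (F DF : 'rV[R]_n -> R) i B : integrableRd F ->
  (forall w, is_derive w (delta_mx 0 i) F (DF w)) ->
  (forall w, `|DF w| <= B * J w) -> intRd DF = 0.
Proof.
move=> iF dF DB.
have B0 : 0 <= B.
  have := le_trans (normr_ge0 _) (DB 0).
  by rewrite pmulr_lge0// J_gt0.
rewrite /intRd -/(I _ _).
apply: (@int_derive0 _ _ _ (lebesgue_tuple n)
  (fun h t => tof (rowt t + h *: delta_mx 0 i)) _ _ (@rowt R n) (delta_mx 0 i) _ F DF
  (fun t => B * (3 * J (rowt t)))).
- move=> h; have := scales_tuple (h *: (delta_mx 0 i : 'rV[R]_n)) (oner_neq0 R).
  rewrite normr1 expr1n invr1; congr (scales _ _ _); apply: funext => t.
  by rewrite scale1r addrC.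
- by move=> h x; rewrite rowtK.
- exact: iF.
- by do 2 apply: L1Zl; exact: integrable_J.
- move=> t s s1; rewrite (le_trans (DB _))//.
  by apply: ler_wpM2l => //; exact: J_shift.
Qed.
End Jfun.

Section Gaussians.
Variables (R : realType) (n : nat).
Local Notation leb := (@lebesgue_measure R).
Local Notation sqpi := (Num.sqrt (@pi R)).

Let sqpi_gt0 : 0 < sqpi. Proof. by rewrite sqrtr_gt0 pi_gt0. Qed.

Definition g1d (l x : R) : R := expR (- (l * x) ^+ 2).

Lemma L1_g1d l : 0 < l -> L1 leb (g1d l).
Proof.
move=> l0; have h : L1 leb (@gauss_fun R) by exact: integrableT_gauss.
have := scales_L1 (scales_line 0 (lt0r_neq0 l0)) h.
by apply: eq_L1 => x; rewrite /= /gauss_fun add0r.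
Qed.

Lemma g1d_cos l a b : 0 < l -> I leb (fun x => g1d l x * cos (a - b * x)) =
  l^-1 * sqpi * expR (- (b / (2 * l)) ^+ 2) * cos a.
Proof.
move=> l0; have lF : L1 leb (fun x => expR (- x ^+ 2) * cos (a - (b / l) * x)).
  apply: (@L1_le _ _ _ leb _ (@gauss_fun R)).
  - apply: measurable_funM; first exact: measurable_gauss_fun.
    apply: measurableT_comp; first exact: continuous_measurable_fun (@continuous_cos R).
    by apply: measurable_funB => //; apply: measurable_funM.
  - exact: integrableT_gauss.
  - move=> t; rewrite normrM (ger0_norm (expR_ge0 _)) -[leRHS]mulr1.
    by apply: ler_wpM2l; [exact: expR_ge0|exact: cos_max].
have := scales_I (scales_line 0 (lt0r_neq0 l0)) lF.
rewrite gauss_cos gtr0_norm// => h.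
rewrite -!mulrA; rewrite (mulrA sqpi) (_ : b / (2 * l) = b / l / 2); last first.
  by field; rewrite lt0r_neq0.
rewrite -h; apply: eq_I => x; rewrite /= /g1d add0r; congr (_ * cos (a - _)).
by rewrite mulrA divfK// lt0r_neq0.
Qed.

Definition Egauss (l : R) (xi : 'rV[R]_n) : R := prodV (g1d l) xi.

(** The heat kernel at time l^2, that is (4 pi l^2)^(-n/2) exp(- |w|^2 / (4 l^2)); its Fourier
    transform is [Egauss l]. The product form is the one to which [prodV_cos] applies. *)
Definition Ggauss (l : R) (w : 'rV[R]_n) : R :=
  prodV (fun x => (2 * l * sqpi)^-1 * g1d (2 * l)^-1 x) w.

Lemma EgaussE l xi : Egauss l xi = expR (- (l * enorm xi) ^+ 2).
Proof.
rewrite /Egauss /prodV -expR_sum; congr expR.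
rewrite exprMn sqr_sqrtr; last by apply: sumr_ge0 => i _; rewrite -expr2 sqr_ge0.
rewrite /dot mulr_sumr -sumrN; apply: eq_bigr => i _.
by rewrite exprMn expr2.
Qed.

Lemma Egauss_gt0 l xi : 0 < Egauss l xi.
Proof. by apply: prodr_gt0 => i _; exact: expR_gt0. Qed.

Lemma Egauss_le1 l xi : Egauss l xi <= 1.
Proof. by rewrite EgaussE -expR0 ler_expR lerNl oppr0 sqr_ge0. Qed.

Lemma Ggauss_gt0 l w : 0 < l -> 0 < Ggauss l w.
Proof.
move=> l0; apply: prodr_gt0 => i _; rewrite mulr_gt0 ?expR_gt0// invr_gt0.
by rewrite !mulr_gt0.
Qed.

Lemma integrable_Egauss l : 0 < l -> integrableRd (Egauss l).
Proof. by move=> l0; apply: L1_prodV; exact: L1_g1d. Qed.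

Lemma integrable_Ggauss l : 0 < l -> integrableRd (Ggauss l).
Proof.
by move=> l0; apply: L1_prodV; apply: L1Zl; apply: L1_g1d; rewrite invr_gt0 mulr_gt0.
Qed.

Lemma Ggauss_cos l a xi : 0 < l ->
  intRd (fun w => Ggauss l w * cos (a - dot w xi)) = Egauss l xi * cos a.
Proof.
move=> l0; have l2 : 0 < (2 * l)^-1 by rewrite invr_gt0 mulr_gt0.
apply: prodV_cos; first by apply: L1Zl; exact: L1_g1d.
move=> a' b.
rewrite (@eq_I _ _ _ leb _ (fun x => (2 * l * sqpi)^-1 * (g1d (2 * l)^-1 x * cos (a' - b * x)))); last first.
  by move=> x; rewrite mulrA.
rewrite I_Zl; last first.
  apply: (@L1_le _ _ _ leb _ (g1d (2 * l)^-1)); last 1 first.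
  - move=> t; rewrite normrM (ger0_norm (expR_ge0 _)) -[leRHS]mulr1.
    by apply: ler_wpM2l; [exact: expR_ge0|exact: cos_max].
  - apply: measurable_funM; first exact: L1_meas (L1_g1d l2).
    apply: measurableT_comp; first exact: continuous_measurable_fun (@continuous_cos R).
    by apply: measurable_funB => //; apply: measurable_funM.
  - exact: L1_g1d.
rewrite g1d_cos// mulrA; congr (_ * _).
have -> : b / (2 * (2 * l)^-1) = l * b by field; rewrite lt0r_neq0.
rewrite /g1d mulrA -[RHS]mul1r; congr (_ * _).
by field; rewrite !lt0r_neq0.
Qed.

Lemma Egauss_cos l a w : 0 < l ->
  (2 * pi) ^- n * intRd (fun xi => Egauss l xi * cos (a - dot xi w)) = Ggauss l w * cos a.
Proof.
move=> l0.
rewrite (@prodV_cos _ _ _ (fun b => l^-1 * sqpi * expR (- (b / (2 * l)) ^+ 2))); last 2 first.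
- exact: L1_g1d.
- by move=> a' b; rewrite g1d_cos.
rewrite mulrA; congr (_ * _).
have -> : (2 * pi : R) ^- n = \prod_(i < n) (2 * pi)^-1 by rewrite prodr_const card_ord exprVn.
rewrite /prodV -big_split /=; apply: eq_bigr => i _.
rewrite /g1d mulrA; congr (_ * expR (- _ ^+ 2)); last by rewrite mulrC.
rewrite -{1}[pi]sqr_sqrtr ?pi_ge0//.
by field; rewrite !lt0r_neq0.
Qed.

Lemma int_Ggauss l : 0 < l -> intRd (Ggauss l) = 1.
Proof.
move=> l0; have := Ggauss_cos 0 0 l0.
under eq_fun => w.
  rewrite (_ : dot w 0 = 0) ?subr0 ?cos0 ?mulr1; last by rewrite /dot big1// => i _; rewrite mxE mulr0.
  over.
by move=> ->; rewrite cos0 mulr1 EgaussE (_ : enorm 0 = 0) ?mulr0 ?expr0n ?oppr0 ?expR0// /enorm (_ : dot 0 0 = 0) ?sqrtr0// /dot big1// => i _; rewrite mxE mulr0.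
Qed.
End Gaussians.

(** * Fourier multipliers in real form *)

From mathcomp Require Import complex.

Section IntRd.
Variables (R : realType) (n : nat).
Local Notation V := 'rV[R]_n.
Local Notation mR := (measurableTypeR R).
Local Notation lebn := (@lebesgue_tuple R n).
Implicit Types (f g h : V -> R).

Lemma intRdE g : intRd g = I lebn (g \o @rowt R n).
Proof. by []. Qed.

Lemma integrableRd_meas g : integrableRd g -> mRd g.
Proof. exact: L1_meas. Qed.

Lemma integrableRd_le g h : mRd g -> integrableRd h -> (forall w, `|g w| <= h w) ->
  integrableRd g.
Proof. by move=> mg ih gh; apply: (L1_le mg ih) => t; exact: gh. Qed.

Lemma intRd_norm_le g h : mRd g -> integrableRd h -> (forall w, `|g w| <= h w) ->
  `|intRd g| <= intRd h.
Proof. by move=> mg ih gh; apply: (I_norm_le mg ih) => t; exact: gh. Qed.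

Lemma continuous_mRd g : continuous g -> mRd g.
Proof. by move=> cg; apply: (continuous_mvec cg); exact: (mvec_rowt (@measurable_id _ _ setT)). Qed.

Definition mRd2 (F : V -> V -> R) :=
  measurable_fun setT (fun u : n.-tuple mR * n.-tuple mR => F (rowt u.1) (rowt u.2)).

Lemma mvec_fst : mvec (fun u : n.-tuple mR * n.-tuple mR => rowt u.1 : V).
Proof. by apply: mvec_rowt; exact: measurable_fst. Qed.

Lemma mvec_snd : mvec (fun u : n.-tuple mR * n.-tuple mR => rowt u.2 : V).
Proof. by apply: mvec_rowt; exact: measurable_snd. Qed.

Lemma intRd_swap (F : V -> V -> R) (A B : V -> R) : mRd2 F -> integrableRd A ->
  integrableRd B -> (forall x y, `|F x y| <= A x * B y) ->
  intRd (fun x => intRd (F x)) = intRd (fun y => intRd (F^~ y)).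
Proof.
move=> mF iA iB FAB.
apply: (I_swap (F := fun x y => F (rowt x) (rowt y))).
by apply: (L1_prod (F := fun x y => F (rowt x) (rowt y)) (a := A \o @rowt R n) (b := B \o @rowt R n)).
Qed.
End IntRd.

Section Fourier.
Variables (R : realType) (n : nat).
Local Notation V := 'rV[R]_n.
Implicit Types (f g k : V -> R).

Lemma measurable_cos_fun d (T : measurableType d) (a : T -> R) :
  measurable_fun setT a -> measurable_fun setT (fun x => cos (a x)).
Proof.
by move=> ma; apply: measurableT_comp => //; exact: continuous_measurable_fun (@continuous_cos R).
Qed.

Lemma dotC (v w : V) : dot v w = dot w v.
Proof. by apply: eq_bigr => i _; rewrite mulrC. Qed.

(* The real part of [fourier g xi * cexpi a]; all Fourier analysis below is done
   with these real integrals. *)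
Definition cosT g (xi : V) (a : R) : R := intRd (fun w => g w * cos (a - dot w xi)).

Lemma mul_cos_le (x a : R) : `|x * cos a| <= `|x|.
Proof. by rewrite normrM -[leRHS]mulr1 ler_wpM2l// cos_max. Qed.

Lemma integrable_cosT g xi a : integrableRd g ->
  integrableRd (fun w => g w * cos (a - dot w xi)).
Proof.
move=> ig; apply: (integrableRd_le _ (h := fun w => `|g w|)).
- by apply: measurable_funM; [exact: integrableRd_meas|exact: mRd_cos].
- by have := L1_norm ig.
- by move=> w; exact: mul_cos_le.
Qed.

Lemma cosT_le g h xi a : mRd g -> integrableRd h -> (forall w, `|g w| <= h w) ->
  `|cosT g xi a| <= intRd h.
Proof.
move=> mg ih gh; apply: intRd_norm_le => //.
  by apply: measurable_funM => //; exact: mRd_cos.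
by move=> w; exact: le_trans (mul_cos_le _ _) (gh w).
Qed.

Let sinT g (xi : V) : R := cosT g xi (pi / 2).

Let sinTE g xi : sinT g xi = intRd (fun w => g w * sin (dot w xi)).
Proof.
congr intRd; apply/funext => w; congr (_ * _).
by rewrite cosB cos_pihalf sin_pihalf mul0r add0r mul1r.
Qed.

Let cosTE g xi a : integrableRd g ->
  cosT g xi a = cos a * cosT g xi 0 + sin a * sinT g xi.
Proof.
move=> ig; rewrite /sinT /cosT !intRdE -!I_Zl; [|exact: integrable_cosT..].
rewrite -I_D; [|exact/L1Zl/integrable_cosT..].
apply: eq_I => t /=; rewrite !cosB cos0 sin0 cos_pihalf sin_pihalf; ring.
Qed.

Let fourierE g xi : integrableRd g -> fourier g xi = (cosT g xi 0 +i* - sinT g xi)%C.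
Proof.
move=> ig; rewrite /fourier /intRdC; congr Complex.
  by congr intRd; apply/funext => w /=; rewrite mul0r subr0 sub0r.
rewrite sinTE intRdE -I_N; last first.
  have := integrable_cosT xi (pi / 2) ig; apply: eq_L1 => t /=.
  by rewrite cosB cos_pihalf sin_pihalf mul0r add0r mul1r.
by apply: eq_I => w /=; rewrite mul0r addr0 sinN mulrN.
Qed.

(** Cauchy-Schwarz in the plane. It leads from the assumption [v_regular], which speaks of the
    modulus of [fourier], to bounds on [cosT]. *)
Lemma cosT_fourier g xi a : integrableRd g ->
  `|cosT g xi a| <= ComplexField.Normc.normc (fourier g xi).
Proof.
move=> ig; rewrite fourierE//= cosTE//.
rewrite -sqrtr_sqr ler_wsqrtr// sqrrN.
have := cos2Dsin2 a.
move: (cosT _ _ _) (sinT _ _) (cos a) (sin a) => x y c s cs.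
rewrite -subr_ge0.
have -> : x ^+ 2 + y ^+ 2 - (c * x + s * y) ^+ 2 = (s * x - c * y) ^+ 2 + (1 - (c ^+ 2 + s ^+ 2)) * (x ^+ 2 + y ^+ 2) by ring.
by rewrite cs subrr mul0r addr0 sqr_ge0.
Qed.

Definition fmult_kernel s g (v xi : V) : R := enorm xi `^ s * cosT g xi (dot v xi).

Lemma fourier_multE s g v : integrableRd g ->
  fourier_mult s g v = (2 * pi) ^- n * intRd (fmult_kernel s g v).
Proof.
move=> ig; rewrite /fourier_mult /inv_fourier.
rewrite (_ : fourier g = fun xi => (cosT g xi 0 +i* - sinT g xi)%C); last first.
  by apply/funext => xi; exact: fourierE.
rewrite /=.
rewrite mul0r subr0; congr (_ * intRd _); apply/funext => xi.
by rewrite /fmult_kernel [in RHS]cosTE//; ring.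
Qed.

End Fourier.

Section FourierMeasurable.
Context {R : realType} {n : nat} d (T : measurableType d).
Local Notation V := 'rV[R]_n.
Local Notation mR := (measurableTypeR R).

Lemma measurable_intRd (F : T -> V -> R) :
  measurable_fun setT (fun u : T * n.-tuple mR => F u.1 (rowt u.2)) ->
  measurable_fun setT (fun x => intRd (F x)).
Proof. by move=> mF; exact: (@measurable_I2 _ _ _ _ _ (lebesgue_tuple n) (fun x t => F x (rowt t))). Qed.

Lemma measurable_cosT (g : T -> V -> R) (xi : T -> V) (a : T -> R) :
  measurable_fun setT (fun u : T * n.-tuple mR => g u.1 (rowt u.2)) ->
  mvec xi -> measurable_fun setT a ->
  measurable_fun setT (fun x => cosT (g x) (xi x) (a x)).
Proof.
move=> mg mxi ma; apply: measurable_intRd; apply: measurable_funM => //.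
apply: measurable_cos_fun; apply: measurable_funB.
  exact: (measurableT_comp ma measurable_fst).
apply: measurable_dot; first by apply: mvec_rowt; exact: measurable_snd.
by move=> i; exact: (measurableT_comp (mxi i) measurable_fst).
Qed.

Lemma measurable_powR_base (s : R) (a : T -> R) : measurable_fun setT a ->
  measurable_fun setT (fun x => a x `^ s).
Proof. by move=> ma; exact: (measurableT_comp (@measurable_powR R s) ma). Qed.
End FourierMeasurable.

Section FourierMeasurable2.
Context {R : realType} {n : nat} d (T : measurableType d).
Local Notation V := 'rV[R]_n.
Local Notation mR := (measurableTypeR R).

Lemma measurable_fmult_kernel s (g : T -> V -> R) (v : T -> V) :
  measurable_fun setT (fun u : T * n.-tuple mR => g u.1 (rowt u.2)) -> mvec v ->
  measurable_fun setT (fun u : T * n.-tuple mR => fmult_kernel s (g u.1) (v u.1) (rowt u.2)).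
Proof.
move=> mg mv; have mxi : mvec (fun u : T * n.-tuple mR => rowt u.2 : V).
  by apply: mvec_rowt; exact: measurable_snd.
have mv1 : mvec (fun u : T * n.-tuple mR => v u.1).
  by move=> i; exact: (measurableT_comp (mv i) measurable_fst).
apply: measurable_funM.
  by apply: measurable_powR_base; exact: (measurable_enorm mxi).
apply: (@measurable_cosT R n _ _ (fun u : T * n.-tuple mR => g u.1) (fun u => rowt u.2)
  (fun u => dot (v u.1) (rowt u.2))) => //; last exact: measurable_dot.
apply: (measurableT_comp mg (g := fun u : (T * n.-tuple mR) * n.-tuple mR => (u.1.1, u.2))).
apply: measurable_fun_pair; last exact: measurable_snd.
exact: (measurableT_comp measurable_fst measurable_fst).
Qed.

Lemma measurable_fourier_mult s (g : T -> V -> R) (v : T -> V) :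
  (forall x, integrableRd (g x)) ->
  measurable_fun setT (fun u : T * n.-tuple mR => g u.1 (rowt u.2)) -> mvec v ->
  measurable_fun setT (fun x => fourier_mult s (g x) (v x)).
Proof.
move=> ig mg mv; under eq_fun do rewrite fourier_multE//.
apply: measurable_funM => //.
by apply: measurable_intRd; exact: measurable_fmult_kernel.
Qed.
End FourierMeasurable2.

Section Duality.
Variables (R : realType) (n : nat).
Local Notation V := 'rV[R]_n.
Local Notation mR := (measurableTypeR R).
Implicit Types (g k Phi : V -> R).

(** All phases are allowed because evaluating a multiplier at v uses the phase v . xi and
    translating g shifts the phase; the bound is thus uniform in v and invariant under
    translations. *)
Definition fdom s g Phi := forall xi a, enorm xi `^ s * `|cosT g xi a| <= Phi xi.

Lemma mRd_fourier_mult s g : integrableRd g -> mRd (fourier_mult s g).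
Proof.
move=> ig; apply: (@measurable_fourier_mult _ _ _ _ s (fun=> g)) => //.
  exact: (measurableT_comp (integrableRd_meas ig) measurable_snd).
exact: (mvec_rowt (@measurable_id _ _ setT)).
Qed.

Lemma fdom_kernel s g Phi v xi : fdom s g Phi -> `|fmult_kernel s g v xi| <= Phi xi.
Proof. by move=> fd; rewrite /fmult_kernel normrM ger0_norm ?powR_ge0. Qed.

Lemma mRd_fmult_kernel s g v : integrableRd g -> mRd (fmult_kernel s g v).
Proof.
move=> ig; have := @measurable_fmult_kernel R n _ _ s (fun _ : mR => g) (fun=> v).
move=> /(_ (measurableT_comp (integrableRd_meas ig) measurable_snd) (mvec_cst _)) h.
exact: (measurableT_comp h (measurable_pair1 (0 : mR))).
Qed.

Lemma fourier_mult_bound s g Phi v : integrableRd g -> integrableRd Phi -> fdom s g Phi ->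
  `|fourier_mult s g v| <= (2 * pi) ^- n * intRd Phi.
Proof.
move=> ig iP fd; rewrite fourier_multE// normrM ger0_norm; last first.
  by rewrite invr_ge0 exprn_ge0// mulr_ge0// pi_ge0.
apply: ler_wpM2l; first by rewrite invr_ge0 exprn_ge0// mulr_ge0// pi_ge0.
apply: intRd_norm_le => //; first exact: mRd_fmult_kernel.
by move=> xi; exact: fdom_kernel.
Qed.

(** Both sides are the double integral of g(w) k(v) cos((v - w) . xi), which is symmetric since the
    cosine is even. *)
Lemma cosT_sym g k xi : integrableRd g -> integrableRd k ->
  intRd (fun v => cosT g xi (dot v xi) * k v) = intRd (fun w => g w * cosT k xi (dot w xi)).
Proof.
move=> ig ik.
have E1 v : cosT g xi (dot v xi) * k v = intRd (fun w => g w * k v * cos (dot v xi - dot w xi)).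
  rewrite /cosT !intRdE -I_Zr; last exact: integrable_cosT.
  by apply: eq_I => t /=; ring.
have E2 w : g w * cosT k xi (dot w xi) = intRd (fun v => g w * k v * cos (dot v xi - dot w xi)).
  rewrite /cosT !intRdE -I_Zl; last exact: integrable_cosT.
  by apply: eq_I => t /=; rewrite -mulrA -cosN opprB.
under eq_fun do rewrite E1.
under [in RHS]eq_fun do rewrite E2.
apply: (intRd_swap (A := fun v => `|k v|) (B := fun w => `|g w|)).
- apply: measurable_funM.
    apply: measurable_funM.
      exact: (measurableT_comp (integrableRd_meas ig) measurable_snd).
    exact: (measurableT_comp (integrableRd_meas ik) measurable_fst).
  apply: measurable_cos_fun; apply: measurable_funB; apply: measurable_dot;
    by [exact: mvec_fst|exact: mvec_snd|exact: mvec_cst].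
- by have := L1_norm ik.
- by have := L1_norm ig.
- by move=> v w; rewrite (mulrC `|_|) -normrM; exact: mul_cos_le.
Qed.

(** Fubini moves the integral over xi outside; at fixed xi the multiplier is a constant and the
    claim is [cosT_sym]. The exchanges are dominated by |k(v)| Pg(xi) and by |g(v)| Pk(xi). *)
Lemma fourier_mult_duality s g k Pg Pk : integrableRd g -> integrableRd k ->
  integrableRd Pg -> integrableRd Pk -> fdom s g Pg -> fdom s k Pk ->
  intRd (fun v => fourier_mult s g v * k v) = intRd (fun w => g w * fourier_mult s k w).
Proof.
move=> ig ik iPg iPk fg fk.
pose c : R := (2 * pi) ^- n.
have ikg v : integrableRd (fmult_kernel s g v).
  by apply: (integrableRd_le (mRd_fmult_kernel _ _ ig) iPg) => xi; exact: fdom_kernel.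
have ikk v : integrableRd (fmult_kernel s k v).
  by apply: (integrableRd_le (mRd_fmult_kernel _ _ ik) iPk) => xi; exact: fdom_kernel.
have E1 v : fourier_mult s g v * k v = intRd (fun xi => c * (fmult_kernel s g v xi * k v)).
  rewrite fourier_multE// -mulrA !intRdE -I_Zr; last exact: ikg.
  by rewrite I_Zl//; apply: L1Zr; exact: ikg.
have E2 v : g v * fourier_mult s k v = intRd (fun xi => c * (g v * fmult_kernel s k v xi)).
  rewrite fourier_multE// mulrCA !intRdE -I_Zl; last exact: ikk.
  by rewrite -[in LHS]I_Zl//; apply: L1Zl; exact: ikk.
under eq_fun do rewrite E1.
under [in RHS]eq_fun do rewrite E2.
have c0 : 0 <= c by rewrite invr_ge0 exprn_ge0// mulr_ge0// pi_ge0.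
have m2k (h : V -> R) : integrableRd h -> measurable_fun setT (fun u : n.-tuple mR * n.-tuple mR => fmult_kernel s h (rowt u.1) (rowt u.2)).
  move=> ih; apply: (measurable_fmult_kernel _ (g := fun=> h)).
    exact: (measurableT_comp (integrableRd_meas ih) measurable_snd).
  by apply: mvec_rowt; exact: measurable_id.
rewrite (intRd_swap (A := fun v => c * `|k v|) (B := Pg)) => [||||x y]; first last.
- rewrite normrM (ger0_norm c0) -mulrA; apply: ler_wpM2l => //.
  by rewrite normrM mulrC; apply: ler_wpM2l => //; exact: fdom_kernel.
- exact: iPg.
- by apply: L1Zl; have := L1_norm ik.
- apply: measurable_funM => //; apply: measurable_funM; first exact: m2k.
  exact: (measurableT_comp (integrableRd_meas ik) measurable_fst).
rewrite [RHS](intRd_swap (A := fun v => c * `|g v|) (B := Pk)) => [||||x y]; first last.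
- rewrite normrM (ger0_norm c0) -mulrA; apply: ler_wpM2l => //.
  by rewrite normrM; apply: ler_wpM2l => //; exact: fdom_kernel.
- exact: iPk.
- by apply: L1Zl; have := L1_norm ig.
- apply: measurable_funM => //; apply: measurable_funM; last exact: m2k.
  exact: (measurableT_comp (integrableRd_meas ig) measurable_fst).
congr intRd; apply/funext => xi; rewrite /fmult_kernel.
have mcos (h : V -> R) : integrableRd h -> mRd (fun w => cosT h xi (dot w xi)).
  move=> ih; apply: (measurable_cosT (g := fun=> h)).
  - exact: (measurableT_comp (integrableRd_meas ih) measurable_snd).
  - exact: mvec_cst.
  - by apply: measurable_dot; [exact: (mvec_rowt (@measurable_id _ _ setT))|exact: mvec_cst].
have icos (h h' : V -> R) : integrableRd h -> integrableRd h' ->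
    integrableRd (fun w => h' w * cosT h xi (dot w xi)).
  move=> ih ih'; apply: (L1_bounded_mul (B := intRd (fun w => `|h w|)) ih') => [|t]; first exact: mcos.
  by apply: cosT_le => //; [exact: integrableRd_meas|by have := L1_norm ih].
transitivity (c * enorm xi `^ s * intRd (fun v => cosT g xi (dot v xi) * k v)).
  rewrite [in RHS]intRdE -I_Zl; first by apply: eq_I => t /=; ring.
  by have := icos _ _ ig ik; apply: eq_L1 => t /=; rewrite mulrC.
rewrite cosT_sym// [in LHS]intRdE -I_Zl; last exact: icos.
by apply: eq_I => t /=; ring.
Qed.
End Duality.

(** * Integrals of powers, and negative powers as superpositions of Gaussians *)

Section PowerIntegrals.
Variable R : realType.
Local Notation mR := (measurableTypeR R).
Local Notation leb := (@lebesgue_measure R).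

(** Monotone convergence along an exhaustion of D, by which an improper integral is controlled
    through the fundamental theorem on compact intervals. *)
Lemma L1_exhaust (f : R -> R) (F : nat -> set R) (D : set R) (C : R) :
  measurable_fun (setT : set mR) f -> (forall x, 0 <= f x) -> nondecreasing_seq F ->
  (forall n, measurable (F n : set mR)) -> \bigcup_n F n = D ->
  (forall n, (\int[leb]_(x in F n) (f x)%:E <= C%:E)%E) -> L1 leb (fun x => f x * \1_D x).
Proof.
move=> mf f0 ndF mF <- FC.
have mU : measurable (\bigcup_n F n : set mR) by exact: bigcup_measurable.
apply/integrableP; split.
  by apply/measurable_EFinP; apply: measurable_funM.
apply: (@le_lt_trans _ _ C%:E); last exact: ltry.
have -> : (\int[leb]_x `|(f x * \1_(\bigcup_n F n) x)%:E| =
    \int[leb]_(x in \bigcup_n F n) (f x)%:E)%E.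
  rewrite [RHS]integral_mkcond; apply: eq_integral => x _.
  rewrite patchE indicE; case: ifP => _ /=; rewrite ?mulr1 ?mulr0 ?normr0// ger0_norm//.
have mfE : measurable_fun (\bigcup_n F n) (EFin \o f).
  by apply/measurable_EFinP; exact: measurable_funTS.
have cv : (\int[leb]_(x in F i) (f x)%:E @[i --> \oo] --> \int[leb]_(x in \bigcup_i F i) (f x)%:E)%E.
  apply: ge0_nondecreasing_set_cvg_integral => //=.
    by move=> i; apply/measurable_EFinP; exact: measurable_funTS.
  by move=> *; rewrite lee_fin.
rewrite -(cvg_lim _ cv)//; apply: lime_le; last exact: nearW.
by apply/cvg_ex; eexists; exact: cv.
Qed.

Lemma int_pow_itv (b x y : R) : b != 0 -> 0 < x -> x < y ->
  (\int[leb]_(r in `[x, y]) (r `^ (b - 1))%:E = ((y `^ b - x `^ b) / b)%:E)%E.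
Proof.
move=> b0 x0 xy.
have dF (r : R) : 0 < r -> is_derive r 1 (fun r => r `^ b / b) (r `^ (b - 1)).
  move=> r0; have : is_derive r 1 ((fun r : R => r `^ b) * cst b^-1) (r `^ (b - 1)).
    have := is_derive1_powR b r0 => h.
    apply: is_derive_eq; rewrite /= !scaleR_mul mulr0 add0r mulrA mulVf// mul1r//.
  by [].
have pos r : r \in `[x, y] -> 0 < r by rewrite in_itv/= => /andP[h _]; exact: lt_le_trans h.
have cF (r : R) : 0 < r -> {for r, continuous (fun r => r `^ b / b)}.
  by move=> r0; apply: differentiable_continuous; apply/derivable1_diffP; case: (dF _ r0).
rewrite (@continuous_FTC2 _ _ (fun r => r `^ b / b))//.
- by rewrite -EFinB mulrBl.
- apply: continuous_in_subspaceT => r; rewrite inE => /pos r0.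
  apply: differentiable_continuous; apply/derivable1_diffP.
  by case: (is_derive1_powR (b - 1) r0).
- split.
  + move=> r; rewrite in_itv/= => /andP[xr _].
    by case: (dF r (lt_trans x0 xr)).
  + apply: cvg_at_right_filter; exact: cF.
  + apply: cvg_at_left_filter; apply: cF; exact: lt_trans xy.
- move=> r; rewrite in_itv/= => /andP[xr _].
  by rewrite derive1E; case: (dF r (lt_trans x0 xr)).
Qed.

Lemma mpow (s : R) : measurable_fun (setT : set mR) (fun r : R => r `^ s).
Proof. exact: measurable_powR. Qed.

Lemma L1_pow0 (a tau : R) : 0 < a -> 0 < tau ->
  L1 leb (fun r => r `^ (a - 1) * \1_`]0, tau] r).
Proof.
move=> a0 t0; apply: (@L1_exhaust _ (fun n => `[n.+1%:R^-1, tau]%classic) _ (tau `^ a / a)).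
- exact: mpow.
- by move=> x; exact: powR_ge0.
- move=> m n mn; apply/subsetPset => x /=; rewrite !in_itv/= => /andP[h ->]; rewrite andbT.
  by apply: le_trans h; rewrite lef_pV2 ?posrE// ler_nat.
- by move=> n; exact: measurable_itv.
- apply/seteqP; split => x /=.
    move=> [n _] /=; rewrite !in_itv/= => /andP[h ->]; rewrite andbT.
    by apply: lt_le_trans h; rewrite invr_gt0.
  rewrite in_itv/= => /andP[x0 xt].
  exists (Num.trunc x^-1) => //=; rewrite in_itv/= xt andbT.
  rewrite -[leRHS]invrK lef_pV2 ?posrE ?invr_gt0//.
  by rewrite ltW// truncnS_gt.
- move=> n; have [h|h] := ltP (n.+1%:R^-1) tau.
    rewrite int_pow_itv ?gt_eqF ?invr_gt0// lee_fin ler_pM2r ?invr_gt0//.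
    by rewrite gerBl powR_ge0.
  (* Here 1 / (n + 1) >= tau, so the interval has at most the point tau. *)
  rewrite (@integral_Sset1 _ _ _ tau).
    by rewrite lee_fin divr_ge0 ?powR_ge0// ltW.
  move=> x /=; rewrite in_itv/= => /andP[h1 h2]; apply/eqP; rewrite eq_le h2.
  exact: le_trans h1.
Qed.

Lemma L1_powy (b : R) : b < 0 ->
  L1 leb (fun r => r `^ (b - 1) * \1_`[1, +oo[ r).
Proof.
move=> b0; apply: (@L1_exhaust _ (fun n => `[1, n.+1%:R]%classic) _ (- b^-1)).
- exact: mpow.
- by move=> x; exact: powR_ge0.
- move=> m n mn; apply/subsetPset => x /=; rewrite !in_itv/= => /andP[-> h] /=.
  by apply: (le_trans h); rewrite ler_nat.
- by move=> n; exact: measurable_itv.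
- apply/seteqP; split => x /=.
    by move=> [n _] /=; rewrite !in_itv/= => /andP[-> h].
  rewrite in_itv/= andbT => x1.
  exists (Num.trunc x) => //=; rewrite in_itv/= x1/=.
  by rewrite ltW// truncnS_gt.
- case => [|n].
    by rewrite set_itv1 integral_set1 lee_fin oppr_ge0 invr_le0 ltW.
  rewrite int_pow_itv ?lt_eqF ?ltr1n// lee_fin powR1.
  rewrite mulrBl mul1r gerDr.
  by rewrite mulr_ge0_le0 ?powR_ge0// invr_le0 ltW.
Qed.
End PowerIntegrals.

Section Subordination.
Variables (R : realType) (sigma : R).
Hypothesis hsigma : 0 < sigma < 1.
Local Notation mR := (measurableTypeR R).
Local Notation leb := (@lebesgue_measure R).

(* |xi|^(-sigma) is a multiple of the integral of [subk l * exp (- l^2 |xi|^2)]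
   over l, by homogeneity. *)
Definition subk (l : R) : R := l `^ (sigma - 1) * \1_`]0, +oo[ l.

Lemma subk_ge0 l : 0 <= subk l.
Proof. by rewrite mulr_ge0 ?powR_ge0// indicE. Qed.

Lemma subk_le0 l : l <= 0 -> subk l = 0.
Proof. by move=> l0; rewrite /subk indicE mem_setE in_itv/= andbT ltNge l0 mulr0. Qed.

Lemma measurable_subk : measurable_fun (setT : set mR) subk.
Proof. by apply: measurable_funM; [exact: mpow|exact: measurable_indic]. Qed.

Lemma L1_subk_gauss : L1 leb (fun l => subk l * expR (- l ^+ 2)).
Proof.
have [s0 s1] := andP hsigma.
apply: (@L1_le _ _ _ leb _ (fun l => l `^ (sigma - 1) * \1_`]0, 1] l + cauchy1 l)).
- by apply: measurable_funM; [exact: measurable_subk|exact: measurable_gauss_fun].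
- by apply: L1D; [exact: L1_pow0|exact: L1_cauchy1].
- move=> l; rewrite ger0_norm; last by apply: mulr_ge0; [exact: subk_ge0|exact: expR_ge0].
  have [l0|l0] := leP l 0.
    by rewrite subk_le0// mul0r addr_ge0 ?mulr_ge0 ?powR_ge0 ?indicE//; exact/ltW/cauchy1_gt0.
  have [l1|l1] := leP l 1.
    rewrite -[leLHS]addr0; apply: lerD; last exact/ltW/cauchy1_gt0.
    rewrite /subk !indicE !mem_setE !in_itv/= l0 l1/= mulr1.
    rewrite -[leRHS]mulr1; apply: ler_pM => //; [exact: powR_ge0|].
    by rewrite -expR0 ler_expR oppr_le0 sqr_ge0.
  rewrite -[leLHS]add0r; apply: lerD; first by rewrite mulr_ge0 ?powR_ge0 ?indicE.
  apply: le_trans (gauss_cauchy l); rewrite -[leRHS]mul1r; apply: ler_wpM2r; first exact: expR_ge0.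
  rewrite /subk indicE mem_setE in_itv/= l0 mulr1 -[leRHS](powRr0 l).
  by apply: ler_powR; [exact: ltW|rewrite subr_le0 ltW].
Qed.

Definition subc : R := I leb (fun l => subk l * expR (- l ^+ 2)).

(** The contribution of [1, 2] suffices: there l^(sigma - 1) >= 1 / l >= 1 / 2 and exp(- l^2) >=
    exp(- 4). *)
Lemma subc_gt0 : 0 < subc.
Proof.
have [s0 s1] := andP hsigma.
have m12 : measurable (`[1, 2]%classic : set mR) by exact: measurable_itv.
have l12 : leb (`[1, 2]%classic : set mR) = 1%E.
  by rewrite lebesgue_measure_itv/= lte_fin ltr1n/= -EFinB; congr EFin; ring.
have lI : L1 leb (fun l => expR (- 2 ^+ 2) / 2 * \1_`[1, 2] l).
  by apply: L1Zl; exact: integrable_indic_itv.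
apply: (@lt_le_trans _ _ (expR (- 2 ^+ 2) / 2)).
  by rewrite divr_gt0 ?expR_gt0.
have E1 : I leb (\1_`[1, 2]) = 1.
  by rewrite /I /Rintegral integral_indic// setIT [X in fine X]l12.
rewrite -[leLHS]mulr1 -[X in _ * X]E1 -I_Zl; last exact: integrable_indic_itv.
apply: I_le => [//||l]; first exact: L1_subk_gauss.
rewrite indicE mem_setE in_itv/=; case: (boolP (1 <= l <= 2)) => [/andP[l1 l2]|_]; last first.
  by rewrite mulr0 mulr_ge0 ?subk_ge0 ?expR_ge0.
have l0 : 0 < l by exact: lt_le_trans l1.
rewrite mulr1 mulrC; apply: ler_pM; rewrite ?expR_ge0//.
  rewrite /subk indicE mem_setE in_itv/= l0 mulr1.
  apply: (@le_trans _ _ (l `^ (-1))).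
    by rewrite powR_inv1 ?(ltW l0)// lef_pV2 ?posrE.
  by apply: ler_powR => //; lra.
by rewrite ler_expR lerN2 lerXn2r// nnegrE ltW.
Qed.

Lemma subordination e : 0 < e ->
  L1 leb (fun l => subk l * expR (- (l * e) ^+ 2)) /\
  I leb (fun l => subk l * expR (- (l * e) ^+ 2)) = subc * e `^ (- sigma).
Proof.
move=> e0; have sc := scales_line 0 (lt0r_neq0 e0).
(* The substitution e l: the weight has degree sigma - 1, which costs e^(1 - sigma), and the
   Jacobian costs 1 / e. *)
have E l : subk l * expR (- (l * e) ^+ 2) =
    e `^ (1 - sigma) * (subk (0 + e * l) * expR (- (0 + e * l) ^+ 2)).
  rewrite add0r (mulrC l) mulrA; congr (_ * _).
  have [l0|l0] := leP l 0.
    by rewrite !subk_le0 ?mulr0//; rewrite pmulr_rle0.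
  rewrite /subk !indicE !mem_setE !in_itv/= !andbT l0 mulr_gt0// !mulr1.
  rewrite powRM ?ltW// mulrA -powRD; last by apply/implyP => _; rewrite gt_eqF.
  by rewrite (_ : 1 - sigma + (sigma - 1) = 0) ?powRr0 ?mul1r//; ring.
have lF := scales_L1 sc L1_subk_gauss.
split; first by apply: eq_L1 (L1Zl (e `^ (1 - sigma)) lF) => l; rewrite E.
transitivity (I leb (fun l => e `^ (1 - sigma) * (subk (0 + e * l) * expR (- (0 + e * l) ^+ 2)))).
  by apply: eq_I => l; exact: E.
rewrite [LHS](I_Zl _ lF) [X in _ * X](scales_I sc L1_subk_gauss) -/subc gtr0_norm//.
rewrite mulrA mulrC; congr (_ * _).
rewrite -powR_inv1; last exact: ltW.
rewrite -powRD; last by apply/implyP => _; rewrite gt_eqF.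
by congr (_ `^ _); ring.
Qed.

(** The minimum is the bound for the L^1 norm of the heat flow of a divergence at time l^2.
    Convergence at 0 uses sigma > 0; at infinity the power is l^(sigma - 2), and sigma < 1 is
    used. *)
Lemma L1_subk_min C : 0 <= C -> L1 leb (fun l => subk l * Num.min 1 (C / l)).
Proof.
move=> C0; have [s0 s1] := andP hsigma.
apply: (@L1_le _ _ _ leb _ (fun l => l `^ (sigma - 1) * \1_`]0, 1] l +
   C * (l `^ (sigma - 1 - 1) * \1_`[1, +oo[ l))).
- apply: measurable_funM; first exact: measurable_subk.
  apply: measurable_minr => //; apply: measurable_funM => //.
  rewrite (_ : GRing.inv = (fun l : R => if 0 <= l then l `^ (-1) else - (- l) `^ (-1))); last first.
    apply: funext => l; case: ifP => h; first by rewrite powR_inv1.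
    by rewrite powR_inv1 ?invrN ?opprK// oppr_ge0 ltW// ltNge h.
  apply: measurable_fun_ifT.
  + by apply: measurable_fun_ler => //; exact: measurable_id.
  + exact: mpow.
  + apply: measurableT_comp => //; apply: (measurableT_comp (mpow (-1))).
    exact: oppr_measurable.
- by apply: L1D; [exact: L1_pow0|apply: L1Zl; apply: L1_powy; rewrite subr_lt0].
- move=> l; have [l0|l0] := leP l 0.
    by rewrite subk_le0// mul0r normr0 addr_ge0 ?mulr_ge0 ?powR_ge0 ?indicE.
  rewrite ger0_norm; last first.
    by rewrite mulr_ge0 ?subk_ge0// le_min ler01 divr_ge0// ltW.
  have [l1|l1] := leP l 1.
    rewrite -[leLHS]addr0; apply: lerD; last by rewrite !mulr_ge0 ?powR_ge0 ?indicE.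
    rewrite /subk !indicE !mem_setE !in_itv/= l0 l1/= mulr1.
    rewrite -[leRHS]mulr1; apply: ler_wpM2l; first exact: powR_ge0.
    by rewrite ge_min lexx.
  rewrite -[leLHS]add0r; apply: lerD; first by rewrite mulr_ge0 ?powR_ge0 ?indicE.
  rewrite /subk !indicE !mem_setE !in_itv/= !andbT l0 (ltW l1) !mulr1 mulrC.
  apply: (@le_trans _ _ (C / l * l `^ (sigma - 1))).
    by apply: ler_wpM2r; [exact: powR_ge0|rewrite ge_min lexx orbT].
  rewrite -mulrA; apply: ler_wpM2l => //.
  rewrite -powR_inv1; last exact: ltW.
  rewrite -powRD; last by apply/implyP => _; rewrite gt_eqF.
  by rewrite (addrC (-1)).
Qed.
End Subordination.

(** * Riesz potential of a divergence *)

Section DeriveLine.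
Variables (R : realType) (V : normedModType R).

Lemma is_derive_line (F : V -> R) (w u : V) (D : R) :
  is_derive (0 : R) (1 : R) (fun s : R => F (w + s *: u)) D -> is_derive w u F D.
Proof.
have E : (fun h : R => h^-1 *: (((fun s : R => F (w + s *: u)) \o shift (0 : R)) (h *: (1 : R)) -
      (fun s : R => F (w + s *: u)) 0)) =
    (fun h => h^-1 *: ((F \o shift w) (h *: u) - F w)).
  apply/funext => h /=; rewrite scale0r !addr0 scaleR_mul mulr1.
  by congr (_ *: (F _ - _)); rewrite addrC.
by case; rewrite /derivable /derive E => h1 h2; split.
Qed.
End DeriveLine.

Section MeasurableInv.
Variable R : realType.

Lemma measurable_inv : measurable_fun (setT : set (measurableTypeR R)) (fun l : R => l^-1).
Proof.
rewrite (_ : (fun l : R => l^-1) = (fun l : R => if 0 <= l then l `^ (-1) else - (- l) `^ (-1))); last first.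
  apply: funext => l; case: ifP => h; first by rewrite powR_inv1.
  by rewrite powR_inv1 ?invrN ?opprK// oppr_ge0 ltW// ltNge h.
apply: measurable_fun_ifT.
- by apply: measurable_fun_ler => //; exact: measurable_id.
- exact: mpow.
- apply: measurableT_comp => //; apply: (measurableT_comp (@mpow R (-1))).
  exact: oppr_measurable.
Qed.
End MeasurableInv.

Section Coordinates.
Variables (R : realType) (n : nat).
Local Notation V := 'rV[R]_n.

Lemma dot_delta (w xi : V) (s : R) i : dot (w + s *: delta_mx 0 i) xi = dot w xi + s * xi 0 i.
Proof.
rewrite /dot; under eq_bigr do rewrite !mxE mulrDl.
rewrite big_split /=; congr (_ + _).
rewrite (bigD1 i)//= big1 ?addr0; first by rewrite !eqxx mulr1.
by move=> j ji; rewrite (negbTE ji) mulr0 mul0r.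
Qed.

Lemma enorm_ge0 (xi : V) : 0 <= enorm xi.
Proof. exact: sqrtr_ge0. Qed.

Lemma coord_le_enorm (xi : V) i : `|xi 0 i| <= enorm xi.
Proof.
rewrite -sqrtr_sqr ler_wsqrtr// /dot (bigD1 i)//= -expr2 lerDl.
by apply: sumr_ge0 => j _; rewrite -expr2 sqr_ge0.
Qed.

Lemma enorm_eq0 (xi : V) : enorm xi = 0 -> xi = 0.
Proof.
move=> e0; apply/rowP => i; rewrite mxE; apply/eqP; rewrite -normr_le0 -e0.
exact: coord_le_enorm.
Qed.

Lemma J_le1 (w : V) : J w <= 1.
Proof.
apply: prodr_ile1 => i _; rewrite (ltW (cauchy1_gt0 _)) /=.
by have := oneDsqrV_le1 (w 0 i).
Qed.
End Coordinates.

Section Convolution.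
Variables (R : realType) (n : nat).
Local Notation V := 'rV[R]_n.
Local Notation lebn := (@lebesgue_tuple R n).
Variables (A G : V -> R).
Variable b : R.
Hypotheses (iA : integrableRd A) (iG : integrableRd G) (Gb : forall v, `|G v| <= b).

(** Since G is bounded, the integral converges absolutely at every v, and not only at almost every v
    as for two integrable functions. *)
Definition conv (v : V) : R := intRd (fun w => A w * G (v - w)).

Let mAG : mRd2 (fun w v => A w * G (v - w)).
Proof.
apply: measurable_funM; first exact: (measurableT_comp (integrableRd_meas iA) measurable_fst).
by apply: mRd_comp; [exact: integrableRd_meas|exact: (mvecB (@mvec_snd _ _) (@mvec_fst _ _))].
Qed.

Let iGs w : integrableRd (fun v => G (v - w)) /\ intRd (fun v => G (v - w)) = intRd G.
Proof. by have := intRd_translate (- w) iG; under eq_fun do rewrite addrC. Qed.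

Let iGns w : intRd (fun v => `|G (v - w)|) = intRd (fun v => `|G v|).
Proof.
have iN : integrableRd (fun v => `|G v|) by have := L1_norm iG.
by have [_] := intRd_translate (- w) iN; under eq_fun do rewrite addrC.
Qed.

Let L1AG : L1 (lebn \x lebn)%E (fun u => A (rowt u.1) * G (rowt u.2 - rowt u.1)).
Proof.
apply: (L1_iter (F := fun w v => A (rowt w) * G (rowt v - rowt w))
  (H := fun w => `|A (rowt w)| * intRd (fun v => `|G v|))) => //.
- by apply: L1Zr; have := L1_norm iA.
- by move=> w; apply: L1Zl; have [] := iGs (rowt w).
- move=> w; rewrite -(iGns (rowt w)) intRdE -I_Zl; last first.
    by have [h _] := iGs (rowt w); have := L1_norm h.
  by rewrite le_eqVlt; apply/orP; left; apply/eqP/eq_I => t; rewrite normrM.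
Qed.

Lemma integrable_conv : integrableRd conv.
Proof. exact: (L1_I2 (F := fun v w => A (rowt w) * G (rowt v - rowt w)) (L1_swap (F := fun w v => A (rowt w) * G (rowt v - rowt w)) L1AG)). Qed.

Lemma conv_norm : intRd (fun v => `|conv v|) <= intRd (fun w => `|A w|) * intRd (fun v => `|G v|).
Proof.
pose F w v := `|A (rowt w) * G (rowt v - rowt w)| : R.
have LF : L1 (lebn \x lebn)%E (fun u => F u.1 u.2) by have := L1_norm L1AG.
have LF' := L1_swap (F := F) LF.
apply: (@le_trans _ _ (I lebn (fun v => I lebn (F^~ v)))).
  apply: I_le.
  - by have := L1_norm integrable_conv.
  - exact: (L1_I2 (F := fun v w => F w v) LF').
  - move=> v; apply: (le_normr_Rintegral measurableT).
    apply: (L1_bounded_mul (B := b) iA) => [|t]; last exact: Gb.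
    exact: (mRd_comp (integrableRd_meas iG) (mvecB (mvec_cst _) (mvec_rowt (@measurable_id _ _ setT)))).
rewrite -(I_swap LF) mulrC intRdE -I_Zl; last by have := L1_norm iA.
rewrite le_eqVlt; apply/orP; left; apply/eqP/eq_I => w /=.
transitivity (`|A (rowt w)| * intRd (fun v => `|G (v - rowt w)|)); last by rewrite iGns mulrC.
rewrite intRdE -I_Zl; last first.
  by have [h _] := iGs (rowt w); have := L1_norm h.
by apply: eq_I => t; rewrite /F normrM.
Qed.

(** The convolution theorem before factorization: translating G by w shifts the phase. When G is a
    Gaussian, [Ggauss_cos] then splits off its transform. *)
Lemma cosT_conv xi a : cosT conv xi a = intRd (fun w => A w * cosT G xi (a - dot w xi)).
Proof.
pose F w v := A (rowt w) * G (rowt v - rowt w) * cos (a - dot (rowt v) xi) : R.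
have LF : L1 (lebn \x lebn)%E (fun u => F u.1 u.2).
  apply: (L1_bounded_mul (B := 1) L1AG) => [|u]; last exact: cos_max.
  apply: measurable_cos_fun; apply: measurable_funB => //.
  by apply: measurable_dot; [exact: mvec_snd|exact: mvec_cst].
transitivity (I lebn (fun v => I lebn (F^~ v))).
  apply: eq_I => v; rewrite /conv /= intRdE -I_Zr//.
  apply: (L1_bounded_mul (B := b) iA) => [|t]; last exact: Gb.
  exact: (mRd_comp (integrableRd_meas iG) (mvecB (mvec_cst _) (mvec_rowt (@measurable_id _ _ setT)))).
rewrite -(I_swap LF); apply: eq_I => w /=.
have iGc := integrable_cosT xi (a - dot (rowt w) xi) iG.
have [iGt E] := intRd_translate (- rowt w) iGc.
rewrite /cosT -E intRdE -I_Zl//; apply: eq_I => t; rewrite /F /= -mulrA (addrC (- _)).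
congr (_ * (_ * cos _)); rewrite -addrA; congr (_ + _).
rewrite (_ : dot (rowt t - rowt w) xi = dot (rowt t) xi - dot (rowt w) xi); first ring.
rewrite /dot -sumrB; apply: eq_bigr => i _; rewrite !mxE; ring.
Qed.
End Convolution.

Section GaussDerivative.
Variables (R : realType) (n : nat).
Local Notation V := 'rV[R]_n.
Local Notation sqpi := (Num.sqrt (@pi R)).

Definition dGauss (l : R) (i : 'I_n) (x : V) : R := - (x 0 i / (2 * l ^+ 2)) * Ggauss l x.

Let sqpi_gt0 : 0 < sqpi. Proof. by rewrite sqrtr_gt0 pi_gt0. Qed.

Lemma GgaussE l (x : V) :
  Ggauss l x = (2 * l * sqpi) ^- n * expR (- ((2 * l)^-1 ^+ 2 * dot x x)).
Proof.
rewrite /Ggauss /prodV big_split /= prodr_const card_ord -exprVn; congr (_ * _).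
rewrite /g1d -expR_sum; congr expR; rewrite sumrN; congr (- _).
by rewrite /dot mulr_sumr; apply: eq_bigr => i _; rewrite exprMn expr2 (expr2 (x 0 i)).
Qed.

Lemma is_derive_Ggauss l i (x : V) : 0 < l ->
  is_derive x (delta_mx 0 i) (Ggauss l) (dGauss l i x).
Proof.
move=> l0; apply: is_derive_line.
pose q := dot x x; pose k := ((2 * l)^-1 ^+ 2 : R); pose C := ((2 * l * sqpi) ^- n : R).
have -> : (fun s : R => Ggauss l (x + s *: delta_mx 0 i)) =
    cst C * (expR \o (fun s : R => - (k * (q + 2 * s * x 0 i + s ^+ 2)))).
  apply/funext => s; rewrite GgaussE /=; congr (_ * expR (- (_ * _))).
  rewrite dot_delta dotC dot_delta /q !mxE !eqxx /=; ring.
apply: is_derive_eq.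
rewrite /dGauss GgaussE -/C -/k -/q /= !scaleR_mul.
rewrite (_ : q + 2 * 0 * x 0 i + 0 ^+ 2 = q); last by ring.
move: (expR _) => E1.
rewrite /k exprVn exprMn; move: C => C'.
by field; rewrite lt0r_neq0.
Qed.
End GaussDerivative.

Section GaussDerivative2.
Variables (R : realType) (n : nat).
Local Notation V := 'rV[R]_n.
Local Notation sqpi := (Num.sqrt (@pi R)).

Let sqpi_gt0 : 0 < sqpi. Proof. by rewrite sqrtr_gt0 pi_gt0. Qed.

Lemma Ggauss_le l (x : V) : 0 < l -> Ggauss l x <= (2 * l * sqpi) ^- n.
Proof.
move=> l0; rewrite GgaussE -[leRHS]mulr1; apply: ler_wpM2l.
  by rewrite invr_ge0 exprn_ge0// !mulr_ge0// ltW.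
rewrite -expR0 ler_expR oppr_le0 mulr_ge0 ?sqr_ge0//.
by apply: sumr_ge0 => i _; rewrite -expr2 sqr_ge0.
Qed.

(** The linear factor is absorbed by doubling the width: with y = |x_i| / (2 l), one has y <= 1 + (3
    / 4) y^2 <= exp((3 / 4) y^2), and 3 / 4 is the part of the exponent set free. The factor 2^n is
    the ratio of the normalizations. *)
Lemma dGauss_le l i (x : V) : 0 < l -> `|dGauss l i x| <= 2 ^+ n / l * Ggauss (2 * l) x.
Proof.
move=> l0; have l2 : 0 < 2 * l by rewrite mulr_gt0.
rewrite /dGauss normrM normrN (gtr0_norm (Ggauss_gt0 _ l0)) !GgaussE.
have q0 : 0 <= dot x x by apply: sumr_ge0 => j _; rewrite -expr2 sqr_ge0.
have xq : x 0 i ^+ 2 <= dot x x.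
  by rewrite /dot (bigD1 i)//= -expr2 lerDl; apply: sumr_ge0 => j _; rewrite -expr2 sqr_ge0.
have -> : (2 * (2 * l) * sqpi) ^- n = (2 ^+ n)^-1 * (2 * l * sqpi) ^- n.
  by rewrite -mulrA -invfM -exprMn.
have -> : 2 ^+ n / l * ((2 ^+ n)^-1 * (2 * l * sqpi) ^- n * expR (- ((2 * (2 * l))^-1 ^+ 2 * dot x x))) =
   (2 * l * sqpi) ^- n * (l^-1 * expR (- ((2 * (2 * l))^-1 ^+ 2 * dot x x))).
  have : (2 ^+ n : R) != 0 by rewrite expf_neq0.
  move: (2 ^+ n) (expR _) ((2 * l * sqpi) ^- n) => a b c a0; field.
  by rewrite a0 lt0r_neq0.
rewrite mulrCA; apply: ler_wpM2l.
  by rewrite invr_ge0 exprn_ge0// !mulr_ge0// ltW.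
have -> : `|x 0 i / (2 * l ^+ 2)| = l^-1 * `|x 0 i / (2 * l)|.
  have -> : x 0 i / (2 * l ^+ 2) = l^-1 * (x 0 i / (2 * l)) by field; rewrite lt0r_neq0.
  by rewrite normrM gtr0_norm// invr_gt0.
rewrite -mulrA; apply: ler_wpM2l; first by rewrite invr_ge0 ltW.
have -> : - ((2 * (2 * l))^-1 ^+ 2 * dot x x) = - ((2 * l)^-1 ^+ 2 * dot x x) + 3 / 4 * ((2 * l)^-1 ^+ 2 * dot x x).
  by field; rewrite lt0r_neq0.
rewrite expRD mulrC; apply: ler_wpM2l; first exact: expR_ge0.
apply: le_trans (expR_ge1Dx _).
set y := `|_|.
have y2 : y ^+ 2 <= (2 * l)^-1 ^+ 2 * dot x x.
  rewrite /y real_normK ?num_real// exprMn mulrC; apply: ler_wpM2l => //.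
  exact: sqr_ge0.
have := sqr_ge0 (y - 2 / 3); nra.
Qed.

Lemma measurable_Ggauss d (T : measurableType d) (l : T -> R) (x : T -> V) :
  measurable_fun setT l -> mvec x -> measurable_fun setT (fun t => Ggauss (l t) (x t)).
Proof.
move=> ml mx.
have mil : measurable_fun setT (fun t => (2 * l t)^-1).
  apply: (measurableT_comp (@measurable_inv R)); exact: measurable_funM.
have mil2 : measurable_fun setT (fun t => (2 * l t * sqpi)^-1).
  apply: (measurableT_comp (@measurable_inv R)); apply: measurable_funM => //.
  exact: measurable_funM.
apply: (@measurable_prod _ _ _ setT _ (index_enum _) (fun i t => (2 * l t * sqpi)^-1 * g1d (2 * l t)^-1 (x t 0 i))) => i _.
apply: measurable_funM => //; apply: measurableT_comp => //; apply: measurableT_comp => //.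
by apply: measurable_funX; exact: measurable_funM.
Qed.
End GaussDerivative2.

Section CosDerive.
Variables (R : realType) (n : nat) (B : R) (i : 'I_n).
Local Notation V := 'rV[R]_n.
Variables (K DK : V -> R).
Hypotheses (cK : continuous K) (cDK : continuous DK).
Hypothesis (dK : forall w, is_derive w (delta_mx 0 i) K (DK w)).
Hypotheses (KB : forall w, `|K w| <= B * J w) (DKB : forall w, `|DK w| <= B * J w).

Let iBJ : integrableRd (fun w : V => B * J w).
Proof. exact: L1Zl (@integrable_J R n). Qed.

Let iK : integrableRd K.
Proof. by apply: (integrableRd_le _ iBJ) => [|w]; [exact: continuous_mRd|exact: KB]. Qed.

Let iDK : integrableRd DK.
Proof. by apply: (integrableRd_le _ iBJ) => [|w]; [exact: continuous_mRd|exact: DKB]. Qed.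

(** Integration by parts. The factor i of the usual formula is the phase shift by pi / 2, which
    turns the sine into a cosine. *)
Lemma cosT_derive xi a : cosT DK xi a = - xi 0 i * cosT K xi (a - pi / 2).
Proof.
pose F w := K w * cos (a - dot w xi).
pose S w := K w * cos (a - pi / 2 - dot w xi).
have dc w : is_derive w (delta_mx 0 i) (fun w => cos (a - dot w xi)) (xi 0 i * cos (a - pi / 2 - dot w xi)).
  apply: is_derive_line.
  have -> : (fun s : R => cos (a - dot (w + s *: delta_mx 0 i) xi)) =
      cos \o (fun s : R => a - (dot w xi + s * xi 0 i)).
    by apply/funext => s /=; rewrite dot_delta.
  apply: is_derive_eq; rewrite !scaleR_mul !mulr0 ?add0r mul0r addr0.
  by rewrite (addrAC a) cosB cos_pihalf sin_pihalf; ring.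
have dF w : is_derive w (delta_mx 0 i) F (DK w * cos (a - dot w xi) + xi 0 i * S w).
  have : is_derive w (delta_mx 0 i) (K * (fun w => cos (a - dot w xi))) (DK w * cos (a - dot w xi) + xi 0 i * S w).
    apply: is_derive_eq; rewrite !scaleR_mul /S; ring.
  by [].
have iS : integrableRd S by exact: (integrable_cosT _ _ iK).
have iDc : integrableRd (fun w => DK w * cos (a - dot w xi)) by exact: (integrable_cosT _ _ iDK).
have hb w : `|DK w * cos (a - dot w xi) + xi 0 i * S w| <= (B + `|xi 0 i| * B) * J w.
  apply: (le_trans (ler_normD _ _)); rewrite mulrDl; apply: lerD.
    exact: le_trans (mul_cos_le _ _) (DKB w).
  rewrite normrM -mulrA; apply: ler_wpM2l => //.
  exact: le_trans (mul_cos_le _ _) (KB w).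
have := @int_derive_dir0 R n F _ i (B + `|xi 0 i| * B) (integrable_cosT _ _ iK) dF hb.
rewrite intRdE I_D//; last exact: L1Zl iS.
rewrite [X in _ + X]I_Zl; last exact: iS.
move=> h; apply/eqP; rewrite mulNr -addr_eq0; apply/eqP; exact: h.
Qed.
End CosDerive.

Section Riesz.
Variables (R : realType) (n : nat) (sigma B : R).
Local Notation V := 'rV[R]_n.
Local Notation lebn := (@lebesgue_tuple R n).
Local Notation leb := (@lebesgue_measure R).
Local Notation mR := (measurableTypeR R).
Variables (K DK : 'I_n -> V -> R).
Hypotheses (hsigma : 0 < sigma < 1) (B0 : 0 <= B).
Hypotheses (cK : forall i, continuous (K i)) (cDK : forall i, continuous (DK i)).
Hypothesis (dK : forall i w, is_derive w (delta_mx 0 i) (K i) (DK i w)).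
Hypotheses (KB : forall i w, `|K i w| <= B * J w) (DKB : forall i w, `|DK i w| <= B * J w).
Hypothesis (KD : forall i xi a, `|cosT (K i) xi a| * (1 + enorm xi) <= B * J xi).

Let L (w : V) : R := \sum_i DK i w.
Let N : R := n%:R * B.

Let N0 : 0 <= N. Proof. by rewrite mulr_ge0. Qed.

Let iBJ : integrableRd (fun w : V => B * J w).
Proof. exact: L1Zl (@integrable_J R n). Qed.

Let iNJ : integrableRd (fun w : V => N * J w).
Proof. exact: L1Zl (@integrable_J R n). Qed.

Let iK i : integrableRd (K i).
Proof. by apply: (integrableRd_le _ iBJ) => [|w]; [exact: continuous_mRd (@cK i)|exact: KB]. Qed.

Let iDK i : integrableRd (DK i).
Proof. by apply: (integrableRd_le _ iBJ) => [|w]; [exact: continuous_mRd (@cDK i)|exact: DKB]. Qed.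

Let LB w : `|L w| <= N * J w.
Proof.
apply: (le_trans (ler_norm_sum _ _ _)).
apply: (@le_trans _ _ (\sum_(i < n) B * J w)); first exact: ler_sum.
by rewrite sumr_const card_ord -mulrA -[leLHS]mulr_natl.
Qed.

Let iL : integrableRd L.
Proof. by have := @L1_sum _ _ _ lebn _ (index_enum _) xpredT (fun i => DK i \o @rowt R n) (fun i _ => iDK i). Qed.

Let cosT_DK i xi a : cosT (DK i) xi a = - xi 0 i * cosT (K i) xi (a - pi / 2).
Proof. by apply: (@cosT_derive _ _ B); [exact: cK|exact: cDK|exact: KB|exact: DKB]. Qed.

Let cosT_L xi a : cosT L xi a = \sum_i - xi 0 i * cosT (K i) xi (a - pi / 2).
Proof.
under eq_bigr do rewrite -cosT_DK.
rewrite /cosT intRdE -I_sum; last by move=> i _; exact: integrable_cosT.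
by apply: eq_I => t /=; rewrite mulr_suml.
Qed.

(** The transform of a divergence vanishes to first order at xi = 0, which pays for |xi|^(- sigma).
    The factor 1 + |xi|, inherited from [KD], pays for the growth of |xi| at infinity. *)
Let cosT_L_le xi a : `|cosT L xi a| * (1 + enorm xi) <= enorm xi * (N * J xi).
Proof.
rewrite cosT_L; apply: (@le_trans _ _ (\sum_(i < n) enorm xi * (B * J xi))).
  apply: (le_trans (ler_wpM2r _ (ler_norm_sum _ _ _))); first by rewrite addr_ge0 ?enorm_ge0.
  rewrite mulr_suml; apply: ler_sum => i _.
  rewrite normrM normrN -mulrA; apply: ler_pM => //; last exact: coord_le_enorm.
  by rewrite mulr_ge0// addr_ge0 ?enorm_ge0.
by rewrite sumr_const card_ord -[leLHS]mulr_natl /N mulrCA -!mulrA.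
Qed.

Let e1 (xi : V) : 0 < 1 + enorm xi. Proof. by rewrite ltr_pwDl// enorm_ge0. Qed.

Let NJ0 (xi : V) : 0 <= N * J xi. Proof. by rewrite mulr_ge0// J_ge0. Qed.

Let cosT_L_NJ xi a : `|cosT L xi a| <= N * J xi.
Proof.
rewrite -(ler_pM2r (e1 xi)) (le_trans (cosT_L_le xi a))// mulrC.
by apply: ler_wpM2l => //; rewrite -subr_ge0 addrK.
Qed.

(** The zero average of L. It settles the frequency 0, whatever value [powR] gives to the multiplier
    there. *)
Let cosT_L0 a : cosT L 0 a = 0.
Proof.
rewrite cosT_L big1// => i _; by rewrite mxE oppr0 mul0r.
Qed.

(** By [cosT_L_le] only |xi|^(1 - sigma) <= 1 + |xi| is left, which holds for 0 < sigma < 1. *)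
Lemma fdom_div : fdom (- sigma) L (fun xi => N * J xi).
Proof.
move=> xi a; have [s0 s1] := andP hsigma.
have [e0|e0] := eqVneq (enorm xi) 0.
  by rewrite (enorm_eq0 e0) cosT_L0 normr0 mulr0.
have ep : 0 < enorm xi by rewrite lt0r e0 enorm_ge0.
rewrite -(ler_pM2r (e1 xi)) -mulrA.
apply: (le_trans (ler_wpM2l (powR_ge0 _ _) (cosT_L_le xi a))).
rewrite [leLHS]mulrA [leRHS]mulrC.
apply: ler_wpM2r => //.
have -> : enorm xi `^ (- sigma) * enorm xi = enorm xi `^ (1 - sigma).
  rewrite -[X in _ * X](powRr1 (enorm_ge0 xi)) -powRD; first by rewrite addrC.
  by apply/implyP.
have [h|h] := leP (enorm xi) 1.
  apply: (@le_trans _ _ 1); last by rewrite lerDl enorm_ge0.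
  rewrite -[leRHS](powRr0 (enorm xi)); apply: ger_powR; first by rewrite ep.
  by rewrite subr_ge0 ltW.
apply: (@le_trans _ _ (enorm xi)); last by rewrite lerDr.
rewrite -[leRHS](powRr1 (enorm_ge0 xi)); apply: ler_powR; first exact: ltW.
by rewrite gerBl ltW.
Qed.

(* The heat flow of L at time l^2. *)
Let P (l : R) : V -> R := conv L (Ggauss l).

Let gl (l : R) : R := (2 * l * Num.sqrt pi) ^- n.

Let Gb l : 0 < l -> forall x : V, `|Ggauss l x| <= gl l.
Proof. by move=> l0 x; rewrite gtr0_norm ?Ggauss_gt0//; exact: Ggauss_le. Qed.

Let cosT_P l xi a : 0 < l -> cosT (P l) xi a = Egauss l xi * cosT L xi a.
Proof.
move=> l0; rewrite (cosT_conv iL (integrable_Ggauss n l0) (Gb l0)).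
rewrite /cosT intRdE -I_Zl; last exact: (integrable_cosT _ _ iL).
apply: eq_I => t /=; rewrite /cosT Ggauss_cos//; ring.
Qed.

Let heat_P l v : 0 < l ->
  (2 * pi) ^- n * intRd (fun xi => Egauss l xi * cosT L xi (dot v xi)) = P l v.
Proof.
move=> l0; have iE := integrable_Egauss n l0.
have -> : (fun xi => Egauss l xi * cosT L xi (dot v xi)) =
    (fun xi => intRd (fun w => Egauss l xi * (L w * cos (dot v xi - dot w xi)))).
  by apply/funext => xi; rewrite /cosT !intRdE -I_Zl//; exact: (integrable_cosT _ _ iL).
have m2 : mRd2 (fun xi w => Egauss l xi * (L w * cos (dot v xi - dot w xi))).
  apply: measurable_funM; first exact: (measurableT_comp (integrableRd_meas iE) measurable_fst).
  apply: measurable_funM; first exact: (measurableT_comp (integrableRd_meas iL) measurable_snd).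
  apply: measurable_cos_fun; apply: measurable_funB; apply: measurable_dot;
    by [exact: mvec_fst|exact: mvec_snd|exact: mvec_cst].
have iLn : integrableRd (fun w => `|L w|) by have := L1_norm iL.
rewrite (intRd_swap m2 iE iLn); last first.
  move=> x y; rewrite normrM gtr0_norm ?Egauss_gt0//; apply: ler_wpM2l.
    by rewrite ltW// Egauss_gt0.
  exact: mul_cos_le.
have pi2 : (2 * pi : R) ^+ n != 0 by rewrite expf_neq0// mulf_neq0// gt_eqF// pi_gt0.
have -> : (fun y : V => intRd (fun x : V => Egauss l x * (L y * cos (dot v x - dot y x)))) =
    (fun y : V => (2 * pi) ^+ n * (L y * Ggauss l (v - y))).
  apply/funext => y; have := Egauss_cos 0 (v - y) l0; rewrite cos0 mulr1 => <-.
  rewrite mulrCA mulVKf// intRdE -I_Zl; last exact: (integrable_cosT _ _ iE).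
  apply: eq_I => t /=; rewrite -cosN mulrCA; congr (_ * (_ * cos _)).
  by rewrite sub0r; congr (- _); rewrite dotC /dot -sumrB; apply: eq_bigr => i _; rewrite !mxE; ring.
rewrite intRdE I_Zl ?mulKf//.
apply: (L1_bounded_mul (B := gl l) iL) => [|t]; last exact: Gb.
exact: (mRd_comp (integrableRd_meas (integrable_Ggauss n l0)) (mvecB (mvec_cst _) (mvec_rowt (@measurable_id _ _ setT)))).
Qed.

Let intJ : R := intRd (@J R n).

Let intL : intRd (fun w => `|L w|) <= N * intJ.
Proof.
rewrite /intJ !intRdE -I_Zl; last exact: integrable_J.
by apply: I_le => //; [have := L1_norm iL|move=> t; exact: LB].
Qed.

Let intG l : 0 < l -> intRd (fun w : V => `|Ggauss l w|) = 1.
Proof.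
move=> l0; rewrite -(int_Ggauss n l0); congr intRd; apply/funext => w.
by rewrite gtr0_norm// Ggauss_gt0.
Qed.

Let P_le1 l : 0 < l -> intRd (fun v => `|P l v|) <= N * intJ.
Proof.
move=> l0; apply: (le_trans (conv_norm iL (integrable_Ggauss n l0) (Gb l0))).
by rewrite intG// mulr1.
Qed.

Let iDG l i : 0 < l -> integrableRd (@dGauss R n l i).
Proof.
move=> l0; have l2 : 0 < 2 * l by rewrite mulr_gt0.
apply: (integrableRd_le _ (h := fun x => 2 ^+ n / l * Ggauss (2 * l) x)) => [||x].
- apply: measurable_funM; last exact: (integrableRd_meas (integrable_Ggauss n l0)).
  apply: measurableT_comp => //; apply: measurable_funM => //.
  exact: (mvec_rowt (@measurable_id _ _ setT)).
- by apply: L1Zl; exact: integrable_Ggauss.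
- exact: dGauss_le.
Qed.

Let DGb l i : 0 < l -> forall x : V, `|dGauss l i x| <= 2 ^+ n / l * gl (2 * l).
Proof.
move=> l0 x; apply: (le_trans (dGauss_le i x l0)); apply: ler_wpM2l.
  by rewrite divr_ge0// ltW.
by apply: Ggauss_le; rewrite mulr_gt0.
Qed.

Let dGaussN l i (x : V) : dGauss l i (- x) = - dGauss l i x.
Proof. by rewrite /dGauss !GgaussE mxE /dot; under eq_bigr do rewrite !mxE mulrNN; rewrite !mulNr opprK. Qed.

Let GgaussN l (x : V) : Ggauss l (- x) = Ggauss l x.
Proof. by rewrite !GgaussE /dot; under eq_bigr do rewrite !mxE mulrNN. Qed.

Let conv_DK l i v : 0 < l -> conv (DK i) (Ggauss l) v = conv (K i) (dGauss l i) v.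
Proof.
move=> l0.
pose F w := K i w * Ggauss l (w - v).
have dG w : is_derive w (delta_mx 0 i) (fun w => Ggauss l (w - v)) (dGauss l i (w - v)).
  have := is_derive_Ggauss i (w - v) l0; case; rewrite /derivable /derive => h1 h2.
  have E : (fun h : R => h^-1 *: ((Ggauss l \o shift (w - v)) (h *: delta_mx 0 i) - Ggauss l (w - v))) =
   (fun h : R => h^-1 *: (((fun w => Ggauss l (w - v)) \o shift w) (h *: delta_mx 0 i) - Ggauss l (w - v))).
    by apply/funext => h /=; rewrite addrA.
  by rewrite E in h1 h2; split.
have dF w : is_derive w (delta_mx 0 i) F (DK i w * Ggauss l (w - v) + K i w * dGauss l i (w - v)).
  have : is_derive w (delta_mx 0 i) (K i * (fun w => Ggauss l (w - v))) (DK i w * Ggauss l (w - v) + K i w * dGauss l i (w - v)).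
    by apply: is_derive_eq; rewrite !scaleR_mul; ring.
  by [].
have mx : mvec (fun t : n.-tuple mR => rowt t - v) by exact: (mvecB (mvec_rowt (@measurable_id _ _ setT)) (mvec_cst _)).
have i1 (A : V -> R) : integrableRd A -> integrableRd (fun w => A w * Ggauss l (w - v)).
  move=> iA; apply: (L1_bounded_mul (B := gl l) iA) => [|t]; last exact: Gb.
  exact: (mRd_comp (integrableRd_meas (integrable_Ggauss n l0)) mx).
have i2 : integrableRd (fun w => K i w * dGauss l i (w - v)).
  apply: (L1_bounded_mul (B := 2 ^+ n / l * gl (2 * l)) (iK i)) => [|t]; last exact: DGb.
  exact: (mRd_comp (integrableRd_meas (iDG i l0)) mx).
have hb w : `|DK i w * Ggauss l (w - v) + K i w * dGauss l i (w - v)| <=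
    (B * gl l + B * (2 ^+ n / l * gl (2 * l))) * J w.
  apply: (le_trans (ler_normD _ _)); 
  have E x y : B * x * J w + B * y * J w = B * J w * x + B * J w * y by ring.
  rewrite mulrDl E !normrM; apply: lerD; apply: ler_pM => //; try exact: Gb.
  by rewrite -normrM; exact: DGb.
have := @int_derive_dir0 R n F _ i _ (i1 _ (iK i)) dF hb.
rewrite intRdE I_D//; last exact: i1.
move=> h.
have E1 : conv (DK i) (Ggauss l) v = I lebn (fun t => DK i (rowt t) * Ggauss l (rowt t - v)).
  by apply: eq_I => t /=; rewrite -(opprB v) GgaussN.
have E2 : conv (K i) (dGauss l i) v = - I lebn (fun t => K i (rowt t) * dGauss l i (rowt t - v)).
  rewrite -(I_N i2); apply: eq_I => t /=.
  by rewrite -[in RHS](opprB v) dGaussN mulrN opprK.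
by apply/eqP; rewrite E1 E2 -addr_eq0; apply/eqP; exact: h.
Qed.

Let P_le2 l : 0 < l -> intRd (fun v => `|P l v|) <= N * intJ * (2 ^+ n / l).
Proof.
move=> l0; have l2 : 0 < 2 * l by rewrite mulr_gt0.
have PE v : P l v = \sum_i conv (K i) (dGauss l i) v.
  under eq_bigr do rewrite -conv_DK//.
  rewrite /P /conv intRdE -I_sum; first by apply: eq_I => t /=; rewrite mulr_suml.
  move=> i _; apply: (L1_bounded_mul (B := gl l) (iDK i)) => [|t]; last exact: Gb.
  exact: (mRd_comp (integrableRd_meas (integrable_Ggauss n l0)) (mvecB (mvec_cst _) (mvec_rowt (@measurable_id _ _ setT)))).
have ic i := integrable_conv (iK i) (iDG i l0).
apply: (@le_trans _ _ (intRd (fun v => \sum_i `|conv (K i) (dGauss l i) v|))).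
  apply: I_le.
  - by have := L1_norm (integrable_conv iL (integrable_Ggauss n l0)).
  - by have := @L1_sum _ _ _ lebn _ (index_enum _) xpredT _ (fun i _ => L1_norm (ic i)).
  - by move=> t /=; rewrite PE; exact: ler_norm_sum.
rewrite intRdE I_sum; last by move=> i _; have := L1_norm (ic i).
apply: (@le_trans _ _ (\sum_(i < n) B * intJ * (2 ^+ n / l))); last first.
  by rewrite sumr_const card_ord -[leLHS]mulr_natl /N !mulrA.
apply: ler_sum => i _.
apply: (le_trans (conv_norm (iK i) (iDG i l0) (DGb i l0))).
apply: ler_pM => //; first 2 last.
- rewrite /intJ !intRdE -I_Zl; last exact: integrable_J.
  by apply: I_le => //; [have := L1_norm (iK i)|move=> t; exact: KB].
- rewrite -[leRHS]mulr1 -[X in _ <= _ * X](int_Ggauss n l2) !intRdE -I_Zl; last exact: integrable_Ggauss.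
  apply: I_le => //; [by have := L1_norm (iDG i l0)|by apply: L1Zl; exact: integrable_Ggauss|].
  by move=> t; exact: dGauss_le.
- by apply: I_ge0 => t /=.
- by apply: I_ge0 => t /=.
Qed.

Let P_le l : 0 < l -> intRd (fun v => `|P l v|) <= N * intJ * Num.min 1 (2 ^+ n / l).
Proof.
move=> l0; rewrite /Num.min; case: ifP => _; last exact: P_le2.
by rewrite mulr1; exact: P_le1.
Qed.

Let eg (l : R) (xi : V) : R := expR (- (l * enorm xi) ^+ 2).

Let cK_sub xi a : enorm xi `^ (- sigma) * cosT L xi a =
  (subc sigma)^-1 * I leb (fun l => subk sigma l * eg l xi * cosT L xi a).
Proof.
have [e0|e0] := eqVneq (enorm xi) 0.
  by rewrite (enorm_eq0 e0) cosT_L0; under eq_I do rewrite mulr0; rewrite I_0 !mulr0.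
have ep : 0 < enorm xi by rewrite lt0r e0 enorm_ge0.
have [h1 h2] := subordination hsigma ep.
rewrite I_Zr// h2 mulrA mulrA mulVf ?mul1r// gt_eqF//; exact: subc_gt0.
Qed.

Let measurable_cosTL d (T : measurableType d) (xi : T -> V) (a : T -> R) :
  mvec xi -> measurable_fun setT a -> measurable_fun setT (fun t => cosT L (xi t) (a t)).
Proof.
move=> mxi ma; apply: (measurable_cosT (g := fun=> L)) => //.
exact: (measurableT_comp (integrableRd_meas iL) measurable_snd).
Qed.

Let mxi2 : mvec (fun u : n.-tuple mR * mR => rowt u.1 : V).
Proof. by apply: mvec_rowt; exact: measurable_fst. Qed.

Let measurable_eg : measurable_fun setT (fun u : n.-tuple mR * mR => eg u.2 (rowt u.1)).
Proof.
apply: measurableT_comp => //; apply: measurableT_comp => //; apply: measurable_funX.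
apply: measurable_funM; first exact: measurable_snd.
exact: (measurable_enorm mxi2).
Qed.

Let Fs v (x : n.-tuple mR) (l : mR) : R :=
  subk sigma l * eg l (rowt x) * cosT L (rowt x) (dot v (rowt x)).

Let Fp (l : mR) (x : n.-tuple mR) : R := subk sigma l * P l (rowt x).

(** Integrating first in l recovers |xi|^(- sigma) |cosT L| by [subordination], and [fdom_div]
    dominates it. *)
Let L1_sub v : L1 (lebn \x leb)%E (fun u => Fs v u.1 u.2).
Proof.
have s0 := subc_gt0 hsigma.
apply: (L1_iter (F := Fs v)
  (H := fun x => subc sigma * (N * J (rowt x)))) => [||x|x].
- apply: measurable_funM; last first.
    by apply: measurable_cosTL => //; apply: measurable_dot => //; exact: mvec_cst.
  apply: measurable_funM => //.
  exact: (measurableT_comp (measurable_subk sigma) measurable_snd).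
- by apply: L1Zl; exact: iNJ.
- have [e0|e0] := eqVneq (enorm (rowt x)) 0.
    apply: (eq_L1 (f := fun=> 0)); last exact: L1_0.
    by move=> l; rewrite /Fs (enorm_eq0 e0) cosT_L0 mulr0.
  have ep : 0 < enorm (rowt x) by rewrite lt0r e0 enorm_ge0.
  by have [h1 h2] := subordination hsigma ep; apply: L1Zr.
- have -> : I leb (fun l => `|subk sigma l * eg l (rowt x) * cosT L (rowt x) (dot v (rowt x))|) =
     subc sigma * (enorm (rowt x) `^ (- sigma) * `|cosT L (rowt x) (dot v (rowt x))|).
    have [e0|e0] := eqVneq (enorm (rowt x)) 0.
      rewrite (enorm_eq0 e0) cosT_L0 normr0 !mulr0; under eq_I do rewrite mulr0 normr0.
      exact: I_0.
    have ep : 0 < enorm (rowt x) by rewrite lt0r e0 enorm_ge0.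
    have [h1 h2] := subordination hsigma ep.
    rewrite mulrA -h2 -I_Zr//; apply: eq_I => l.
    by rewrite normrM ger0_norm// mulr_ge0// ?subk_ge0 ?expR_ge0.
  by apply: ler_wpM2l; [exact: ltW|exact: fdom_div].
Qed.

Let pi2 : (2 * pi : R) ^+ n != 0.
Proof. by rewrite expf_neq0// mulf_neq0// gt_eqF// pi_gt0. Qed.

Let inner_P v l : I lebn (fun x => subk sigma l * eg l (rowt x) * cosT L (rowt x) (dot v (rowt x))) =
  (2 * pi) ^+ n * (subk sigma l * P l v).
Proof.
have [l0|l0] := leP l 0.
  by rewrite (subk_le0 _ l0); under eq_I do rewrite !mul0r; rewrite I_0 mul0r mulr0.
rewrite -heat_P// mulrCA mulVKf// intRdE -I_Zl.
  by apply: eq_I => x /=; rewrite EgaussE// mulrA.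
apply: (L1_bounded_mul (B := N) (integrable_Egauss n l0)) => [|t].
  apply: measurable_cosTL; first exact: (mvec_rowt (@measurable_id _ _ setT)).
  by apply: measurable_dot; [exact: mvec_cst|exact: (mvec_rowt (@measurable_id _ _ setT))].
by apply: (le_trans (cosT_L_NJ _ _)); rewrite -[leRHS]mulr1; apply: ler_wpM2l => //; exact: J_le1.
Qed.

Let L1_subP v : L1 leb (fun l => subk sigma l * P l v).
Proof.
have h := L1_I2 (F := fun l x => Fs v x l)
  (L1_swap (F := Fs v) (L1_sub v)).
have := L1Zl ((2 * pi) ^- n) h; apply: eq_L1 => l.
by rewrite inner_P mulKf.
Qed.

Let RieszE v : Ifrac sigma L v = (subc sigma)^-1 * I leb (fun l => subk sigma l * P l v).
Proof.
rewrite /Ifrac fourier_multE//.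
have -> : fmult_kernel (- sigma) L v = (fun xi => (subc sigma)^-1 *
    I leb (fun l => subk sigma l * eg l xi * cosT L xi (dot v xi))).
  by apply/funext => xi; rewrite /fmult_kernel cK_sub.
rewrite intRdE I_Zl; last first.
  exact: (L1_I2 (F := Fs v) (L1_sub v)).
rewrite (I_swap (F := Fs v) (L1_sub v)).
under [in LHS]eq_I do rewrite inner_P.
by rewrite I_Zl//; rewrite mulrCA mulKf.
Qed.

Let mP : measurable_fun setT (fun u : mR * n.-tuple mR => P u.1 (rowt u.2)).
Proof.
apply: (@measurable_intRd R n _ _ (fun u w => L w * Ggauss u.1 (rowt u.2 - w))).
apply: measurable_funM; first exact: (measurableT_comp (integrableRd_meas iL) measurable_snd).
apply: measurable_Ggauss; first exact: (measurableT_comp measurable_fst measurable_fst).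
apply: mvecB; first exact: (mvec_rowt (measurableT_comp measurable_snd measurable_fst)).
exact: (mvec_rowt measurable_snd).
Qed.

Definition Riesz_const : R :=
  (subc sigma)^-1 * (I leb (fun l => subk sigma l * Num.min 1 (2 ^+ n / l)) * (n%:R * intJ)).

(** While [L1_sub] works at one fixed v, this is integrability jointly in l and v. It rests on the
    L^1 norms of the heat flow and yields an integrable Riesz potential. *)
Let L1_subPv : L1 (leb \x lebn)%E (fun u => Fp u.1 u.2).
Proof.
apply: (L1_iter (F := Fp)
  (H := fun l => N * intJ * (subk sigma l * Num.min 1 (2 ^+ n / l)))) => [||l|l].
- apply: measurable_funM => //.
  exact: (measurableT_comp (measurable_subk sigma) measurable_fst).
- by apply: L1Zl; exact: L1_subk_min.
- have [l0|l0] := leP l 0.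
    by apply: (eq_L1 (f := fun=> 0)); [move=> ?; rewrite /Fp (subk_le0 _ l0) mul0r|exact: L1_0].
  by apply: L1Zl; exact: (integrable_conv iL (integrable_Ggauss n l0)).
- have [l0|l0] := leP l 0.
    by rewrite /Fp (subk_le0 _ l0); under eq_I do rewrite mul0r normr0; rewrite I_0 mul0r mulr0.
  under eq_I do rewrite normrM ger0_norm ?subk_ge0//.
  rewrite I_Zl; last by have := L1_norm (integrable_conv iL (integrable_Ggauss n l0)).
  by rewrite mulrCA; apply: ler_wpM2l; [exact: subk_ge0|exact: P_le].
Qed.

Lemma integrable_Riesz : integrableRd (Ifrac sigma L).
Proof.
have h := L1_I2 (F := fun x l => Fp l x)
  (L1_swap (F := Fp) L1_subPv).
by have := L1Zl (subc sigma)^-1 h; apply: eq_L1 => x /=; rewrite RieszE.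
Qed.

Lemma Riesz_bound : intRd (fun v => `|Ifrac sigma L v|) <= Riesz_const * B.
Proof.
have s0 := subc_gt0 hsigma.
have La : L1 (leb \x lebn)%E (fun u => `|Fp u.1 u.2|) by have := L1_norm L1_subPv.
apply: (@le_trans _ _ ((subc sigma)^-1 * I lebn (fun x => I leb (fun l => `|subk sigma l * P l (rowt x)|)))).
  rewrite -I_Zl; last first.
    exact: (L1_I2 (F := fun x l => `|Fp l x|) (L1_swap (F := fun l x => `|Fp l x|) La)).
  apply: I_le.
  - by have := L1_norm integrable_Riesz.
  - apply: L1Zl.
    exact: (L1_I2 (F := fun x l => `|Fp l x|) (L1_swap (F := fun l x => `|Fp l x|) La)).
  - move=> x /=; rewrite RieszE normrM ger0_norm ?invr_ge0 ?(ltW s0)//.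
    apply: ler_wpM2l; first by rewrite invr_ge0 ltW.
    exact: (le_normr_Rintegral measurableT (L1_subP _)).
rewrite -(I_swap (F := fun l x => `|Fp l x|) La) /Riesz_const -mulrA.
apply: ler_wpM2l; first by rewrite invr_ge0 ltW.
rewrite -mulrA -mulrA (mulrC intJ) (mulrA n%:R) -/N -I_Zr; last exact: L1_subk_min.
apply: I_le.
- exact: (L1_I2 (F := fun l x => `|Fp l x|) La).
- by apply: L1Zr; exact: L1_subk_min.
- move=> l; have [l0|l0] := leP l 0.
    by rewrite /Fp (subk_le0 _ l0); under eq_I do rewrite mul0r normr0; rewrite I_0 !mul0r.
  under eq_I do rewrite normrM ger0_norm ?subk_ge0//.
  rewrite I_Zl; last by have := L1_norm (integrable_conv iL (integrable_Ggauss n l0)).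
  rewrite -mulrA; apply: ler_wpM2l; first exact: subk_ge0.
  by rewrite mulrC; exact: P_le.
Qed.

Lemma cosT_Riesz xi a : cosT (Ifrac sigma L) xi a = enorm xi `^ (- sigma) * cosT L xi a.
Proof.
pose F (l : mR) (x : n.-tuple mR) : R := subk sigma l * P l (rowt x) * cos (a - dot (rowt x) xi).
have LF : L1 (leb \x lebn)%E (fun u => F u.1 u.2).
  apply: (L1_bounded_mul (B := 1) L1_subPv) => [|u]; last exact: cos_max.
  apply: measurable_cos_fun; apply: measurable_funB => //.
  by apply: measurable_dot; [exact: (mvec_rowt measurable_snd)|exact: mvec_cst].
transitivity ((subc sigma)^-1 * I lebn (fun x => I leb (F^~ x))).
  rewrite -I_Zl; last exact: (L1_I2 (F := fun x l => F l x) (L1_swap LF)).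
  apply: eq_I => x; rewrite /= RieszE -mulrA; congr (_ * _).
  by rewrite -(I_Zr _ (L1_subP _)).
rewrite cK_sub -(I_swap LF); congr (_ * _); apply: eq_I => l.
rewrite /F; have [l0|l0] := leP l 0.
  by rewrite (subk_le0 _ l0); under eq_I do rewrite !mul0r; rewrite I_0 !mul0r.
under eq_I do rewrite -mulrA.
have iP := integrable_conv iL (integrable_Ggauss n l0).
rewrite I_Zl; last exact: (integrable_cosT _ _ iP).
by rewrite -mulrA /eg -(EgaussE l xi) -cosT_P.
Qed.

Lemma fdom_Riesz : fdom sigma (Ifrac sigma L) (fun xi => N * J xi).
Proof.
move=> xi a; rewrite cosT_Riesz.
have [e0|e0] := eqVneq (enorm xi) 0.
  by rewrite (enorm_eq0 e0) cosT_L0 mulr0 normr0 mulr0.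
rewrite normrM ger0_norm ?powR_ge0// mulrA -powRD ?subrr ?powRr0 ?mul1r ?cosT_L_NJ//.
exact/implyP.
Qed.

Let cL : continuous L.
Proof.
by apply: continuous_big => [|i _]; [exact: add_continuous|exact: cDK].
Qed.

(** The substitution w = v - l z moves l into the argument of L, where continuity and boundedness of
    L allow l to tend to 0. *)
Let P_scaled l v : 0 < l -> P l v = intRd (fun z => L (v - l *: z) * Ggauss 1 z).
Proof.
move=> l0; have iLG : integrableRd (fun w => L w * Ggauss l (v - w)).
  apply: (L1_bounded_mul (B := gl l) iL) => [|t]; last exact: Gb.
  exact: (mRd_comp (integrableRd_meas (integrable_Ggauss n l0)) (mvecB (mvec_cst _) (mvec_rowt (@measurable_id _ _ setT)))).
have nl0 : - l != 0 by rewrite oppr_eq0 gt_eqF.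
have [i1 E] := intRd_affine v nl0 iLG.
have ln : l ^+ n != 0 by rewrite expf_neq0// gt_eqF.
have l2 : `|- l| = l by rewrite normrN gtr0_norm.
rewrite l2 in E.
have -> : P l v = l ^+ n * intRd (fun w => L (v + - l *: w) * Ggauss l (v - (v + - l *: w))).
  by rewrite E mulVKf.
rewrite !intRdE -I_Zl//; apply: eq_I => t /=; rewrite scaleNr mulrCA; congr (_ * _).
rewrite opprD opprK addrA subrr add0r !GgaussE.
have -> : dot (l *: rowt t) (l *: rowt t) = l ^+ 2 * dot (rowt t) (rowt t).
  by rewrite /dot mulr_sumr; apply: eq_bigr => i _; rewrite !mxE; ring.
rewrite mulrA; congr (_ * expR (- _)); first last.
  by field; rewrite gt_eqF.
rewrite mulr1 [2 * l]mulrC -mulrA exprMn; move: ((2 * Num.sqrt pi) ^+ n) => X.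
by rewrite invfM mulVKf.
Qed.

Let hseq (m : nat) : R := m.+1%:R^-1.

Let hseq0 m : 0 < hseq m. Proof. by rewrite invr_gt0. Qed.

Let cvg_hseq : hseq m @[m --> \oo] --> (0 : R).
Proof. exact: cvg_harmonic. Qed.

Let P_cvg v : P (hseq m) v @[m --> \oo] --> L v.
Proof.
have -> : (fun m => P (hseq m) v) = (fun m => intRd (fun z => L (v - hseq m *: z) * Ggauss 1 z)).
  by apply/funext => m; rewrite P_scaled.
have -> : L v = I lebn (fun t => L v * Ggauss 1 (rowt t)).
  rewrite -[LHS]mulr1 -[X in _ * X = _](int_Ggauss n (@ltr01 R)) -I_Zl//; exact: integrable_Ggauss.
apply: (I_cvg (F := fun m t => L (v - hseq m *: rowt t) * Ggauss 1 (rowt t)) (g := fun t => N * Ggauss 1 (rowt t))).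
- move=> m; apply: measurable_funM; last exact: (integrableRd_meas (integrable_Ggauss n (@ltr01 R))).
  apply: (mRd_comp (integrableRd_meas iL)); apply: mvecB; first exact: mvec_cst.
  by apply: mvecZ => //; exact: (mvec_rowt (@measurable_id _ _ setT)).
- move=> t; apply: cvgMl; apply: continuous_cvg; first exact: cL.
  rewrite -[X in _ --> X]subr0; apply: cvgB; first exact: cvg_cst.
  by rewrite -(scale0r (rowt t)); apply: cvgZl.
- by apply: L1Zl; exact: integrable_Ggauss.
- move=> m t; rewrite normrM (gtr0_norm (Ggauss_gt0 _ _))//; apply: ler_wpM2r.
    by rewrite ltW// Ggauss_gt0.
  by apply: (le_trans (LB _)); rewrite -[leRHS]mulr1; apply: ler_wpM2l => //; exact: J_le1.
Qed.

(** Fourier inversion by Gaussian regularization: the regularized integral is the heat flow of L. As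
    l tends to 0, it converges to the left-hand side by dominated convergence in xi, and to L v by
    [P_cvg]. *)
Let inversion v : (2 * pi) ^- n * intRd (fun xi => cosT L xi (dot v xi)) = L v.
Proof.
have mc : measurable_fun setT (fun t : n.-tuple mR => cosT L (rowt t) (dot v (rowt t))).
  apply: measurable_cosTL; first exact: (mvec_rowt (@measurable_id _ _ setT)).
  by apply: measurable_dot; [exact: mvec_cst|exact: (mvec_rowt (@measurable_id _ _ setT))].
have h : (2 * pi) ^- n * I lebn (fun t => Egauss (hseq m) (rowt t) * cosT L (rowt t) (dot v (rowt t))) @[m --> \oo]
   --> (2 * pi) ^- n * I lebn (fun t => cosT L (rowt t) (dot v (rowt t))).
  apply: cvgMr; apply: (I_cvg (g := fun t => N * J (rowt t))).
  - move=> m; apply: measurable_funM => //.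
    exact: (integrableRd_meas (integrable_Egauss n (hseq0 m))).
  - move=> t; rewrite -[X in _ --> X]mul1r; apply: cvgMl.
    have -> : (fun m => Egauss (hseq m) (rowt t)) = (fun m => expR (- (hseq m * enorm (rowt t)) ^+ 2)).
      by apply/funext => m; rewrite EgaussE.
    rewrite -[X in _ --> X]expR0; apply: continuous_cvg; first exact: continuous_expR.
    rewrite -[X in _ --> X]oppr0; apply: cvgN.
    rewrite (_ : 0 = (0 * enorm (rowt t)) ^+ 2); last by rewrite mul0r expr0n.
    by rewrite expr2; under eq_fun do rewrite expr2; apply: cvgM; apply: cvgMl.
  - exact: iNJ.
  - move=> m t; rewrite normrM gtr0_norm ?Egauss_gt0//.
    apply: (le_trans _ (cosT_L_NJ (rowt t) (dot v (rowt t)))).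
    by rewrite -[leRHS]mul1r; apply: ler_wpM2r => //; exact: Egauss_le1.
have E : (fun m => (2 * pi) ^- n * I lebn (fun t => Egauss (hseq m) (rowt t) * cosT L (rowt t) (dot v (rowt t)))) =
    (fun m => P (hseq m) v).
  by apply/funext => m; rewrite -heat_P.
rewrite E in h.
transitivity (lim (P (hseq m) v @[m --> \oo])).
  by apply/esym; exact: (cvg_lim _ h).
by apply: cvg_lim => //; exact: P_cvg.
Qed.

Lemma Dfrac_Riesz w : Dfrac sigma (Ifrac sigma L) w = L w.
Proof.
rewrite /Dfrac (fourier_multE _ _ integrable_Riesz) -inversion; congr (_ * intRd _).
apply/funext => xi; rewrite /fmult_kernel cosT_Riesz.
have [e0|e0] := eqVneq (enorm xi) 0.
  by rewrite (enorm_eq0 e0) cosT_L0 !mulr0.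
rewrite mulrA -powRD ?subrr ?powRr0 ?mul1r//.
exact/implyP.
Qed.
End Riesz.

(** * Decay of the Fourier transform of test functions *)

Section CkAlgebra.
Variables (R : realType) (V : normedModType R).
Implicit Types f g l : V -> R.

Lemma CkD k f g : Ck k f -> Ck k g -> Ck k (fun x => f x + g x).
Proof.
elim: k f g => [f g cf cg|k IH f g [df Df] [dg Dg]] /=.
  by move=> x; apply: cvgD; [exact: cf|exact: cg].
split=> [p|u]; first exact: differentiableD (df p) (dg p).
rewrite (_ : 'D_u _ = fun x => 'D_u f x + 'D_u g x).
  by apply: IH; [exact: Df|exact: Dg].
by apply/funext => x; exact: deriveD (diff_derivable (df x)) (diff_derivable (dg x)).
Qed.

Lemma CkZ k c f : Ck k f -> Ck k (fun x => c * f x).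
Proof.
elim: k f => [f cf|k IH f [df Df]] /=.
  by move=> x; apply: cvgMr; exact: cf.
split=> [p|u]; first exact: differentiableZ (df p).
rewrite (_ : 'D_u _ = fun x => c * 'D_u f x).
  by apply: IH; exact: Df.
by apply/funext => x; exact: deriveZ (diff_derivable (df x)).
Qed.

(** The directional derivatives of l are constants, so the product rule leaves f times a constant
    and a product of the same shape with a derivative of f; hence f is assumed smooth to all
    orders. *)
Lemma Ck_mul_lin k f l (l' : V -> R) : (forall x, differentiable l x) ->
  (forall u x, 'D_u l x = l' u) -> (forall j, Ck j f) -> Ck k (fun x => f x * l x).
Proof.
move=> dl Dl; elim: k f => [|k IH] f cf.
  move=> x; apply: cvgM; first exact: (cf 0%N).
  exact: differentiable_continuous (dl x).
have [df Df] := cf 1%N.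
split=> [p|u]; first exact: differentiableM (df p) (dl p).
rewrite (_ : 'D_u _ = fun x => l' u * f x + 'D_u f x * l x).
  apply: CkD; first exact: CkZ.
  by apply: IH => j; have [_ h] := cf j.+1; exact: h.
apply/funext => x; rewrite (deriveM (diff_derivable (df x)) (diff_derivable (dl x))) Dl.
by rewrite !scaleR_mul mulrC [l x * _]mulrC.
Qed.

Lemma derive_lin l u x : (forall y h, l (y + h) = l y + l h) ->
  (forall (s : R) h, l (s *: h) = s * l h) -> 'D_u l x = l u.
Proof.
move=> lD lZ; rewrite /derive.
rewrite (_ : (fun h : R => _) = fun h : R => h^-1 *: (h * l u)); last first.
  by apply/funext => h /=; rewrite lD lZ addrK.
apply: cvg_lim => //; apply: (@cvg_trans _ (cst (l u) @ 0^')); last exact: cvg_cst.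
apply: near_eq_cvg; near=> h; rewrite scaleR_mul mulKf//.
by near: h; exact: nbhs_dnbhs_neq.
Unshelve. all: by end_near. Qed.

Lemma differentiable_lin l x : continuous l -> (forall (a : R) u v, l (a *: u + v) = a * l u + l v) ->
  differentiable l x.
Proof.
move=> cl ll; pose f : {linear V -> R} := HB.pack l (@GRing.isLinear.Build R V R *:%R l ll).
exact: (@linear_differentiable _ _ _ f).
Qed.
End CkAlgebra.

Section ContinuousAux.
Variables (R : realType).

Lemma continuous_triple (T A B C : topologicalType) (f : T -> A) (g : T -> B) (h : T -> C) :
  continuous f -> continuous g -> continuous h -> continuous (fun x => (f x, g x, h x)).
Proof.
by move=> cf cg ch x; exact: (cvg_pair (cvg_pair (cf x) (cg x)) (ch x)).
Qed.

Lemma continuous_affine (V : normedModType R) (y : V) (b : R) : continuous (fun w : V => y + b *: w).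
Proof. by move=> w; apply: cvgD; [exact: cvg_cst|apply: cvgZr; exact: cvg_id]. Qed.

Lemma continuous_lin2 (T : topologicalType) (f g : T -> R) b e :
  continuous f -> continuous g -> continuous (fun x => b * f x + e * g x).
Proof. by move=> cf cg x; apply: cvgD; apply: cvgMr; [exact: cf|exact: cg]. Qed.
Lemma continuous_scale (T : topologicalType) (f : T -> R) p :
  continuous f -> continuous (fun x => p * f x).
Proof. by move=> cf x; apply: cvgMr; exact: cf. Qed.
End ContinuousAux.

Lemma norm_lin2_le (R : realType) (M b e x y B1 B2 : R) : `|b| <= M -> `|e| <= M ->
  `|x| <= B1 -> `|y| <= B2 -> `|b * x + e * y| <= M * (B1 + B2).
Proof.
move=> hb he hx hy; apply: (le_trans (ler_normD _ _)).
by rewrite mulrDr !normrM; apply: lerD; apply: ler_pM.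
Qed.

Section Good.
Variables (R : realType) (d : nat).
Local Notation V := 'rV[R]_d.
Local Notation phase := (R * V * V)%type.
Variable S : set phase.
Hypothesis cS : compact S.
Implicit Types chi : phase -> R.

(** With S fixed, this class is stable under derivatives and under multiplication by coordinates, so
    estimates can be iterated without following supports. *)
Definition smooth_supp chi := (forall k, Ck k chi) /\ (forall m, ~ S m -> chi m = 0).

Lemma smooth_supp_cont chi : smooth_supp chi -> continuous chi.
Proof. by case=> /(_ 0%N). Qed.

Lemma smooth_supp_diff chi m : smooth_supp chi -> differentiable chi m.
Proof. by case=> /(_ 1%N)[]. Qed.

Lemma smooth_supp_D chi u : smooth_supp chi -> smooth_supp ('D_u chi).
Proof.
move=> [ck z]; split=> [k|m Sm]; first by have [_ h] := ck k.+1; exact: h.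
have cl : closed S by apply: compact_closed => //; exact: norm_hausdorff.
have : \forall m' \near m, chi m' = (cst 0 : phase -> R) m'.
  have : open (~` S) by exact: closed_openC.
  move=> /(_ m) /= /(_ Sm); apply: filterS => m' /= ; exact: z.
by move/near_eq_derive => ->; rewrite derive_cst.
Qed.

Lemma smooth_supp_bounded chi : smooth_supp chi -> exists2 B, 0 <= B & forall m, `|chi m| <= B.
Proof.
move=> gc; have cc := smooth_supp_cont gc.
have : compact (chi @` S) by apply: continuous_compact => //; exact: continuous_subspaceT.
move=> /compact_bounded[N [_ hN]].
exists (`|N| + 1) => [|m]; first by rewrite addr_ge0.
have [Sm|Sm] := pselect (S m); last by rewrite (gc.2 _ Sm) normr0 addr_ge0.
apply: hN; last by exists m.
by rewrite ltr_pwDr// ler_norm.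
Qed.

Lemma coordy_diff m (i : 'I_d) : differentiable (fun m : phase => m.1.2 0 i) m.
Proof.
apply: differentiable_lin => [|a u v]; last by rewrite !mxE.
move=> x; apply: (@continuous_comp _ _ _ (fun m : phase => m.1.2) (fun w => w 0 i)); last exact: coord_continuous.
by apply: (@continuous_comp _ _ _ (fun m : phase => m.1) (fun w => w.2)); [exact: cvg_fst|exact: cvg_snd].
Qed.

Lemma coordw_diff m (i : 'I_d) : differentiable (fun m : phase => m.2 0 i) m.
Proof.
apply: differentiable_lin => [|a u v]; last by rewrite !mxE.
by move=> x; apply: (@continuous_comp _ _ _ (fun m : phase => m.2) (fun w => w 0 i)); [exact: cvg_snd|exact: coord_continuous].
Qed.

Lemma coordy_D u m (i : 'I_d) : 'D_u (fun m : phase => m.1.2 0 i) m = u.1.2 0 i.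
Proof. by apply: (derive_lin (l := fun m : phase => m.1.2 0 i)) => *; rewrite !mxE. Qed.

Lemma coordw_D u m (i : 'I_d) : 'D_u (fun m : phase => m.2 0 i) m = u.2 0 i.
Proof. by apply: (derive_lin (l := fun m : phase => m.2 0 i)) => *; rewrite !mxE. Qed.

Lemma smooth_supp_coordy chi i : smooth_supp chi -> smooth_supp (fun m => chi m * m.1.2 0 i).
Proof.
move=> [ck z]; split=> [k|m Sm]; last by rewrite z// mul0r.
apply: (@Ck_mul_lin _ _ _ _ _ (fun u : phase => u.1.2 0 i)) => // [x|u m]; last exact: coordy_D.
exact: coordy_diff.
Qed.

Lemma smooth_supp_coordw chi i : smooth_supp chi -> smooth_supp (fun m => chi m * m.2 0 i).
Proof.
move=> [ck z]; split=> [k|m Sm]; last by rewrite z// mul0r.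
apply: (@Ck_mul_lin _ _ _ _ _ (fun u : phase => u.2 0 i)) => // [x|u m]; last exact: coordw_D.
exact: coordw_diff.
Qed.

(** The test function composed with A^-1, as a function of w alone: y enters through [y1] and [y2],
    and [b], [e] are the second column of A^-1. *)
Definition ker chi (th : R) (y1 y2 : V) (b e : R) (w : V) : R :=
  chi (th, y1 + b *: w, y2 + e *: w).

(* Makes the decay of [ker chi th y1 y2 b e] uniform in its parameters. *)
Definition adm (M th : R) (y1 y2 : V) (b e : R) :=
  [/\ `|b| <= M, `|e| <= M & forall w, S (th, y1 + b *: w, y2 + e *: w) -> forall i, `|w 0 i| <= M].

Lemma ker_cont chi th y1 y2 b e : smooth_supp chi -> continuous (ker chi th y1 y2 b e).
Proof.
move=> gc w; rewrite /ker.
apply: (@continuous_comp _ _ _ (fun w : V => (th, y1 + b *: w, y2 + e *: w) : phase) chi); last exact: smooth_supp_cont.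
have h := @continuous_triple V R V V (fun=> th) _ _ (@cst_continuous V R th) (@continuous_affine R V y1 b) (@continuous_affine R V y2 e).
exact: h w.
Qed.

Lemma ker_derive chi th y1 y2 b e i w : smooth_supp chi ->
  is_derive w (delta_mx 0 i) (ker chi th y1 y2 b e)
   (b * ker ('D_((0, delta_mx 0 i, 0) : phase) chi) th y1 y2 b e w +
    e * ker ('D_((0, 0, delta_mx 0 i) : phase) chi) th y1 y2 b e w).
Proof.
move=> gc.
pose u : phase := (0, b *: delta_mx 0 i, e *: delta_mx 0 i).
pose m : phase := (th, y1 + b *: w, y2 + e *: w).
have dm : differentiable chi m := smooth_supp_diff m gc.
have -> : b * ker ('D_((0, delta_mx 0 i, 0) : phase) chi) th y1 y2 b e w +
    e * ker ('D_((0, 0, delta_mx 0 i) : phase) chi) th y1 y2 b e w = 'D_u chi m.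
  rewrite /ker !deriveE// -/m.
  have -> : u = b *: ((0, delta_mx 0 i, 0) : phase) + e *: ((0, 0, delta_mx 0 i) : phase).
    by congr (_, _, _) => /=; rewrite !scaler0 ?addr0 ?add0r.
  by rewrite linearD !linearZ.
have := diff_derivable (v := u) dm => /derivableP[].
rewrite /derivable /derive.
have E : (fun h : R => h^-1 *: ((chi \o shift m) (h *: u) - chi m)) =
   (fun h : R => h^-1 *: ((ker chi th y1 y2 b e \o shift w) (h *: delta_mx 0 i) - ker chi th y1 y2 b e w)).
  apply/funext => h /=; rewrite /ker /m; congr (_ *: (chi (_, _, _) - _)) => /=.
  - by rewrite scaler0 add0r.
  - by rewrite scalerDr addrCA scalerA mulrC -scalerA.
  - by rewrite scalerDr addrCA scalerA mulrC -scalerA.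
by rewrite E => h1 h2; split.
Qed.

(** Turns a bounded function supported in a box into one dominated by a multiple of J. *)
Lemma J_ge_box M (w : V) : 0 <= M -> (forall i, `|w 0 i| <= M) -> 1 <= (1 + M ^+ 2) ^+ d * J w.
Proof.
move=> M0 wM.
have -> : (1 + M ^+ 2) ^+ d = \prod_(i < d) (1 + M ^+ 2) by rewrite prodr_const card_ord.
rewrite /J /prodV -big_split /=; elim/big_ind : _ => // [x y x1 y1|i _]; first exact: mulr_ege1.
rewrite /cauchy1 -ler_pdivrMr ?invr_gt0 ?ltr_pwDl ?sqr_ge0// div1r invrK lerD2l.
by rewrite -[leLHS]real_normK ?num_real// lerXn2r ?nnegrE.
Qed.

Lemma ker_bound chi M : smooth_supp chi -> 0 <= M -> exists2 B, 0 <= B &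
  forall th y1 y2 b e, adm M th y1 y2 b e -> forall w, `|ker chi th y1 y2 b e w| <= B * J w.
Proof.
move=> gc M0; have [B B0 hB] := smooth_supp_bounded gc.
exists (B * (1 + M ^+ 2) ^+ d) => [|th y1 y2 b e [hb he hs] w].
  by rewrite mulr_ge0// exprn_ge0// addr_ge0// sqr_ge0.
have [Sm|Sm] := pselect (S (th, y1 + b *: w, y2 + e *: w)); last first.
  by rewrite /ker (gc.2 _ Sm) normr0 mulr_ge0 ?J_ge0// mulr_ge0// exprn_ge0// addr_ge0// sqr_ge0.
rewrite /ker; apply: (le_trans (hB (th, y1 + b *: w, y2 + e *: w))); rewrite -[leLHS]mulr1 -mulrA; apply: ler_wpM2l => //.
by apply: J_ge_box => //; exact: hs.
Qed.

Lemma integrable_ker chi M th y1 y2 b e : smooth_supp chi -> 0 <= M -> adm M th y1 y2 b e ->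
  integrableRd (ker chi th y1 y2 b e).
Proof.
move=> gc M0 ad; have [B B0 hB] := ker_bound gc M0.
apply: (integrableRd_le _ (L1Zl B (@integrable_J R d))) => [|w]; last exact: hB.
by apply: continuous_mRd; exact: ker_cont.
Qed.

(** Induction on the list: a factor |xi_i| is traded for a derivative in w_i, which by the chain
    rule is a combination, with coefficients b and e bounded by M, of kernels of the same form for
    derivatives of chi. Repetitions in the list give decay of any order. *)
Lemma ker_cosT chi M (l : seq 'I_d) : smooth_supp chi -> 0 <= M -> exists2 B, 0 <= B &
  forall th y1 y2 b e, adm M th y1 y2 b e -> forall (xi : V) a,
   (\prod_(i <- l) (1 + `|xi 0 i|)) * `|cosT (ker chi th y1 y2 b e) xi a| <= B.
Proof.
move=> + M0; elim: l chi => [|i l IH] chi gc.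
  have [B B0 hB] := ker_bound gc M0.
  exists (B * intRd (@J R d)) => [|th y1 y2 b e ad xi a].
    by rewrite mulr_ge0//; apply: I_ge0 => t; exact: J_ge0.
  rewrite big_nil mul1r intRdE -I_Zl; last exact: integrable_J.
  apply: (cosT_le (h := fun w => B * J w)).
  - by apply: continuous_mRd; exact: ker_cont.
  - exact: L1Zl (@integrable_J R d).
  - exact: hB.
have [B B0 hB] := IH _ gc.
pose u1 : phase := (0, delta_mx 0 i, 0); pose u2 : phase := (0, 0, delta_mx 0 i).
have [B1 B10 hB1] := IH _ (smooth_supp_D u1 gc); have [B2 B20 hB2] := IH _ (smooth_supp_D u2 gc).
exists (B + M * (B1 + B2)) => [|th y1 y2 b e ad xi a].
  by rewrite addr_ge0// mulr_ge0// addr_ge0.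
set k := ker _ _ _ _ _ _; pose k1 := ker ('D_u1 chi) th y1 y2 b e; pose k2 := ker ('D_u2 chi) th y1 y2 b e.
have ik1 : integrableRd k1 by exact: (integrable_ker (smooth_supp_D u1 gc) M0 ad).
have ik2 : integrableRd k2 by exact: (integrable_ker (smooth_supp_D u2 gc) M0 ad).
have ck1 : continuous k1 by exact: ker_cont (smooth_supp_D u1 gc).
have ck2 : continuous k2 by exact: ker_cont (smooth_supp_D u2 gc).
have [hb he _] := ad.
(* The phase a + pi / 2 compensates the shift in [cosT_derive]. *)
have E : - xi 0 i * cosT k xi a = b * cosT k1 xi (a + pi / 2) + e * cosT k2 xi (a + pi / 2).
  have [C C0 hC] := ker_bound gc M0.
  have [C1 C10 hC1] := ker_bound (smooth_supp_D u1 gc) M0.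
  have [C2 C20 hC2] := ker_bound (smooth_supp_D u2 gc) M0.
  have cDK : continuous (fun w => b * k1 w + e * k2 w).
    exact: (@continuous_lin2 R V k1 k2 b e ck1 ck2).
  have J0 w : 0 <= J (w : V) by exact: J_ge0.
  have := @cosT_derive R d (C + M * (C1 + C2)) i k (fun w => b * k1 w + e * k2 w) (ker_cont gc) cDK
    (fun w => ker_derive _ _ _ _ _ i w gc).
  move=> /(_ _ _ xi (a + pi / 2)).
  rewrite addrK => <-.
  - rewrite /cosT !intRdE -(I_Zl b (integrable_cosT _ _ ik1)) -(I_Zl e (integrable_cosT _ _ ik2)).
    rewrite -I_D; [|apply: L1Zl; exact: (integrable_cosT _ _ ik1)|apply: L1Zl; exact: (integrable_cosT _ _ ik2)].
    by apply: eq_I => t /=; ring.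
  - move=> w; apply: (le_trans (hC _ _ _ _ _ ad w)); apply: ler_wpM2r => //.
    by rewrite lerDl mulr_ge0// addr_ge0.
  - move=> w; apply: (@le_trans _ _ (M * (C1 + C2) * J w)); last first.
      by apply: ler_wpM2r => //; rewrite lerDr.
    rewrite -mulrA mulrDl; apply: norm_lin2_le => //; [exact: hC1|exact: hC2].
rewrite big_cons mulrAC mulrDl mul1r mulrDl; apply: lerD.
  by rewrite mulrC; exact: hB.
rewrite -(normrN (xi 0 i)) -normrM E.
have P0 : 0 <= \prod_(j <- l) (1 + `|xi 0 j|) by apply: prodr_ge0 => j _; rewrite addr_ge0.
have H1 := hB1 _ _ _ _ _ ad xi (a + pi / 2); have H2 := hB2 _ _ _ _ _ ad xi (a + pi / 2).
rewrite -/k1 in H1; rewrite -/k2 in H2.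
move: (\prod_(j <- l) _) (cosT k1 _ _) (cosT k2 _ _) P0 H1 H2 => Pr x y P0 H1 H2.
rewrite -(ger0_norm P0) -normrM mulrDl -!mulrA.
by apply: norm_lin2_le => //; rewrite normrM (ger0_norm P0) mulrC.
Qed.

Lemma enorm_le_prod (xi : V) : 1 + enorm xi <= \prod_(i < d) (1 + `|xi 0 i|).
Proof.
have h2 : dot xi xi <= (\sum_(i < d) `|xi 0 i|) ^+ 2.
  rewrite expr2 mulr_suml; apply: ler_sum => i _; rewrite mulr_sumr (bigD1 i)//= -expr2 -real_normK ?num_real// expr2 lerDl.
  by apply: sumr_ge0 => j _; rewrite mulr_ge0.
have h1 : enorm xi <= \sum_(i < d) `|xi 0 i|.
  apply: (le_trans (ler_wsqrtr h2)); rewrite sqrtr_sqr ger0_norm//.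
  by apply: sumr_ge0.
apply: (le_trans (lerD (lexx 1) h1)).
elim: (index_enum _) => [|i l IH]; first by rewrite !big_nil addr0.
rewrite !big_cons; have P1 : 1 <= \prod_(j <- l) (1 + `|xi 0 j|).
  by elim/big_ind : _ => // [x y x1 y1|j _]; [exact: mulr_ege1|rewrite lerDl].
rewrite mulrDl mul1r addrCA addrC; apply: lerD => //.
by rewrite -[leLHS]mulr1; apply: ler_wpM2l.
Qed.

Lemma J_prod_ge1 (xi : V) : 1 <= (\prod_(i < d) (1 + `|xi 0 i|)) ^+ 2 * J xi.
Proof.
rewrite -prodrXl /J /prodV -big_split /=.
elim/big_ind : _ => // [x y x1 y1|i _]; first exact: mulr_ege1.
rewrite /cauchy1 ler_pdivlMr ?ltr_pwDl ?sqr_ge0// mul1r sqrrD expr1n mul1r real_normK ?num_real//.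
by rewrite -addrA lerD2l lerDr mulrn_wge0.
Qed.

Lemma ker_decay chi M : smooth_supp chi -> 0 <= M -> exists2 B, 0 <= B &
  forall th y1 y2 b e, adm M th y1 y2 b e -> forall (xi : V) a,
   `|cosT (ker chi th y1 y2 b e) xi a| * (1 + enorm xi) <= B * J xi.
Proof.
move=> gc M0; pose l := index_enum 'I_d.
(* Three factors per coordinate: one pays for 1 + |xi|, and two for the reciprocal of J. *)
have [B B0 hB] := ker_cosT (l ++ l ++ l) gc M0.
exists B => // th y1 y2 b e ad xi a.
have := hB _ _ _ _ _ ad xi a; rewrite !big_cat /=.
have := enorm_le_prod xi; have := J_prod_ge1 xi.
have P0 : 0 <= \prod_(i < d) (1 + `|xi 0 i|) by apply: prodr_ge0 => j _; rewrite addr_ge0.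
rewrite -/l in P0 *; move: (\prod_(i <- l) _) P0 (cosT _ _ _) => P P0 x h1 h2 h3.
apply: (@le_trans _ _ (`|x| * P)); first exact: ler_wpM2l.
apply: (@le_trans _ _ (`|x| * P * (P ^+ 2 * J xi))); first by rewrite -[leLHS]mulr1; apply: ler_wpM2l; rewrite ?mulr_ge0.
rewrite mulrA; apply: ler_wpM2r; first exact: J_ge0.
by apply: (le_trans _ h3); rewrite le_eqVlt; apply/orP; left; apply/eqP; ring.
Qed.
End Good.

(** * The matrices A and their inverses *)

From mathcomp Require Import mxtens.

Section TensorDet.
Variables (R : comNzRingType) (d : nat).

(** The tensor product stays triangular: for i < j, either the remainders mod d differ and the
    identity factor vanishes, or the quotients are strictly ordered and A vanishes. The triangular
    case is enough for [det_constant_norm]. *)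
Lemma det_tens_trig (m : nat) (A : 'M[R]_m) : is_trig_mx A ->
  \det (A *t (1%:M : 'M[R]_d)) = (\det A) ^+ d.
Proof.
move=> trA; rewrite det_trig; last first.
  apply/is_trig_mxP => i j ij; rewrite !mxE.
  have [e|ne] := eqVneq (i %% d)%N (j %% d)%N; last first.
    by rewrite -val_eqE /= (negbTE ne) mulr0.
  rewrite (is_trig_mxP trA) ?mul0r//= ltn_neqAle leq_div2r ?(ltnW ij)// andbT.
  apply: contraTN ij => /eqP h.
  by rewrite (divn_eq i d) (divn_eq j d) h e ltnn.
rewrite det_trig// -prodrXl.
rewrite (reindex (@mxtens_index m d)) /=; last first.
  by exists (@mxtens_unindex m d) => k _; [exact: mxtens_indexK|exact: mxtens_unindexK].
rewrite (eq_bigr (fun p => A p.1 p.1)); last first.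
  by move=> [i j] _; rewrite tensmxE mxE eqxx mulr1.
rewrite -(pair_bigA _ (fun i _ => A i i)) /=; apply: eq_bigr => i _.
by rewrite prodr_const card_ord.
Qed.
End TensorDet.

Section Osc.
Variables (R : realType).
Local Notation mR := (measurableTypeR R).

(** All entries of the matrices and their derivatives belong to this family: differentiation lowers
    b by 1 and acts linearly on (u, v). *)
Definition osc (b u v r : R) : R := r `^ b * (u * sin (ln r) + v * cos (ln r)).

Lemma is_derive_osc (b u v r : R) : 0 < r ->
  is_derive r (1 : R) (osc b u v) (osc (b - 1) (b * u - v) (b * v + u) r).
Proof.
move=> r0.
have hln := is_derive1_ln r0.
have hp := is_derive1_powR b r0.
rewrite /osc.
apply: is_derive_eq.
rewrite !scaleR_mul (_ : r `^ b = r `^ (b - 1) * r).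
  by field; rewrite gt_eqF.
rewrite -[X in _ * X](@powRr1 _ r) ?ltW// -powRD ?subrK//.
by apply/implyP => _; rewrite gt_eqF.
Qed.

Lemma osc_le (b u v r : R) : `|osc b u v r| <= (`|u| + `|v|) * r `^ b.
Proof.
rewrite /osc normrM ger0_norm ?powR_ge0// mulrC; apply: ler_wpM2r; first exact: powR_ge0.
apply: (le_trans (ler_normD _ _)); rewrite !normrM; apply: lerD.
  by rewrite -[leRHS]mulr1; apply: ler_wpM2l => //; exact: sin_max.
by rewrite -[leRHS]mulr1; apply: ler_wpM2l => //; exact: cos_max.
Qed.

Lemma measurable_osc b u v : measurable_fun (setT : set mR) (osc b u v).
Proof.
apply: measurable_funM; first exact: mpow.
have ms : measurable_fun (setT : set mR) (fun r : R => sin (ln r)).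
  by apply: (measurableT_comp (continuous_measurable_fun (@continuous_sin R))); exact: measurable_ln.
have mc : measurable_fun (setT : set mR) (fun r : R => cos (ln r)).
  by apply: (measurableT_comp (continuous_measurable_fun (@continuous_cos R))); exact: measurable_ln.
by apply: measurable_funD; apply: measurable_funM.
Qed.

Lemma continuous_osc (b u v r : R) : 0 < r -> {for r, continuous (osc b u v)}.
Proof.
move=> r0; apply: differentiable_continuous; apply/derivable1_diffP.
by have [] := is_derive_osc b u v r0.
Qed.
End Osc.

Lemma near_gt0 (R : realType) (r : R) : 0 < r -> \forall s \near r, 0 < s.
Proof. by move=> r0; apply: (@cvgr_gt _ _ (nbhs r) _ id r) => //; exact: cvg_id. Qed.

Section Coefficients.
Variables (R : realType) (alpha beta : R).
Hypotheses (hal : 0 < alpha) (hab : alpha < beta).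
Let hbe : 0 < beta. Proof. exact: lt_trans hab. Qed.

(* Closed forms of [h1], [h2] and of their derivatives. *)
Definition H1 : R -> R := fun r => alpha^-1 * osc (beta - alpha) beta 1 r.
Definition H2 : R -> R := fun r => alpha^-1 * osc (beta - alpha) (-1) beta r.
Definition DH1 : R -> R := fun r =>
  alpha^-1 * osc (beta - alpha - 1) ((beta - alpha) * beta - 1) ((beta - alpha) * 1 + beta) r.
Definition DH2 : R -> R := fun r =>
  alpha^-1 * osc (beta - alpha - 1) ((beta - alpha) * -1 - beta) ((beta - alpha) * beta + -1) r.

Lemma g1E : g1 beta = osc beta 1 0.
Proof. by apply/funext => r; rewrite /g1 /osc mul1r mul0r addr0. Qed.

Lemma g2E : g2 beta = osc beta 0 1.
Proof. by apply/funext => r; rewrite /g2 /osc mul1r mul0r add0r. Qed.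

Lemma alpha_pow_gt0 (r : R) : 0 < r -> 0 < alpha * r `^ (alpha - 1).
Proof. by move=> r0; rewrite mulr_gt0// powR_gt0. Qed.

Let osc_div u v (r : R) : 0 < r ->
  osc (beta - 1) u v r / (alpha * r `^ (alpha - 1)) = alpha^-1 * osc (beta - alpha) u v r.
Proof.
move=> r0; rewrite /osc (_ : beta - alpha = (beta - 1) - (alpha - 1)); last by ring.
have rn : r != 0 by rewrite gt_eqF.
rewrite [r `^ (_ - (alpha - 1))]powRB ?rn ?implybT//.
by rewrite invfM; ring.
Qed.

Lemma is_derive_g1 (r : R) : 0 < r -> is_derive r (1 : R) (g1 beta) (alpha * r `^ (alpha - 1) * H1 r).
Proof.
move=> r0; rewrite g1E /H1 -osc_div// mulrC divfK ?gt_eqF ?alpha_pow_gt0//.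
have := is_derive_osc beta 1 0 r0.
by rewrite mulr1 mulr0 subr0 add0r.
Qed.

Lemma is_derive_g2 (r : R) : 0 < r -> is_derive r (1 : R) (g2 beta) (alpha * r `^ (alpha - 1) * H2 r).
Proof.
move=> r0; rewrite g2E /H2 -osc_div// mulrC divfK ?gt_eqF ?alpha_pow_gt0//.
have := is_derive_osc beta 0 1 r0.
by rewrite mulr1 mulr0 sub0r addr0.
Qed.

Lemma h1E (r : R) : 0 < r -> h1 alpha beta r = H1 r.
Proof.
move=> r0; rewrite /h1 derive1E (@derive_val _ _ _ _ _ _ _ (is_derive_g1 r0)).
by rewrite mulrC mulKf// gt_eqF// alpha_pow_gt0.
Qed.

Lemma h2E (r : R) : 0 < r -> h2 alpha beta r = H2 r.
Proof.
move=> r0; rewrite /h2 derive1E (@derive_val _ _ _ _ _ _ _ (is_derive_g2 r0)).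
by rewrite mulrC mulKf// gt_eqF// alpha_pow_gt0.
Qed.

Lemma is_derive_H1 (r : R) : 0 < r -> is_derive r (1 : R) H1 (DH1 r).
Proof.
move=> r0; have h := is_derive_osc (beta - alpha) beta 1 r0.
by rewrite /H1 /DH1; apply: is_derive_eq; rewrite !scaleR_mul; ring.
Qed.

Lemma is_derive_H2 (r : R) : 0 < r -> is_derive r (1 : R) H2 (DH2 r).
Proof.
move=> r0; have h := is_derive_osc (beta - alpha) (-1) beta r0.
by rewrite /H2 /DH2; apply: is_derive_eq; rewrite !scaleR_mul; ring.
Qed.

Lemma dh1E (r : R) : 0 < r -> derive1 (h1 alpha beta) r = DH1 r.
Proof.
move=> r0; rewrite derive1E -(@derive_val _ _ _ _ _ _ _ (is_derive_H1 r0)).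
by apply: near_eq_derive; near=> s; apply: h1E; near: s; exact: near_gt0.
Unshelve. all: by end_near. Qed.

Lemma dh2E (r : R) : 0 < r -> derive1 (h2 alpha beta) r = DH2 r.
Proof.
move=> r0; rewrite derive1E -(@derive_val _ _ _ _ _ _ _ (is_derive_H2 r0)).
by apply: near_eq_derive; near=> s; apply: h2E; near: s; exact: near_gt0.
Unshelve. all: by end_near. Qed.

Definition Del (r : R) : R := - (alpha^-1 * r `^ (2 * beta - alpha)).

(** The oscillations cancel through sin^2 + cos^2 = 1, and a power without zeros remains. *)
Lemma detE (r : R) : 0 < r -> g1 beta r * H2 r - g2 beta r * H1 r = Del r.
Proof.
move=> r0; rewrite /g1 /g2 /H1 /H2 /Del /osc.
have rn : r != 0 by rewrite gt_eqF.
rewrite (_ : 2 * beta - alpha = beta + (beta - alpha)); last by ring.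
rewrite (@powRD _ r beta (beta - alpha)) ?rn ?implybT//.
have := cos2Dsin2 (ln r); move: (cos _) (sin _) (r `^ beta) (r `^ (beta - alpha)) => c s p q cs.
transitivity (- (alpha^-1 * p * q * (c ^+ 2 + s ^+ 2))); first by ring.
by rewrite cs; ring.
Qed.

Lemma Del_lt0 (r : R) : 0 < r -> Del r < 0.
Proof. by move=> r0; rewrite oppr_lt0 mulr_gt0 ?invr_gt0// powR_gt0. Qed.

Lemma invmx_Dmat (de : R) : de != 0 -> invmx (Dmat de) = Dmat de^-1.
Proof.
move=> d0; have E : Dmat de *m Dmat de^-1 = 1%:M.
  rewrite /Dmat mulmx_block !mulmx0 !mul0mx !addr0 !add0r mulmx1 -scalar_mxM mulfV//.
  by rewrite -scalar_mx_block.
have [u _] := mulmx1_unit E.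
by rewrite -[LHS]mulmx1 -E mulKmx.
Qed.

Lemma AmatE (de r : R) : de != 0 -> 0 < r -> Amat alpha beta de r =
  block_mx (g1 beta r)%:M (de * g2 beta r)%:M (H1 r / de)%:M (H2 r)%:M.
Proof.
move=> d0 r0; rewrite /Amat invmx_Dmat// /Dmat /Wmat !mulmx_block h1E// h2E//.
rewrite !(mulmx0, mul0mx, addr0, add0r, mulmx1, mul1mx) -!scalar_mxM.
by rewrite -mulrA (mulrC _ de^-1) mulrA mulfV// mul1r.
Qed.

Lemma invAmatE (de r : R) : de != 0 -> 0 < r -> invmx (Amat alpha beta de r) =
  block_mx (H2 r / Del r)%:M (- (de * g2 beta r) / Del r)%:M
           (- (H1 r / de) / Del r)%:M (g1 beta r / Del r)%:M.
Proof.
move=> d0 r0; have De := Del_lt0 r0; have Dn : Del r != 0 by rewrite lt_eqF.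
set X := block_mx _ _ _ _.
have E : Amat alpha beta de r *m X = 1%:M.
  rewrite AmatE// /X mulmx_block -!scalar_mxM -!raddfD /=.
  have dE := detE r0.
  have -> : g1 beta r * (H2 r / Del r) + de * g2 beta r * (- (H1 r / de) / Del r) = 1.
    transitivity ((g1 beta r * H2 r - g2 beta r * H1 r) / Del r); first by field; rewrite ?d0 ?Dn.
    by rewrite dE divff.
  have -> : g1 beta r * (- (de * g2 beta r) / Del r) + de * g2 beta r * (g1 beta r / Del r) = 0.
    by field; rewrite ?Dn.
  have -> : H1 r / de * (H2 r / Del r) + H2 r * (- (H1 r / de) / Del r) = 0.
    by field; rewrite ?d0 ?Dn.
  have -> : H1 r / de * (- (de * g2 beta r) / Del r) + H2 r * (g1 beta r / Del r) = 1.
    transitivity ((g1 beta r * H2 r - g2 beta r * H1 r) / Del r); first by field; rewrite ?d0 ?Dn.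
    by rewrite dE divff.
  by rewrite raddf0 -scalar_mx_block.
have [u _] := mulmx1_unit E.
by rewrite -[LHS]mulmx1 -E mulKmx.
Qed.

(** At r = delta = 1 the logarithm vanishes and the matrix has rows (0, 1) and (1 / alpha, beta /
    alpha); exchanging its columns makes it triangular. The exchange is an involution, so its
    determinant on R^(2d) is a sign, lost in the absolute value, and the kernels only involve
    |c|. *)
Lemma det_constant_norm (d : nat) (c : R) : det_constant (d := d) alpha beta c -> `|c| = alpha ^- d.
Proof.
move=> hc; have := hc 1 1 (oner_neq0 _) ltr01.
rewrite powR1 mulr1 => <-.
rewrite AmatE ?oner_neq0//.
have -> : g1 beta 1 = 0 by rewrite /g1 ln1 sin0 mulr0.
have -> : g2 beta 1 = 1 by rewrite /g2 ln1 cos0 powR1 mulr1.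
have -> : H1 1 = alpha^-1 by rewrite /H1 /osc powR1 ln1 sin0 cos0; ring.
have -> : H2 1 = beta / alpha by rewrite /H2 /osc powR1 ln1 sin0 cos0; ring.
rewrite mulr1 divr1.
pose P : 'M[R]_(1 + 1) := block_mx 0 1%:M 1%:M 0.
have PP : P *m P = 1%:M.
  by rewrite /P mulmx_block !mulmx0 !mul0mx !mulmx1 !addr0 !add0r -scalar_mx_block.
set A : 'M[R]_(1 + 1) := block_mx _ _ _ _.
have AP : A *m P = block_mx 1%:M 0 (beta / alpha)%:M (alpha^-1)%:M.
  by rewrite /A /P mulmx_block !mulmx0 !mulmx1 raddf0 !addr0 !add0r.
have dP : \det (P *t (1%:M : 'M[R]_d)) ^+ 2 = 1.
  by rewrite expr2 -det_mulmx tensmx_mul PP mulmx1 det_tens_trig ?det1 ?expr1n ?scalar_mx_is_trig.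
have hd : \det (A *t (1%:M : 'M[R]_d)) * \det (P *t (1%:M : 'M[R]_d)) = alpha ^- d.
  rewrite -det_mulmx tensmx_mul mulmx1 AP det_tens_trig.
    by rewrite det_lblock det_scalar1 mul1r det_scalar1 exprVn.
  by rewrite is_trig_block_mx// eqxx !scalar_mx_is_trig.
have nP : `|\det (P *t (1%:M : 'M[R]_d))| = 1.
  by apply/eqP; rewrite -(@eqrXn2 _ 2)// -normrX dP normr1 expr1n.
by rewrite -[LHS]mulr1 -[X in _ * X = _]nP -normrM hd gtr0_norm// invr_gt0 exprn_gt0.
Qed.

(** Expanded, the product is the sum of the moduli of the terms in the coefficients of [DH1] and
    [DH2]; it also exceeds beta + 1, the value for [H1] and [H2]. *)
Definition hC : R := alpha^-1 * ((beta + 1) * (beta - alpha + 1)).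

Lemma hC_gt0 : 0 < hC.
Proof.
by rewrite /hC !mulr_gt0 ?invr_gt0// addr_gt0// subr_gt0.
Qed.

Let al0 : `|alpha^-1| = alpha^-1. Proof. by rewrite gtr0_norm// invr_gt0. Qed.

Lemma g1_le (r : R) : `|g1 beta r| <= r `^ beta.
Proof. by rewrite g1E; have := osc_le beta 1 0 r; rewrite normr1 normr0 addr0 mul1r. Qed.

Lemma g2_le (r : R) : `|g2 beta r| <= r `^ beta.
Proof. by rewrite g2E; have := osc_le beta 0 1 r; rewrite normr1 normr0 add0r mul1r. Qed.

Let osc_hC (b u v r : R) : `|u| + `|v| <= (beta + 1) * (beta - alpha + 1) ->
  `|alpha^-1 * osc b u v r| <= hC * r `^ b.
Proof.
move=> h; rewrite normrM al0 /hC -mulrA; apply: ler_wpM2l; first by rewrite invr_ge0 ltW.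
by apply: (le_trans (osc_le _ _ _ _)); apply: ler_wpM2r => //; exact: powR_ge0.
Qed.

Lemma H1_le (r : R) : `|H1 r| <= hC * r `^ (beta - alpha).
Proof. by apply: osc_hC; rewrite normr1 (gtr0_norm hbe); move: hab hbe; nra. Qed.

Lemma H2_le (r : R) : `|H2 r| <= hC * r `^ (beta - alpha).
Proof. by apply: osc_hC; rewrite normrN1 (gtr0_norm hbe); move: hab hbe; nra. Qed.

Lemma DH1_le (r : R) : `|DH1 r| <= hC * r `^ (beta - alpha - 1).
Proof.
apply: osc_hC; have ba : 0 < beta - alpha by rewrite subr_gt0.
apply: (le_trans (lerD (ler_normB _ _) (ler_normD _ _))).
rewrite !normrM normr1 (gtr0_norm hbe) (gtr0_norm ba); nra.
Qed.

Lemma DH2_le (r : R) : `|DH2 r| <= hC * r `^ (beta - alpha - 1).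
Proof.
apply: osc_hC; have ba : 0 < beta - alpha by rewrite subr_gt0.
apply: (le_trans (lerD (ler_normB _ _) (ler_normD _ _))).
rewrite !normrM !normrN1 (gtr0_norm hbe) (gtr0_norm ba); nra.
Qed.

Lemma invDel_le (r : R) : 0 < r -> `|(Del r)^-1| = alpha * r `^ (alpha - 2 * beta).
Proof.
move=> r0; rewrite normfV /Del normrN gtr0_norm; last by rewrite mulr_gt0 ?invr_gt0// powR_gt0.
by rewrite invfM invrK -powRN opprB.
Qed.

Lemma g_Del_le g (r : R) : 0 < r -> `|g| <= r `^ beta -> `|g / Del r| <= alpha * r `^ (alpha - beta).
Proof.
move=> r0 hg; rewrite normrM invDel_le// (_ : alpha - beta = beta + (alpha - 2 * beta)); last by ring.
rewrite (@powRD _ r beta (alpha - 2 * beta)); last by apply/implyP => _; rewrite gt_eqF.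
by rewrite [leRHS]mulrCA; apply: ler_wpM2r => //; rewrite mulr_ge0 ?powR_ge0// ltW.
Qed.
End Coefficients.

Section Kernels.
Variables (R : realType) (d : nat) (alpha beta : R).
Local Notation V := 'rV[R]_d.
Local Notation phase := (R * V * V)%type.
Hypotheses (hal : 0 < alpha) (hab : alpha < beta).

Section Coef.
Variables (th r : R).
(* The entries of [invmx (Amat th r)]. *)
Definition ka : R := H2 alpha beta r / Del alpha beta r.
Definition kb : R := - (th * g2 beta r) / Del alpha beta r.
Definition kc : R := - (H1 alpha beta r / th) / Del alpha beta r.
Definition ke : R := g1 beta r / Del alpha beta r.
End Coef.

Lemma AinvE (r s : R) (y w : V) : s != 0 -> 0 < r ->
  Ainv alpha beta r s y w = col_mx (ka r *: y + kb (s / r `^ alpha) r *: w)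
    (kc (s / r `^ alpha) r *: y + ke r *: w).
Proof.
move=> s0 r0; rewrite /Ainv invAmatE//; last by rewrite mulf_neq0// invr_neq0// gt_eqF// powR_gt0.
by rewrite mul_block_col !mul_scalar_mx.
Qed.

(** A applied to its inverse. It confines y and w on the support of the kernels, where eta and zeta
    lie in unit balls. *)
Lemma ker_coord th r (y w : V) : th != 0 -> 0 < r ->
  let eta := ka r *: y + kb th r *: w in let zeta := kc th r *: y + ke r *: w in
  y = g1 beta r *: eta + (th * g2 beta r) *: zeta /\
  w = (H1 alpha beta r / th) *: eta + H2 alpha beta r *: zeta.
Proof.
move=> th0 r0 eta zeta; rewrite /eta /zeta /ka /kb /kc /ke.
have Dn : Del alpha beta r != 0 by rewrite lt_eqF// Del_lt0.
have dE := detE alpha beta r0; rewrite -dE in Dn *.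
by split; apply/rowP => i; rewrite !mxE; field; rewrite ?th0 ?Dn.
Qed.

End Kernels.

(** * Kernels *)

Lemma lin2_coord_le (R : realType) (d : nat) (p q P Q : R) (u z : 'rV[R]_d) i :
  `|p| <= P -> `|q| <= Q -> `|u 0 i| <= 1 -> `|z 0 i| <= 1 ->
  `|(p *: u + q *: z) 0 i| <= P + Q.
Proof.
move=> hp hq hu hz; rewrite !mxE; apply: (le_trans (ler_normD _ _)); rewrite !normrM.
by rewrite -[P]mulr1 -[Q]mulr1; apply: lerD; apply: ler_pM.
Qed.

Section KernelFormulas.
Variables (R : realType) (d : nat) (alpha beta c : R).
Local Notation V := 'rV[R]_d.
Local Notation phase := (R * V * V)%type.
Hypotheses (hal : 0 < alpha) (hab : alpha < beta).
Variable psi : phase -> R.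
Hypothesis hpsi : test_function psi.

Definition psi_supp := closure [set m : phase | psi m != 0].

Lemma cS : compact psi_supp. Proof. by case: hpsi. Qed.

Lemma S_box m : psi_supp m -> [/\ -2 < m.1.1 < -1, enorm m.1.2 < 1 & enorm m.2 < 1].
Proof. by case: hpsi => _ _ h _ _ /h. Qed.

Lemma smooth_supp_psi : smooth_supp psi_supp psi.
Proof.
split=> [k|m Sm]; first by case: hpsi.
by apply: contrapT => /eqP pm; apply: Sm; exact: subset_closure.
Qed.

Lemma coord_lt1 (w : V) i : enorm w < 1 -> `|w 0 i| <= 1.
Proof. by move=> h; apply/ltW; exact: le_lt_trans (coord_le_enorm w i) h. Qed.

Lemma smooth_supp_th chi th y1 y2 b e : smooth_supp psi_supp chi -> ~~ (-2 < th < -1) -> ker chi th y1 y2 b e = fun=> 0.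
Proof.
move=> [_ z] h; apply/funext => w; apply: z => /S_box[/= h' _ _].
by rewrite h' in h.
Qed.

Section Coef.
Variables (r s : R).
Definition kth : R := s / r `^ alpha.
Definition kb' : R := kb alpha beta kth r.
Definition kc' : R := kc alpha beta kth r.
Definition ka' : R := ka alpha beta r.
Definition ke' : R := ke alpha beta r.
Definition KC : R := `|c|^-1 * r `^ (- hdim (d := d) alpha beta).
(** [A1] and [A2] are the two entries of [Frow] at delta = s / r^alpha. *)
Definition A1 : R := DH1 alpha beta r / kth.
Definition A2 : R := DH2 alpha beta r.
End Coef.

(* [chi] at (th, A_th(r)^-1 (y, w)), where th = s / r^alpha. *)
Definition kk chi (r s : R) (y : V) : V -> R :=
  ker chi (kth r s) (ka' r *: y) (kc' r s *: y) (kb' r s) (ke' r).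

Let kth0 r s : -2 < kth r s < -1 -> kth r s != 0 /\ s != 0.
Proof.
move=> /andP[_ h]; have h0 : kth r s < 0 by apply: lt_trans h _; rewrite oppr_lt0.
split; first by rewrite lt_eqF.
by apply: contraTneq h0 => ->; rewrite /kth mul0r ltxx.
Qed.

Lemma psi_rE r s y w : 0 < r -> psi_r alpha beta psi r (s, y, w) = kk psi r s y w.
Proof.
move=> r0; rewrite /psi_r -/(kth r s); case: ifPn => h; last by rewrite /kk (smooth_supp_th _ _ _ _ smooth_supp_psi h).
have [th0 s0] := kth0 h.
by rewrite AinvE// col_mxKu col_mxKd.
Qed.

(* Minus the i-th component of [vecK]; [dvker] is its i-th derivative in w. *)
Definition vker (i : 'I_d) (r s : R) (y w : V) : R := KC r *
  (A1 r s * kk (fun m => psi m * m.1.2 0 i) r s y w + A2 r * kk (fun m => psi m * m.2 0 i) r s y w).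

Definition kkD chi i (r s : R) (y w : V) : R :=
  kb' r s * kk ('D_((0, delta_mx 0 i, 0) : phase) chi) r s y w +
  ke' r * kk ('D_((0, 0, delta_mx 0 i) : phase) chi) r s y w.

Definition dvker (i : 'I_d) (r s : R) (y w : V) : R := KC r *
  (A1 r s * kkD (fun m => psi m * m.1.2 0 i) i r s y w + A2 r * kkD (fun m => psi m * m.2 0 i) i r s y w).

(** The vector factor of [vecK] is linear in (eta, zeta) = A^-1 (y, w); its coordinates are absorbed
    into the test functions psi eta_i and psi zeta_i, so the estimates for [ker] apply. *)
Lemma vecKE r s y w i : 0 < r -> vecK alpha beta c psi r (s, y, w) 0 i = - vker i r s y w.
Proof.
move=> r0; rewrite /vecK psi_rE// /vker -/(KC r) -/(kth r s).
have [h|h] := boolP (-2 < kth r s < -1); last first.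
  rewrite /kk !(smooth_supp_th _ _ _ _ _ h); [|exact: smooth_supp_coordw smooth_supp_psi|exact: smooth_supp_coordy smooth_supp_psi|exact: smooth_supp_psi].
  by rewrite !mulr0 oppr0 scale0r mxE addr0 mulr0 oppr0.
have [th0 s0] := kth0 h.
rewrite AinvE// /Frow mul_row_col !mul_scalar_mx !mxE dh1E// dh2E//.
rewrite /kk /ker -/(kth r s) /= !mxE /ka' /kb' /kc' /ke' /A1 /A2.
by move: (psi _) (KC r) => p q; ring.
Qed.

Lemma is_derive_kk chi r s y i w : smooth_supp psi_supp chi ->
  is_derive w (delta_mx 0 i) (kk chi r s y) (kkD chi i r s y w).
Proof. by move=> gc; exact: ker_derive gc. Qed.

Lemma is_derive_vker i r s y w : is_derive w (delta_mx 0 i) (vker i r s y) (dvker i r s y w).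
Proof.
have g1 := smooth_supp_coordy i smooth_supp_psi; have g2 := smooth_supp_coordw i smooth_supp_psi.
have h1 := is_derive_kk r s y i w g1; have h2 := is_derive_kk r s y i w g2.
rewrite /vker; apply: is_derive_eq; rewrite !scaleR_mul /dvker; ring.
Qed.

Lemma LkerE r s y w : 0 < r -> Lker alpha beta c psi r (s, y, w) = \sum_i dvker i r s y w.
Proof.
move=> r0; rewrite /Lker /divergence -sumrN; apply: eq_bigr => i _.
rewrite (_ : (fun w' => _) = - vker i r s y); last by apply/funext => w'; rewrite vecKE.
rewrite deriveN; last by have [] := is_derive_vker i r s y w.
by rewrite opprK (@derive_val _ _ _ _ _ _ _ (is_derive_vker i r s y w)).
Qed.

(* On the support of the kernels, r^alpha is between - s / 2 and - s. *)
Lemma pow_range (p s : R) : s < 0 -> exists2 B, 0 <= B &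
  forall r, 0 < r -> -2 < kth r s < -1 -> r `^ p <= B.
Proof.
move=> s0; exists ((- s) `^ (p / alpha) + (- s / 2) `^ (p / alpha)) => [|r r0].
  by rewrite addr_ge0 ?powR_ge0.
rewrite /kth; have ra : 0 < r `^ alpha by rewrite powR_gt0.
rewrite ltr_pdivlMr// ltr_pdivrMr// mulN1r => /andP[h1 h2].
rewrite (_ : p = alpha * (p / alpha)); last by rewrite mulrC divfK// gt_eqF.
rewrite powRrM; set q := (_ / _).
rewrite (_ : alpha * q / alpha = q); last by rewrite mulrAC divff ?mul1r// gt_eqF.
have [q0|q0] := leP 0 q.
  apply: (@le_trans _ _ ((- s) `^ q)); last by rewrite lerDl powR_ge0.
  by apply: ge0_ler_powR => //; rewrite ?nnegrE; lra.
apply: (@le_trans _ _ ((- s / 2) `^ q)); last by rewrite lerDr powR_ge0.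
have -> : q = - (- q) by rewrite opprK.
rewrite !(powRN _ (- q)) lef_pV2 ?posrE ?powR_gt0//; last by lra.
by apply: ge0_ler_powR => //; rewrite ?nnegrE; lra.
Qed.

Definition unif_bound s M := 0 <= M /\ forall r, 0 < r -> -2 < kth r s < -1 ->
  [/\ `|KC r| <= M, `|A1 r s| <= M, `|A2 r| <= M, r `^ (alpha - 1) <= M &
    forall y, adm psi_supp M (kth r s) (ka' r *: y) (kc' r s *: y) (kb' r s) (ke' r) /\
      forall w, psi_supp (kth r s, ka' r *: y + kb' r s *: w, kc' r s *: y + ke' r *: w) ->
        forall i, `|y 0 i| <= M].

Lemma unif_boundP s : s < 0 -> exists M, unif_bound s M.
Proof.
move=> s0.
have [P1 P10 hP1] := pow_range (- hdim (d := d) alpha beta) s0.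
have [P2 P20 hP2] := pow_range (beta - alpha - 1) s0.
have [P3 P30 hP3] := pow_range (alpha - 1) s0.
have [P4 P40 hP4] := pow_range (alpha - beta) s0.
have [P5 P50 hP5] := pow_range beta s0.
have [P6 P60 hP6] := pow_range (beta - alpha) s0.
have hC0 := ltW (hC_gt0 hal hab).
have a0 := ltW hal.
(* One term per clause. The numerical factors come from 1 <= |th| <= 2: [kb] contains th once, y =
   g1 eta + th g2 zeta costs 1 + 2, and w = (H1 / th) eta + H2 zeta costs 1 + 1. *)
pose M := `|c|^-1 * P1 + hC alpha beta * P2 + P3 + 2 * (alpha * P4) + 3 * P5 + 2 * (hC alpha beta * P6).
have c0 : 0 <= `|c|^-1 by rewrite invr_ge0.
have M1 : 0 <= `|c|^-1 * P1 by rewrite mulr_ge0.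
have M2 : 0 <= hC alpha beta * P2 by rewrite mulr_ge0.
have M4 : 0 <= alpha * P4 by rewrite mulr_ge0.
have M6 : 0 <= hC alpha beta * P6 by rewrite mulr_ge0.
have hM1 : `|c|^-1 * P1 <= M.
  by rewrite /M; move: M1 M2 P30 M4 P50 M6; move: (`|c|^-1 * P1) (hC _ _ * P2) (alpha * P4) (hC _ _ * P6) => ? ? ? ?; lra.
have M0 : 0 <= M by apply: le_trans hM1.
have hM2 : hC alpha beta * P2 <= M.
  by rewrite /M; move: M1 M2 P30 M4 P50 M6; move: (`|c|^-1 * P1) (hC _ _ * P2) (alpha * P4) (hC _ _ * P6) => ? ? ? ?; lra.
have hM3 : P3 <= M.
  by rewrite /M; move: M1 M2 P30 M4 P50 M6; move: (`|c|^-1 * P1) (hC _ _ * P2) (alpha * P4) (hC _ _ * P6) => ? ? ? ?; lra.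
have hM4 : 2 * (alpha * P4) <= M.
  by rewrite /M; move: M1 M2 P30 M4 P50 M6; move: (`|c|^-1 * P1) (hC _ _ * P2) (alpha * P4) (hC _ _ * P6) => ? ? ? ?; lra.
have hM5 : 3 * P5 <= M.
  by rewrite /M; move: M1 M2 P30 M4 P50 M6; move: (`|c|^-1 * P1) (hC _ _ * P2) (alpha * P4) (hC _ _ * P6) => ? ? ? ?; lra.
have hM6 : 2 * (hC alpha beta * P6) <= M.
  by rewrite /M; move: M1 M2 P30 M4 P50 M6; move: (`|c|^-1 * P1) (hC _ _ * P2) (alpha * P4) (hC _ _ * P6) => ? ? ? ?; lra.
clearbody M; exists M; split; first exact: M0.
move=> r r0 h; have [th0 s0'] := kth0 h; have /andP[ha hb] := h.
have t1 : 1 <= `|kth r s| by rewrite ltr0_norm; lra.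
have t2 : `|kth r s| <= 2 by rewrite ltr0_norm; lra.
have divth x : `|x / kth r s| <= `|x|.
  by rewrite normrM normfV ler_pdivrMr ?ler_peMr// (lt_le_trans ltr01).
have multh x : `|kth r s * x| <= 2 * `|x| by rewrite normrM ler_wpM2r.
have K1 : r `^ (- hdim (d := d) alpha beta) <= P1 by exact: hP1.
have K2 := hP2 _ r0 h; have K3 := hP3 _ r0 h; have K4 := hP4 _ r0 h; have K5 := hP5 _ r0 h; have K6 := hP6 _ r0 h.
have gb : `|g1 beta r / Del alpha beta r| <= alpha * P4.
  by apply: (le_trans (g_Del_le hal r0 (g1_le _ _))); exact: ler_wpM2l.
have gb2 : `|g2 beta r / Del alpha beta r| <= alpha * P4.
  by apply: (le_trans (g_Del_le hal r0 (g2_le _ _))); exact: ler_wpM2l.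
have H1b : `|H1 alpha beta r| <= hC alpha beta * P6.
  by apply: (le_trans (H1_le hal hab _)); exact: ler_wpM2l.
have H2b : `|H2 alpha beta r| <= hC alpha beta * P6.
  by apply: (le_trans (H2_le hal hab _)); exact: ler_wpM2l.
split.
- rewrite /KC normrM (ger0_norm c0) (ger0_norm (powR_ge0 _ _)); apply: (@le_trans _ _ (`|c|^-1 * P1)) => //.
  exact: ler_wpM2l.
- rewrite /A1; apply: (le_trans (divth _)); apply: (le_trans (DH1_le hal hab _)).
  apply: (@le_trans _ _ (hC alpha beta * P2)) => //.
  exact: ler_wpM2l.
- rewrite /A2; apply: (le_trans (DH2_le hal hab _)).
  apply: (@le_trans _ _ (hC alpha beta * P2)) => //.
  exact: ler_wpM2l.
- exact: le_trans K3 hM3.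
- move=> y; split; first split.
  + rewrite /kb' /kb mulNr normrN -mulrA; apply: (le_trans (multh _)); lra.
  + rewrite /ke' /ke; apply: (le_trans gb); lra.
  + move=> w Sw i; have [/= _ he hz] := S_box Sw.
    have [_ ->] := @ker_coord R d alpha beta hal (kth r s) r y w th0 r0.
    apply: (@le_trans _ _ (hC alpha beta * P6 + hC alpha beta * P6)); last by lra.
    by apply: lin2_coord_le; [exact: le_trans (divth _) H1b|exact: H2b|exact: coord_lt1 he|exact: coord_lt1 hz].
  + move=> w Sw i; have [/= _ he hz] := S_box Sw.
    have [-> _] := @ker_coord R d alpha beta hal (kth r s) r y w th0 r0.
    apply: (@le_trans _ _ (P5 + 2 * P5)); last by lra.
    apply: lin2_coord_le; [exact: le_trans (g1_le _ _) K5| |exact: coord_lt1 he|exact: coord_lt1 hz].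
    by apply: (le_trans (multh _)); apply: ler_wpM2l => //; exact: le_trans (g2_le _ _) K5.
Qed.
End KernelFormulas.

(** * Bounds and Fourier decay of the kernels, uniform in r at fixed time *)

Section BoundedDecay.
Variables (R : realType) (d : nat).
Local Notation V := 'rV[R]_d.
Implicit Types F G : V -> R.

Definition bnd F (B : R) := forall w, `|F w| <= B * J w.
Definition dec F (B : R) := forall xi a, `|cosT F xi a| * (1 + enorm xi) <= B * J xi.

Lemma bnd_le F B B' : B <= B' -> bnd F B -> bnd F B'.
Proof. by move=> BB h w; apply: (le_trans (h w)); apply: ler_wpM2r => //; exact: J_ge0. Qed.

Lemma dec_le F B B' : B <= B' -> dec F B -> dec F B'.
Proof. by move=> BB h xi a; apply: (le_trans (h xi a)); apply: ler_wpM2r => //; exact: J_ge0. Qed.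

Lemma bnd_integrable F B : mRd F -> bnd F B -> integrableRd F.
Proof. by move=> mF h; exact: (integrableRd_le mF (L1Zl B (@integrable_J R d)) h). Qed.

Lemma bnd_lin2 F G M p q B1 B2 : `|p| <= M -> `|q| <= M -> bnd F B1 -> bnd G B2 ->
  bnd (fun w => p * F w + q * G w) (M * (B1 + B2)).
Proof.
by move=> hp hq h1 h2 w; rewrite -mulrA mulrDl; apply: norm_lin2_le.
Qed.

Lemma bnd_scale F M p B : `|p| <= M -> bnd F B -> bnd (fun w => p * F w) (M * B).
Proof. by move=> hp h w; rewrite normrM -mulrA; apply: ler_pM => //; exact: h. Qed.

Lemma cosT_lin2 F G p q xi a : integrableRd F -> integrableRd G ->
  cosT (fun w => p * F w + q * G w) xi a = p * cosT F xi a + q * cosT G xi a.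
Proof.
move=> iF iG; have cF := integrable_cosT xi a iF; have cG := integrable_cosT xi a iG.
rewrite /cosT !intRdE -(I_Zl p cF) -(I_Zl q cG) -I_D; [|exact: L1Zl cF|exact: L1Zl cG].
by apply: eq_I => t /=; ring.
Qed.

Lemma cosT_scale F p xi a : integrableRd F -> cosT (fun w => p * F w) xi a = p * cosT F xi a.
Proof.
move=> iF; have cF := integrable_cosT xi a iF.
by rewrite /cosT !intRdE -(I_Zl p cF); apply: eq_I => t /=; ring.
Qed.

Lemma cosT_0 (xi : V) a : cosT (fun=> 0) xi a = 0.
Proof. by rewrite /cosT intRdE -[RHS](@I_0 _ _ _ (@lebesgue_tuple R d)); apply: eq_I => t /=; rewrite mul0r. Qed.

Let e0 (xi : V) : 0 <= 1 + enorm xi. Proof. by rewrite addr_ge0 ?enorm_ge0. Qed.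

Lemma dec_lin2 F G M p q B1 B2 : integrableRd F -> integrableRd G ->
  `|p| <= M -> `|q| <= M -> dec F B1 -> dec G B2 ->
  dec (fun w => p * F w + q * G w) (M * (B1 + B2)).
Proof.
move=> iF iG hp hq h1 h2 xi a; rewrite cosT_lin2//.
rewrite -[X in _ * X](ger0_norm (e0 xi)) -normrM mulrDl -!mulrA mulrDl.
by apply: norm_lin2_le => //; rewrite normrM (ger0_norm (e0 xi)).
Qed.

Lemma dec_scale F M p B : integrableRd F -> `|p| <= M -> dec F B -> dec (fun w => p * F w) (M * B).
Proof.
move=> iF hp h xi a; rewrite cosT_scale// normrM -!mulrA; apply: ler_pM => //.
by rewrite mulr_ge0.
Qed.

Lemma bnd0 B : 0 <= B -> bnd (fun=> 0) B.
Proof. by move=> B0 w; rewrite normr0 mulr_ge0// J_ge0. Qed.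

Lemma dec0 B : 0 <= B -> dec (fun=> 0) B.
Proof. by move=> B0 xi a; rewrite cosT_0 normr0 mul0r mulr_ge0// J_ge0. Qed.

Lemma dec_fdom (sigma : R) F B : 0 < sigma < 1 -> dec F B -> fdom sigma F (fun xi => B * J xi).
Proof.
move=> /andP[s0 s1] h xi a; apply: (le_trans _ (h xi a)); rewrite mulrC; apply: ler_wpM2l => //.
have [e1|e1] := leP (enorm xi) 1.
  apply: (@le_trans _ _ 1); last by rewrite lerDl enorm_ge0.
  have <- : 1 `^ sigma = 1 :> R by rewrite powR1.
  by apply: ge0_ler_powR => //; rewrite ?nnegrE ?enorm_ge0// ltW.
apply: (@le_trans _ _ (enorm xi)); last by rewrite lerDr.
rewrite -[leRHS](powRr1 (enorm_ge0 xi)); apply: ler_powR; exact: ltW.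
Qed.

Lemma exists_unif_ord (P : 'I_d -> R -> Prop) : (forall i, exists2 B, 0 <= B & P i B) ->
  (forall i B B', B <= B' -> P i B -> P i B') -> exists2 B, 0 <= B & forall i, P i B.
Proof.
move=> h mono; have [f hf] := choice (fun i => let: ex_intro2 B b0 bP := h i in ex_intro (fun B => 0 <= B /\ P i B) B (conj b0 bP)).
exists (\sum_i f i) => [|i]; first by apply: sumr_ge0 => i _; have [] := hf i.
apply: (mono _ (f i)); last by have [] := hf i.
by rewrite (bigD1 i)//= lerDl; apply: sumr_ge0 => j _; have [] := hf j.
Qed.
End BoundedDecay.

Section KernelBounds.
Variables (R : realType) (d : nat) (alpha beta c : R).
Local Notation V := 'rV[R]_d.
Local Notation phase := (R * V * V)%type.
Hypotheses (hal : 0 < alpha) (hab : alpha < beta).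
Variable psi : phase -> R.
Hypothesis hpsi : test_function psi.
Variable s : R.
Hypothesis s0 : s < 0.
Local Notation kk := (kk alpha beta).
Local Notation kth := (kth alpha).
Local Notation S := (psi_supp psi).
Local Notation KK i r y := (vker alpha beta c psi i r s y).
Local Notation DKK i r y := (dvker alpha beta c psi i r s y).

Lemma kk_out chi r y : smooth_supp S chi -> ~~ (-2 < kth r s < -1) -> kk chi r s y = fun=> 0.
Proof. by move=> gc h; rewrite /kk (smooth_supp_th hpsi _ _ _ _ gc h). Qed.

Lemma kk_cont chi r y : smooth_supp S chi -> continuous (kk chi r s y).
Proof. by move=> gc; exact: ker_cont gc. Qed.

(** The factor [J y] costs only a constant: either the kernel vanishes identically in w, or y lies
    in a fixed box, where J is bounded below. *)
Lemma kk_bound chi : smooth_supp S chi -> exists2 B, 0 <= B &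
  forall r y, 0 < r -> bnd (kk chi r s y) (B * J y) /\ dec (kk chi r s y) (B * J y).
Proof.
move=> gc; have [M [M0 hM]] := unif_boundP c hal hab hpsi s0.
have [B B0 hB] := ker_bound (cS hpsi) gc M0; have [B' B'0 hB'] := ker_decay (cS hpsi) gc M0.
pose D := (1 + M ^+ 2) ^+ d; have D0 : 0 <= D by rewrite exprn_ge0// addr_ge0// sqr_ge0.
exists ((B + B') * D) => [|r y r0]; first by rewrite mulr_ge0// addr_ge0.
have Z0 : 0 <= (B + B') * D * J y by rewrite mulr_ge0 ?J_ge0// mulr_ge0// addr_ge0.
have [h|h] := boolP (-2 < kth r s < -1); last first.
  by rewrite (kk_out _ gc h); split; [exact: bnd0|exact: dec0].
have [_ _ _ _ /(_ y)[ad hy]] := hM r r0 h.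
have [[w Sw]|nS] := pselect (exists w, S (kth r s, ka' alpha beta r *: y + kb' alpha beta r s *: w,
    kc' alpha beta r s *: y + ke' alpha beta r *: w)); last first.
  rewrite (_ : kk chi r s y = fun=> 0); first by split; [exact: bnd0|exact: dec0].
  by apply/funext => w; apply: gc.2 => Sw; apply: nS; exists w.
have Jy : 1 <= D * J y by apply: J_ge_box => //; exact: hy Sw.
split.
  apply: (@bnd_le _ _ _ B); last exact: hB.
  by rewrite -mulrA -[leLHS]mulr1; apply: ler_pM => //; rewrite lerDl.
apply: (@dec_le _ _ _ B'); last exact: hB'.
by rewrite -mulrA -[leLHS]mulr1; apply: ler_pM => //; rewrite lerDr.
Qed.

Lemma vker_out i r y : ~~ (-2 < kth r s < -1) -> KK i r y = fun=> 0.
Proof.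
move=> h; apply/funext => w; rewrite /vker !kk_out ?mulr0 ?addr0 ?mulr0//.
  exact: smooth_supp_coordw (smooth_supp_psi hpsi).
exact: smooth_supp_coordy (smooth_supp_psi hpsi).
Qed.

Lemma kkD_out chi i r y : smooth_supp S chi -> ~~ (-2 < kth r s < -1) ->
  kkD alpha beta chi i r s y = fun=> 0.
Proof.
move=> gc h; apply/funext => w; rewrite /kkD.
rewrite (kk_out y (smooth_supp_D (cS hpsi) _ gc) h) (kk_out y (smooth_supp_D (cS hpsi) _ gc) h).
by rewrite !mulr0 addr0.
Qed.

Lemma dvker_out i r y : ~~ (-2 < kth r s < -1) -> DKK i r y = fun=> 0.
Proof.
move=> h; apply/funext => w.
have E1 := kkD_out i y (smooth_supp_coordy i (smooth_supp_psi hpsi)) h.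
have E2 := kkD_out i y (smooth_supp_coordw i (smooth_supp_psi hpsi)) h.
by rewrite /dvker E1 E2 !mulr0 addr0 mulr0.
Qed.

Lemma vker_cont i r y : continuous (KK i r y).
Proof.
have h := @continuous_lin2 R V _ _ (A1 alpha beta r s) (A2 alpha beta r)
  (@kk_cont _ r y (smooth_supp_coordy i (smooth_supp_psi hpsi))) (@kk_cont _ r y (smooth_supp_coordw i (smooth_supp_psi hpsi))).
exact: (@continuous_scale R V _ (KC d alpha beta c r) h).
Qed.

Lemma kkD_cont chi i r y : smooth_supp S chi -> continuous (kkD alpha beta chi i r s y).
Proof.
move=> gc; have h1 := @kk_cont _ r y (smooth_supp_D (cS hpsi) ((0, delta_mx 0 i, 0) : phase) gc).
have h2 := @kk_cont _ r y (smooth_supp_D (cS hpsi) ((0, 0, delta_mx 0 i) : phase) gc).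
exact: (@continuous_lin2 R V _ _ (kb' alpha beta r s) (ke' alpha beta r) h1 h2).
Qed.

Lemma dvker_cont i r y : continuous (DKK i r y).
Proof.
have h := @continuous_lin2 R V _ _ (A1 alpha beta r s) (A2 alpha beta r)
  (@kkD_cont _ i r y (smooth_supp_coordy i (smooth_supp_psi hpsi))) (@kkD_cont _ i r y (smooth_supp_coordw i (smooth_supp_psi hpsi))).
exact: (@continuous_scale R V _ (KC d alpha beta c r) h).
Qed.

Lemma kkD_bound chi i : smooth_supp S chi -> exists2 B, 0 <= B &
  forall r y, 0 < r -> -2 < kth r s < -1 -> bnd (kkD alpha beta chi i r s y) (B * J y).
Proof.
move=> gc; have [M [M0 hM]] := unif_boundP c hal hab hpsi s0.
have [B1 B10 h1] := kk_bound (smooth_supp_D (cS hpsi) ((0, delta_mx 0 i, 0) : phase) gc).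
have [B2 B20 h2] := kk_bound (smooth_supp_D (cS hpsi) ((0, 0, delta_mx 0 i) : phase) gc).
exists (M * (B1 + B2)) => [|r y r0 h]; first by rewrite mulr_ge0// addr_ge0.
have [_ _ _ _ /(_ y)[[hb he _] hy]] := hM r r0 h.
rewrite -mulrA mulrDl; apply: bnd_lin2 => //.
  by have [] := h1 r y r0.
by have [] := h2 r y r0.
Qed.

Lemma vker_bound : exists2 B, 0 <= B & forall i r y, 0 < r ->
  [/\ bnd (KK i r y) (B * J y), bnd (DKK i r y) (B * J y) & dec (KK i r y) (B * J y)].
Proof.
have [M [M0 hM]] := unif_boundP c hal hab hpsi s0.
apply: exists_unif_ord => [i|i B B' BB h r y r0]; last first.
  have [h1 h2 h3] := h r y r0; have BJ : B * J y <= B' * J y by apply: ler_wpM2r => //; exact: J_ge0.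
  by split; [exact: bnd_le h1|exact: bnd_le h2|exact: dec_le h3].
have gy := smooth_supp_coordy i (smooth_supp_psi hpsi); have gw := smooth_supp_coordw i (smooth_supp_psi hpsi).
have [B1 B10 h1] := kk_bound gy; have [B2 B20 h2] := kk_bound gw.
have [B3 B30 h3] := kkD_bound i gy; have [B4 B40 h4] := kkD_bound i gw.
exists (M * (M * (B1 + B2 + B3 + B4))) => [|r y r0]; first by rewrite !mulr_ge0// !addr_ge0.
have Z0 : 0 <= M * (M * (B1 + B2 + B3 + B4)) * J y by rewrite mulr_ge0 ?J_ge0// !mulr_ge0// !addr_ge0.
have [h|h] := boolP (-2 < kth r s < -1); last first.
  by rewrite vker_out// dvker_out//; split; [exact: bnd0|exact: bnd0|exact: dec0].
have [hK hA1 hA2 _ _] := hM r r0 h.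
have [b1 d1] := h1 r y r0; have [b2 d2] := h2 r y r0.
have b3 := h3 r y r0 h; have b4 := h4 r y r0 h.
have i1 : integrableRd (kk (fun m : phase => psi m * m.1.2 0 i) r s y).
  by apply: (bnd_integrable _ b1); apply: continuous_mRd; exact: kk_cont.
have i2 : integrableRd (kk (fun m : phase => psi m * m.2 0 i) r s y).
  by apply: (bnd_integrable _ b2); apply: continuous_mRd; exact: kk_cont.
have i12 := bnd_integrable _ (bnd_lin2 hA1 hA2 b1 b2).
have ic : mRd (fun w => A1 alpha beta r s * kk (fun m : phase => psi m * m.1.2 0 i) r s y w +
    A2 alpha beta r * kk (fun m : phase => psi m * m.2 0 i) r s y w).
  by apply: measurable_funD; apply: measurable_funM => //; apply: integrableRd_meas.
have le1 : M * (M * (B1 * J y + B2 * J y)) <= M * (M * (B1 + B2 + B3 + B4)) * J y.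
  rewrite -mulrDl !mulrA; apply: ler_wpM2r; first exact: J_ge0.
  by apply: ler_wpM2l; rewrite ?mulr_ge0// -addrA lerDl addr_ge0.
have le2 : M * (M * (B3 * J y + B4 * J y)) <= M * (M * (B1 + B2 + B3 + B4)) * J y.
  rewrite -mulrDl !mulrA; apply: ler_wpM2r; first exact: J_ge0.
  by apply: ler_wpM2l; rewrite ?mulr_ge0// -addrA lerDr addr_ge0.
split.
- by apply: (bnd_le le1); apply: bnd_scale => //; exact: bnd_lin2.
- by apply: (bnd_le le2); apply: bnd_scale => //; exact: bnd_lin2.
- by apply: (dec_le le1); apply: dec_scale => //; [exact: i12|exact: dec_lin2].
Qed.
End KernelBounds.

Section Translation.
Variables (R : realType) (d : nat).
Local Notation V := 'rV[R]_d.

Lemma dotDl (u v w : V) : dot (u + v) w = dot u w + dot v w.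
Proof. by rewrite /dot -big_split /=; apply: eq_bigr => i _; rewrite !mxE mulrDl. Qed.

Lemma cosT_translate (g : V -> R) v xi a : integrableRd g ->
  cosT (fun w => g (v + w)) xi a = cosT g xi (a + dot v xi).
Proof.
move=> ig; have iG := integrable_cosT xi (a + dot v xi) ig.
have [_ E] := intRd_translate v iG; rewrite /cosT -[RHS]E; congr intRd; apply/funext => w.
by rewrite dotDl; congr (_ * cos _); ring.
Qed.

Lemma fourier_mult_translate s (g : V -> R) v u : integrableRd g ->
  fourier_mult s (fun w => g (v + w)) u = fourier_mult s g (v + u).
Proof.
move=> ig; have [ig' _] := intRd_translate v ig.
rewrite (fourier_multE _ _ ig') (fourier_multE _ _ ig); congr (_ * intRd _); apply/funext => xi.
by rewrite /fmult_kernel cosT_translate// dotDl addrC [dot v xi + _]addrC.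
Qed.

Lemma fourier_mult0 s (u : V) : fourier_mult s (fun=> 0) u = 0.
Proof.
rewrite fourier_multE; last exact: L1_0.
rewrite (_ : fmult_kernel _ _ _ = fun=> 0) ?intRdE ?I_0 ?mulr0//.
by apply/funext => xi; rewrite /fmult_kernel cosT_0 mulr0.
Qed.

Lemma enorm_le_sum (w : V) : enorm w <= \sum_i `|w 0 i|.
Proof.
have h2 : dot w w <= (\sum_(i < d) `|w 0 i|) ^+ 2.
  rewrite expr2 mulr_suml; apply: ler_sum => i _; rewrite mulr_sumr (bigD1 i)//= -expr2 -real_normK ?num_real// expr2 lerDl.
  by apply: sumr_ge0 => j _; rewrite mulr_ge0.
apply: (le_trans (ler_wsqrtr h2)); rewrite sqrtr_sqr ger0_norm//.
exact: sumr_ge0.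
Qed.

Lemma enorm_le_bound M (w : V) : (forall i, `|w 0 i| <= M) -> enorm w <= d%:R * M.
Proof.
move=> h; apply: (le_trans (enorm_le_sum w)).
apply: (@le_trans _ _ (\sum_(i < d) M)); first by apply: ler_sum => i _; exact: h.
by rewrite sumr_const card_ord mulr_natl.
Qed.
End Translation.

Section BoxBound.
Variables (R : realType) (d : nat).
Local Notation V := 'rV[R]_d.
Local Notation phase := (R * V * V)%type.

Lemma compact_cube (M : R) : compact [set w : V | forall i, `|w 0 i| <= M].
Proof.
have -> : [set w : V | forall i, `|w 0 i| <= M] = [set w : V | forall i, `[- M, M]%classic (w ord0 i)].
  by apply/seteqP; split=> w h i; have := h i; rewrite /= in_itv/= ler_norml.
by apply: (@rV_compact _ _ (fun=> `[- M, M]%classic)) => i; exact: segment_compact.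
Qed.

Lemma box_bounded (q : phase -> R) M : continuous q -> exists2 B, 0 <= B & forall t (y w : V),
  `|t| <= M -> (forall i, `|y 0 i| <= M) -> (forall i, `|w 0 i| <= M) -> `|q (t, y, w)| <= B.
Proof.
move=> cq; pose A : set phase := (`[- M, M]%classic `*` [set w : V | forall i, `|w 0 i| <= M]) `*` [set w : V | forall i, `|w 0 i| <= M].
have cA : compact A.
  apply: compact_setX; last exact: compact_cube.
  by apply: compact_setX; [exact: segment_compact|exact: compact_cube].
have : compact (q @` A) by apply: continuous_compact => //; exact: continuous_subspaceT.
move=> /compact_bounded[N [_ hN]].
exists (`|N| + 1) => [|t y w ht hy hw]; first by rewrite addr_ge0.
apply: hN; first by rewrite ltr_pwDr// ler_norm.
by exists (t, y, w) => //; split=> //; split=> //=; rewrite in_itv/= -ler_norml.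
Qed.
End BoxBound.

Section SwapRZ.
Variables (R : realType) (n : nat).
Local Notation mR := (measurableTypeR R).
Local Notation leb := (@lebesgue_measure R).
Local Notation lebn := (@lebesgue_tuple R n).
Local Notation sq := (@lebesgue_square R n).
Local Notation Z := (n.-tuple mR * n.-tuple mR)%type.
Variables (F : mR -> Z -> R) (h : mR -> R).
Hypothesis mF : measurable_fun setT (fun u : mR * Z => F u.1 u.2).
Hypothesis iF : forall r t, L1 lebn (fun q => F r (t, q)).
Hypothesis bF : forall r t, I lebn (fun q => `|F r (t, q)|) <= h r * J (rowt t).
Hypothesis ih : L1 leb h.

Lemma swap_measurable r : measurable_fun setT (F r).
Proof. exact: (measurableT_comp mF (measurable_pair1 r)). Qed.

Lemma swap_L1z r : L1 sq (F r).
Proof.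
have h1 : L1 (lebn \x lebn)%E (fun u : Z => F r (u.1, u.2)).
  apply: (L1_iter (F := fun t q => F r (t, q)) (H := fun t => h r * J (rowt t))) => //.
  - apply: (measurableT_comp (swap_measurable r)); apply: measurable_fun_pair; [exact: measurable_fst|exact: measurable_snd].
  - by apply: L1Zl; exact: integrable_J.
by apply: (eq_L1 _ h1) => -[].
Qed.

Lemma swap_iter r : I sq (F r) = I lebn (fun t => I lebn (fun q => F r (t, q))).
Proof.
have h1 : L1 (lebn \x lebn)%E (fun u : Z => F r (u.1, u.2)) by apply: (eq_L1 _ (swap_L1z r)) => -[].
by rewrite -(I_prod h1); apply: eq_I => -[].
Qed.

(** The last variable is controlled by an L^1 bound and not by a pointwise majorant, since
    integrability in w of the Riesz potential is known only in that form. *)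
Lemma swap_L1 : L1 (leb \x sq)%E (fun u => F u.1 u.2).
Proof.
apply: (L1_iter (F := F) (H := fun r => h r * I lebn (fun t => J (rowt t)))) => //.
- by apply: L1Zr.
- exact: swap_L1z.
- move=> r.
  have h2 : L1 (lebn \x lebn)%E (fun u : Z => `|F r (u.1, u.2)|).
    by apply: (eq_L1 _ (L1_norm (swap_L1z r))) => -[].
  have -> : I sq (fun y => `|F r y|) = I lebn (fun t => I lebn (fun q => `|F r (t, q)|)).
    by rewrite -(I_prod h2); apply: eq_I => -[].
  rewrite -I_Zl; last exact: integrable_J.
  apply: I_le; last exact: bF.
  + exact: (L1_I2 (F := fun t q => `|F r (t, q)|) h2).
  + by apply: L1Zl; exact: integrable_J.
Qed.

Lemma swap_I : I sq (fun z => I leb (F^~ z)) = I leb (fun r => I sq (F r)).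
Proof. exact/esym/(I_swap swap_L1). Qed.

Lemma swap_L1_I2 : L1 sq (fun z => I leb (F^~ z)).
Proof. exact: (L1_I2 (F := fun z r => F r z) (L1_swap swap_L1)). Qed.
End SwapRZ.

Section Indicator.
Variables (R : realType) (tau : R).
Local Notation mR := (measurableTypeR R).
Local Notation leb := (@lebesgue_measure R).

(** Integrals over ]0, tau[ are written on the whole line with this weight, so that measurability
    and Fubini need no restricted domain. *)
Definition ind (r : R) : R := \1_(`]0, tau[%classic) r.

Lemma ind_in r : ind r != 0 -> 0 < r < tau.
Proof.
rewrite /ind indicE; have [|_] := boolP (r \in _); last by rewrite eqxx.
by rewrite inE /= in_itv.
Qed.

Lemma ind_case r : ind r = 0 \/ (ind r = 1 /\ 0 < r < tau).
Proof.
have [->|h] := eqVneq (ind r) 0; [by left|right]; split; last exact: ind_in.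
by move: h; rewrite /ind indicE; case: (_ \in _); rewrite ?eqxx.
Qed.

Lemma ind01 r : 0 <= ind r <= 1.
Proof. by have [->|[-> _]] := ind_case r; rewrite ?lexx ler01. Qed.

Lemma measurable_ind : measurable_fun (setT : set mR) ind.
Proof. exact: measurable_indic. Qed.

Lemma L1_ind : 0 < tau -> L1 leb ind.
Proof.
move=> t0; apply: (L1_le measurable_ind (L1_pow0 (@ltr01 R) t0)) => r.
have [->|[-> /andP[r0 rt]]] := ind_case r.
  by rewrite normr0 mulr_ge0 ?powR_ge0// indicE.
by rewrite normr1 subrr powRr0 mul1r indicE mem_set//= in_itv/= r0 ltW.
Qed.

Lemma Rint_ind (G : R -> R) : \int[leb]_(r in `]0, tau[) G r = I leb (fun r => ind r * G r).
Proof.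
rewrite Rintegral_mkcond /I; congr Rintegral; apply/funext => r.
by rewrite /patch /ind indicE; case: ifP => _; rewrite ?mul1r ?mul0r.
Qed.
End Indicator.

Section KernelMeasurable.
Context {R : realType} {d : nat} dT (T : measurableType dT).
Variables (alpha beta : R).
Local Notation V := 'rV[R]_d.
Local Notation phase := (R * V * V)%type.
Variables (r s : T -> R).
Hypotheses (mr : measurable_fun setT r) (ms : measurable_fun setT s).

Lemma measurable_div (f g : T -> R) : measurable_fun setT f -> measurable_fun setT g ->
  measurable_fun setT (fun x => f x / g x).
Proof. by move=> mf mg; apply: measurable_funM => //; exact: (measurableT_comp (@measurable_inv R)). Qed.

Lemma measurable_oscT b u v : measurable_fun setT (fun x => osc b u v (r x)).
Proof. exact: (measurableT_comp (@measurable_osc R b u v)). Qed.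

Lemma measurable_kth : measurable_fun setT (fun x => kth alpha (r x) (s x)).
Proof. by apply: measurable_div => //; exact: measurable_powR_base. Qed.

Lemma measurable_g1 : measurable_fun setT (fun x => g1 beta (r x)).
Proof. by rewrite g1E; exact: measurable_oscT. Qed.

Lemma measurable_g2 : measurable_fun setT (fun x => g2 beta (r x)).
Proof. by rewrite g2E; exact: measurable_oscT. Qed.

Lemma measurable_H1 : measurable_fun setT (fun x => H1 alpha beta (r x)).
Proof. by apply: measurable_funM => //; exact: measurable_oscT. Qed.

Lemma measurable_H2 : measurable_fun setT (fun x => H2 alpha beta (r x)).
Proof. by apply: measurable_funM => //; exact: measurable_oscT. Qed.

Lemma measurable_DH1 : measurable_fun setT (fun x => DH1 alpha beta (r x)).
Proof. by apply: measurable_funM => //; exact: measurable_oscT. Qed.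

Lemma measurable_DH2 : measurable_fun setT (fun x => DH2 alpha beta (r x)).
Proof. by apply: measurable_funM => //; exact: measurable_oscT. Qed.

Lemma measurable_Del : measurable_fun setT (fun x => Del alpha beta (r x)).
Proof.
rewrite (_ : (fun x => _) = fun x => - alpha^-1 * r x `^ (2 * beta - alpha)); last first.
  by apply/funext => x; rewrite /Del mulNr.
by apply: measurable_funM => //; exact: measurable_powR_base.
Qed.

Lemma measurable_ka' : measurable_fun setT (fun x => ka' alpha beta (r x)).
Proof. by apply: measurable_div; [exact: measurable_H2|exact: measurable_Del]. Qed.

Lemma measurable_ke' : measurable_fun setT (fun x => ke' alpha beta (r x)).
Proof. by apply: measurable_div; [exact: measurable_g1|exact: measurable_Del]. Qed.

Lemma measurable_kb' : measurable_fun setT (fun x => kb' alpha beta (r x) (s x)).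
Proof.
apply: measurable_div; last exact: measurable_Del.
by apply: measurableT_comp => //; apply: measurable_funM; [exact: measurable_kth|exact: measurable_g2].
Qed.

Lemma measurable_kc' : measurable_fun setT (fun x => kc' alpha beta (r x) (s x)).
Proof.
apply: measurable_div; last exact: measurable_Del.
by apply: measurableT_comp => //; apply: measurable_div; [exact: measurable_H1|exact: measurable_kth].
Qed.

Lemma measurable_kk (chi : phase -> R) (y w : T -> V) : continuous chi -> mvec y -> mvec w ->
  measurable_fun setT (fun x => kk alpha beta chi (r x) (s x) (y x) (w x)).
Proof.
move=> cc my mw; rewrite /kk /ker; apply: continuous_mphase => //.
- exact: measurable_kth.
- by apply: mvecD; apply: mvecZ => //; [exact: measurable_ka'|exact: measurable_kb'].
- by apply: mvecD; apply: mvecZ => //; [exact: measurable_kc'|exact: measurable_ke'].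
Qed.

Lemma measurable_KC c : measurable_fun setT (fun x => KC d alpha beta c (r x)).
Proof. by apply: measurable_funM => //; exact: measurable_powR_base. Qed.

Lemma measurable_A1 : measurable_fun setT (fun x => A1 alpha beta (r x) (s x)).
Proof. by apply: measurable_div; [exact: measurable_DH1|exact: measurable_kth]. Qed.

Lemma measurable_vker c psi i (y w : T -> V) : test_function psi -> mvec y -> mvec w ->
  measurable_fun setT (fun x => vker alpha beta c psi i (r x) (s x) (y x) (w x)).
Proof.
move=> hp my mw; have gp := smooth_supp_psi hp.
apply: measurable_funM; first exact: measurable_KC.
apply: measurable_funD; apply: measurable_funM.
- exact: measurable_A1.
- by apply: measurable_kk => //; exact: smooth_supp_cont (smooth_supp_coordy i gp).
- exact: measurable_DH2.
- by apply: measurable_kk => //; exact: smooth_supp_cont (smooth_supp_coordw i gp).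
Qed.

Lemma measurable_kkD (S : set phase) chi i (y w : T -> V) : compact S -> smooth_supp S chi -> mvec y -> mvec w ->
  measurable_fun setT (fun x => kkD alpha beta chi i (r x) (s x) (y x) (w x)).
Proof.
move=> cS gc my mw; apply: measurable_funD; apply: measurable_funM.
- exact: measurable_kb'.
- by apply: measurable_kk => //; exact: smooth_supp_cont (smooth_supp_D cS _ gc).
- exact: measurable_ke'.
- by apply: measurable_kk => //; exact: smooth_supp_cont (smooth_supp_D cS _ gc).
Qed.

Lemma measurable_dvker c psi i (y w : T -> V) : test_function psi -> mvec y -> mvec w ->
  measurable_fun setT (fun x => dvker alpha beta c psi i (r x) (s x) (y x) (w x)).
Proof.
move=> hp my mw; have gp := smooth_supp_psi hp.
apply: measurable_funM; first exact: measurable_KC.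
apply: measurable_funD; apply: measurable_funM.
- exact: measurable_A1.
- by apply: (measurable_kkD i (cS hp)) => //; exact: smooth_supp_coordy.
- exact: measurable_DH2.
- by apply: (measurable_kkD i (cS hp)) => //; exact: smooth_supp_coordw.
Qed.
End KernelMeasurable.

(** * Exchanging r and (y, w) at fixed time *)

Section Terms.
Variables (R : realType) (d : nat) (sigma alpha beta c tau : R).
Local Notation V := 'rV[R]_d.
Local Notation phase := (R * V * V)%type.
Local Notation mR := (measurableTypeR R).
Local Notation leb := (@lebesgue_measure R).
Local Notation lebn := (@lebesgue_tuple R d).
Local Notation sq := (@lebesgue_square R d).
Local Notation Z := (d.-tuple mR * d.-tuple mR)%type.
Hypotheses (hsigma : 0 < sigma < 1) (hal : 0 < alpha) (hab : alpha < beta) (tau0 : 0 < tau).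
Variable psi : phase -> R.
Hypothesis hpsi : test_function psi.
Variable s : R.
Hypothesis s0 : s < 0.
Local Notation S := (psi_supp psi).
Local Notation kth := (kth alpha).
Local Notation kkp r y := (kk alpha beta psi r s y).
Local Notation KK i r y := (vker alpha beta c psi i r s y).
Local Notation DKK i r y := (dvker alpha beta c psi i r s y).
Local Notation ind := (ind tau).

Let gp := smooth_supp_psi hpsi.

Lemma kk_support : exists2 M, 0 <= M & forall chi r y w, smooth_supp S chi -> 0 < r ->
  kk alpha beta chi r s y w != 0 -> (forall i, `|y 0 i| <= M) /\ (forall i, `|w 0 i| <= M).
Proof.
have [M [M0 hM]] := unif_boundP c hal hab hpsi s0; exists M => // chi r y w gc r0 n0.
have [h|h] := boolP (-2 < kth r s < -1); last first.
  by move: n0; rewrite (kk_out (alpha:=alpha) beta hpsi y gc h) eqxx.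
have [_ _ _ _ /(_ y)[[_ _ hw] hy]] := hM r r0 h.
have Sw : S (kth r s, ka' alpha beta r *: y + kb' alpha beta r s *: w, kc' alpha beta r s *: y + ke' alpha beta r *: w).
  by apply: contrapT => nS; move: n0; rewrite /kk /ker gc.2// eqxx.
by split; [exact: hy Sw|exact: hw].
Qed.

Lemma vker_support : exists2 M, 0 <= M & forall i r y w, 0 < r ->
  (KK i r y w != 0 -> (forall i, `|y 0 i| <= M) /\ (forall i, `|w 0 i| <= M)) /\
  (DKK i r y w != 0 -> (forall i, `|y 0 i| <= M) /\ (forall i, `|w 0 i| <= M)).
Proof.
have [M M0 hM] := kk_support; exists M => // i r y w r0.
have gy := smooth_supp_coordy i gp; have gw := smooth_supp_coordw i gp.
split; apply: contraNP => nb.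
  have z chi : smooth_supp S chi -> kk alpha beta chi r s y w = 0.
    by move=> gc; apply/eqP; apply: contrapT => /negP h; apply: nb; exact: (hM chi r y w gc r0 h).
  have e1 := z _ gy; have e2 := z _ gw.
  by rewrite /vker e1 e2 !mulr0 addr0 mulr0.
have z chi : smooth_supp S chi -> kkD alpha beta chi i r s y w = 0.
  have z chi' : smooth_supp S chi' -> kk alpha beta chi' r s y w = 0.
    by move=> gc; apply/eqP; apply: contrapT => /negP h; apply: nb; exact: (hM chi' r y w gc r0 h).
  move=> gc; rewrite /kkD (z _ (smooth_supp_D (cS hpsi) _ gc)) (z _ (smooth_supp_D (cS hpsi) _ gc)).
  by rewrite !mulr0 addr0.
have e1 := z _ gy; have e2 := z _ gw.
by rewrite /dvker e1 e2 !mulr0 addr0 mulr0.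
Qed.

Definition coefG (r : R) : R :=
  - alpha * `|c|^-1 * r `^ (alpha - 1 - hdim (d := d) alpha beta) * (s / r `^ alpha).

Lemma GkerE r y w : 0 < r ->
  Gker alpha beta sigma c psi r (s, y, w) = coefG r * Dfrac sigma (kkp r y) w.
Proof.
move=> r0; rewrite (_ : kkp r y = fun w' => psi_r alpha beta psi r (s, y, w')); first by [].
by apply/funext => w'; rewrite psi_rE.
Qed.

Lemma coefG_le : exists2 C, 0 <= C & forall r, 0 < r -> -2 < kth r s < -1 -> `|coefG r| <= C.
Proof.
have [M [M0 hM]] := unif_boundP c hal hab hpsi s0.
exists (alpha * M * M * 2) => [|r r0 h]; first by rewrite !mulr_ge0// ltW.
have [hK _ _ hr _] := hM r r0 h; have /andP[ha hb] := h.
have -> : coefG r = - (alpha * KC d alpha beta c r * r `^ (alpha - 1) * kth r s).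
  rewrite /coefG /KC /kth (@powRD _ r (alpha - 1) (- hdim (d := d) alpha beta)).
    by move: (r `^ (alpha - 1)) (r `^ (- hdim alpha beta)) (r `^ alpha) => p q t; ring.
  by apply/implyP => _; rewrite gt_eqF.
rewrite normrN normrM normrM normrM (gtr0_norm hal) (ger0_norm (powR_ge0 _ _)).
apply: ler_pM; rewrite ?mulr_ge0 ?powR_ge0 ?(ltW hal)//.
  apply: ler_pM; rewrite ?mulr_ge0 ?powR_ge0 ?(ltW hal)//.
  by apply: ler_wpM2l => //; exact: ltW.
by rewrite ltr0_norm; lra.
Qed.

Lemma integrable_kkp r y : 0 < r -> integrableRd (kkp r y).
Proof.
move=> r0; have [B B0 /(_ r y r0)[hb _]] := kk_bound c hal hab hpsi s0 gp.
by apply: (bnd_integrable _ hb); apply: continuous_mRd; exact: kk_cont gp.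
Qed.

(** [measurable_fourier_mult] asks for integrability in w at every parameter, while [kk] is
    controlled for r > 0 only; the weight removes the other values of r. *)
Definition cut_kk r y w := ind r * kkp r y w.

Lemma integrable_cut_kk r y : integrableRd (cut_kk r y).
Proof.
rewrite /cut_kk; have [->|[-> /andP[r0 _]]] := ind_case tau r.
  by apply: (eq_L1 (f := fun=> 0)); [move=> t /=; rewrite mul0r|exact: L1_0].
by apply: (eq_L1 (f := kkp r y \o @rowt R d)); [move=> t /=; rewrite mul1r|exact: integrable_kkp].
Qed.

Lemma cut_kk1 r y : ind r = 1 -> cut_kk r y = kkp r y.
Proof. by move=> i1; apply/funext => w; rewrite /cut_kk i1 mul1r. Qed.

Definition cutG r y w := ind r * coefG r * Dfrac sigma (cut_kk r y) w.

Lemma ind_Gker r y w : ind r * Gker alpha beta sigma c psi r (s, y, w) = cutG r y w.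
Proof.
rewrite /cutG; have [i0|[i1 /andP[r0 _]]] := ind_case tau r; first by rewrite i0 !mul0r.
by rewrite cut_kk1// GkerE// mulrA.
Qed.

Lemma Rint_Gker y w : \int[leb]_(r in `]0, tau[) Gker alpha beta sigma c psi r (s, y, w) =
  I leb (fun r => cutG r y w).
Proof. by apply: (etrans (Rint_ind _ _)); apply: eq_I => r; exact: ind_Gker. Qed.

Let c2pi : R := (2 * pi) ^- d.
Let c2pi0 : 0 <= c2pi. Proof. by rewrite invr_ge0 exprn_ge0// mulr_ge0// pi_ge0. Qed.
Let intJ : R := intRd (@J R d).
Let intJ0 : 0 <= intJ. Proof. by apply: I_ge0 => t; exact: J_ge0. Qed.

Lemma intRd_BJ B : intRd (fun w : V => B * J w) = B * intJ.
Proof. by rewrite !intRdE -I_Zl//; exact: integrable_J. Qed.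

(** D^sigma destroys the compact support in w, so there is only a uniform bound in that variable and
    integrability in w must come from the data. The box for y lets the data be majorized uniformly
    in y. *)
Lemma cutG_le : exists M C, [/\ 0 <= M, 0 <= C & forall r y w,
  `|cutG r y w| <= ind r * C * J y /\ (cutG r y w != 0 -> forall i, `|y 0 i| <= M)].
Proof.
have [M M0 hM] := kk_support; have [C C0 hC] := coefG_le.
have [B B0 hB] := kk_bound c hal hab hpsi s0 gp.
exists M, (C * (c2pi * (B * intJ))); split => // [|r y w].
  by rewrite !mulr_ge0.
rewrite /cutG; have [->|[i1 /andP[r0 _]]] := ind_case tau r.
  by rewrite !mul0r normr0 eqxx.
rewrite cut_kk1// i1 !mul1r.
have [h|h] := boolP (-2 < kth r s < -1); last first.
  rewrite (kk_out (alpha:=alpha) beta hpsi y gp h) /Dfrac fourier_mult0 mulr0 normr0 eqxx; split => //.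
  by rewrite !mulr_ge0 ?J_ge0.
split; last first.
  apply: contraNP => nb.
  rewrite (_ : kkp r y = fun=> 0) ?/Dfrac ?fourier_mult0 ?mulr0//.
  apply/funext => w'; apply/eqP; apply: contrapT => /negP n0; apply: nb.
  by have [] := hM _ _ _ _ gp r0 n0.
have [hb hd] := hB r y r0.
rewrite normrM -mulrA; apply: ler_pM => //; first exact: hC.
have iP : integrableRd (fun xi : V => B * J y * J xi) by exact: L1Zl (@integrable_J R d).
apply: (le_trans (fourier_mult_bound w (integrable_kkp y r0) iP (dec_fdom hsigma hd))).
by rewrite intRd_BJ le_eqVlt; apply/orP; left; apply/eqP; rewrite /c2pi; ring.
Qed.

Lemma measurable_cut_kk : measurable_fun setT (fun u : (mR * Z) * d.-tuple mR =>
  cut_kk u.1.1 (rowt u.1.2.1) (rowt u.2)).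
Proof.
apply: measurable_funM.
  exact: (measurableT_comp (@measurable_ind R tau) (measurableT_comp measurable_fst measurable_fst)).
apply: measurable_kk => //.
- exact: (measurableT_comp measurable_fst measurable_fst).
- exact: smooth_supp_cont gp.
- by apply: mvec_rowt; exact: (measurableT_comp measurable_fst (measurableT_comp measurable_snd measurable_fst)).
- by apply: mvec_rowt; exact: measurable_snd.
Qed.

Lemma measurable_cutG : measurable_fun setT (fun u : mR * Z => cutG u.1 (rowt u.2.1) (rowt u.2.2)).
Proof.
apply: measurable_funM.
  apply: measurable_funM; first exact: (measurableT_comp (@measurable_ind R tau) measurable_fst).
  apply: measurable_funM; last exact: (measurable_kth alpha measurable_fst (@measurable_cst _ _ _ _ setT s)).
  by apply: measurable_funM => //; exact: measurable_powR_base measurable_fst.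
apply: (@measurable_fourier_mult R d _ _ sigma (fun u : mR * Z => cut_kk u.1 (rowt u.2.1)) (fun u => rowt u.2.2)).
- by move=> u; exact: integrable_cut_kk.
- exact: measurable_cut_kk.
- by apply: mvec_rowt; exact: (measurableT_comp measurable_snd measurable_snd).
Qed.

Definition div_vker r y (w : V) := \sum_i DKK i r y w.

Definition riesz_vker r y := Ifrac sigma (div_vker r y).

Lemma integrable_div_vker r y : 0 < r -> integrableRd (div_vker r y).
Proof.
move=> r0; have [B B0 hB] := vker_bound c hal hab hpsi s0.
have iD i : integrableRd (DKK i r y).
  have [_ hb _] := hB i r y r0.
  by apply: (bnd_integrable _ hb); apply: continuous_mRd; exact: dvker_cont.
by have := @L1_sum _ _ _ lebn _ (index_enum _) xpredT (fun i => DKK i r y \o @rowt R d) (fun i _ => iD i).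
Qed.

(** All estimates for the Riesz potential are linear in the bound on K, which is B J(y) here; so
    they inherit the factor [J y]. *)
Lemma riesz_vker_riesz : exists2 B, 0 <= B & forall r y, 0 < r ->
  [/\ integrableRd (riesz_vker r y), intRd (fun w => `|riesz_vker r y w|) <= B * J y,
      forall w, `|riesz_vker r y w| <= B * J y, fdom sigma (riesz_vker r y) (fun xi => B * J y * J xi) &
      forall w, Dfrac sigma (riesz_vker r y) w = div_vker r y w].
Proof.
have [B B0 hB] := vker_bound c hal hab hpsi s0.
(* One summand each for the L^1 norm, the pointwise bound and the domination in frequency. *)
pose C := `|Riesz_const d sigma| * B + c2pi * (d%:R * B * intJ) + d%:R * B.
have C1 : 0 <= `|Riesz_const d sigma| * B by rewrite mulr_ge0.
have C2 : 0 <= c2pi * (d%:R * B * intJ) by rewrite !mulr_ge0.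
have C3 : 0 <= d%:R * B by rewrite mulr_ge0.
exists C => [|r y r0]; first by rewrite !addr_ge0.
have BJ0 : 0 <= B * J y by rewrite mulr_ge0// J_ge0.
have cK i : continuous (KK i r y) by exact: vker_cont.
have cDK i : continuous (DKK i r y) by exact: dvker_cont.
have dK i w : is_derive w (delta_mx 0 i) (KK i r y) (DKK i r y w) by exact: is_derive_vker.
have KB i w : `|KK i r y w| <= B * J y * J w by have [h _ _] := hB i r y r0; exact: h.
have DKB i w : `|DKK i r y w| <= B * J y * J w by have [_ h _] := hB i r y r0; exact: h.
have KD i xi a : `|cosT (KK i r y) xi a| * (1 + enorm xi) <= B * J y * J xi by have [_ _ h] := hB i r y r0; exact: h.
have iR := integrable_Riesz hsigma BJ0 cK cDK dK KB DKB KD.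
have J0 := J_ge0 y.
split => //.
- apply: (le_trans (Riesz_bound hsigma BJ0 cK cDK dK KB DKB KD)); rewrite mulrA; apply: ler_wpM2r => //.
  apply: (@le_trans _ _ (`|Riesz_const d sigma| * B)); first by apply: ler_wpM2r => //; exact: ler_norm.
  by rewrite /C -addrA lerDl addr_ge0.
- move=> w; have fd := fdom_div hsigma BJ0 cK cDK dK KB DKB KD.
  have iP : integrableRd (fun xi : V => d%:R * (B * J y) * J xi) by exact: L1Zl (@integrable_J R d).
  apply: (le_trans (fourier_mult_bound w (integrable_div_vker y r0) iP fd)).
  rewrite intRd_BJ -/c2pi; apply: (@le_trans _ _ (c2pi * (d%:R * B * intJ) * J y)).
    by rewrite le_eqVlt; apply/orP; left; apply/eqP; ring.
  by apply: ler_wpM2r => //; rewrite /C addrAC lerDr addr_ge0.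
- move=> xi a; apply: (le_trans (fdom_Riesz hsigma BJ0 cK cDK dK KB DKB KD xi a)).
  by apply: ler_wpM2r; [exact: J_ge0|rewrite mulrA; apply: ler_wpM2r => //; rewrite /C lerDr addr_ge0].
- move=> w; exact: (Dfrac_Riesz hsigma BJ0 cK cDK dK KB DKB KD).
Qed.

Definition cut_div_vker r y w := ind r * div_vker r y w.

Lemma cut_div_vker1 r y : ind r = 1 -> cut_div_vker r y = div_vker r y.
Proof. by move=> i1; apply/funext => w; rewrite /cut_div_vker i1 mul1r. Qed.

Lemma integrable_cut_div_vker r y : integrableRd (cut_div_vker r y).
Proof.
have [i0|[i1 /andP[r0 _]]] := ind_case tau r; last by rewrite cut_div_vker1//; exact: integrable_div_vker.
by apply: (eq_L1 (f := fun=> 0)); [move=> t /=; rewrite /cut_div_vker i0 mul0r|exact: L1_0].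
Qed.

Definition cutGv r y w := ind r * Ifrac sigma (cut_div_vker r y) w.

Lemma ind_Gvker r y w : ind r * Gvker alpha beta sigma c psi r (s, y, w) = cutGv r y w.
Proof.
rewrite /cutGv; have [i0|[i1 /andP[r0 _]]] := ind_case tau r.
  by rewrite i0; exact: etrans (mul0r _) (esym (mul0r _)).
rewrite (cut_div_vker1 y i1).
have E : div_vker r y = fun w' => Lker alpha beta c psi r (s, y, w').
  by apply/funext => w'; rewrite LkerE.
by rewrite E.
Qed.

Lemma Rint_Gvker y w : \int[leb]_(r in `]0, tau[) Gvker alpha beta sigma c psi r (s, y, w) =
  I leb (fun r => cutGv r y w).
Proof. by apply: (etrans (Rint_ind _ _)); apply: eq_I => r; exact: ind_Gvker. Qed.

(** In contrast with [cutG_le], the kernel is integrable in w; it will be paired with D^sigma of the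
    data, which is only bounded. The pointwise bound serves the integral over r at fixed (y, w). *)
Lemma cutGv_le : exists M C, [/\ 0 <= M, 0 <= C & forall r y,
  [/\ forall w, `|cutGv r y w| <= ind r * C * J y, forall w, cutGv r y w != 0 -> forall i, `|y 0 i| <= M,
    integrableRd (cutGv r y) & intRd (fun w => `|cutGv r y w|) <= ind r * C * J y]].
Proof.
have [M M0 hM] := vker_support; have [B B0 hB] := riesz_vker_riesz.
exists M, B; split => // r y; rewrite /cutGv.
have [i0|[i1 /andP[r0 _]]] := ind_case tau r.
  rewrite i0; split => [w|w||].
  - by rewrite !mul0r normr0.
  - by rewrite mul0r eqxx.
  - by apply: (eq_L1 (f := fun=> 0)); [move=> t /=; rewrite mul0r|exact: L1_0].
  - by rewrite !mul0r intRdE -[leRHS](@I_0 _ _ _ lebn) le_eqVlt; apply/orP; left; apply/eqP/eq_I => t /=; rewrite mul0r normr0.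
have [h1 h2 h3 h4 h5] := hB r y r0.
have E : (fun w => ind r * Ifrac sigma (cut_div_vker r y) w) = riesz_vker r y.
  apply/funext => w; rewrite (cut_div_vker1 y i1) i1; exact: mul1r.
rewrite !i1 cut_div_vker1// !mul1r; split => [w|w||].
- by rewrite mul1r; exact: h3.
- rewrite mul1r; apply: contraNP => nb.
  rewrite (_ : div_vker r y = fun=> 0) ?/Ifrac ?fourier_mult0//.
  apply/funext => w'; rewrite /div_vker big1// => i _; apply/eqP; apply: contrapT => /negP n0; apply: nb.
  by have [_ /(_ n0)[]] := hM i r y w' r0.
- by apply: (eq_L1 _ h1) => t /=; rewrite mul1r.
- by under eq_fun do rewrite mul1r; exact: h2.
Qed.

Lemma measurable_cut_div_vker : measurable_fun setT (fun u : (mR * Z) * d.-tuple mR =>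
  cut_div_vker u.1.1 (rowt u.1.2.1) (rowt u.2)).
Proof.
apply: measurable_funM.
  exact: (measurableT_comp (@measurable_ind R tau) (measurableT_comp measurable_fst measurable_fst)).
apply: (@measurable_sum _ _ _ setT _ (index_enum _)) => i.
apply: measurable_dvker => //.
- exact: (measurableT_comp measurable_fst measurable_fst).
- by apply: mvec_rowt; exact: (measurableT_comp measurable_fst (measurableT_comp measurable_snd measurable_fst)).
- by apply: mvec_rowt; exact: measurable_snd.
Qed.

Lemma measurable_cutGv : measurable_fun setT (fun u : mR * Z => cutGv u.1 (rowt u.2.1) (rowt u.2.2)).
Proof.
apply: measurable_funM; first exact: (measurableT_comp (@measurable_ind R tau) measurable_fst).
apply: (@measurable_fourier_mult R d _ _ (- sigma) (fun u : mR * Z => cut_div_vker u.1 (rowt u.2.1)) (fun u => rowt u.2.2)).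
- by move=> u; exact: integrable_cut_div_vker.
- exact: measurable_cut_div_vker.
- by apply: mvec_rowt; exact: (measurableT_comp measurable_snd measurable_snd).
Qed.

Lemma L1_cutGv y w : L1 leb (fun r => cutGv r y w).
Proof.
have [M [C [M0 C0 hG]]] := cutGv_le.
apply: (L1_le _ (L1Zr (C * J y) (L1_ind tau0))) => [|r]; last first.
  by have [h1 _ _ _] := hG r y; rewrite mulrA.
have := measurableT_comp measurable_cutGv (measurable_pair2 (tof y, tof w)).
by rewrite /comp /= !rowtK.
Qed.

Section Data.
(** At a fixed time, g stands for S0 in the first term and for f in the second, in coordinates
    relative to p. *)
Variable g : V -> V -> R.
Hypothesis mg : mRd2 g.
Hypothesis ig : forall y, integrableRd (g y).
Hypothesis hg : forall M, exists phi Phi, [/\ integrableRd phi, integrableRd Phi &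
  forall y : V, (forall i, `|y 0 i| <= M) -> (forall w, `|g y w| <= phi w) /\ fdom sigma (g y) Phi].

Let Dg y w := Dfrac sigma (g y) w.

Lemma fdom_data y : exists2 Phi, integrableRd Phi & fdom sigma (g y) Phi.
Proof.
have [phi [Phi [_ iP h]]] := hg (\sum_i `|y 0 i|); exists Phi => //.
apply: (h y _).2 => i; rewrite (bigD1 i)//= lerDl; exact: sumr_ge0.
Qed.

Lemma Dg_bound M : exists2 D, 0 <= D & forall (y w : V), (forall i, `|y 0 i| <= M) -> `|Dg y w| <= D.
Proof.
have [phi [Phi [_ iP h]]] := hg M; exists (`|c2pi * intRd Phi|) => // y w hy.
by apply: (le_trans (fourier_mult_bound w (ig y) iP (h y hy).2)); exact: ler_norm.
Qed.

Lemma measurable_Dg : mRd2 Dg.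
Proof.
apply: (@measurable_fourier_mult R d _ _ sigma (fun u : Z => g (rowt u.1)) (fun u => rowt u.2)).
- by move=> u; exact: ig.
- have := measurableT_comp mg (g := fun u : Z * d.-tuple mR => (u.1.1, u.2)); apply.
  by apply: measurable_fun_pair; [exact: (measurableT_comp measurable_fst measurable_fst)|exact: measurable_snd].
- by apply: mvec_rowt; exact: measurable_snd.
Qed.

Let F1 (r : mR) (z : Z) : R := g (rowt z.1) (rowt z.2) * cutG r (rowt z.1) (rowt z.2).

Let F1_le : exists phi, exists2 C, integrableRd phi & forall r z,
  `|F1 r z| <= ind r * C * J (rowt z.1) * phi (rowt z.2).
Proof.
have [M [C [M0 C0 hG]]] := cutG_le; have [phi [Phi [ip iP h]]] := hg M.
exists (fun w => `|phi w|), C => [|r z]; first by have := L1_norm ip.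
have [h1 h2] := hG r (rowt z.1) (rowt z.2); rewrite /F1.
have [->|n0] := eqVneq (cutG r (rowt z.1) (rowt z.2)) 0.
  have /andP[i0 _] := ind01 tau r.
  by rewrite mulr0 normr0 !mulr_ge0 ?J_ge0.
have [hp _] := h _ (h2 n0).
rewrite normrM mulrC; apply: ler_pM => //.
by apply: (le_trans (hp _)); exact: ler_norm.
Qed.

Let mF1 : measurable_fun setT (fun u : mR * Z => F1 u.1 u.2).
Proof.
apply: measurable_funM; last exact: measurable_cutG.
exact: (measurableT_comp mg measurable_snd).
Qed.

Let F1_swap : exists h : mR -> R, [/\ L1 leb h, forall r t, L1 lebn (fun q => F1 r (t, q)) &
  forall r t, I lebn (fun q => `|F1 r (t, q)|) <= h r * J (rowt t)].
Proof.
have [phi [C ip hF]] := F1_le.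
have mFt r t : measurable_fun setT (fun q => F1 r (t, q)).
  exact: (measurableT_comp (swap_measurable mF1 r) (measurable_pair1 t)).
have iFt r t : L1 lebn (fun q => F1 r (t, q)).
  apply: (L1_le (mFt r t) (L1Zl (ind r * C * J (rowt t)) ip)) => q; exact: (hF r (t, q)).
exists (fun r => ind r * (C * intRd phi)); split => [|//|r t].
  by apply: L1Zr; exact: L1_ind.
rewrite (_ : _ * _ * _ = ind r * C * J (rowt t) * intRd phi); last by ring.
rewrite intRdE -I_Zl//; apply: I_le => [||q]; last exact: (hF r (t, q)).
  by have := L1_norm (iFt r t).
exact: L1Zl.
Qed.

Lemma L1_cutG y w : L1 leb (fun r => cutG r y w).
Proof.
have [M [C [M0 C0 hG]]] := cutG_le.
apply: (L1_le _ (L1Zr (C * J y) (L1_ind tau0))) => [|r]; last first.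
  by have [h1 _] := hG r y w; rewrite mulrA.
have := measurableT_comp measurable_cutG (measurable_pair2 (tof y, tof w)).
by rewrite /comp /= !rowtK.
Qed.

Lemma L1_Dg_kk r : 0 < r -> L1 sq (fun z => Dg (rowt z.1) (rowt z.2) * kkp r (rowt z.1) (rowt z.2)).
Proof.
move=> r0; have [M M0 hM] := kk_support; have [D D0 hD] := Dg_bound M.
have [B B0 hB] := kk_bound c hal hab hpsi s0 gp.
apply: (L1_prod (F := fun t q => Dg (rowt t) (rowt q) * kkp r (rowt t) (rowt q))
  (a := fun t => J (rowt t)) (b := fun q => D * B * J (rowt q))).
- apply: measurable_funM; first exact: measurable_Dg.
  apply: measurable_kk => //; [exact: smooth_supp_cont gp|exact: mvec_fst|exact: mvec_snd].
- exact: integrable_J.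
- by apply: L1Zl; exact: integrable_J.
- move=> t q; have [->|n0] := eqVneq (kkp r (rowt t) (rowt q)) 0.
    by rewrite mulr0 normr0 !mulr_ge0 ?J_ge0.
  have [hy _] := hM _ _ _ _ gp r0 n0; have [hb _] := hB r (rowt t) r0.
  rewrite normrM; apply: (@le_trans _ _ (D * (B * J (rowt t) * J (rowt q)))).
    by apply: ler_pM => //; exact: hD.
  by rewrite le_eqVlt; apply/orP; left; apply/eqP; ring.
Qed.

(** Here D^sigma is taken off the kernel: after the exchange, duality at fixed (r, y) moves it onto
    g, where the equation can be used later. *)
Lemma term1 :
  L1 sq (fun z => g (rowt z.1) (rowt z.2) *
    \int[leb]_(r in `]0, tau[) Gker alpha beta sigma c psi r (s, rowt z.1, rowt z.2)) /\
  I sq (fun z => g (rowt z.1) (rowt z.2) *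
    \int[leb]_(r in `]0, tau[) Gker alpha beta sigma c psi r (s, rowt z.1, rowt z.2)) =
  I leb (fun r => ind r * coefG r *
    I sq (fun z => Dg (rowt z.1) (rowt z.2) * kkp r (rowt z.1) (rowt z.2))).
Proof.
have [h [ih iF bF]] := F1_swap.
have -> : (fun z : Z => g (rowt z.1) (rowt z.2) *
    \int[leb]_(r in `]0, tau[) Gker alpha beta sigma c psi r (s, rowt z.1, rowt z.2)) =
    (fun z => I leb (F1^~ z)).
  apply/funext => z; transitivity (g (rowt z.1) (rowt z.2) * I leb (fun r => cutG r (rowt z.1) (rowt z.2))).
    by rewrite Rint_Gker.
  exact/esym/(I_Zl _ (L1_cutG (rowt z.1) (rowt z.2))).
split; first exact: (swap_L1_I2 mF1 iF bF ih).
rewrite (swap_I mF1 iF bF ih); apply: eq_I => r.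
rewrite (swap_iter mF1 iF bF).
have [i0|[i1 /andP[r0 _]]] := ind_case tau r.
  rewrite i0 !mul0r -[RHS](@I_0 _ _ _ lebn); apply: eq_I => t.
  rewrite -[RHS](@I_0 _ _ _ lebn); apply: eq_I => q.
  by rewrite /F1 /cutG i0 !mul0r mulr0.
rewrite i1 mul1r.
have iD := L1_Dg_kk r0.
rewrite (I_prod (F := fun t q => Dg (rowt t) (rowt q) * kkp r (rowt t) (rowt q)) iD) -I_Zl; last first.
  exact: (L1_I2 (F := fun t q => Dg (rowt t) (rowt q) * kkp r (rowt t) (rowt q)) iD).
apply: eq_I => t; have [Phi iPhi fPhi] := fdom_data (rowt t).
have [B B0 /(_ r (rowt t) r0)[hb hd]] := kk_bound c hal hab hpsi s0 gp.
have iP : integrableRd (fun xi : V => B * J (rowt t) * J xi) by exact: L1Zl (@integrable_J R d).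
have dual := fourier_mult_duality (ig (rowt t)) (integrable_kkp (rowt t) r0) iPhi iP fPhi (dec_fdom hsigma hd).
have -> : I lebn (fun q => Dg (rowt t) (rowt q) * kkp r (rowt t) (rowt q)) =
    intRd (fun w => g (rowt t) w * fourier_mult sigma (kkp r (rowt t)) w) by exact: dual.
rewrite intRdE -I_Zl; first by apply: eq_I => q; rewrite /F1 /cutG i1 cut_kk1//= mul1r mulrCA.
have mDk : mRd (fourier_mult sigma (kkp r (rowt t))) by exact: mRd_fourier_mult (integrable_kkp _ r0).
apply: (L1_bounded_mul (B := c2pi * intRd (fun xi : V => B * J (rowt t) * J xi)) (ig (rowt t)) mDk) => q.
exact: (fourier_mult_bound _ (integrable_kkp _ r0) iP (dec_fdom hsigma hd)).
Qed.

Let F2 (r : mR) (z : Z) : R := Dg (rowt z.1) (rowt z.2) * cutGv r (rowt z.1) (rowt z.2).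

Let mF2 : measurable_fun setT (fun u : mR * Z => F2 u.1 u.2).
Proof.
apply: measurable_funM; last exact: measurable_cutGv.
exact: (measurableT_comp measurable_Dg measurable_snd).
Qed.

Let F2_swap : exists h : mR -> R, [/\ L1 leb h, forall r t, L1 lebn (fun q => F2 r (t, q)) &
  forall r t, I lebn (fun q => `|F2 r (t, q)|) <= h r * J (rowt t)].
Proof.
have [M [C [M0 C0 hG]]] := cutGv_le; have [D D0 hD] := Dg_bound M.
have mFt r t : measurable_fun setT (fun q => F2 r (t, q)).
  exact: (measurableT_comp (swap_measurable mF2 r) (measurable_pair1 t)).
have bFt r t q : `|F2 r (t, q)| <= D * `|cutGv r (rowt t) (rowt q)|.
  rewrite /F2 /=; have [->|n0] := eqVneq (cutGv r (rowt t) (rowt q)) 0; first by rewrite !(mulr0, normr0).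
  have [_ hy _ _] := hG r (rowt t).
  by rewrite normrM; apply: ler_wpM2r => //; apply: hD; exact: hy n0.
have iFt r t : L1 lebn (fun q => F2 r (t, q)).
  have [_ _ iG _] := hG r (rowt t).
  by apply: (L1_le (mFt r t) (L1Zl D (L1_norm iG))) => q; exact: bFt.
exists (fun r => ind r * (D * C)); split => [|//|r t].
  by apply: L1Zr; exact: L1_ind.
have [_ _ iG hI] := hG r (rowt t).
apply: (@le_trans _ _ (D * intRd (fun w => `|cutGv r (rowt t) w|))).
  rewrite intRdE -I_Zl; last by have := L1_norm iG.
  apply: I_le => [||q]; last exact: bFt.
    by have := L1_norm (iFt r t).
  by apply: L1Zl; have := L1_norm iG.
apply: (le_trans (ler_wpM2l D0 hI)).
by rewrite le_eqVlt; apply/orP; left; apply/eqP; ring.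
Qed.

Variable Dgi : 'I_d -> V -> V -> R.
Hypothesis cg : forall y, continuous (g y).
Hypothesis dgi : forall i y w, is_derive w (delta_mx 0 i) (g y) (Dgi i y w).
Hypothesis mDgi : forall i, mRd2 (Dgi i).
Hypothesis bDgi : forall M, exists2 C, 0 <= C & forall i (y w : V),
  (forall i, `|y 0 i| <= M) -> (forall i, `|w 0 i| <= M) -> `|g y w| <= C /\ `|Dgi i y w| <= C.

Lemma Dgi_vker_le : exists2 C, 0 <= C & forall i r y w, 0 < r ->
  [/\ `|Dgi i y w * KK i r y w| <= C * J y * J w, `|g y w * KK i r y w| <= C * J y * J w &
      `|g y w * DKK i r y w| <= C * J y * J w].
Proof.
have [M M0 hM] := vker_support; have [C C0 hC] := bDgi M.
have [B B0 hB] := vker_bound c hal hab hpsi s0.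
exists (C * B) => [|i r y w r0]; first exact: mulr_ge0.
have [h1 h2 _] := hB i r y r0; have [s1 s2] := hM i r y w r0.
have Z0 : 0 <= C * B * J y * J w by rewrite !mulr_ge0 ?J_ge0.
have aux (p q : R) : (q != 0 -> `|p| <= C) -> `|q| <= B * J y * J w -> `|p * q| <= C * B * J y * J w.
  have [->|n0] := eqVneq q 0; first by rewrite mulr0 normr0.
  move=> /(_ isT) hp hq; rewrite normrM -!mulrA; apply: ler_pM => //; by rewrite mulrA.
split; apply: aux; try exact: h1; try exact: h2.
- by move=> /s1[hy hw]; have [] := hC i y w hy hw.
- by move=> /s1[hy hw]; have [] := hC i y w hy hw.
- by move=> /s2[hy hw]; have [] := hC i y w hy hw.
Qed.

Let iDK i r y : 0 < r -> [/\ integrableRd (fun w => Dgi i y w * KK i r y w),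
  integrableRd (fun w => g y w * KK i r y w) & integrableRd (fun w => g y w * DKK i r y w)].
Proof.
move=> r0; have [C C0 hC] := Dgi_vker_le.
have mgy : mRd (g y) by exact: continuous_mRd.
have mKK : mRd (KK i r y) by apply: continuous_mRd; exact: vker_cont.
have mDKK : mRd (DKK i r y) by apply: continuous_mRd; exact: dvker_cont.
have mDy : mRd (Dgi i y).
  have := measurableT_comp (mDgi i) (measurable_pair1 (tof y)).
  by rewrite /comp /= rowtK.
split; apply: (@bnd_integrable _ _ _ (C * J y)); try exact: measurable_funM.
- by move=> w; have [] := hC i r y w r0.
- by move=> w; have [] := hC i r y w r0.
- by move=> w; have [] := hC i r y w r0.
Qed.

Let ibp i r y : 0 < r -> intRd (fun w => g y w * DKK i r y w) = - intRd (fun w => Dgi i y w * KK i r y w).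
Proof.
move=> r0; have [C C0 hC] := Dgi_vker_le; have [i1 i2 i3] := iDK i y r0.
have dF w : is_derive w (delta_mx 0 i) (fun w => g y w * KK i r y w) (Dgi i y w * KK i r y w + g y w * DKK i r y w).
  have h : is_derive w (delta_mx 0 i) (KK i r y) (DKK i r y w) by exact: is_derive_vker.
  have : is_derive w (delta_mx 0 i) (g y * KK i r y) (Dgi i y w * KK i r y w + g y w * DKK i r y w).
    by apply: is_derive_eq; rewrite !scaleR_mul; ring.
  by [].
have hb w : `|Dgi i y w * KK i r y w + g y w * DKK i r y w| <= (C * J y + C * J y) * J w.
  have [b1 _ b3] := hC i r y w r0.
  by apply: (le_trans (ler_normD _ _)); rewrite mulrDl; apply: lerD.
have := @int_derive_dir0 R d _ _ i _ i2 dF hb.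
rewrite intRdE I_D//; move=> h.
by apply/eqP; rewrite -addr_eq0 addrC; apply/eqP; exact: h.
Qed.

Definition parts_kernel r y w : R := \sum_i - (Dgi i y w * KK i r y w).

Lemma L1_parts_kernel r : 0 < r -> L1 sq (fun z => parts_kernel r (rowt z.1) (rowt z.2)).
Proof.
move=> r0; have [C C0 hC] := Dgi_vker_le.
apply: L1_sum => i _; apply: L1N.
apply: (L1_prod (F := fun t q => Dgi i (rowt t) (rowt q) * KK i r (rowt t) (rowt q))
  (a := fun t => C * J (rowt t)) (b := fun q => J (rowt q))).
- apply: measurable_funM; first exact: mDgi.
  by apply: measurable_vker => //; [exact: mvec_fst|exact: mvec_snd].
- by apply: L1Zl; exact: integrable_J.
- exact: integrable_J.
- by move=> t q; have [] := hC i r (rowt t) (rowt q) r0.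
Qed.

(** Duality moves D^sigma from g onto the Riesz potential, where it gives back the divergence;
    integration by parts then moves the derivatives onto g. *)
Let inner2 r y : 0 < r -> intRd (fun w => Dg y w * riesz_vker r y w) = intRd (parts_kernel r y).
Proof.
move=> r0; have [Phi iPhi fPhi] := fdom_data y.
have [B B0 /(_ r y r0)[iR _ _ fR eR]] := riesz_vker_riesz.
have iP : integrableRd (fun xi : V => B * J y * J xi) by exact: L1Zl (@integrable_J R d).
have dual := fourier_mult_duality (ig y) iR iPhi iP fPhi fR.
rewrite [LHS]dual.
have -> : (fun w => g y w * fourier_mult sigma (riesz_vker r y) w) = (fun w => \sum_i g y w * DKK i r y w).
  by apply/funext => w; rewrite -[fourier_mult _ _ _]/(Dfrac sigma (riesz_vker r y) w) eR /div_vker mulr_sumr.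
have E1 := @I_sum _ _ _ lebn _ (index_enum _) xpredT (fun i t => g y (rowt t) * DKK i r y (rowt t)).
have E2 := @I_sum _ _ _ lebn _ (index_enum _) xpredT (fun i t => - (Dgi i y (rowt t) * KK i r y (rowt t))).
transitivity (\sum_i intRd (fun w => g y w * DKK i r y w)).
  by apply: E1 => i _; have [] := iDK i y r0.
transitivity (\sum_i intRd (fun w => - (Dgi i y w * KK i r y w))); last first.
  by apply/esym/E2 => i _; apply: L1N; have [] := iDK i y r0.
apply: eq_bigr => i _; have [h1 _ _] := iDK i y r0.
transitivity (- intRd (fun w => Dgi i y w * KK i r y w)); first exact: ibp.
exact: (esym (I_N h1)).
Qed.

Lemma term2 :
  L1 sq (fun z => Dg (rowt z.1) (rowt z.2) *
    \int[leb]_(r in `]0, tau[) Gvker alpha beta sigma c psi r (s, rowt z.1, rowt z.2)) /\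
  I sq (fun z => Dg (rowt z.1) (rowt z.2) *
    \int[leb]_(r in `]0, tau[) Gvker alpha beta sigma c psi r (s, rowt z.1, rowt z.2)) =
  I leb (fun r => ind r * I sq (fun z => parts_kernel r (rowt z.1) (rowt z.2))).
Proof.
have [h [ih iF bF]] := F2_swap.
have -> : (fun z : Z => Dg (rowt z.1) (rowt z.2) *
    \int[leb]_(r in `]0, tau[) Gvker alpha beta sigma c psi r (s, rowt z.1, rowt z.2)) =
    (fun z => I leb (F2^~ z)).
  apply/funext => z; transitivity (Dg (rowt z.1) (rowt z.2) * I leb (fun r => cutGv r (rowt z.1) (rowt z.2))).
    by rewrite Rint_Gvker.
  exact/esym/(I_Zl _ (L1_cutGv (rowt z.1) (rowt z.2))).
split; first exact: (swap_L1_I2 mF2 iF bF ih).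
rewrite (swap_I mF2 iF bF ih); apply: eq_I => r.
rewrite (swap_iter mF2 iF bF).
have [i0|[i1 /andP[r0 _]]] := ind_case tau r.
  rewrite i0 !mul0r -[RHS](@I_0 _ _ _ lebn); apply: eq_I => t.
  rewrite -[RHS](@I_0 _ _ _ lebn); apply: eq_I => q.
  by rewrite /F2 /cutGv i0 !mul0r mulr0.
rewrite i1 mul1r (I_prod (F := fun t q => parts_kernel r (rowt t) (rowt q)) (L1_parts_kernel r0)).
apply: eq_I => t; rewrite -[RHS]/(intRd (parts_kernel r (rowt t))) -inner2//.
by apply: eq_I => q; rewrite /F2 /cutGv i1 cut_div_vker1//= mul1r.
Qed.
End Data.
End Terms.

(** * The curves *)

Section ChainRule.
Variables (R : realType).

Lemma is_derive_scalel (W : normedModType R) (a : R -> R) (r a' : R) (u : W) :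
  is_derive r (1 : R) a a' -> is_derive r (1 : R) (fun r => a r *: u) (a' *: u).
Proof.
case; rewrite /derivable /derive => h1 h2.
have E : (fun h : R => h^-1 *: (((fun r => a r *: u) \o shift r) (h *: (1 : R)) - a r *: u)) =
   (fun h : R => (h^-1 *: ((a \o shift r) (h *: (1 : R)) - a r)) *: u).
  by apply/funext => h /=; rewrite -scalerBl scalerA.
have hc : (h^-1 *: ((a \o shift r) (h *: (1 : R)) - a r)) *: u @[h --> 0^'] --> a' *: u.
  apply: cvgZl; rewrite -h2; exact: h1.
split; first by rewrite /derivable E; apply/cvg_ex; exists (a' *: u).
by rewrite /derive E; apply: cvg_lim.
Qed.

Lemma is_derive_chain3 (V1 V2 V3 : normedModType R) (f : V1 * V2 * V3 -> R)
    (a : R -> V1) (b : R -> V2) (c : R -> V3) (r : R) a' b' c' :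
  differentiable f (a r, b r, c r) ->
  is_derive r (1 : R) a a' -> is_derive r (1 : R) b b' -> is_derive r (1 : R) c c' ->
  is_derive r (1 : R) (fun r => f (a r, b r, c r)) ('d f (a r, b r, c r) (a', b', c')).
Proof.
move=> df [da <-] [db <-] [dc <-].
have {}da : differentiable a r by apply/derivable1_diffP.
have {}db : differentiable b r by apply/derivable1_diffP.
have {}dc : differentiable c r by apply/derivable1_diffP.
pose G := fun r => (a r, b r, c r).
have dab := differentiable_pair da db.
have dG : differentiable G r := differentiable_pair dab dc.
have dfG : differentiable (f \o G) r by exact: differentiable_comp.
split; first exact: diff_derivable dfG.
have -> : (fun r => f (a r, b r, c r)) = f \o G by [].
rewrite deriveE// diff_comp//= /G diff_pair// diff_pair//.
by rewrite !deriveE.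
Qed.

Lemma is_derive_cstD (W : normedModType R) (k : W) (a : R -> W) (r : R) a' :
  is_derive r (1 : R) a a' -> is_derive r (1 : R) (fun r => k + a r) a'.
Proof.
move=> ha; have : is_derive r (1 : R) (cst k + a) (0 + a') by exact: is_deriveD.
by rewrite add0r.
Qed.

Lemma is_derive_add (W : normedModType R) (a b : R -> W) (r : R) a' b' :
  is_derive r (1 : R) a a' -> is_derive r (1 : R) b b' ->
  is_derive r (1 : R) (fun r => a r + b r) (a' + b').
Proof. by move=> ha hb; have : is_derive r (1 : R) (a + b) (a' + b') by exact: is_deriveD. Qed.
End ChainRule.

Section FTC0.
Variables (R : realType) (tau : R) (F D : R -> R) (F0 : R).
Local Notation leb := (@lebesgue_measure R).
Local Notation mR := (measurableTypeR R).
Hypothesis tau0 : 0 < tau.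
Hypothesis dF : forall r : R, 0 < r -> is_derive r (1 : R) F (D r).
Hypothesis cD : forall r : R, 0 < r -> {for r, continuous D}.
Hypothesis mD : measurable_fun (setT : set mR) D.
Hypothesis iD : L1 leb (fun r => ind tau r * D r).
Hypothesis cF0 : F (tau / m.+2%:R) @[m --> \oo] --> F0.

(** The denominator m + 2 keeps the left endpoint strictly below tau, also for m = 0. *)
Let a (m : nat) : R := tau / m.+2%:R.

Let a0 m : 0 < a m. Proof. by rewrite divr_gt0. Qed.

Let at_ m : a m < tau.
Proof. by rewrite ltr_pdivrMr// -[ltLHS]mulr1 ltr_pM2l// ltr1n. Qed.

Let cF (r : R) : 0 < r -> {for r, continuous F}.
Proof. by move=> r0; apply: differentiable_continuous; apply/derivable1_diffP; have [] := dF r0. Qed.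

Let piece m : I leb (fun r => \1_(`]a m, tau[%classic) r * D r) = F tau - F (a m).
Proof.
have h : (\int[leb]_(r in `[a m, tau]) (D r)%:E = (F tau)%:E - (F (a m))%:E)%E.
  apply: continuous_FTC2 => //.
  - apply: continuous_in_subspaceT => r; rewrite inE/= in_itv/= => /andP[r1 _].
    by apply: cD; exact: lt_le_trans r1.
  - split=> [r|  |].
    + by rewrite in_itv/= => /andP[r1 _]; have [] := dF (lt_trans (a0 m) r1).
    + by apply: cvg_at_right_filter; exact: cF.
    + by apply: cvg_at_left_filter; exact: cF.
  - by move=> r; rewrite in_itv/= => /andP[r1 _]; rewrite derive1E (@derive_val _ _ _ _ _ _ _ (dF (lt_trans (a0 m) r1))).
transitivity (\int[leb]_(r in `]a m, tau[) D r).
  rewrite Rintegral_mkcond /I; congr Rintegral; apply/funext => r.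
  by rewrite /patch indicE; case: ifP => _; rewrite ?mul1r ?mul0r.
rewrite /Rintegral integral_itv_obnd_cbnd; last by apply/measurable_EFinP; exact: measurable_funTS.
by rewrite integral_itv_bndo_bndc ?h//; by apply/measurable_EFinP; exact: measurable_funTS.
Qed.

(** F is differentiable for r > 0 only and D may blow up at 0: the fundamental theorem is applied on
    [a m, tau], and dominated convergence lets the left endpoint tend to 0. *)
Lemma FTC0 : I leb (fun r => ind tau r * D r) = F tau - F0.
Proof.
have h1 : I leb (fun r => \1_(`]a m, tau[%classic) r * D r) @[m --> \oo] --> I leb (fun r => ind tau r * D r).
  apply: (@I_cvg _ _ _ leb (fun m (r : mR) => \1_(`]a m, tau[%classic) r * D r) (fun r : mR => ind tau r * D r)
    (fun r : mR => `|ind tau r * D r|)).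
  - by move=> m; apply: measurable_funM => //; exact: measurable_indic.
  - move=> r; apply: cvgMl; have [i0|[i1 /andP[r0 rt]]] := ind_case tau r.
      rewrite i0 (_ : (fun m => _) = fun=> 0); first exact: cvg_cst.
      apply/funext => m; rewrite indicE; case: (boolP (r \in _)) => //; rewrite inE/= in_itv/= => /andP[r1 r2].
      have : ind tau r = 1 by rewrite /ind indicE mem_set//= in_itv/= (lt_trans (a0 m) r1).
      by rewrite i0 => /eqP; rewrite eq_sym oner_eq0.
    rewrite i1; apply: cvg_near_cst; near=> m; rewrite indicE mem_set//= in_itv/= rt andbT.
    rewrite /a ltr_pdivrMr// -ltr_pdivrMl//.
    near: m; have := nbhs_infty_gtr (r^-1 * tau); apply: filterS => m; move=> hm.
    by apply: (lt_trans hm); rewrite ltr_nat.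
  - by have := L1_norm iD.
  - move=> m r; rewrite !normrM; apply: ler_wpM2r => //.
    rewrite indicE; case: (boolP (r \in _)); last by rewrite normr0.
    rewrite inE/= in_itv/= => /andP[r1 r2].
    by rewrite /ind indicE mem_set//= in_itv/= (lt_trans (a0 m) r1).
have h2 : F tau - F (a m) @[m --> \oo] --> F tau - F0 by apply: cvgB => //; exact: cvg_cst.
have E : (fun m => I leb (fun r => \1_(`]a m, tau[%classic) r * D r)) = (fun m => F tau - F (a m)).
  by apply/funext => m; exact: piece.
rewrite E in h1; transitivity (lim ((F tau - F (a m)) @[m --> \oo])).
  by apply/esym; apply: cvg_lim.
by apply: cvg_lim.
Unshelve. all: by end_near. Qed.
End FTC0.

Section Path.
Variables (R : realType) (d : nat) (alpha beta : R).
Local Notation V := 'rV[R]_d.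
Local Notation phase := (R * V * V)%type.
Local Notation mR := (measurableTypeR R).
Local Notation leb := (@lebesgue_measure R).
Hypotheses (hal : 0 < alpha) (hab : alpha < beta).
Variables (f : phase -> R) (p : phase).
Hypothesis hf : Ck 1 f.

Definition curve (r th : R) (eta zeta : V) : phase :=
  kmul p (r `^ alpha * th, g1 beta r *: eta + (th * g2 beta r) *: zeta,
    (H1 alpha beta r / th) *: eta + H2 alpha beta r *: zeta).

Definition dpath_transport (r th : R) (eta zeta : V) : R := alpha * r `^ (alpha - 1) * th * transport f (curve r th eta zeta).
Definition dpath_velocity (r th : R) (eta zeta : V) : R := \sum_i (DH1 alpha beta r / th * eta 0 i + DH2 alpha beta r * zeta 0 i) *
   'D_((0, 0, delta_mx 0 i) : phase) f (curve r th eta zeta).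
Definition dpath (r th : R) (eta zeta : V) : R := dpath_transport r th eta zeta + dpath_velocity r th eta zeta.

Lemma cvg_curve (T : Type) (F : set_system T) (FF : Filter F) (u : T -> R) (r th : R) (eta zeta : V) :
  g1 beta (u x) @[x --> F] --> g1 beta r -> g2 beta (u x) @[x --> F] --> g2 beta r ->
  H1 alpha beta (u x) @[x --> F] --> H1 alpha beta r -> H2 alpha beta (u x) @[x --> F] --> H2 alpha beta r ->
  (u x) `^ alpha @[x --> F] --> r `^ alpha ->
  curve (u x) th eta zeta @[x --> F] --> curve r th eta zeta.
Proof.
move=> c1 c2 c3 c4 c5; rewrite /curve /kmul /=.
have cs : (u x) `^ alpha * th @[x --> F] --> r `^ alpha * th by exact: cvgMl.
have q1 : p.1.1 + (u x) `^ alpha * th @[x --> F] --> p.1.1 + r `^ alpha * th.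
  by apply: cvgD => //; exact: cvg_cst.
have q2 : p.1.2 + (g1 beta (u x) *: eta + (th * g2 beta (u x)) *: zeta) + ((u x) `^ alpha * th) *: p.2 @[x --> F] -->
    p.1.2 + (g1 beta r *: eta + (th * g2 beta r) *: zeta) + (r `^ alpha * th) *: p.2.
  apply: cvgD; last exact: cvgZl.
  apply: cvgD; first exact: cvg_cst.
  by apply: cvgD; apply: cvgZl => //; exact: cvgMr.
have q3 : p.2 + ((H1 alpha beta (u x) / th) *: eta + H2 alpha beta (u x) *: zeta) @[x --> F] -->
    p.2 + ((H1 alpha beta r / th) *: eta + H2 alpha beta r *: zeta).
  apply: cvgD; first exact: cvg_cst.
  by apply: cvgD; apply: cvgZl => //; exact: cvgMl.
exact: (cvg_pair (cvg_pair q1 q2) q3).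
Qed.

Let fd m : differentiable f m. Proof. by case: hf. Qed.

Lemma diff_phaseE m (a : R) (b c : V) : 'd f m (a, b, c) = a * 'D_((1, 0, 0) : phase) f m +
  \sum_i b 0 i * 'D_((0, delta_mx 0 i, 0) : phase) f m +
  \sum_i c 0 i * 'D_((0, 0, delta_mx 0 i) : phase) f m.
Proof.
have -> : (a, b, c) = a *: ((1, 0, 0) : phase) + \sum_i b 0 i *: ((0, delta_mx 0 i, 0) : phase) +
    \sum_i c 0 i *: ((0, 0, delta_mx 0 i) : phase).
  have sb : \sum_i b 0 i *: ((0, delta_mx 0 i, 0) : phase) = (0, b, 0).
    rewrite [in RHS](row_sum_delta b); elim/big_rec2 : _ => // i y1 y2 _ ->.
    by congr (_, _, _) => /=; rewrite ?scaler0 ?addr0.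
  have sc : \sum_i c 0 i *: ((0, 0, delta_mx 0 i) : phase) = (0, 0, c).
    rewrite [in RHS](row_sum_delta c); elim/big_rec2 : _ => // i y1 y2 _ ->.
    by congr (_, _, _) => /=; rewrite ?scaler0 ?addr0.
  by rewrite sb sc; congr (_, _, _) => /=; rewrite ?scaler0 ?addr0 ?add0r// scaleR_mul mulr1.
rewrite !linearD linearZ !linear_sum /= deriveE//; congr (_ + _ + _).
  by apply: eq_bigr => i _; rewrite linearZ deriveE.
by apply: eq_bigr => i _; rewrite linearZ deriveE.
Qed.

Lemma is_derive_path (r th : R) (eta zeta : V) : th != 0 -> 0 < r ->
  is_derive r (1 : R) (fun r => f (curve r th eta zeta)) (dpath r th eta zeta).
Proof.
move=> th0 r0; rewrite /curve /kmul /=.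
have h1 := is_derive_g1 beta hal r0; have h2 := is_derive_g2 beta hal r0.
have h3 := is_derive_H1 alpha beta r0; have h4 := is_derive_H2 alpha beta r0.
have h5 := is_derive1_powR alpha r0.
pose w' : V := (DH1 alpha beta r / th) *: eta + DH2 alpha beta r *: zeta.
pose s' := alpha * r `^ (alpha - 1) * th.
have hs : is_derive r (1 : R) (fun r => r `^ alpha * th) s'.
  by apply: is_derive_eq; rewrite !scaleR_mul; rewrite /s'; ring.
have ha : is_derive r (1 : R) (fun r => p.1.1 + r `^ alpha * th) s'.
  have : is_derive r (1 : R) (cst p.1.1 + (fun r => r `^ alpha * th)) s' by apply: is_derive_eq; rewrite add0r.
  by [].
have hc : is_derive r (1 : R) (fun r => p.2 + ((H1 alpha beta r / th) *: eta + H2 alpha beta r *: zeta)) w'.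
  have q1 : is_derive r (1 : R) (fun r => H1 alpha beta r / th) (DH1 alpha beta r / th).
    by apply: is_derive_eq; rewrite !scaleR_mul; ring.
  have q2 := is_derive_scalel eta q1; have q3 := is_derive_scalel zeta h4.
  exact: is_derive_cstD (is_derive_add q2 q3).
pose m := curve r th eta zeta.
(* The design of the curve: since g' = alpha r^(alpha - 1) H, the position moves with s' times the
   full velocity. The part due to p.2 comes from the drift in the group law. *)
have hb : is_derive r (1 : R) (fun r => p.1.2 + (g1 beta r *: eta + (th * g2 beta r) *: zeta) + (r `^ alpha * th) *: p.2) (s' *: m.2).
  have q1 : is_derive r (1 : R) (fun r => th * g2 beta r) (th * (alpha * r `^ (alpha - 1) * H2 alpha beta r)).
    by apply: is_derive_eq; rewrite !scaleR_mul; ring.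
  have q2 := is_derive_scalel zeta q1; have q3 := is_derive_scalel eta h1; have q4 := is_derive_scalel p.2 hs.
  have := is_derive_add (is_derive_cstD p.1.2 (is_derive_add q3 q2)) q4.
  rewrite (_ : _ + _ + _ = s' *: m.2)//; apply/rowP => i; rewrite !mxE /s'.
  by field.
have := is_derive_chain3 (fd _) ha hb hc.
rewrite diff_phaseE => h; apply: is_derive_eq.
rewrite /dpath /dpath_transport /dpath_velocity -/s' /transport mulrDr; congr (_ + _ + _).
  by rewrite mulr_sumr; apply: eq_bigr => i _; rewrite mxE mulrA.
by apply: eq_bigr => i _; rewrite !mxE.
Qed.

Lemma continuous_transport : continuous (transport f).
Proof.
case: hf => _ cf m; apply: cvgD; first exact: (cf ((1, 0, 0) : phase)).
apply: (@continuous_big _ _ _ _ _ (@add_continuous _) _ _ (fun i (q : phase) => q.2 0 i * 'D_((0, delta_mx 0 i, 0) : phase) f q)) => i _ q.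
apply: cvgM; last exact: (cf ((0, delta_mx 0 i, 0) : phase)).
exact: differentiable_continuous (coordw_diff q i).
Qed.

Lemma continuous_curve (r th : R) (eta zeta : V) : 0 < r ->
  curve r' th eta zeta @[r' --> r] --> curve r th eta zeta.
Proof.
move=> r0.
have c1 : {for r, continuous (g1 beta)} by rewrite g1E; exact: continuous_osc.
have c2 : {for r, continuous (g2 beta)} by rewrite g2E; exact: continuous_osc.
have c3 : {for r, continuous (H1 alpha beta)} by apply: cvgMr; exact: continuous_osc.
have c4 : {for r, continuous (H2 alpha beta)} by apply: cvgMr; exact: continuous_osc.
have c5 : {for r, continuous (fun r : R => r `^ alpha)}.
  apply: differentiable_continuous; apply/derivable1_diffP.
  by have [] := is_derive1_powR alpha r0.
exact: cvg_curve.
Qed.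

(** The exponents alpha, beta and beta - alpha are positive, so all powers vanish at 0, whatever
    value [ln] takes there. *)
Lemma curve0 th eta zeta : curve 0 th eta zeta = p.
Proof.
rewrite /curve /g1 /g2 /H1 /H2 /osc !powR0 ?gt_eqF ?subr_gt0 ?(lt_trans hal hab)//.
rewrite !mul0r !mulr0 mul0r !scale0r !addr0 /kmul /= scale0r !addr0.
by case: p => -[].
Qed.

(** The oscillating factors have no limit at 0; the entries are squeezed to 0 by their bounds C r^b
    with b > 0. *)
Lemma cvg_curve0 th eta zeta (u : nat -> R) : (forall n, 0 < u n) -> u n @[n --> \oo] --> (0 : R) ->
  curve (u n) th eta zeta @[n --> \oo] --> p.
Proof.
move=> u0 cu; rewrite -[X in _ --> X](curve0 th eta zeta).
have cp (b : R) (h : R -> R) C : 0 < b -> h 0 = 0 -> (forall r, `|h r| <= C * r `^ b) -> h (u n) @[n --> \oo] --> h 0.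
  move=> b0 h0 hb; rewrite h0; apply/norm_cvg0P.
  have cq : C * (u n) `^ b @[n --> \oo] --> (0 : R).
    rewrite -(mulr0 C); apply: cvgMr.
    by have /cvg_at_rightP h' := powR_cvg0 b0; apply: h'; split.
  apply: (@squeeze_cvgr _ _ _ _ (cst 0) (fun n => C * (u n) `^ b)) => //; last exact: cvg_cst.
  by near=> n; rewrite normr_ge0/=.
apply: cvg_curve.
- apply: (cp beta _ 1) => [||r]; [exact: lt_trans hab|by rewrite /g1 powR0 ?mul0r// gt_eqF// (lt_trans hal)|by rewrite mul1r; exact: g1_le].
- apply: (cp beta _ 1) => [||r]; [exact: lt_trans hab|by rewrite /g2 powR0 ?mul0r// gt_eqF// (lt_trans hal)|by rewrite mul1r; exact: g2_le].
- apply: (cp (beta - alpha) _ (hC alpha beta)) => [||r]; [by rewrite subr_gt0|by rewrite /H1 /osc powR0 ?mul0r ?mulr0// gt_eqF// subr_gt0|exact: H1_le].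
- apply: (cp (beta - alpha) _ (hC alpha beta)) => [||r]; [by rewrite subr_gt0|by rewrite /H2 /osc powR0 ?mul0r ?mulr0// gt_eqF// subr_gt0|exact: H2_le].
- apply: (cp alpha (fun r => r `^ alpha) 1) => [||r]; [by []|by rewrite powR0// gt_eqF|by rewrite mul1r ger0_norm// powR_ge0].
Unshelve. all: by end_near. Qed.

Let q0 (m : phase) := `|f m| + `|transport f m| + \sum_i `|'D_((0, 0, delta_mx 0 i) : phase) f m|.

Let cont_q0 : continuous q0.
Proof.
case: hf => _ cf m; apply: cvgD.
  apply: cvgD; apply: cvg_norm; last exact: continuous_transport.
  exact: differentiable_continuous (fd m).
apply: (@continuous_big _ _ _ _ _ (@add_continuous _) _ _ (fun i (q : phase) => `|'D_((0, 0, delta_mx 0 i) : phase) f q|)) => i _ q.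
by apply: cvg_norm; exact: (cf ((0, 0, delta_mx 0 i) : phase)).
Qed.

Lemma curve_box tau : exists2 M, 0 <= M & forall r th (eta zeta : V), 0 < r <= tau -> -2 < th < -1 ->
  (forall i, `|eta 0 i| <= 1) -> (forall i, `|zeta 0 i| <= 1) ->
  exists t y w, [/\ curve r th eta zeta = (t, y, w), `|t| <= M, forall i, `|y 0 i| <= M & forall i, `|w 0 i| <= M].
Proof.
have hC0 := ltW (hC_gt0 hal hab).
pose T1 := tau `^ alpha; pose T2 := tau `^ beta; pose T3 := hC alpha beta * tau `^ (beta - alpha).
pose X := \sum_i `|p.1.2 0 i|; pose Y := \sum_i `|p.2 0 i|.
have T10 : 0 <= T1 by exact: powR_ge0. have T20 : 0 <= T2 by exact: powR_ge0.
have T30 : 0 <= T3 by rewrite mulr_ge0 ?powR_ge0.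
have X0 : 0 <= X by exact: sumr_ge0. have Y0 : 0 <= Y by exact: sumr_ge0.
have TY : 0 <= T1 * Y by rewrite mulr_ge0.
have P0 : 0 <= `|p.1.1| by [].
(* Time needs |t| + 2 T1, position X + 3 T2 + 2 T1 Y, velocity Y + 2 T3; the sum covers all
   three. *)
exists (`|p.1.1| + X + Y + 2 * T1 + 2 * (T1 * Y) + 3 * T2 + 2 * T3) => [|r th eta zeta /andP[r0 rt] /andP[ta tb] he hz].
  by lra.
have th1 : 1 <= `|th| by rewrite ltr0_norm; lra.
have th2 : `|th| <= 2 by rewrite ltr0_norm; lra.
have tau0 : 0 <= tau by apply: le_trans (ltW r0) rt.
have le_pow b : 0 <= b -> r `^ b <= tau `^ b by move=> b0; apply: ge0_ler_powR => //; rewrite ?nnegrE// ltW.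
have b1 : r `^ alpha <= T1 by apply: le_pow; exact: ltW.
have b2 : r `^ beta <= T2 by apply: le_pow; exact/ltW/(lt_trans hal).
have b3 : hC alpha beta * r `^ (beta - alpha) <= T3 by apply: ler_wpM2l => //; apply: le_pow; rewrite subr_ge0 ltW.
have ra0 : 0 <= r `^ alpha by exact: powR_ge0.
have s1 : `|r `^ alpha * th| <= 2 * T1 by rewrite normrM ger0_norm// mulrC; apply: ler_pM.
have divth x : `|x / th| <= `|x|.
  by rewrite normrM normfV ler_pdivrMr ?ler_peMr// (lt_le_trans ltr01).
have coordX i : `|p.1.2 0 i| <= X by rewrite /X (bigD1 i)//= lerDl; exact: sumr_ge0.
have coordY i : `|p.2 0 i| <= Y by rewrite /Y (bigD1 i)//= lerDl; exact: sumr_ge0.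
rewrite /curve /kmul /=; eexists; eexists; eexists; split; first by [].
- apply: (le_trans (ler_normD _ _)).
  by apply: (le_trans (lerD (lexx _) s1)); lra.
- move=> i; rewrite mxE [X in `|X + _|]mxE [X in `|_ + X|]mxE.
  apply: (le_trans (ler_normD _ _)); apply: (@le_trans _ _ ((X + (T2 + 2 * T2)) + 2 * T1 * Y)); last first.
    by rewrite -mulrA; lra.
  apply: lerD; last by rewrite normrM; apply: ler_pM.
  apply: (le_trans (ler_normD _ _)); apply: lerD => //.
  apply: lin2_coord_le => //; first exact: le_trans (g1_le _ _) b2.
  by rewrite normrM; apply: ler_pM => //; exact: le_trans (g2_le _ _) b2.
- move=> i; rewrite mxE; apply: (le_trans (ler_normD _ _)).
  apply: (@le_trans _ _ (Y + (T3 + T3))); last by lra.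
  apply: lerD => //; apply: lin2_coord_le => //.
    by apply: (le_trans (divth _)); exact: le_trans (H1_le hal hab _) b3.
  exact: le_trans (H2_le hal hab _) b3.
Qed.

(** Both powers are integrable at 0, the second one because alpha < beta; this makes the integrals
    over r absolutely convergent in the new variables. *)
Lemma path_bounds tau : exists2 C, 0 <= C & forall r th (eta zeta : V), 0 < r <= tau -> -2 < th < -1 ->
  (forall i, `|eta 0 i| <= 1) -> (forall i, `|zeta 0 i| <= 1) ->
  [/\ `|f (curve r th eta zeta)| <= C, `|dpath_transport r th eta zeta| <= C * r `^ (alpha - 1) &
    `|dpath_velocity r th eta zeta| <= C * r `^ (beta - alpha - 1)].
Proof.
have hC0 := ltW (hC_gt0 hal hab).
have [M M0 hM] := curve_box tau; have [B B0 hB] := box_bounded M cont_q0.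
have aB : 0 <= alpha * B by rewrite mulr_ge0// ltW.
have hB0 : 0 <= hC alpha beta * B by rewrite mulr_ge0.
exists (B + 2 * (alpha * B) + 2 * (hC alpha beta * B)) => [|r th eta zeta rt tt he hz]; first by lra.
have [t [y [w [E bt by_ bw]]]] := hM r th eta zeta rt tt he hz.
have := hB t y w bt by_ bw; rewrite -E.
have S0 : 0 <= \sum_i `|'D_((0, 0, delta_mx 0 i) : phase) f (curve r th eta zeta)| by exact: sumr_ge0.
rewrite /q0 ger0_norm; last by rewrite !addr_ge0.
move=> hq; have /andP[ta tb] := tt.
have th1 : 1 <= `|th| by rewrite ltr0_norm; lra.
have th2 : `|th| <= 2 by rewrite ltr0_norm; lra.
have n1 := normr_ge0 (f (curve r th eta zeta)); have n2 := normr_ge0 (transport f (curve r th eta zeta)).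
have f1 : `|f (curve r th eta zeta)| <= B by lra.
have f2 : `|transport f (curve r th eta zeta)| <= B by lra.
have f3 : \sum_i `|'D_((0, 0, delta_mx 0 i) : phase) f (curve r th eta zeta)| <= B by lra.
split; first by lra.
- rewrite /dpath_transport normrM normrM normrM (gtr0_norm hal) (ger0_norm (powR_ge0 _ _)).
  have ra0 : 0 <= r `^ (alpha - 1) by exact: powR_ge0.
  apply: (@le_trans _ _ (alpha * r `^ (alpha - 1) * 2 * B)).
    by apply: ler_pM => //; rewrite ?mulr_ge0 ?(ltW hal)//; apply: ler_wpM2l => //; rewrite mulr_ge0// ltW.
  rewrite (_ : alpha * r `^ (alpha - 1) * 2 * B = 2 * (alpha * B) * r `^ (alpha - 1)); last by ring.
  by apply: ler_wpM2r => //; lra.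
- have ra0 : 0 <= r `^ (beta - alpha - 1) by exact: powR_ge0.
  have divth x : `|x / th| <= `|x|.
    by rewrite normrM normfV ler_pdivrMr ?ler_peMr// (lt_le_trans ltr01).
  apply: (@le_trans _ _ (2 * (hC alpha beta * r `^ (beta - alpha - 1)) * B)); last first.
    rewrite (_ : 2 * _ * B = 2 * (hC alpha beta * B) * r `^ (beta - alpha - 1)); last by ring.
    by apply: ler_wpM2r => //; lra.
  rewrite /dpath_velocity; apply: (le_trans (ler_norm_sum _ _ _)).
  apply: (@le_trans _ _ (2 * (hC alpha beta * r `^ (beta - alpha - 1)) *
    \sum_i `|'D_((0, 0, delta_mx 0 i) : phase) f (curve r th eta zeta)|)); last first.
    by apply: ler_wpM2l => //; apply: mulr_ge0 => //; exact: mulr_ge0.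
  rewrite mulr_sumr; apply: ler_sum => i _; rewrite normrM; apply: ler_wpM2r => //.
  apply: (le_trans (ler_normD _ _)); rewrite mulr_natl mulr2n; apply: lerD.
    rewrite normrM -[leRHS]mulr1; apply: ler_pM => //.
    by apply: (le_trans (divth _)); exact: DH1_le.
  by rewrite normrM -[leRHS]mulr1; apply: ler_pM => //; exact: DH2_le.
Qed.

Lemma continuous_dpath (r th : R) (eta zeta : V) : 0 < r -> {for r, continuous (fun r => dpath r th eta zeta)}.
Proof.
move=> r0; have cm := @continuous_curve r th eta zeta r0.
have c1 : {for r, continuous (DH1 alpha beta)} by apply: cvgMr; exact: continuous_osc.
have c2 : {for r, continuous (DH2 alpha beta)} by apply: cvgMr; exact: continuous_osc.
have c5 : {for r, continuous (fun r : R => r `^ (alpha - 1))}.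
  apply: differentiable_continuous; apply/derivable1_diffP.
  by have [] := is_derive1_powR (alpha - 1) r0.
case: hf => _ cf; apply: cvgD.
  apply: cvgM; first by apply: cvgMl; apply: cvgMr; exact: c5.
  exact: (cvg_comp _ _ cm (@continuous_transport _)).
apply: (@cvg_big _ _ +%R 0 xpredT (@add_continuous _) _ _ _ (fun i (r : R) => (DH1 alpha beta r / th * eta 0 i + DH2 alpha beta r * zeta 0 i) *
   'D_((0, 0, delta_mx 0 i) : phase) f (curve r th eta zeta))) => i _.
apply: cvgM.
  by apply: cvgD; apply: cvgMl; [apply: cvgMl; exact: c1|exact: c2].
exact: (cvg_comp _ _ cm (@cf ((0, 0, delta_mx 0 i) : phase) _)).
Qed.

Section MeasurablePath.
Context dT (T : measurableType dT) (r th : T -> R) (eta zeta : T -> V).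
Hypotheses (mr : measurable_fun setT r) (mth : measurable_fun setT th) (me : mvec eta) (mz : mvec zeta).

Lemma measurable_curve (q : phase -> R) : continuous q ->
  measurable_fun setT (fun x => q (curve (r x) (th x) (eta x) (zeta x))).
Proof.
move=> cq; rewrite /curve /kmul /=.
have ms : measurable_fun setT (fun x => r x `^ alpha * th x).
  by apply: measurable_funM => //; exact: measurable_powR_base.
apply: continuous_mphase => //.
- exact: measurable_funD.
- apply: mvecD; last by apply: mvecZ => //; exact: mvec_cst.
  apply: mvecD; first exact: mvec_cst.
  apply: mvecD; apply: mvecZ => //; first exact: measurable_g1.
  by apply: measurable_funM => //; exact: measurable_g2.
- apply: mvecD; first exact: mvec_cst.
  apply: mvecD; apply: mvecZ => //; last exact: measurable_H2.
  by apply: measurable_div => //; exact: measurable_H1.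
Qed.

Lemma measurable_dpath_transport : measurable_fun setT (fun x => dpath_transport (r x) (th x) (eta x) (zeta x)).
Proof.
apply: measurable_funM; last exact: measurable_curve continuous_transport.
by apply: measurable_funM => //; apply: measurable_funM => //; exact: measurable_powR_base.
Qed.

Lemma measurable_dpath_velocity : measurable_fun setT (fun x => dpath_velocity (r x) (th x) (eta x) (zeta x)).
Proof.
apply: (@measurable_sum _ _ _ setT _ (index_enum _)) => i.
case: hf => _ cf.
apply: measurable_funM; last exact: measurable_curve (cf ((0, 0, delta_mx 0 i) : phase)).
apply: measurable_funD; apply: measurable_funM; [|exact: me| |exact: mz].
- by apply: measurable_div => //; exact: measurable_DH1.
- exact: measurable_DH2.
Qed.
End MeasurablePath.

Lemma path_integral tau th (eta zeta : V) : 0 < tau -> -2 < th < -1 ->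
  (forall i, `|eta 0 i| <= 1) -> (forall i, `|zeta 0 i| <= 1) ->
  I leb (fun r => ind tau r * dpath r th eta zeta) = f (curve tau th eta zeta) - f p.
Proof.
move=> tau0 tt he hz; have /andP[ta tb] := tt.
have th0 : th != 0 by rewrite lt_eqF//; lra.
have mD : measurable_fun (setT : set mR) (fun r => dpath r th eta zeta).
  by apply: measurable_funD; [apply: measurable_dpath_transport|apply: measurable_dpath_velocity] => //; exact: mvec_cst.
apply: (@FTC0 R tau (fun r => f (curve r th eta zeta)) (fun r => dpath r th eta zeta) (f p)) => //.
- by move=> r r0; exact: is_derive_path.
- by move=> r r0; exact: continuous_dpath.
- have [C C0 hC] := path_bounds tau.
  have i1 := L1Zl C (L1_pow0 hal tau0).
  have ba : 0 < beta - alpha by rewrite subr_gt0.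
  have i2 := L1Zl C (L1_pow0 ba tau0).
  apply: (L1_le _ (L1D i1 i2)) => [|r].
    by apply: measurable_funM => //; exact: measurable_ind.
  have [->|[-> /andP[r0 rt]]] := ind_case tau r.
    by rewrite mul0r normr0 addr_ge0// mulr_ge0// mulr_ge0 ?powR_ge0// indicE.
  have rt' : 0 < r <= tau by rewrite r0 ltW.
  have [_ h1 h2] := hC r th eta zeta rt' tt he hz.
  rewrite mul1r indicE mem_set ?mulr1/=; last by rewrite in_itv/=.
  by apply: (le_trans (ler_normD _ _)); apply: lerD.
- have cm : curve (tau / m.+2%:R) th eta zeta @[m --> \oo] --> p.
    apply: (@cvg_curve0 th eta zeta (fun m => tau / m.+2%:R)) => [n|]; first by rewrite divr_gt0.
    rewrite -(mulr0 tau); apply: cvgMr.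
    have h := @cvg_harmonic R; rewrite -(cvg_shiftS _) in h; exact: h.
  exact: (cvg_comp _ _ cm (differentiable_continuous (fd p))).
Qed.
End Path.

(** * Change of the time variable *)

Section TimeScaling.
Variables (R : realType) (d : nat) (alpha : R).
Local Notation V := 'rV[R]_d.
Local Notation mR := (measurableTypeR R).
Local Notation leb := (@lebesgue_measure R).
Local Notation sq := (@lebesgue_square R d).
Local Notation Z := (d.-tuple mR * d.-tuple mR)%type.
Hypothesis hal : 0 < alpha.

Definition jth (th : R) : R := \1_(`]-2, -1[%classic) th.

Lemma jth_ge0 th : 0 <= jth th. Proof. by rewrite /jth indicE. Qed.

Lemma jth_in th : -2 < th < -1 -> jth th = 1.
Proof. by move=> h; rewrite /jth indicE mem_set//= in_itv/=. Qed.

Lemma L1_jth : L1 leb jth.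
Proof.
have h := scales_L1 (@scales_line R 2 1 (oner_neq0 _)) (L1_ind (@ltr01 R)).
apply: (eq_L1 _ h) => th /=; rewrite /ind /jth !indicE mul1r; congr (nat_of_bool _)%:R.
apply/idP/idP; rewrite !inE /= !in_itv/= => /andP[h1 h2]; apply/andP; split; lra.
Qed.

Variables (E : R -> R -> V -> V -> R) (h : R -> R).
Hypothesis mE : measurable_fun setT (fun u : (mR * mR) * Z => E u.1.1 u.1.2 (rowt u.2.1) (rowt u.2.2)).
Hypothesis ih : L1 leb h.
Hypothesis h0 : forall r, ~~ (0 < r) -> h r = 0.
Hypothesis bE : forall r th eta zeta, `|E r th eta zeta| <= h r * jth th * (J eta * J zeta).

Definition space_int (r th : mR) : R := I sq (fun u => E r th (rowt u.1) (rowt u.2)).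

Let JJ (u : Z) : R := J (rowt u.1) * J (rowt u.2).

Lemma L1_JJ : L1 sq JJ.
Proof.
apply: (L1_prod (F := fun t q => J (rowt t) * J (rowt q)) (a := fun t => J (rowt t)) (b := fun q => J (rowt q))).
- have mJ := integrableRd_meas (@integrable_J R d).
  by apply: measurable_funM; [exact: (measurableT_comp mJ measurable_fst)|exact: (measurableT_comp mJ measurable_snd)].
- exact: integrable_J.
- exact: integrable_J.
- by move=> t q; rewrite normrM !ger0_norm ?J_ge0.
Qed.

Let mEz r th : measurable_fun setT (fun u : Z => E r th (rowt u.1) (rowt u.2)).
Proof. exact: (measurableT_comp mE (measurable_pair1 (r, th))). Qed.

Lemma L1_Ez r th : L1 sq (fun u => E r th (rowt u.1) (rowt u.2)).
Proof.
by apply: (L1_le (mEz r th) (L1Zl (h r * jth th) L1_JJ)) => u; exact: bE.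
Qed.

Let c2 : R := I sq JJ.

Lemma space_int_le r th : `|space_int r th| <= h r * jth th * c2.
Proof.
rewrite -I_Zl; last exact: L1_JJ.
apply: (I_norm_le (mEz r th)); first by apply: L1Zl; exact: L1_JJ.
by move=> u; exact: bE.
Qed.

Lemma measurable_space_int : measurable_fun setT (fun u : mR * mR => space_int u.1 u.2).
Proof.
exact: (@measurable_I2 _ _ _ _ _ sq (fun (x : mR * mR) (u : Z) => E x.1 x.2 (rowt u.1) (rowt u.2))).
Qed.

Lemma L1_space_int : L1 (leb \x leb)%E (fun u => space_int u.1 u.2).
Proof.
apply: (L1_prod (F := fun r th : mR => space_int r th) (a := fun r : mR => h r) (b := fun th : mR => jth th * c2)) => //.
- exact: measurable_space_int.
- by apply: L1Zr; exact: L1_jth.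
- by move=> r th; rewrite mulrA; exact: space_int_le.
Qed.

Lemma space_int_swap : I leb (fun r => I leb (fun th => space_int r th)) = I leb (fun th => I sq (fun u => I leb (fun r => E r th (rowt u.1) (rowt u.2)))) /\
  forall th, L1 sq (fun u => I leb (fun r : mR => E r th (rowt u.1) (rowt u.2))).
Proof.
pose F th (r : mR) (u : Z) : R := E r th (rowt u.1) (rowt u.2).
have LF th : L1 (leb \x sq)%E (fun x => F th x.1 x.2).
  apply: (L1_prod (F := F th) (a := fun r : mR => h r) (b := fun u => jth th * JJ u)) => //.
  - have := measurableT_comp mE (g := fun x : mR * Z => ((x.1, th), x.2)); apply.
    apply: measurable_fun_pair; last exact: measurable_snd.
    by apply: measurable_fun_pair => //; exact: measurable_fst.
  - by apply: L1Zl; exact: L1_JJ.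
  - by move=> r u; rewrite mulrA; exact: bE.
split; last by move=> th; exact: (L1_I2 (F := fun u r => F th r u) (L1_swap (LF th))).
rewrite (I_swap (F := fun r th : mR => space_int r th) L1_space_int); apply: eq_I => th.
exact: (I_swap (LF th)).
Qed.

(** At fixed r > 0 the factor r^(- alpha) is the Jacobian of s -> th, so the L^1 norm in s equals
    that of [space_int r] in th, at most a constant times h(r). This is integrable and justifies the
    exchange of s and r. *)
Lemma space_int_scale t : I leb (fun s => I leb (fun r : mR => r `^ (- alpha) * space_int r ((s - t) / r `^ alpha))) =
  I leb (fun r => I leb (fun th => space_int r th)).
Proof.
pose G (r s : mR) : R := r `^ (- alpha) * space_int r ((s - t) / r `^ alpha).
have space_int0 r th : ~~ (0 < r) -> space_int r th = 0.
  by move=> r0; apply/eqP; rewrite -normr_le0; apply: (le_trans (space_int_le r th)); rewrite h0// !mul0r.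
have LPr r : L1 leb (fun th => space_int r th).
  apply: (L1_le _ (L1Zl (h r * c2) L1_jth)) => [|th].
    exact: (measurableT_comp measurable_space_int (measurable_pair1 r)).
  by rewrite mulrAC; exact: space_int_le.
have sc r : 0 < r -> [/\ L1 leb (G r), I leb (G r) = I leb (fun th => space_int r th) &
    I leb (fun s => `|G r s|) = I leb (fun th => `|space_int r th|)].
  move=> r0; have ra : 0 < r `^ alpha by rewrite powR_gt0.
  have ian : (r `^ alpha)^-1 != 0 by rewrite invr_neq0// gt_eqF.
  have sl := @scales_line R (- t / r `^ alpha) (r `^ alpha)^-1 ian.
  have ab : `|(r `^ alpha)^-1|^-1 = r `^ alpha by rewrite normfV invrK gtr0_norm.
  rewrite ab in sl.
  have Es s : - t / r `^ alpha + (r `^ alpha)^-1 * s = (s - t) / r `^ alpha.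
    by rewrite [X in _ + X]mulrC -mulrDl addrC.
  have l1 := scales_L1 sl (LPr r); have i1 := scales_I sl (LPr r).
  have i2 := scales_I sl (L1_norm (LPr r)).
  have E1 : (fun th => space_int r th) \o (fun s : mR => - t / r `^ alpha + (r `^ alpha)^-1 * s) = fun s => space_int r ((s - t) / r `^ alpha).
    by apply/funext => s /=; rewrite Es.
  have E2 : (fun th => `|space_int r th|) \o (fun s : mR => - t / r `^ alpha + (r `^ alpha)^-1 * s) = fun s => `|space_int r ((s - t) / r `^ alpha)|.
    by apply/funext => s /=; rewrite Es.
  rewrite E1 in l1 i1; rewrite E2 in i2.
  split.
  - exact: L1Zl l1.
  - rewrite /G (I_Zl _ l1) i1 powRN mulKf// gt_eqF//.
  - transitivity (r `^ (- alpha) * I leb (fun s => `|space_int r ((s - t) / r `^ alpha)|)).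
      rewrite -I_Zl; last by have := L1_norm l1.
      by apply: eq_I => s; rewrite /G normrM ger0_norm// powR_ge0.
    by rewrite i2 powRN mulKf// gt_eqF.
have G0 r s : ~~ (0 < r) -> G r s = 0 by move=> r0; rewrite /G space_int0// mulr0.
have LG : L1 (leb \x leb)%E (fun u => G u.1 u.2).
  apply: (L1_iter (F := G) (H := fun r : mR => h r * (c2 * I leb jth))).
  - apply: measurable_funM; first exact: measurable_powR_base measurable_fst.
    have := measurableT_comp measurable_space_int (g := fun u : mR * mR => (u.1, (u.2 - t) / u.1 `^ alpha)); apply.
    apply: measurable_fun_pair; first exact: measurable_fst.
    apply: measurable_div; last exact: measurable_powR_base measurable_fst.
    by apply: measurable_funB => //; exact: measurable_snd.
  - by apply: L1Zr.
  - move=> r; have [r0|r0] := boolP (0 < r); first by have [] := sc r r0.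
    by apply: (eq_L1 (f := fun=> 0)); [move=> s; rewrite G0|exact: L1_0].
  - move=> r; have [r0|r0] := boolP (0 < r); last first.
      rewrite h0// mul0r le_eqVlt; apply/orP; left; apply/eqP.
      by rewrite -[RHS](@I_0 _ _ _ leb); apply: eq_I => s; rewrite G0// normr0.
    have [_ _ ->] := sc r r0.
    rewrite mulrA -I_Zl; last exact: L1_jth.
    apply: I_le; [by have := L1_norm (LPr r)|by apply: L1Zl; exact: L1_jth|].
    by move=> th; rewrite mulrAC; exact: space_int_le.
rewrite -(I_swap LG); apply: eq_I => r.
have [r0|r0] := boolP (0 < r); first by have [] := sc r r0.
transitivity (0 : R).
  by rewrite -[RHS](@I_0 _ _ _ leb); apply: eq_I => s; rewrite G0.
by rewrite -[LHS](@I_0 _ _ _ leb); apply: eq_I => s; rewrite space_int0.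
Qed.
End TimeScaling.

Section ChangeOfVariables.
Variables (R : realType) (d : nat) (alpha beta : R).
Local Notation V := 'rV[R]_d.
Local Notation mR := (measurableTypeR R).
Local Notation sq := (@lebesgue_square R d).
Local Notation Z := (d.-tuple mR * d.-tuple mR)%type.
Hypotheses (hal : 0 < alpha).

(** The absolute value of the determinant of A_th(r) on R^(2d); it does not depend on th. *)
Definition Dfac (r : R) : R := (alpha^-1 * r `^ (2 * beta - alpha)) ^+ d.

Lemma cov_inv (r th : R) (F : V -> V -> R) : th != 0 -> 0 < r ->
  L1 sq (fun u => F (rowt u.1) (rowt u.2)) ->
  L1 sq (fun z => F (ka alpha beta r *: rowt z.1 + kb alpha beta th r *: rowt z.2)
               (kc alpha beta th r *: rowt z.1 + ke alpha beta r *: rowt z.2)) /\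
  I sq (fun z => F (ka alpha beta r *: rowt z.1 + kb alpha beta th r *: rowt z.2)
               (kc alpha beta th r *: rowt z.1 + ke alpha beta r *: rowt z.2)) =
  Dfac r * I sq (fun u => F (rowt u.1) (rowt u.2)).
Proof.
move=> th0 r0 LF; have De := Del_lt0 beta hal r0; have Dn : Del alpha beta r != 0 by rewrite lt_eqF.
have dt : ka alpha beta r * ke alpha beta r - kb alpha beta th r * kc alpha beta th r = (Del alpha beta r)^-1.
  have dE := detE alpha beta r0; rewrite /ka /kb /kc /ke.
  transitivity ((g1 beta r * H2 alpha beta r - g2 beta r * H1 alpha beta r) / Del alpha beta r / Del alpha beta r).
    by field; rewrite ?th0 ?Dn.
  by rewrite dE divff ?mul1r.
have dn : ka alpha beta r * ke alpha beta r - kb alpha beta th r * kc alpha beta th r != 0 by rewrite dt invr_neq0.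
have sc := @scales_square R d 0 0 _ _ _ _ dn; rewrite dt in sc.
have nD : `|(Del alpha beta r)^-1| ^- d = Dfac r.
  rewrite normfV exprVn invrK ltr0_norm// /Del opprK //.
rewrite nD in sc.
have E : (fun u : Z => F (rowt u.1) (rowt u.2)) \o lin2 0 0 (ka alpha beta r) (kb alpha beta th r) (kc alpha beta th r) (ke alpha beta r) =
  (fun z => F (ka alpha beta r *: rowt z.1 + kb alpha beta th r *: rowt z.2)
               (kc alpha beta th r *: rowt z.1 + ke alpha beta r *: rowt z.2)).
  by apply/funext => z; rewrite /= /lin2 /= !rowtK !add0r.
have h1 := scales_L1 sc LF; have h2 := scales_I sc LF.
by rewrite E in h1 h2.
Qed.

Lemma cov_shift (y0 w0 : V) (F : V -> V -> R) : L1 sq (fun u => F (rowt u.1) (rowt u.2)) ->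
  I sq (fun z => F (y0 + rowt z.1) (w0 + rowt z.2)) = I sq (fun u => F (rowt u.1) (rowt u.2)).
Proof.
move=> LF; have dn : 1 * 1 - 0 * 0 != 0 :> R by rewrite mulr0 subr0 mulr1 oner_neq0.
have sc := @scales_square R d y0 w0 _ _ _ _ dn.
have -> : (fun z : Z => F (y0 + rowt z.1) (w0 + rowt z.2)) = (fun u : Z => F (rowt u.1) (rowt u.2)) \o lin2 y0 w0 1 0 0 1.
  by apply/funext => z; rewrite /= /lin2 /= !rowtK !scale1r !scale0r !addr0.
by rewrite (scales_I sc LF) mulr0 subr0 mulr1 normr1 expr1n invr1 mul1r.
Qed.
End ChangeOfVariables.

(** * Conclusion *)

Section Slices.
Variables (R : realType) (d : nat) (sigma : R).
Local Notation V := 'rV[R]_d.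
Local Notation phase := (R * V * V)%type.
Variables (h0 : phase -> R) (t s : R) (x v : V).
Hypotheses (ch : continuous h0) (rh : v_regular sigma h0).

(** In these coordinates relative to p, the kernels appear without translation. *)
Definition slice (y w : V) : R := h0 (kmul (t, x, v) (s, y, w)).

Lemma slice_measurable : mRd2 slice.
Proof.
have h := @continuous_mphase R d _ _ h0 (fun=> t + s)
  (fun u : d.-tuple (measurableTypeR R) * d.-tuple (measurableTypeR R) => x + rowt u.1 + s *: v) (fun u => v + rowt u.2) ch (measurable_cst _).
apply: h; last by apply: mvecD; [exact: mvec_cst|exact: mvec_snd].
by apply: mvecD; [apply: mvecD; [exact: mvec_cst|exact: mvec_fst]|exact: mvec_cst].
Qed.

Lemma continuous_line (a : R) (y : V) : continuous (fun w => h0 (a, y, w)).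
Proof.
move=> w; apply: (@continuous_comp _ _ _ (fun w : V => (a, y, w) : phase) h0); last exact: ch.
have h := @continuous_triple V R V V (fun=> a) (fun=> y) id (@cst_continuous V R a) (@cst_continuous V V y) (fun w => cvg_id).
exact: h w.
Qed.

Lemma integrable_line (a : R) (y : V) : integrableRd (fun w => h0 (a, y, w)).
Proof.
have [phi [Phi [ip _ h]]] := rh (`|a| + enorm y).
have [] := h a y; rewrite ?lerDl ?lerDr ?enorm_ge0// => hp _.
exact: (integrableRd_le (continuous_mRd (@continuous_line a y)) ip hp).
Qed.

Lemma integrable_slice y : integrableRd (slice y).
Proof. by have [] := intRd_translate v (integrable_line (t + s) (x + y + s *: v)). Qed.

Lemma Dfrac_slice y w :
  Dfrac sigma (slice y) w = Dfrac sigma (fun w' => h0 (t + s, x + y + s *: v, w')) (v + w).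
Proof. exact: (fourier_mult_translate sigma v w (integrable_line (t + s) (x + y + s *: v))). Qed.

Lemma continuous_slice y : continuous (slice y).
Proof.
move=> w; have cs : continuous (fun w : V => v + w).
  by have := @continuous_affine R V v 1; under eq_fun do rewrite scale1r.
exact: (@continuous_comp _ _ _ (fun w : V => v + w) (fun w => h0 (t + s, x + y + s *: v, w)) _ (cs w) (@continuous_line _ _ _)).
Qed.

Lemma slice_derive i y w : (forall m, differentiable h0 m) ->
  is_derive w (delta_mx 0 i) (slice y) ('D_((0, 0, delta_mx 0 i) : phase) h0 (kmul (t, x, v) (s, y, w))).
Proof.
move=> dh; pose m : phase := kmul (t, x, v) (s, y, w); pose u : phase := (0, 0, delta_mx 0 i).
have := diff_derivable (v := u) (dh m) => /derivableP[].
rewrite /derivable /derive.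
have E : (fun h : R => h^-1 *: ((h0 \o shift m) (h *: u) - h0 m)) =
   (fun h : R => h^-1 *: ((slice y \o shift w) (h *: delta_mx 0 i) - slice y w)).
  apply/funext => h; rewrite /slice /=; congr (_ *: (h0 (_, _, _) - _)) => /=.
  - by rewrite scaler0 add0r.
  - by rewrite scaler0 add0r.
  - by rewrite addrCA.
by rewrite E => h1 h2; split.
Qed.

Lemma slice_bounded (Q : phase -> R) M : continuous Q -> exists2 C, 0 <= C & forall y w : V,
  (forall i, `|y 0 i| <= M) -> (forall i, `|w 0 i| <= M) -> `|Q (kmul (t, x, v) (s, y, w))| <= C.
Proof.
move=> cQ; pose X := \sum_i `|(x + s *: v) 0 i|; pose Y := \sum_i `|v 0 i|.
have X0 : 0 <= X by exact: sumr_ge0. have Y0 : 0 <= Y by exact: sumr_ge0.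
have [C C0 hC] := box_bounded (`|t + s| + X + Y + `|M|) cQ; exists C => // y w hy hw.
have M0 := normr_ge0 M; have t0 := normr_ge0 (t + s); have MM := ler_norm M.
apply: hC => /= [|i|i].
- by rewrite -2!addrA lerDl addr_ge0// addr_ge0.
- rewrite (_ : x + y + s *: v = y + (x + s *: v)); last by rewrite addrAC addrC.
  rewrite mxE; apply: (le_trans (ler_normD _ _)); have hyi := hy i.
  have : `|(x + s *: v) 0 i| <= X by rewrite /X (bigD1 i)//= lerDl; exact: sumr_ge0.
  lra.
- rewrite mxE; apply: (le_trans (ler_normD _ _)); have hwi := hw i.
  have : `|v 0 i| <= Y by rewrite /Y (bigD1 i)//= lerDl; exact: sumr_ge0.
  lra.
Qed.

Lemma slice_regular M : exists phi Phi, [/\ integrableRd phi, integrableRd Phi &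
  forall y : V, (forall i, `|y 0 i| <= M) -> (forall w, `|slice y w| <= phi w) /\ fdom sigma (slice y) Phi].
Proof.
pose X := \sum_i `|(x + s *: v) 0 i|.
have X0 : 0 <= X by exact: sumr_ge0.
have dX : 0 <= d%:R * (`|M| + X) by rewrite mulr_ge0// addr_ge0.
(* Large enough for the time t + s and, by [enorm_le_bound], for the norm of x + y + s v when y lies
   in the box. *)
have [phi [Phi [ip iP h]]] := rh (`|t + s| + d%:R * (`|M| + X)).
exists (fun w => phi (v + w)), Phi; split => // [|y hy]; first by have [] := intRd_translate v ip.
have [||hp hP] := h (t + s) (x + y + s *: v); first by rewrite lerDl.
  apply: (@le_trans _ _ (d%:R * (`|M| + X))); last by rewrite lerDr.
  apply: enorm_le_bound => i; rewrite (_ : x + y + s *: v = y + (x + s *: v)); last first.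
    by rewrite addrAC addrC.
  rewrite mxE; apply: (le_trans (ler_normD _ _)); apply: lerD.
    by apply: (le_trans (hy i)); exact: ler_norm.
  by rewrite /X (bigD1 i)//= lerDl; exact: sumr_ge0.
have il := integrable_line (t + s) (x + y + s *: v).
split => [w|xi a]; first exact: hp.
have E : cosT (slice y) xi a = cosT (fun w => h0 (t + s, x + y + s *: v, w)) xi (a + dot v xi).
  exact: (cosT_translate v xi a il).
rewrite E; apply: le_trans (hP xi); apply: ler_wpM2l; first exact: powR_ge0.
exact: cosT_fourier.
Qed.
End Slices.

Section PsiBound.
Variables (R : realType) (d : nat).
Local Notation V := 'rV[R]_d.
Local Notation phase := (R * V * V)%type.
Variable psi : phase -> R.
Hypothesis hpsi : test_function psi.

Lemma psi_support th eta zeta : psi (th, eta, zeta) != 0 ->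
  [/\ -2 < th < -1, forall i, `|eta 0 i| <= 1 & forall i, `|zeta 0 i| <= 1].
Proof.
move=> n0; have : psi_supp psi (th, eta, zeta) by apply: contrapT => /((smooth_supp_psi hpsi).2 _)/eqP; exact/negP.
by move=> /(S_box hpsi)[/= h h1 h2]; split => // i; exact: coord_lt1.
Qed.

Lemma psi_out th eta zeta : ~~ (-2 < th < -1) -> psi (th, eta, zeta) = 0.
Proof. by apply: contraNeq => /psi_support[]. Qed.

(** On the support of psi the coordinates of eta and zeta are at most 1, where J is at least 2^(-
    d); so a bound on that box becomes an integrable majorant on the whole space. *)
Lemma psi_mul_le : exists2 B, 0 <= B & forall (C th : R) (eta zeta : V) (q : R), 0 <= C ->
  (-2 < th < -1 -> (forall i, `|eta 0 i| <= 1) -> (forall i, `|zeta 0 i| <= 1) -> `|q| <= C) ->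
  `|psi (th, eta, zeta) * q| <= B * C * jth th * (J eta * J zeta).
Proof.
have [B B0 hB] := smooth_supp_bounded (cS hpsi) (smooth_supp_psi hpsi).
pose k : R := (1 + 1 ^+ 2) ^+ d; have k0 : 0 <= k by rewrite exprn_ge0// addr_ge0// exprn_ge0.
exists (B * (k * k)) => [|C th eta zeta q C0 hq]; first by rewrite !mulr_ge0.
have JJ0 : 0 <= J eta * J zeta by rewrite mulr_ge0 ?J_ge0.
have [->|n0] := eqVneq (psi (th, eta, zeta)) 0.
  by rewrite mul0r normr0; apply: mulr_ge0 => //; apply: mulr_ge0; [rewrite !mulr_ge0|exact: jth_ge0].
have [ht he hz] := psi_support n0.
rewrite (jth_in ht) mulr1 normrM; apply: (@le_trans _ _ (B * C)).
  by apply: ler_pM => //; exact: hq.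
have j1 := J_ge_box ler01 he; have j2 := J_ge_box ler01 hz.
have j12 : 1 <= (k * J eta) * (k * J zeta) by exact: mulr_ege1.
rewrite (_ : B * (k * k) * C * (J eta * J zeta) = B * C * (k * J eta * (k * J zeta))); last by ring.
by rewrite ler_peMr// mulr_ge0.
Qed.
End PsiBound.

Section Representation.
Variables (R : realType) (d : nat) (sigma alpha beta c tau : R).
Local Notation V := 'rV[R]_d.
Local Notation phase := (R * V * V)%type.
Local Notation mR := (measurableTypeR R).
Local Notation leb := (@lebesgue_measure R).
Local Notation sq := (@lebesgue_square R d).
Local Notation Z := (d.-tuple mR * d.-tuple mR)%type.
Hypotheses (hsigma : 0 < sigma < 1) (hal : 0 < alpha) (hab : alpha < beta) (tau0 : 0 < tau).
Hypothesis hc : det_constant (d := d) alpha beta c.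
Variable psi : phase -> R.
Hypothesis hpsi : test_function psi.
Variables f S0 : phase -> R.
Hypotheses (hf : Ck 1 f) (hfv : v_regular sigma f) (hS : continuous S0) (hSv : v_regular sigma S0).
Hypothesis heq : forall t x v, transport f (t, x, v) = Dfrac sigma (fun w => S0 (t, x, w)) v.
Variables (t : R) (x v : V).
Local Notation p := ((t, x, v) : phase).
Local Notation path := (curve alpha beta p).
Local Notation ind := (ind tau).

Let cf : continuous f.
Proof. by case: hf => df _ m; exact: differentiable_continuous (df m). Qed.

(** At fixed time, left translation by p shifts y and w by constants only, so there is no
    Jacobian. *)
Lemma kconv_inner (h0 K : phase -> R) (s : R) :
  L1 sq (fun z => slice h0 t (s - t) x v (rowt z.1) (rowt z.2) * K (s - t, rowt z.1, rowt z.2)) ->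
  I sq (fun z => h0 (phaset (s, z)) * K (kmul (kinv p) (phaset (s, z)))) =
  I sq (fun z => slice h0 t (s - t) x v (rowt z.1) (rowt z.2) * K (s - t, rowt z.1, rowt z.2)).
Proof.
move=> LF; have := cov_shift (- x + t *: v - s *: v) (- v)
  (F := fun y w => slice h0 t (s - t) x v y w * K (s - t, y, w)) LF.
move=> <-; apply: eq_I => z; rewrite /slice /phaset /kmul /kinv /=.
have e1 : t + (s - t) = s by rewrite addrC subrK.
have e2 : x + (- x + t *: v - s *: v + rowt z.1) + (s - t) *: v = rowt z.1.
  by apply/rowP => i; rewrite !mxE; ring.
have e3 : v + (- v + rowt z.2) = rowt z.2 by rewrite addrA subrr add0r.
have e4 : - x + t *: v + rowt z.1 + s *: - v = - x + t *: v - s *: v + rowt z.1.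
  by rewrite scalerN addrAC.
by rewrite e1 e2 e3 e4 [- t + s]addrC.
Qed.

Lemma kth_lt0 r s : 0 < r -> s < 0 -> kth alpha r s != 0.
Proof. by move=> r0 s0; rewrite mulf_neq0 ?invr_neq0 ?(lt_eqF s0)// gt_eqF// powR_gt0. Qed.

Lemma curve_inverse r s y w : 0 < r -> s < 0 ->
  path r (kth alpha r s) (ka alpha beta r *: y + kb alpha beta (kth alpha r s) r *: w)
    (kc alpha beta (kth alpha r s) r *: y + ke alpha beta r *: w) = kmul p (s, y, w).
Proof.
move=> r0 s0; have ra : 0 < r `^ alpha by rewrite powR_gt0.
have th0 := kth_lt0 r0 s0.
have [e1 e2] := @ker_coord R d alpha beta hal (kth alpha r s) r y w th0 r0.
rewrite /curve -e1 -e2 (_ : r `^ alpha * kth alpha r s = s)//.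
by rewrite /kth mulrC divfK// gt_eqF.
Qed.

(** The minus sign is there because the curve starts at p, and f(p) minus the value at its end is
    wanted. *)
Definition transport_flux (r th : R) (eta zeta : V) : R := ind r * (psi (th, eta, zeta) * - dpath_transport alpha beta f p r th eta zeta).
Definition velocity_flux (r th : R) (eta zeta : V) : R := ind r * (psi (th, eta, zeta) * - dpath_velocity alpha beta f p r th eta zeta).

Lemma flux_le : exists h1 h2 : R -> R,
  [/\ L1 leb h1 /\ L1 leb h2, forall r : R, ~~ (0 < r) -> h1 r = 0 /\ h2 r = 0,
    forall (r th : R) (eta zeta : V), `|transport_flux r th eta zeta| <= h1 r * jth th * (J eta * J zeta) &
    forall (r th : R) (eta zeta : V), `|velocity_flux r th eta zeta| <= h2 r * jth th * (J eta * J zeta)].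
Proof.
have [C C0 hC] := path_bounds hal hab p hf tau; have [B B0 hB] := psi_mul_le hpsi.
have L a : 0 < a -> L1 leb (fun r => ind r * (B * (C * r `^ (a - 1)))).
  move=> a0; apply: (L1_le _ (L1Zl (B * C) (L1_pow0 a0 tau0))) => [|r].
    apply: measurable_funM; first exact: measurable_ind.
    by apply: measurable_funM => //; apply: measurable_funM => //; exact: measurable_powR.
  have [->|[-> /andP[r0 rt]]] := ind_case tau r.
    by rewrite mul0r normr0 !mulr_ge0 ?powR_ge0// indicE.
  rewrite mul1r ger0_norm ?mulr_ge0 ?powR_ge0// indicE mem_set/=; last by rewrite in_itv/= r0 ltW.
  by rewrite mulr1 mulrA.
exists (fun r => ind r * (B * (C * r `^ (alpha - 1)))), (fun r => ind r * (B * (C * r `^ (beta - alpha - 1)))).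
split; first by split; apply: L => //; rewrite subr_gt0.
- move=> r r0; have [->|[_ /andP[r1 _]]] := ind_case tau r; first by rewrite !mul0r.
  by rewrite r1 in r0.
- move=> r th eta zeta; rewrite /transport_flux; have [->|[-> /andP[r0 rt]]] := ind_case tau r.
    by rewrite !mul0r normr0.
  rewrite !mul1r; apply: hB; first by rewrite mulr_ge0 ?powR_ge0.
  by move=> ht he hz; rewrite normrN; have [|_ h1 h2] := hC r th eta zeta _ ht he hz; first by rewrite r0 ltW.
- move=> r th eta zeta; rewrite /velocity_flux; have [->|[-> /andP[r0 rt]]] := ind_case tau r.
    by rewrite !mul0r normr0.
  rewrite !mul1r; apply: hB; first by rewrite mulr_ge0 ?powR_ge0.
  by move=> ht he hz; rewrite normrN; have [|_ h1 h2] := hC r th eta zeta _ ht he hz; first by rewrite r0 ltW.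
Qed.

Let U := ((mR * mR) * Z)%type.
Let mr : measurable_fun setT (fun u : U => u.1.1).
Proof. exact: (measurableT_comp measurable_fst measurable_fst). Qed.
Let mth : measurable_fun setT (fun u : U => u.1.2).
Proof. exact: (measurableT_comp measurable_snd measurable_fst). Qed.
Let me : mvec (fun u : U => rowt u.2.1 : V).
Proof. by apply: mvec_rowt; exact: (measurableT_comp measurable_fst measurable_snd). Qed.
Let mz : mvec (fun u : U => rowt u.2.2 : V).
Proof. by apply: mvec_rowt; exact: (measurableT_comp measurable_snd measurable_snd). Qed.
Let mind : measurable_fun setT (fun u : U => ind u.1.1).
Proof. exact: (measurableT_comp (@measurable_ind R tau) mr). Qed.
Let mpsi : measurable_fun setT (fun u : U => psi (u.1.2, rowt u.2.1, rowt u.2.2)).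
Proof. exact: (continuous_mphase (smooth_supp_cont (smooth_supp_psi hpsi)) mth me mz). Qed.

Lemma measurable_transport_flux : measurable_fun setT (fun u : (mR * mR) * Z => transport_flux u.1.1 u.1.2 (rowt u.2.1) (rowt u.2.2)).
Proof.
apply: measurable_funM => //; apply: measurable_funM => //; apply: measurableT_comp => //.
exact: measurable_dpath_transport.
Qed.

Lemma measurable_velocity_flux : measurable_fun setT (fun u : (mR * mR) * Z => velocity_flux u.1.1 u.1.2 (rowt u.2.1) (rowt u.2.2)).
Proof.
apply: measurable_funM => //; apply: measurable_funM => //; apply: measurableT_comp => //.
exact: measurable_dpath_velocity.
Qed.

Lemma space_int_flux_out r th : ~~ (-2 < th < -1) -> space_int transport_flux r th = 0 /\ space_int velocity_flux r th = 0.
Proof.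
move=> h; split; rewrite -[RHS](@I_0 _ _ _ sq); apply: eq_I => u.
  by rewrite /transport_flux (psi_out hpsi _ _ h) mul0r mulr0.
by rewrite /velocity_flux (psi_out hpsi _ _ h) mul0r mulr0.
Qed.

(** The normalization of the kernels: |c| = alpha^(- d) cancels the constant in the determinant, and
    hdim exceeds the power in the determinant by alpha, which leaves the Jacobian of s -> th. *)
Lemma KC_Dfac r : 0 < r -> KC d alpha beta c r * Dfac d alpha beta r = r `^ (- alpha).
Proof.
move=> r0; rewrite /KC /Dfac (det_constant_norm hal hc) invrK exprMn -(powR_mulrn d (powR_ge0 r _)) -powRrM.
rewrite exprVn /hdim opprD powRD; last by apply/implyP => _; rewrite gt_eqF.
rewrite (powRN _ ((2 * beta - alpha) * d%:R)).
have n1 : alpha ^+ d != 0 by rewrite expf_neq0// gt_eqF.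
have n2 : r `^ ((2 * beta - alpha) * d%:R) != 0 by rewrite gt_eqF// powR_gt0.
by move: (r `^ _) (r `^ _) (alpha ^+ d) n1 n2 => P Q W n1 n2; field; rewrite n1.
Qed.

Lemma coefG_Dfac r s : 0 < r -> coefG d alpha beta c s r * Dfac d alpha beta r =
  - (r `^ (- alpha) * (alpha * r `^ (alpha - 1) * kth alpha r s)).
Proof.
move=> r0; rewrite -KC_Dfac// /coefG /KC -/(kth alpha r s).
rewrite (@powRD _ r (alpha - 1) (- hdim (d := d) alpha beta)); last by apply/implyP => _; rewrite gt_eqF.
by move: (r `^ _) (r `^ _) (Dfac _ _ _ _) `|c|^-1 => P Q W k; ring.
Qed.

Lemma measurable_psi_path r th (Q : phase -> R) : continuous Q ->
  measurable_fun setT (fun u : Z => psi (th, rowt u.1, rowt u.2) * Q (path r th (rowt u.1) (rowt u.2))).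
Proof.
move=> cQ; apply: measurable_funM.
  by apply: (continuous_mphase (smooth_supp_cont (smooth_supp_psi hpsi))) => //; [exact: mvec_fst|exact: mvec_snd].
by apply: measurable_curve => //; [exact: mvec_fst|exact: mvec_snd].
Qed.

Lemma L1_psi_path r th (Q : phase -> R) : 0 < r -> continuous Q ->
  L1 sq (fun u => psi (th, rowt u.1, rowt u.2) * Q (path r th (rowt u.1) (rowt u.2))).
Proof.
move=> r0 cQ; have [M M0 hM] := @curve_box R d alpha beta hal hab p r.
have [C C0 hC] := box_bounded M cQ; have [B B0 hB] := psi_mul_le hpsi.
apply: (L1_le (measurable_psi_path r th cQ) (L1Zl (B * C * jth th) (@L1_JJ R d))) => u.
apply: hB => // ht he hz.
have [|a [y [w [-> ba by_ bw]]]] := hM r th _ _ _ ht he hz; first by rewrite r0 lexx.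
exact: hC.
Qed.

Lemma kth_out r s : 0 <= s -> ~~ (-2 < kth alpha r s < -1).
Proof.
move=> s0; rewrite negb_and -!leNgt; apply/orP; right.
by apply: (@le_trans _ _ 0); [rewrite oppr_le0|rewrite /kth divr_ge0// powR_ge0].
Qed.

Lemma Gker_out r s y w : 0 <= s -> 0 < r -> Gker alpha beta sigma c psi r (s, y, w) = 0.
Proof.
move=> s0 r0; rewrite GkerE//.
by rewrite (kk_out (alpha := alpha) beta hpsi _ (smooth_supp_psi hpsi) (kth_out r s0)) /Dfrac fourier_mult0 mulr0.
Qed.

Lemma Gvker_out r s y w : 0 <= s -> 0 < r -> Gvker alpha beta sigma c psi r (s, y, w) = 0.
Proof.
move=> s0 r0; have E : (fun w' => Lker alpha beta c psi r (s, y, w')) = fun=> 0.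
  apply/funext => w'; rewrite LkerE//; apply: big1 => i _.
  by rewrite (dvker_out beta c hpsi i y (kth_out r s0)).
by rewrite /Gvker E /Ifrac fourier_mult0.
Qed.

Lemma inner_out (h0 : phase -> R) (K : R -> phase -> R) s :
  (forall r y w, 0 < r -> K r (s - t, y, w) = 0) ->
  I sq (fun z => h0 (phaset (s, z)) * \int[leb]_(r in `]0, tau[) K r (kmul (kinv p) (phaset (s, z)))) = 0.
Proof.
move=> K0; rewrite -[RHS](@I_0 _ _ _ sq); apply: eq_I => z.
rewrite Rint_ind (_ : I leb _ = 0) ?mulr0// -[RHS](@I_0 _ _ _ leb); apply: eq_I => r.
have [->|[_ /andP[r0 _]]] := ind_case tau r; first exact: mul0r.
have -> : kmul (kinv p) (phaset (s, z)) = (s - t, - x + t *: v + rowt z.1 + s *: - v, - v + rowt z.2).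
  by rewrite /kmul /kinv /phaset /= [- t + s]addrC.
by rewrite K0// mulr0.
Qed.

Lemma space_int_flux_ind0 r th : ind r = 0 -> space_int transport_flux r th = 0 /\ space_int velocity_flux r th = 0.
Proof.
move=> i0; split; rewrite -[RHS](@I_0 _ _ _ sq); apply: eq_I => u.
  by rewrite /transport_flux i0 mul0r.
by rewrite /velocity_flux i0 mul0r.
Qed.

Lemma inner1 s :
  I sq (fun z => S0 (phaset (s, z)) * \int[leb]_(r in `]0, tau[)
     Gker alpha beta sigma c psi r (kmul (kinv p) (phaset (s, z)))) =
  I leb (fun r : mR => r `^ (- alpha) * space_int transport_flux r ((s - t) / r `^ alpha)).
Proof.
(* For s >= t both sides vanish: th = (s - t) / r^alpha is then outside (-2, -1) for every r > 0. *)
have [s0|s0] := ltP (s - t) 0; last first.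
  rewrite (inner_out S0 (K := Gker alpha beta sigma c psi)); last by move=> r y w; exact: Gker_out.
  rewrite -[LHS](@I_0 _ _ _ leb); apply: eq_I => r.
  by have [-> _] := @space_int_flux_out r _ (kth_out r s0); rewrite mulr0.
have [L E] := term1 c hsigma hal hab tau0 hpsi s0 (slice_measurable t (s - t) x v hS)
  (integrable_slice t (s - t) x v hS hSv) (slice_regular t (s - t) x v hS hSv).
rewrite (kconv_inner (K := fun m => \int[leb]_(r in `]0, tau[) Gker alpha beta sigma c psi r m) L) E.
apply: eq_I => r; have [i0|[i1 /andP[r0 _]]] := ind_case tau r.
  have -> : space_int transport_flux r ((s - t) / r `^ alpha) = 0; last by rewrite i0 !mul0r mulr0.
  by rewrite -[RHS](@I_0 _ _ _ sq); apply: eq_I => u; rewrite /transport_flux i0 mul0r.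
pose th := kth alpha r (s - t); rewrite -/th.
pose Fp (eta zeta : V) : R := psi (th, eta, zeta) * transport f (path r th eta zeta).
have cT := @continuous_transport R d f hf.
have LF : L1 sq (fun u => Fp (rowt u.1) (rowt u.2)) by exact: L1_psi_path.
have [_ cov] := cov_inv beta hal (kth_lt0 r0 s0) r0 LF.
have E' : I sq (fun z => Dfrac sigma (slice S0 t (s - t) x v (rowt z.1)) (rowt z.2) *
    kk alpha beta psi r (s - t) (rowt z.1) (rowt z.2)) = Dfac d alpha beta r * I sq (fun u => Fp (rowt u.1) (rowt u.2)).
  rewrite -cov; apply: eq_I => z; rewrite /Fp (curve_inverse (rowt z.1) (rowt z.2) r0 s0) mulrC; congr (_ * _).
  (* The equation enters here: D^sigma S0 at a point of the curve is the transport derivative of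
     f. *)
  by rewrite (Dfrac_slice t (s - t) x v hS hSv) -heq.
have EP : space_int transport_flux r th = - (alpha * r `^ (alpha - 1) * th) * I sq (fun u => Fp (rowt u.1) (rowt u.2)).
  rewrite -(I_Zl _ LF); apply: eq_I => u; rewrite /transport_flux i1 /dpath_transport /Fp.
  by move: (psi _) (transport _ _) => P Q; ring.
rewrite i1 mul1r E' EP mulrA coefG_Dfac// -/th.
by move: (I _ _) => P; ring.
Qed.

Lemma inner2 s :
  I sq (fun z => Dfrac sigma (fun w => f ((phaset (s, z)).1.1, (phaset (s, z)).1.2, w)) (phaset (s, z)).2 *
     \int[leb]_(r in `]0, tau[) Gvker alpha beta sigma c psi r (kmul (kinv p) (phaset (s, z)))) =
  I leb (fun r : mR => r `^ (- alpha) * space_int velocity_flux r ((s - t) / r `^ alpha)).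
Proof.
pose h0 : phase -> R := fun m => Dfrac sigma (fun w => f (m.1.1, m.1.2, w)) m.2.
have [s0|s0] := ltP (s - t) 0; last first.
  rewrite (inner_out h0 (K := Gvker alpha beta sigma c psi)); last by move=> r y w; exact: Gvker_out.
  rewrite -[LHS](@I_0 _ _ _ leb); apply: eq_I => r.
  by have [_ ->] := @space_int_flux_out r _ (kth_out r s0); rewrite mulr0.
have df : forall m, differentiable f m by case: hf.
have cD : forall u, continuous ('D_u f) by case: hf.
pose e i : phase := (0, 0, delta_mx 0 i).
have mD i : mRd2 (fun y w => 'D_(e i) f (kmul p (s - t, y, w))).
  exact: (slice_measurable t (s - t) x v (cD (e i))).
have bD M : exists2 C, 0 <= C & forall i (y w : V), (forall i, `|y 0 i| <= M) -> (forall i, `|w 0 i| <= M) ->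
    `|slice f t (s - t) x v y w| <= C /\ `|'D_(e i) f (kmul p (s - t, y, w))| <= C.
  have c1 : continuous (fun m => `|f m| + \sum_i `|'D_(e i) f m|).
    move=> m; apply: cvgD; first by apply: cvg_norm; exact: cf.
    apply: (@continuous_big _ _ _ _ _ (@add_continuous _) _ _ (fun i (q : phase) => `|'D_(e i) f q|)) => i _ q.
    by apply: cvg_norm; exact: cD.
  have [C C0 hC] := slice_bounded t (s - t) x v M c1; exists C => // i y w hy hw.
  have := hC y w hy hw; rewrite ger0_norm; last by rewrite addr_ge0// sumr_ge0.
  move=> h; split; apply: le_trans h; first by rewrite lerDl sumr_ge0.
  by rewrite (bigD1 i)//= addrCA lerDl addr_ge0// sumr_ge0.
have dS i y w : is_derive w (delta_mx 0 i) (slice f t (s - t) x v y) ('D_(e i) f (kmul p (s - t, y, w))).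
  exact: slice_derive.
have [L E] := term2 c hsigma hal hab tau0 hpsi s0 (slice_measurable t (s - t) x v cf)
  (integrable_slice t (s - t) x v cf hfv) (slice_regular t (s - t) x v cf hfv)
  (@continuous_slice R d f t (s - t) x v cf) dS mD bD.
have Es y : Dfrac sigma (slice f t (s - t) x v y) = slice h0 t (s - t) x v y.
  by apply/funext => w; rewrite (Dfrac_slice t (s - t) x v cf hfv).
transitivity (I sq (fun z => h0 (phaset (s, z)) * \int[leb]_(r in `]0, tau[) Gvker alpha beta sigma c psi r (kmul (kinv p) (phaset (s, z))))).
  by [].
have EF : (fun z : Z => Dfrac sigma (slice f t (s - t) x v (rowt z.1)) (rowt z.2) *
    \int[leb]_(r in `]0, tau[) Gvker alpha beta sigma c psi r (s - t, rowt z.1, rowt z.2)) =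
   (fun z => slice h0 t (s - t) x v (rowt z.1) (rowt z.2) *
    \int[leb]_(r in `]0, tau[) Gvker alpha beta sigma c psi r (s - t, rowt z.1, rowt z.2)).
  by apply/funext => z; rewrite Es.
rewrite EF in L E.
rewrite (kconv_inner (K := fun m => \int[leb]_(r in `]0, tau[) Gvker alpha beta sigma c psi r m) L) E.
apply: eq_I => r; have [i0|[i1 /andP[r0 _]]] := ind_case tau r.
  by rewrite i0 mul0r (space_int_flux_ind0 _ i0).2 mulr0.
pose th := kth alpha r (s - t); rewrite -/th i1 mul1r.
pose Fp (eta zeta : V) : R := KC d alpha beta c r * velocity_flux r th eta zeta.
have [h1 [h2 [_ _ _ b2]]] := flux_le.
have L2 := L1_Ez measurable_velocity_flux b2 r th.
have [_ cov] := cov_inv (F := Fp) beta hal (kth_lt0 r0 s0) r0 (L1Zl _ L2).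
transitivity (Dfac d alpha beta r * I sq (fun u => Fp (rowt u.1) (rowt u.2))).
  (* The vector field of the kernel, F A^-1 (y, w), is the derivative w_r' of the velocity along the
     curve, so the integrand is the velocity part of the derivative of f. *)
  rewrite -cov; apply: eq_I => z; rewrite /Fp /velocity_flux i1 mul1r /parts_kernel /dpath_velocity.
  rewrite !(curve_inverse (rowt z.1) (rowt z.2) r0 s0) mulrA mulrN -mulNr mulr_sumr; apply: eq_bigr => i _.
  rewrite /vker /kk /ker /= /A1 /A2 -/th.
  by move: ('D_(e i) f _) (psi _) (KC _ _ _ _ _) => a b k; ring.
by rewrite (I_Zl _ L2) mulrCA mulrA KC_Dfac.
Qed.

Definition space_path_int (th : mR) : R := I sq (fun u => psi (th, rowt u.1, rowt u.2) * f (path tau th (rowt u.1) (rowt u.2))).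

Lemma inner0 s : I sq (fun z => f (phaset (s, z)) * Kker alpha beta c psi tau (kmul (kinv p) (phaset (s, z)))) =
  tau `^ (- alpha) * space_path_int ((s - t) / tau `^ alpha).
Proof.
have KkerE r y w : 0 < r -> Kker alpha beta c psi r (s - t, y, w) =
    KC d alpha beta c r * kk alpha beta psi r (s - t) y w.
  by move=> r0; rewrite /Kker psi_rE.
have [s0|s0] := ltP (s - t) 0; last first.
  transitivity (0 : R).
    rewrite -[RHS](@I_0 _ _ _ sq); apply: eq_I => z.
    have -> : kmul (kinv p) (phaset (s, z)) = (s - t, - x + t *: v + rowt z.1 + s *: - v, - v + rowt z.2).
      by rewrite /kmul /kinv /phaset /= [- t + s]addrC.
    by rewrite KkerE// (kk_out (alpha := alpha) beta hpsi _ (smooth_supp_psi hpsi) (kth_out tau s0)) !mulr0.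
  have -> : space_path_int ((s - t) / tau `^ alpha) = 0; last by rewrite mulr0.
  rewrite -[RHS](@I_0 _ _ _ sq); apply: eq_I => u.
  by rewrite (psi_out hpsi _ _ (kth_out tau s0)) mul0r.
pose th := kth alpha tau (s - t); rewrite -/th.
pose Fp (eta zeta : V) : R := KC d alpha beta c tau * (psi (th, eta, zeta) * f (path tau th eta zeta)).
have LP : L1 sq (fun u => psi (th, rowt u.1, rowt u.2) * f (path tau th (rowt u.1) (rowt u.2))).
  exact: L1_psi_path.
have [L cov] := cov_inv (F := Fp) beta hal (kth_lt0 tau0 s0) tau0 (L1Zl _ LP).
have E z : Fp (ka alpha beta tau *: rowt z.1 + kb alpha beta th tau *: rowt z.2)
    (kc alpha beta th tau *: rowt z.1 + ke alpha beta tau *: rowt z.2) =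
    slice f t (s - t) x v (rowt z.1) (rowt z.2) * Kker alpha beta c psi tau (s - t, rowt z.1, rowt z.2).
  rewrite KkerE// /Fp (curve_inverse (rowt z.1) (rowt z.2) tau0 s0) mulrA mulrC; congr (_ * _).
have EF : (fun z : Z => Fp (ka alpha beta tau *: rowt z.1 + kb alpha beta th tau *: rowt z.2)
    (kc alpha beta th tau *: rowt z.1 + ke alpha beta tau *: rowt z.2)) =
    (fun z => slice f t (s - t) x v (rowt z.1) (rowt z.2) * Kker alpha beta c psi tau (s - t, rowt z.1, rowt z.2)).
  by apply/funext => z; exact: E.
rewrite EF in L cov.
by rewrite (kconv_inner (K := Kker alpha beta c psi tau) L) cov (I_Zl _ LP) mulrA [Dfac _ _ _ _ * _]mulrC KC_Dfac.
Qed.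

Let W := (mR * Z)%type.
Let mth' : measurable_fun setT (fun u : W => u.1). Proof. exact: measurable_fst. Qed.
Let me' : mvec (fun u : W => rowt u.2.1 : V).
Proof. by apply: mvec_rowt; exact: (measurableT_comp measurable_fst measurable_snd). Qed.
Let mz' : mvec (fun u : W => rowt u.2.2 : V).
Proof. by apply: mvec_rowt; exact: (measurableT_comp measurable_snd measurable_snd). Qed.

Lemma L1_psi_prod (q : R -> V -> V -> R) C : 0 <= C ->
  measurable_fun setT (fun u : W => q u.1 (rowt u.2.1) (rowt u.2.2)) ->
  (forall (th : R) (eta zeta : V), -2 < th < -1 -> (forall i, `|eta 0 i| <= 1) ->
    (forall i, `|zeta 0 i| <= 1) -> `|q th eta zeta| <= C) ->
  L1 (leb \x sq)%E (fun u : W => psi (u.1, rowt u.2.1, rowt u.2.2) * q u.1 (rowt u.2.1) (rowt u.2.2)).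
Proof.
move=> C0 mq hq; have [B B0 hB] := psi_mul_le hpsi.
apply: (L1_prod (F := fun (th : mR) (u : Z) => psi (th, rowt u.1, rowt u.2) * q th (rowt u.1) (rowt u.2))
  (a := fun th => B * C * jth th) (b := fun u => J (rowt u.1) * J (rowt u.2))).
- apply: measurable_funM => //.
  exact: (continuous_mphase (smooth_supp_cont (smooth_supp_psi hpsi)) mth' me' mz').
- by apply: L1Zl; exact: L1_jth.
- exact: L1_JJ.
- by move=> th u; apply: hB => //; exact: hq.
Qed.

Let Lf : L1 (leb \x sq)%E (fun u : W => psi (u.1, rowt u.2.1, rowt u.2.2) * f (path tau u.1 (rowt u.2.1) (rowt u.2.2))).
Proof.
have [C C0 hC] := path_bounds hal hab p hf tau.
apply: (L1_psi_prod (q := fun th eta zeta => f (path tau th eta zeta)) C0).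
  by apply: measurable_curve.
by move=> th eta zeta ht he hz; have [|->] := hC tau th eta zeta _ ht he hz; rewrite ?tau0 ?lexx.
Qed.

Let Lpsi : L1 (leb \x sq)%E (fun u : W => psi (u.1, rowt u.2.1, rowt u.2.2)).
Proof.
have h := L1_psi_prod (q := fun _ _ _ => 1) ler01 (measurable_cst _).
apply: (eq_L1 _ (h _)) => [u|th eta zeta _ _ _]; first exact: mulr1.
by rewrite normr1.
Qed.

Lemma kconv_Kker : kconv (Kker alpha beta c psi tau) f p = I leb space_path_int.
Proof.
have LP0 : L1 leb space_path_int.
  exact: (L1_I2 (F := fun (th : mR) (u : Z) => psi (th, rowt u.1, rowt u.2) * f (path tau th (rowt u.1) (rowt u.2))) Lf).
transitivity (I leb (fun s => tau `^ (- alpha) * space_path_int ((s - t) / tau `^ alpha))).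
  by apply: eq_I => s; exact: inner0.
have ra : 0 < tau `^ alpha by rewrite powR_gt0.
have ian : (tau `^ alpha)^-1 != 0 by rewrite invr_neq0// gt_eqF.
have sl := @scales_line R (- t / tau `^ alpha) (tau `^ alpha)^-1 ian.
have ab : `|(tau `^ alpha)^-1|^-1 = tau `^ alpha by rewrite normfV invrK gtr0_norm.
rewrite ab in sl.
have l1 := scales_L1 sl LP0; have i1 := scales_I sl LP0.
have E0 : space_path_int \o (fun s : mR => - t / tau `^ alpha + (tau `^ alpha)^-1 * s) = fun s => space_path_int ((s - t) / tau `^ alpha).
  by apply/funext => s /=; rewrite [X in _ + X]mulrC -mulrDl addrC.
rewrite E0 in l1 i1.
by rewrite (I_Zl _ l1) i1 powRN mulKf// gt_eqF.
Qed.

Let E (r th : R) (eta zeta : V) : R := transport_flux r th eta zeta + velocity_flux r th eta zeta.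

Lemma I_E th eta zeta : I leb (fun r => E r th eta zeta) =
  psi (th, eta, zeta) * (f p - f (path tau th eta zeta)).
Proof.
(* [path_integral] needs (th, eta, zeta) in the box that contains the support of psi; elsewhere both
   sides vanish. *)
have [n0|n0] := eqVneq (psi (th, eta, zeta)) 0.
  rewrite n0 mul0r -[RHS](@I_0 _ _ _ leb); apply: eq_I => r.
  by rewrite /E /transport_flux /velocity_flux n0 !mul0r !mulr0 addr0.
have [ht he hz] := psi_support hpsi n0.
have [h1 [h2 [[l1 l2] _ b1 b2]]] := flux_le.
have ms (G : R -> R -> V -> V -> R) (h : R -> R) :
    measurable_fun setT (fun u : U => G u.1.1 u.1.2 (rowt u.2.1) (rowt u.2.2)) -> L1 leb h ->
    (forall r th eta zeta, `|G r th eta zeta| <= h r * jth th * (J eta * J zeta)) ->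
    L1 leb (fun r => G r th eta zeta).
  move=> mG lh bG; apply: (L1_le _ (L1Zr (jth th * (J eta * J zeta)) lh)) => [|r]; last by rewrite mulrA; exact: bG.
  have mp : measurable_fun setT (fun r : mR => ((r, th : mR), (tof eta, tof zeta)) : U).
    by apply: measurable_fun_pair => //; apply: measurable_fun_pair.
  by have := measurableT_comp mG mp; rewrite /comp /= !rowtK.
have LE : L1 leb (fun r => E r th eta zeta).
  exact: L1D (ms _ _ measurable_transport_flux l1 b1) (ms _ _ measurable_velocity_flux l2 b2).
have := path_integral hal hab p hf tau0 ht he hz.
have -> : (fun r => ind r * dpath alpha beta f p r th eta zeta) = (fun r => - (psi (th, eta, zeta))^-1 * E r th eta zeta).
  apply/funext => r; rewrite /E /transport_flux /velocity_flux /dpath; move: (psi _) n0 (dpath_transport _ _ _ _ _ _ _ _) (dpath_velocity _ _ _ _ _ _ _ _) => P P0 a b.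
  by field.
rewrite (I_Zl _ LE) => h; rewrite -[f p - _]opprB -h.
by rewrite mulNr opprK mulrA divff ?mul1r.
Qed.

(** Only the sum of the two fluxes is a derivative along the curve. Both convolutions are therefore
    brought to the variables (r, th, eta, zeta) separately and added before r is integrated out. *)
Lemma kconv_sum :
  kconv (fun m => \int[leb]_(r in `]0, tau[) Gker alpha beta sigma c psi r m) S0 p +
  kconv (fun m => \int[leb]_(r in `]0, tau[) Gvker alpha beta sigma c psi r m)
    (fun q => Dfrac sigma (fun w => f (q.1.1, q.1.2, w)) q.2) p =
  f p - I leb space_path_int.
Proof.
have [h1 [h2 [[l1 l2] h0 b1 b2]]] := flux_le.
have LE1 r th := L1_Ez measurable_transport_flux b1 r th.
have LE2 r th := L1_Ez measurable_velocity_flux b2 r th.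
have mE : measurable_fun setT (fun u : U => E u.1.1 u.1.2 (rowt u.2.1) (rowt u.2.2)).
  exact: measurable_funD measurable_transport_flux measurable_velocity_flux.
have bE (r th : R) (eta zeta : V) : `|E r th eta zeta| <= (h1 r + h2 r) * jth th * (J eta * J zeta).
  by rewrite !mulrDl; apply: (le_trans (ler_normD _ _)); apply: lerD.
have [sw _] := space_int_swap mE (L1D l1 l2) bE.
transitivity (I leb (fun r => I leb (fun th : mR => space_int transport_flux r th)) + I leb (fun r => I leb (fun th : mR => space_int velocity_flux r th))).
  rewrite -(space_int_scale alpha measurable_transport_flux l1 (fun r r0 => (h0 r r0).1) b1 t).
  rewrite -(space_int_scale alpha measurable_velocity_flux l2 (fun r r0 => (h0 r r0).2) b2 t).
  congr (_ + _); apply: eq_I => s; [exact: inner1|exact: inner2].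
have P1 := L1_space_int measurable_transport_flux l1 b1; have P2 := L1_space_int measurable_velocity_flux l2 b2.
have P := L1_space_int mE (L1D l1 l2) bE.
rewrite -(I_prod (F := fun r th : mR => space_int transport_flux r th) P1) -(I_prod (F := fun r th : mR => space_int velocity_flux r th) P2) -(I_D P1 P2).
transitivity (I (leb \x leb)%E (fun u : mR * mR => space_int E u.1 u.2)).
  by apply: eq_I => u; rewrite /space_int -I_D.
rewrite (I_prod (F := fun r th : mR => space_int E r th) P) sw.
transitivity (I leb (fun th => I sq (fun u => psi (th, rowt u.1, rowt u.2) * (f p - f (path tau th (rowt u.1) (rowt u.2)))))).
  by apply: eq_I => th; apply: eq_I => u; exact: I_E.
have LD : L1 (leb \x sq)%E (fun u : W => psi (u.1, rowt u.2.1, rowt u.2.2) * (f p - f (path tau u.1 (rowt u.2.1) (rowt u.2.2)))).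
  by apply: (eq_L1 _ (L1B (L1Zr (f p) Lpsi) Lf)) => u; rewrite mulrBr.
rewrite -(I_prod (F := fun (th : mR) (u : Z) => psi (th, rowt u.1, rowt u.2) * (f p - f (path tau th (rowt u.1) (rowt u.2)))) LD).
rewrite (_ : (fun u : W => _) = fun u => psi (u.1, rowt u.2.1, rowt u.2.2) * f p -
  psi (u.1, rowt u.2.1, rowt u.2.2) * f (path tau u.1 (rowt u.2.1) (rowt u.2.2))); last first.
  by apply/funext => u; rewrite mulrBr.
rewrite (I_B (L1Zr (f p) Lpsi) Lf) (I_Zr _ Lpsi).
have -> : I (leb \x sq)%E (fun u : W => psi (u.1, rowt u.2.1, rowt u.2.2)) = 1 by case: hpsi.
rewrite mul1r; congr (_ - _).
exact: (I_prod (F := fun (th : mR) (u : Z) => psi (th, rowt u.1, rowt u.2) * f (path tau th (rowt u.1) (rowt u.2))) Lf).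
Qed.
End Representation.

Theorem proposition3p2 (R : realType) (d : nat) (hd : (0 < d)%N)
  (sigma alpha beta : R)
  (hsigma : 0 < sigma < 1) (halpha : 0 < alpha) (hbeta : alpha < beta)
  (c : R) (hc0 : c != 0) (hc : det_constant (d := d) alpha beta c)
  (psi : R * 'rV[R]_d * 'rV[R]_d -> R) (hpsi : test_function psi)
  (f S0 : R * 'rV[R]_d * 'rV[R]_d -> R)
  (hf : Ck 1 f) (hfv : v_regular sigma f)
  (hS : continuous S0) (hSv : v_regular sigma S0)
  (heq : forall t x v,
    transport f (t, x, v) = Dfrac sigma (fun w => S0 (t, x, w)) v) :
  forall tau : R, 0 < tau -> forall (t : R) (x v : 'rV[R]_d),
    f (t, x, v) - kconv (Kker alpha beta c psi tau) f (t, x, v) =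
    kconv (fun m => \int[lebesgue_measure]_(r in `]0, tau[)
                      Gker alpha beta sigma c psi r m)
      S0 (t, x, v) +
    kconv (fun m => \int[lebesgue_measure]_(r in `]0, tau[)
                      Gvker alpha beta sigma c psi r m)
      (fun p => Dfrac sigma (fun w => f (p.1.1, p.1.2, w)) p.2) (t, x, v).
Proof.
move=> tau tau0 t x v.
apply: etrans (esym (kconv_sum hsigma halpha hbeta tau0 hc hpsi hf hfv hS hSv heq t x v)).
by rewrite (kconv_Kker halpha hbeta tau0 hc hpsi hf t x v).
Qed.
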